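(* Let $n\ge3$ and $d\ge3$. Then the set \[ \{ f\in\mathrm{End}_d^n : f^{k}(\mathcal{C}_f)\subseteq f^{2}(\mathcal{C}_f) \text{ for some } k\ge3\} \] is contained in a proper Zariski closed subvariety of $\mathrm{End}_d^n$.
   Context: Work over an algebraically closed field $\mathbb{F}$ of characteristic $0$. $\mathrm{End}_d^n$ is the set of morphisms $f:\mathbb{P}^n\to\mathbb{P}^n$ of algebraic degree $d$ (i.e. $f=[f_0:\dots:f_n]$, $f_i$ homogeneous of degree $d$ with no common zero), a Zariski open subset of $\mathbb{P}^N$, $N=(n+1)\binom{d+n}{n}-1$. The critical locus is $\mathcal{C}_f=\{\det(\partial f_i/\partial x_j)=0\}$. *)

(* Defs.v *)
From HB Require Import structures.
From mathcomp Require Import all_boot all_order all_algebra.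
From mathcomp Require Import mpoly.
Set Implicit Arguments. Unset Strict Implicit. Unset Printing Implicit Defensive.
Import Order.TTheory GRing.Theory.
Local Open Scope ring_scope.

(* A point of F^{n+1}; points of P^n are nonzero such vectors up to scaling. *)
Definition nonzero_vec (F : ringType) (n : nat) (x : 'I_n.+1 -> F) : Prop :=
  exists i, x i != 0.

Definition polymap (F : ringType) (n : nat) := 'I_n.+1 -> {mpoly F[n.+1]}.

Definition is_homog (F : ringType) (n d : nat) (p : {mpoly F[n.+1]}) : Prop :=
  forall m : 'X_{1..n.+1}, p@_m != 0 -> mdeg m = d.

Definition peval (F : comRingType) (n : nat) (f : polymap F n)
  (x : 'I_n.+1 -> F) : 'I_n.+1 -> F := fun i => (f i).@[x].

(* f = [f_0 : ... : f_n] is a morphism P^n -> P^n of degree d, i.e. an element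
   of End_d^n: f_i homogeneous of degree d with no common nonzero zero. *)
Definition is_endo (F : comRingType) (n d : nat) (f : polymap F n) : Prop :=
  (forall i, is_homog d (f i)) /\
  (forall x : 'I_n.+1 -> F, (forall i, peval f x i = 0) -> forall j, x j = 0).

Definition in_crit (F : comRingType) (n : nat) (f : polymap F n)
  (x : 'I_n.+1 -> F) : Prop :=
  nonzero_vec x /\ \det (\matrix_(i, j) ((f i)^`M(j)).@[x]) = 0.

(* f^k(C_f) \subseteq f^l(C_f), as sets of points of P^n *)
Definition crit_image_incl (F : comRingType) (n : nat) (f : polymap F n)
  (k l : nat) : Prop :=
  forall x, in_crit f x ->
    exists y, in_crit f y /\
      exists c : F, c != 0 /\
        iter k (peval f) x = (fun i => c * iter l (peval f) y i).

(* Coordinates on the parameter space: index set for the coefficients of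
   (f_0,...,f_n) (pairs (i, m) with m a monomial of degree <= d; coefficients
   of monomials of degree < d vanish on End_d^n). *)
Definition coef_index (n d : nat) := ('I_n.+1 * 'X_{1..n.+1 < d.+1})%type.

Definition coef_vec (F : ringType) (n d : nat) (f : polymap F n) :
  'I_#|{: coef_index n d}| -> F :=
  fun j => let: (i, m) := enum_val j in (f i)@_(val m).

(* Main.v *)
(**
Let [P = det Df], a form of degree [e = (n+1)(d-1) > n+1], and [C = {P = 0}].  For a generic [f]:
the ring [F[x]] is free over [F[f]]; [P] has nonzero gradient on a plane, hence is prime; and
[f^2] is birational on [C].  Genericity of the first two is seen on explicit maps and by a
dimension count.  For the third, one exhibits a map whose second iterate has a reduced
one-point fibre on [C]; the inverse is then given by determinants in [f^2] which make sense for
all [f] and are nonzero for a generic one.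

Suppose such an [f] satisfies [f^k(C) <= f^2(C)] with [k >= 3].  Inverting [f^2] on [C] yields a
rational self-map [g] of [C] with [f^2 o g = f^k].  Monomials in [g] are integral over the
coordinate ring of [C], whose normalisation has a conductor containing powers of the partial
derivatives of [P]; as the singular locus of [C] has codimension at least two in [C] and [F[x]] is
free over [F[f]], these monomials are represented by forms.  So [g] is locally given by forms, and the
pull-back of the residue form of [P] by [g] is a multiple of that form by a factor [Psi / P_l(g)]
which is represented by a form as well.  Since [e > n+1], its degree would be negative, so it
vanishes, i.e. [g] is ramified everywhere.  But [f^2 o g = f^k] is finite, hence generically
unramified on [C] in characteristic [0]: a contradiction.
*)
Require Import Defs.
From HB Require Import structures.
From mathcomp Require Import all_boot all_order all_algebra all_fingroup.
From mathcomp Require Import mpoly ring zify.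
From Stdlib Require Import Classical ClassicalEpsilon FunctionalExtensionality.
Set Implicit Arguments. Unset Strict Implicit. Unset Printing Implicit Defensive.
Import GRing.Theory.
Local Open Scope ring_scope.

(** * Substitution and distinguished variables *)

(** Geometry on [C] is rendered by divisibility: a polynomial vanishes on [C] iff [P] divides it,
    and a fraction [Om / Z] is regular when [Om] lies in the ideal [(Z, P)]. The hypothesis only
    gives, for each [x] on [C], some [y] on [C] with [f^2(y) = f^k(x)], for vectors after rescaling
    by a root. Identities checked at such pairs become divisibilities because [P] is prime. The
    obstacle is that the vector [y] is determined by [x] only up to scaling, so birationality is
    used for monomials in [y] of one degree [t] divisible by [d^2]. Hence only forms in [y] of
    degree a multiple of [t] are lifted to forms in [x]; the map [g] appears as the vectors
    [y_i^(t-1) y], one chart for each [i]; and it is the [t]-th power of [Psi / P_l(g)], corrected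
    by a power of [y_i^t], that does not depend on the chart. Its degree is
    [-(e-n-1) t (d^(k-2) - 1)], negative because [d >= 3] gives [e > n+1] and [k >= 3] gives
    [d^(k-2) > 1]. The bound [n >= 3] enters the dimension count for smoothness on a plane, which
    needs three variables besides the one normalised to [1]. *)

HB.lock Definition msub (R : comNzRingType) n m (h : 'I_n -> {mpoly R[m]})
  (p : {mpoly R[n]}) : {mpoly R[m]} := mmap (@mpolyC m R) h p.

Section Substitution.
Variable R : comNzRingType.

(** Constants and variables generate the ring, so an identity between ring morphisms or derivations
    need only be checked on them. *)
Lemma mpoly_ring_ind n (K : {mpoly R[n]} -> Prop) :
  (forall c, K c%:MP) -> (forall i, K 'X_i) ->
  (forall p q, K p -> K q -> K (p + q)) ->
  (forall p q, K p -> K q -> K (p * q)) -> forall p, K p.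
Proof.
move=> KC KX KD KM; elim/mpolyind => [|c m p _ _ Kp]; first by rewrite -mpolyC0.
apply: (KD) => //; rewrite -mul_mpolyC; apply: (KM) => //.
rewrite mpolyXE_id; apply: (big_ind K) => [|p1 p2|i _]; rewrite -?mpolyC1 //.
  exact: KM.
by elim: (m i) => [|k IH]; rewrite ?expr0 -?mpolyC1 // exprS; apply: KM.
Qed.

Lemma msub_is_additive n m (h : 'I_n -> {mpoly R[m]}) : additive (msub h).
Proof. by move=> p q; rewrite unlock rmorphB. Qed.

Lemma msub_is_multiplicative n m (h : 'I_n -> {mpoly R[m]}) : multiplicative (msub h).
Proof. by split=> [p q|]; rewrite unlock ?rmorphM ?rmorph1. Qed.

HB.instance Definition _ n m (h : 'I_n -> {mpoly R[m]}) :=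
  GRing.isAdditive.Build {mpoly R[n]} {mpoly R[m]} (msub h) (msub_is_additive h).
HB.instance Definition _ n m (h : 'I_n -> {mpoly R[m]}) :=
  GRing.isMultiplicative.Build {mpoly R[n]} {mpoly R[m]} (msub h) (msub_is_multiplicative h).

Lemma msubD n m (h : 'I_n -> {mpoly R[m]}) p q : msub h (p + q) = msub h p + msub h q.
Proof. exact: (rmorphD (msub h)). Qed.
Lemma msubM n m (h : 'I_n -> {mpoly R[m]}) p q : msub h (p * q) = msub h p * msub h q.
Proof. exact: (rmorphM (msub h)). Qed.

Lemma msubC n m (h : 'I_n -> {mpoly R[m]}) c : msub h c%:MP = c%:MP.
Proof. by rewrite unlock mmapC. Qed.

Lemma msubXU n m (h : 'I_n -> {mpoly R[m]}) i : msub h 'X_i = h i.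
Proof. by rewrite unlock mmapX mmap1U. Qed.

Lemma msubX n m (h : 'I_n -> {mpoly R[m]}) k :
  msub h 'X_[k] = \prod_(i < n) h i ^+ k i.
Proof. by rewrite unlock mmapX. Qed.

Lemma msubZ n m (h : 'I_n -> {mpoly R[m]}) c p : msub h (c *: p) = c *: msub h p.
Proof. by rewrite -!mul_mpolyC rmorphM /= msubC. Qed.

Lemma meval_msub n m (h : 'I_n -> {mpoly R[m]}) v p :
  (msub h p).@[v] = p.@[fun i => (h i).@[v]].
Proof.
elim/mpoly_ring_ind: p => [c|i|p q ep eq|p q ep eq].
- by rewrite msubC !mevalC.
- by rewrite msubXU mevalXU.
- by rewrite rmorphD /= !mevalD ep eq.
- by rewrite rmorphM /= !mevalM ep eq.
Qed.

Lemma msub_msub n m l (h : 'I_n -> {mpoly R[m]}) (g : 'I_m -> {mpoly R[l]}) p :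
  msub g (msub h p) = msub (fun i => msub g (h i)) p.
Proof.
elim/mpoly_ring_ind: p => [c|i|p q ep eq|p q ep eq].
- by rewrite !msubC.
- by rewrite !msubXU.
- by rewrite !rmorphD /= ep eq.
- by rewrite !rmorphM /= ep eq.
Qed.

Lemma eq_msub n m (h g : 'I_n -> {mpoly R[m]}) p : h =1 g -> msub h p = msub g p.
Proof.
move=> e; elim/mpoly_ring_ind: p => [c|i|p q ep eq|p q ep eq].
- by rewrite !msubC.
- by rewrite !msubXU.
- by rewrite !rmorphD /= ep eq.
- by rewrite !rmorphM /= ep eq.
Qed.

Lemma msub_id n (p : {mpoly R[n]}) : msub (fun i => 'X_i) p = p.
Proof.
elim/mpoly_ring_ind: p => [c|i|p q ep eq|p q ep eq].
- by rewrite !msubC.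
- by rewrite !msubXU.
- by rewrite !rmorphD /= ep eq.
- by rewrite !rmorphM /= ep eq.
Qed.

Lemma mderivXU n (i j : 'I_n) : ('X_i : {mpoly R[n]})^`M(j) = (i == j)%:R.
Proof.
rewrite mderivX mnm1E; case: eqP => [->|_]; last by rewrite scale0r.
rewrite scale1r (_ : (U_(j) - U_(j))%MM = 0%MM) ?mpolyX0 //.
by apply/mnmP => k; rewrite mnmBE subnn mnm0E.
Qed.

Lemma mderiv_msub n m (h : 'I_n -> {mpoly R[m]}) p j :
  (msub h p)^`M(j) = \sum_i msub h (p^`M(i)) * (h i)^`M(j).
Proof.
elim/mpoly_ring_ind: p => [c|i|p q ep eq|p q ep eq].
- by rewrite msubC mderivC big1 // => i _; rewrite mderivC rmorph0 mul0r.
- rewrite msubXU (bigD1 i) //= mderivXU eqxx rmorph1 mul1r big1 ?addr0 // => k ki.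
  by rewrite mderivXU eq_sym (negPf ki) rmorph0 mul0r.
- rewrite rmorphD /= mderivD ep eq -big_split; apply: eq_bigr => i _ /=.
  by rewrite mderivD rmorphD /= mulrDl.
- rewrite rmorphM /= mderivM ep eq mulr_suml mulr_sumr -big_split.
  apply: eq_bigr => i _ /=; rewrite mderivM rmorphD !rmorphM /= mulrDl -!mulrA.
  by congr (_ + _); congr (_ * _); rewrite mulrC.
Qed.

End Substitution.

(* The variable [l] singled out as the indeterminate of a univariate polynomial. *)
HB.lock Definition ptom (R : comNzRingType) n (l : 'I_n.+1)
  (q : {poly {mpoly R[n]}}) : {mpoly R[n.+1]} :=
  (horner_eval 'X_l \o map_poly (@msub R n n.+1 (fun j : 'I_n => 'X_(lift l j)))) q.

HB.lock Definition mtop (R : comNzRingType) n (l : 'I_n.+1)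
  (p : {mpoly R[n.+1]}) : {poly {mpoly R[n]}} :=
  mmap (polyC \o @mpolyC n R)
       (fun i => if unlift l i is Some j then ('X_j)%:P else 'X) p.

Section SingleOut.
Variable R : comNzRingType.

Lemma mtop_is_additive n (l : 'I_n.+1) : additive (@mtop R n l).
Proof. by move=> p q; rewrite unlock rmorphB. Qed.

Lemma mtop_is_multiplicative n (l : 'I_n.+1) : multiplicative (@mtop R n l).
Proof. by split=> [p q|]; rewrite unlock ?rmorphM ?rmorph1. Qed.

HB.instance Definition _ n (l : 'I_n.+1) :=
  GRing.isAdditive.Build {mpoly R[n.+1]} {poly {mpoly R[n]}} (@mtop R n l) (@mtop_is_additive n l).
HB.instance Definition _ n (l : 'I_n.+1) :=
  GRing.isMultiplicative.Build {mpoly R[n.+1]} {poly {mpoly R[n]}} (@mtop R n l)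
    (@mtop_is_multiplicative n l).

Lemma mtopD n (l : 'I_n.+1) (p q : {mpoly R[n.+1]}) : mtop l (p + q) = mtop l p + mtop l q.
Proof. exact: rmorphD. Qed.
Lemma mtopM n (l : 'I_n.+1) (p q : {mpoly R[n.+1]}) : mtop l (p * q) = mtop l p * mtop l q.
Proof. exact: rmorphM. Qed.

Definition mlft n (l : 'I_n.+1) : {mpoly R[n]} -> {mpoly R[n.+1]} :=
  @msub R n n.+1 (fun j : 'I_n => 'X_(lift l j)).

HB.instance Definition _ n l := GRing.RMorphism.on (@mlft n l).
Arguments mlft : simpl never.

Lemma mlftD n (l : 'I_n.+1) p q : mlft l (p + q) = mlft l p + mlft l q.
Proof. exact: (rmorphD (mlft l)). Qed.
Lemma mlftM n (l : 'I_n.+1) p q : mlft l (p * q) = mlft l p * mlft l q.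
Proof. exact: (rmorphM (mlft l)). Qed.

Lemma ptomE n (l : 'I_n.+1) (q : {poly {mpoly R[n]}}) :
  ptom l q = (horner_eval 'X_l \o map_poly (mlft l)) q.
Proof. by rewrite unlock. Qed.

Lemma ptom_is_additive n (l : 'I_n.+1) : additive (@ptom R n l).
Proof. by move=> p q; rewrite !ptomE rmorphB. Qed.

Lemma ptom_is_multiplicative n (l : 'I_n.+1) : multiplicative (@ptom R n l).
Proof. by split=> [p q|]; rewrite !ptomE ?rmorphM ?rmorph1. Qed.

HB.instance Definition _ n (l : 'I_n.+1) :=
  GRing.isAdditive.Build {poly {mpoly R[n]}} {mpoly R[n.+1]} (@ptom R n l)
    (@ptom_is_additive n l).
HB.instance Definition _ n (l : 'I_n.+1) :=
  GRing.isMultiplicative.Build {poly {mpoly R[n]}} {mpoly R[n.+1]} (@ptom R n l)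
    (@ptom_is_multiplicative n l).

Lemma ptomD n (l : 'I_n.+1) (p q : {poly {mpoly R[n]}}) : ptom l (p + q) = ptom l p + ptom l q.
Proof. exact: rmorphD. Qed.
Lemma ptomM n (l : 'I_n.+1) (p q : {poly {mpoly R[n]}}) : ptom l (p * q) = ptom l p * ptom l q.
Proof. exact: rmorphM. Qed.

Lemma mtopC n (l : 'I_n.+1) (c : R) : mtop l c%:MP = (c%:MP)%:P.
Proof. by rewrite unlock mmapC. Qed.

Lemma mtopX n (l : 'I_n.+1) i :
  @mtop R n l 'X_i = if unlift l i is Some j then ('X_j)%:P else 'X.
Proof. by rewrite unlock mmapX mmap1U. Qed.

Lemma ptomC n (l : 'I_n.+1) (c : {mpoly R[n]}) : ptom l c%:P = mlft l c.
Proof. by rewrite ptomE /= /horner_eval map_polyC hornerC. Qed.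

Lemma ptomX n (l : 'I_n.+1) : @ptom R n l 'X = 'X_l.
Proof. by rewrite ptomE /= /horner_eval map_polyX hornerX. Qed.

Lemma mtopK n (l : 'I_n.+1) : cancel (@mtop R n l) (@ptom R n l).
Proof.
move=> p; elim/mpoly_ring_ind: p => [c|i|p q ep eq|p q ep eq].
- by rewrite mtopC ptomC /mlft msubC.
- rewrite mtopX; case: unliftP => [j ->|->]; last exact: ptomX.
  by rewrite ptomC /mlft msubXU.
- by rewrite mtopD ptomD; congr (_ + _).
- by rewrite mtopM ptomM; congr (_ * _).
Qed.

Lemma mtop_lift n (l : 'I_n.+1) c : mtop l (mlft l c) = c%:P.
Proof.
elim/mpoly_ring_ind: c => [c|i|p q ep eq|p q ep eq].
- by rewrite /mlft msubC mtopC.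
- by rewrite /mlft msubXU mtopX liftK.
- by rewrite mlftD mtopD ep eq polyCD.
- by rewrite mlftM mtopM ep eq polyCM.
Qed.

Lemma ptomK n (l : 'I_n.+1) : cancel (@ptom R n l) (@mtop R n l).
Proof.
move=> p; elim/poly_ind: p => [|p c IH].
  by rewrite !rmorph0.
rewrite ptomD ptomM /= ptomX ptomC.
rewrite mtopD mtopM /= IH mtopX unlift_none.
by rewrite mtop_lift.
Qed.

Definition mins n (l : 'I_n.+1) (a : 'I_n -> R) (b : R) : 'I_n.+1 -> R :=
  fun i => if unlift l i is Some j then a j else b.

Lemma mins_lift n (l : 'I_n.+1) a b j : mins l a b (lift l j) = a j.
Proof. by rewrite /mins liftK. Qed.

Lemma mins_id n (l : 'I_n.+1) a b : mins l a b l = b.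
Proof. by rewrite /mins unlift_none. Qed.

(** The restriction of a polynomial to the line on which every coordinate except the [l]-th is fixed
    by [a]. *)
Definition mfib n (l : 'I_n.+1) (a : 'I_n -> R) : {mpoly R[n.+1]} -> {poly R} :=
  map_poly (meval a) \o @mtop R n l.

HB.instance Definition _ n l a := GRing.RMorphism.on (@mfib n l a).
Arguments mfib : simpl never.

Lemma mfibD n (l : 'I_n.+1) a p q : mfib l a (p + q) = mfib l a p + mfib l a q.
Proof. exact: (rmorphD (mfib l a)). Qed.
Lemma mfibM n (l : 'I_n.+1) a p q : mfib l a (p * q) = mfib l a p * mfib l a q.
Proof. exact: (rmorphM (mfib l a)). Qed.

Lemma mfibE n (l : 'I_n.+1) a b p : (mfib l a p).[b] = p.@[mins l a b].
Proof.
elim/mpoly_ring_ind: p => [c|i|p q ep eq|p q ep eq].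
- by rewrite /mfib /= mtopC map_polyC hornerC /= !mevalC.
- rewrite /mfib /= mtopX mevalXU /mins; case: unliftP => [j _|_].
    by rewrite map_polyC hornerC /= mevalXU.
  by rewrite map_polyX hornerX.
- by rewrite mfibD mevalD hornerD; congr (_ + _).
- by rewrite mfibM mevalM hornerM; congr (_ * _).
Qed.

Lemma mfib_coef n (l : 'I_n.+1) a p i : (mfib l a p)`_i = ((mtop l p)`_i).@[a].
Proof. by rewrite /mfib /= coef_map. Qed.

Lemma mfib_ptomC n (l : 'I_n.+1) a c : mfib l a (ptom l c%:P) = (c.@[a])%:P.
Proof. by rewrite /mfib /= ptomK map_polyC. Qed.

End SingleOut.

(** * Polynomials as functions over an infinite field *)

Section InfiniteField.
Variable F : fieldType.
Hypothesis Finf : forall s : seq F, exists x, x \notin s.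

Lemma poly_nonroot (p : {poly F}) : p != 0 -> exists x, p.[x] != 0.
Proof.
move=> pn0; case: (classic (exists x, p.[x] != 0)) => // H.
have rp x : root p x.
  by apply/rootP; case: (eqVneq p.[x] 0) => // nz; case: H; exists x.
have [s us ss] : exists2 s : seq F, uniq s & size s = size p.
  elim: (size p) => [|k [s us ss]]; first by exists [::].
  by have [x xs] := Finf s; exists (x :: s); rewrite /= ?xs ?ss.
have : (size s < size p)%N by apply: max_poly_roots => //; apply/allP => x _.
by rewrite ss ltnn.
Qed.

(** Induction on the number of variables: a point where the leading coefficient in one variable is
    nonzero gives a nonzero univariate polynomial on the line over it. *)
Lemma mpoly_nonroot n (p : {mpoly F[n]}) : p != 0 -> exists x, p.@[x] != 0.
Proof.
elim: n p => [|n IH] p pn0.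
  exists (fun _ => 0); move: pn0; rewrite [p]nvar0_mpolyC mevalC.
  by rewrite mpolyC_eq0.
have qn0 : mtop ord0 p != 0.
  by apply: contraNneq pn0 => q0; rewrite -[p](mtopK ord0) q0 rmorph0.
have ln0 : lead_coef (mtop ord0 p) != 0 by rewrite lead_coef_eq0.
have [a ha] := IH _ ln0.
have : mfib ord0 a p != 0.
  apply/eqP => /polyP/(_ (size (mtop ord0 p)).-1).
  by rewrite coef0 mfib_coef; apply/eqP.
by move=> /poly_nonroot[b hb]; exists (mins ord0 a b); rewrite -mfibE.
Qed.

Lemma mpoly_eval0 n (p : {mpoly F[n]}) : (forall x, p.@[x] = 0) -> p = 0.
Proof.
by move=> H; apply/eqP/negPn/negP => /mpoly_nonroot[x]; rewrite H eqxx.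
Qed.

Lemma mpoly_eval_inj n (p q : {mpoly F[n]}) : (forall x, p.@[x] = q.@[x]) -> p = q.
Proof.
move=> H; apply/eqP; rewrite -subr_eq0; apply/eqP/mpoly_eval0 => x.
by rewrite mevalB H subrr.
Qed.

End InfiniteField.

Section Char0.
Variable F : closedFieldType.
Hypothesis hchar : [pchar F] =i pred0.

Lemma natr_neq0 k : (k != 0)%N -> (k%:R : F) != 0.
Proof. by move=> k0; have /pcharf0P -> := hchar. Qed.

Lemma closed_infinite (s : seq F) : exists x, x \notin s.
Proof.
have [k hk] : exists k : nat, k%:R \notin s.
  apply: NNPP => H.
  have Hs k : k%:R \in s by apply/negPn/negP => nk; apply: H; exists k.
  have inj : injective (fun k : nat => k%:R : F).
    move=> i j /= eij; wlog lij : i j eij / (i <= j)%N.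
      by move=> W; case: (leqP i j) => [/W->|/ltnW/W->].
    apply/eqP; rewrite eqn_leq lij -subn_eq0 /=; apply: contraTT isT => /natr_neq0.
    by rewrite natrB // eij subrr eqxx.
  have : (size [seq k%:R : F | k <- iota 0 (size s).+1] <= size s)%N.
    apply: uniq_leq_size; first by rewrite map_inj_uniq ?iota_uniq.
    by move=> x /mapP[k _ ->].
  by rewrite size_map size_iota ltnn.
by exists k%:R.
Qed.

End Char0.

(** * Unique factorisation *)

Section Divisibility.
Variable R : comNzRingType.

Definition dv (a b : R) := exists c, b = a * c.

Lemma dvxx a : dv a a. Proof. by exists 1; rewrite mulr1. Qed.
Lemma dv0 a : dv a 0. Proof. by exists 0; rewrite mulr0. Qed.
Lemma dv_trans b a c : dv a b -> dv b c -> dv a c.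
Proof. by move=> [x ->] [y ->]; exists (x * y); rewrite mulrA. Qed.
Lemma dv_mulr a b c : dv a b -> dv a (b * c).
Proof. by move=> [x ->]; exists (x * c); rewrite mulrA. Qed.
Lemma dv_mull a b c : dv a b -> dv a (c * b).
Proof. by rewrite mulrC; apply: dv_mulr. Qed.
Lemma dvD a b c : dv a b -> dv a c -> dv a (b + c).
Proof. by move=> [x ->] [y ->]; exists (x + y); rewrite mulrDr. Qed.
Lemma dvN a b : dv a b -> dv a (- b).
Proof. by move=> [x ->]; exists (- x); rewrite mulrN. Qed.
Lemma dvB a b c : dv a b -> dv a c -> dv a (b - c).
Proof. by move=> h1 h2; apply: dvD => //; apply: dvN. Qed.
Lemma dv_sum I (r : seq I) (Q : pred I) (E : I -> R) a :
  (forall i, Q i -> dv a (E i)) -> dv a (\sum_(i <- r | Q i) E i).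
Proof. by move=> h; apply: big_ind => //; [exact: dv0 | move=> x y; apply: dvD]. Qed.

Definition prime_elt (p : R) :=
  [/\ p != 0, ~ dv p 1 & forall a b, dv p (a * b) -> dv p a \/ dv p b].

Lemma prime_dv_prod p I (r : seq I) (E : I -> R) :
  prime_elt p -> dv p (\prod_(i <- r) E i) -> exists2 i, List.In i r & dv p (E i).
Proof.
case=> _ np1 pM; elim: r => [|i r IH]; rewrite ?big_nil ?big_cons // => /pM[h|/IH[j jr h]].
  by exists i => //; left.
by exists j => //; right.
Qed.

Lemma prime_dv_exp p a k : prime_elt p -> dv p (a ^+ k) -> dv p a.
Proof.
case=> _ np1 pM; elim: k => [|k IH]; rewrite ?expr0 // exprS => /pM[|/IH] //.
Qed.

Lemma polyC_dv (c : R) (p : {poly R}) :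
  (forall i, dv c p`_i) -> exists q, p = c *: q.
Proof.
elim/poly_ind: p => [|p a IH] h; first by exists 0; rewrite scaler0.
have [|q ->] := IH.
  move=> i; have := h i.+1.
  by rewrite coefD coefMX coefC /= addr0.
have := h 0%N; rewrite coefD coefMX coefC /= add0r => -[b ->].
by exists (q * 'X + b%:P); rewrite scalerDr -scalerAl -!mul_polyC polyCM.
Qed.

(** The factors are prime elements rather than irreducible ones, so uniqueness is automatic. The
    condition [dv u 1] makes [u] a unit. *)
Definition factorial_ring :=
  forall a, a != 0 -> exists u s, [/\ dv u 1, forall p, List.In p s -> prime_elt p
                                   & a = u * \prod_(p <- s) p].

End Divisibility.

Lemma dv_iso (A B : comNzRingType) (g : {rmorphism A -> B}) a b :
  dv a b -> dv (g a) (g b).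
Proof. by move=> [c ->]; exists (g c); rewrite rmorphM. Qed.

Lemma prime_iso (A B : comNzRingType) (g : {rmorphism A -> B}) (h : {rmorphism B -> A}) p :
  cancel g h -> cancel h g -> prime_elt p -> prime_elt (g p).
Proof.
move=> gK hK [p0 p1 pM]; split.
- by apply: contraNneq p0 => e; rewrite -[p]gK e rmorph0.
- by move=> /(dv_iso h); rewrite gK rmorph1.
- move=> a b /(dv_iso h); rewrite gK rmorphM => /pM[] /(dv_iso g); rewrite hK; auto.
Qed.

Lemma factorial_iso (A B : comNzRingType) (g : {rmorphism A -> B}) (h : {rmorphism B -> A}) :
  cancel g h -> cancel h g -> factorial_ring A -> factorial_ring B.
Proof.
move=> gK hK fA b b0; have hb0 : h b != 0.
  by apply: contraNneq b0 => e; rewrite -[b]hK e rmorph0.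
have [u [s [u1 sP e]]] := fA _ hb0; exists (g u), (map g s); split.
- by rewrite -(rmorph1 g); apply: dv_iso.
- by move=> p /List.in_map_iff[q [<- qs]]; apply: (prime_iso gK hK); apply: sP.
- by rewrite -[b]hK e rmorphM rmorph_prod big_map.
Qed.

Section FactorialPoly.
Variable R : idomainType.
Hypothesis fR : factorial_ring R.
Implicit Types p q a b : {poly R}.

Lemma dvC_lead (c : R) p : dv c%:P p -> dv c (lead_coef p).
Proof. by move=> [q ->]; rewrite lead_coefM lead_coefC; exists (lead_coef q). Qed.

(** Gauss: a prime constant dividing [a * b] divides the product of the leading coefficients, hence
    one of them; the corresponding leading term may then be dropped, and the total size
    decreases. *)
Lemma prime_polyC (c : R) : prime_elt c -> prime_elt c%:P.
Proof.
case=> c0 nc1 cM; split; first by rewrite polyC_eq0.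
  by move=> /dvC_lead; rewrite lead_coef1.
move=> a b; have [k hk] : exists k, (size a + size b <= k)%N by eexists.
elim: k a b hk => [|k IH] a b hk.
  by move: hk; rewrite leqn0 addn_eq0 size_poly_eq0 => /andP[/eqP -> _]; left; apply: dv0.
have [->|a0] := eqVneq a 0; first by left; apply: dv0.
have [->|b0] := eqVneq b 0; first by right; apply: dv0.
have drop p : p != 0 -> dv c (lead_coef p) ->
    exists2 p' : {poly R}, (size p' < size p)%N & exists r : {poly R}, p = p' + c%:P * r.
  move=> p0 [l lE]; pose m := (size p).-1.
  have sp : size p = m.+1 by rewrite prednK // size_poly_gt0.
  exists (p - lead_coef p *: 'X^m); last first.
    by exists (l *: 'X^m); rewrite lE mul_polyC scalerA subrK.
  rewrite sp ltnS; apply/leq_sizeP => i.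
  rewrite leq_eqVlt => /orP[/eqP <-|hi]; rewrite coefB coefZ coefXn.
    by rewrite eqxx mulr1 subrr.
  by rewrite gtn_eqF // mulr0 subr0 nth_default // sp.
move=> h; have /cM[] : dv c (lead_coef a * lead_coef b).
  by rewrite -lead_coefM; apply: dvC_lead.
- move=> /(drop _ a0)[a' sa' [r aE]].
  have [||ha|hb] := IH a' b; [| |left|by right].
  + by rewrite -ltnS; apply: leq_trans hk; rewrite ltn_add2r.
  + have -> : a' * b = a * b - c%:P * (r * b) by rewrite aE mulrDl mulrA addrK.
    by apply: dvB => //; exists (r * b).
  + by rewrite aE; apply: dvD => //; exists r.
- move=> /(drop _ b0)[b' sb' [r bE]].
  have [||ha|hb] := IH a b'; [| |by left|right].
  + by rewrite -ltnS; apply: leq_trans hk; rewrite ltn_add2l.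
  + have -> : a * b' = a * b - c%:P * (a * r) by rewrite bE mulrDr mulrCA addrK.
    by apply: dvB => //; exists (a * r).
  + by rewrite bE; apply: dvD => //; exists r.
Qed.

(** Each prime factor of [c] stays prime in the polynomial ring, so it divides [a] or [b] and can be
    cancelled there, one factor after the other. *)
Lemma peel_primes (c : R) p a b : c != 0 -> c *: p = a * b ->
  exists c1 c2 (a' b' : {poly R}),
    [/\ c1 != 0, c2 != 0, a = c1 *: a', b = c2 *: b' & p = a' * b'].
Proof.
move=> /fR[u [s [[v uv] sP ->]]].
elim: s a b sP => [|q s IH] a b sP.
  rewrite big_nil mulr1 => e; exists 1, u, a, (v *: b).
  have u0 : u != 0 by apply: contra_eq_neq uv => ->; rewrite mul0r oner_neq0.
  split; rewrite ?oner_neq0 ?scale1r ?scalerA -?uv ?scale1r //.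
  by rewrite -scalerAr -e scalerA mulrC -uv scale1r.
have qP : prime_elt q by apply: sP; left.
have q0 : q != 0 by case: qP.
have qC0 : q%:P != 0 by rewrite polyC_eq0.
have sP' r : List.In r s -> prime_elt r by move=> rs; apply: sP; right.
rewrite big_cons mulrCA -scalerA => e.
have [_ _ qM] := prime_polyC qP.
have /qM[[a1 aE]|[b1 bE]] : dv q%:P (a * b) by rewrite -e -mul_polyC; eexists.
- have e1 : (u * \prod_(j <- s) j) *: p = a1 * b.
    by apply: (mulfI qC0); rewrite mul_polyC e aE mulrA.
  have [c1 [c2 [a' [b' [c10 c20 a1E bE pE]]]]] := IH _ _ sP' e1.
  exists (q * c1), c2, a', b'; split=> //; first by rewrite mulf_neq0.
  by rewrite aE a1E -scalerA mul_polyC.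
- have e1 : (u * \prod_(j <- s) j) *: p = a * b1.
    by apply: (mulfI qC0); rewrite mul_polyC e bE mulrCA.
  have [c1 [c2 [a' [b' [c10 c20 aE b1E pE]]]]] := IH _ _ sP' e1.
  exists c1, (q * c2), a', b'; split=> //; first by rewrite mulf_neq0.
  by rewrite bE b1E -scalerA mul_polyC.
Qed.

Lemma primes_assoc (q t w : R) : prime_elt q -> prime_elt t -> t = q * w -> dv w 1.
Proof.
move=> [q0 nq1 _] [t0 _ tM] e; have /tM[[r rE]|[r rE]] : dv t (q * w) by rewrite -e; apply: dvxx.
  by exists r; apply: (mulfI t0); rewrite mulr1 {1}e rE -mulrA [r * w]mulrC.
by case: nq1; exists r; apply: (mulfI t0); rewrite mulr1 {1}e rE mulrCA.
Qed.

Definition primitive p := forall c : R, prime_elt c -> ~ dv c%:P p.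

(** A prime constant dividing [p] divides its leading coefficient, so at most as many can be
    extracted as that coefficient has prime factors; their number [k] drives the induction. *)
Lemma content_primitive p : p != 0 ->
  exists (c : R) (p' : {poly R}), [/\ c != 0, p = c *: p' & primitive p'].
Proof.
move=> p0; have l0 : lead_coef p != 0 by rewrite lead_coef_eq0.
have [u [s [uU sP e]]] := fR l0.
have [k hk] : exists k, (size s <= k)%N by eexists.
elim: k p s u uU sP hk p0 l0 e => [|k IH] p s u uU sP hk p0 l0 e.
  exists 1, p; split; rewrite ?oner_neq0 ?scale1r // => c cP /dvC_lead.
  have [_ nc1 cM] := cP; move: hk e; case: s sP => // sP _ ->.
  by rewrite big_nil mulr1 => h; apply: nc1; apply: dv_trans uU.
case: (classic (primitive p)) => [pp|].
  by exists 1, p; split; rewrite ?oner_neq0 ?scale1r.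
move=> npp; have [q hq] := not_all_ex_not _ _ npp.
have [qP /NNPP[p1 pE]] := imply_to_and _ _ hq.
have [q0 nq1 qM] := qP.
have p10 : p1 != 0 by apply: contraNneq p0 => e1; rewrite pE e1 mulr0.
have lE : lead_coef p = q * lead_coef p1 by rewrite pE lead_coefM lead_coefC.
have [t ts [w tE]] : exists2 t, List.In t s & dv q t.
  have /qM[h|h] : dv q (u * \prod_(p <- s) p) by rewrite -e lE; eexists.
    by case: nq1; apply: dv_trans uU.
  exact: prime_dv_prod h.
have wU := primes_assoc qP (sP _ ts) tE.
have [s1 [s2 sE]] := List.in_split _ _ ts.
have eM : \prod_(p <- s) p = t * \prod_(p <- s1 ++ s2) p.
  by rewrite sE !big_cat big_cons /= mulrCA.
have [||||||c [p' [c0 p1E pp']]] := IH p1 (s1 ++ s2)%list (u * w) => //.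
- by have [x xE] := uU; have [y yE] := wU; exists (x * y); rewrite mulrACA -xE -yE mulr1.
- move=> r /List.in_app_iff rs; apply: sP; rewrite sE; apply/List.in_app_iff.
  by case: rs; [left|right; right].
- by move: hk; rewrite sE !size_cat /= addnS ltnS.
- by rewrite lead_coef_eq0.
- by apply: (mulfI q0); rewrite -lE e eM tE !mulrA; congr (_ * _); rewrite [q * u]mulrC.
exists (q * c), p'; split=> //; first by rewrite mulf_neq0.
by rewrite pE p1E mul_polyC scalerA.
Qed.

Lemma unit_of_primitive p (c : R) p' : c != 0 -> p = c *: p' -> primitive p -> dv c 1.
Proof.
move=> /fR[u [[|q s] [uU sP ->]]] pE pp; first by rewrite big_nil mulr1.
case: (pp q); first by apply: sP; left.
by rewrite pE big_cons mulrCA -scalerA -mul_polyC; eexists.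
Qed.

(** Divisibility over the fraction field descends: the part of [c] that goes into a primitive factor
    is a unit. *)
Lemma primitive_dv p b (c : R) a : c != 0 -> primitive p -> c *: b = a * p -> dv p b.
Proof.
move=> c0 pp /(peel_primes c0)[c1 [c2 [a' [p' [_ c20 _ pE ->]]]]].
have [x xE] := unit_of_primitive c20 pE pp.
exists (x *: a'); rewrite pE -scalerAr -scalerAl scalerA.
by rewrite [x * _]mulrC -xE scale1r mulrC.
Qed.

(** A polynomial is split as long as it is a product of two polynomials of smaller size. When it is
    not, its primitive part [p'] is prime: the gcd of [p'] and [a] is either constant, and [p']
    divides [b], or of full degree, and [p'] divides [a]. *)
Lemma factorial_poly : factorial_ring {poly R}.
Proof.
move=> p p0; have [k hk] : exists k, (size p <= k)%N by eexists.
elim: k p hk p0 => [|k IH] p hk p0.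
  by move: p0; rewrite -size_poly_gt0 ltnNge hk.
have constP (c : R) : c != 0 -> exists u s, [/\ dv u 1, forall q, List.In q s -> prime_elt q
    & c%:P = u * \prod_(q <- s) q].
  move=> /fR[u [s [uU sP ->]]]; exists u%:P, (map polyC s); split.
  - by rewrite -[1]/(1%:P); apply: (dv_iso polyC).
  - by move=> q /List.in_map_iff[r [<- /sP rP]]; apply: prime_polyC.
  - by rewrite polyCM rmorph_prod big_map.
have [s1|s1] := leqP (size p) 1.
  by rewrite [p]size1_polyC //; apply: constP; rewrite -polyC_eq0 -size1_polyC.
have comb (a b : {poly R}) : (exists u s, [/\ dv u 1, forall q, List.In q s -> prime_elt q
      & a = u * \prod_(q <- s) q]) -> (exists u s, [/\ dv u 1, forall q, List.In q s -> prime_elt q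
      & b = u * \prod_(q <- s) q]) -> exists u s, [/\ dv u 1, forall q, List.In q s -> prime_elt q
      & a * b = u * \prod_(q <- s) q].
  move=> [u [s [[x xE] sP ->]]] [v [t [[y yE] tP ->]]]; exists (u * v), (s ++ t)%list; split.
  - by exists (x * y); rewrite mulrACA -xE -yE mulr1.
  - by move=> q /List.in_app_iff[/sP|/tP].
  - by rewrite big_cat mulrACA.
case: (classic (exists a b : {poly R}, [/\ p = a * b, (size a < size p)%N & (size b < size p)%N])).
  move=> [a [b [pE sa sb]]]; rewrite pE.
  have a0 : a != 0 by apply: contraNneq p0 => e; rewrite pE e mul0r.
  have b0 : b != 0 by apply: contraNneq p0 => e; rewrite pE e mulr0.
  by apply: comb; apply: IH => //; rewrite -ltnS; apply: leq_trans hk.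
move=> irr; have [c [p' [c0 pE pp]]] := content_primitive p0.
rewrite pE -mul_polyC; apply: comb; first exact: constP.
exists 1, [:: p']; split; first exact: dvxx; last by rewrite big_seq1 mul1r.
move=> _ [<-|//]; have sp' : size p' = size p by rewrite pE size_scale.
split.
- by apply: contraNneq p0 => e; rewrite pE e scaler0.
- move=> [x ex]; have e1 : size (p' * x) = 1%N by rewrite -ex size_poly1.
  have x0 : x != 0 by apply: contra_eq_neq e1 => ->; rewrite mulr0 size_poly0.
  have p'0 : p' != 0 by apply: contra_eq_neq e1 => ->; rewrite mul0r size_poly0.
  have := leq_addr (size x).-1 (size p').
  move: e1; rewrite size_mul // -[size x]prednK ?size_poly_gt0 // addnS /= => -> .
  by rewrite sp' leqNgt s1.
move=> a b [w wE].
(* The gcd is that of the fraction field, so it divides [p'] and [a] only after multiplication by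
   the constants [c1] and [c3]. *)
have /Pdiv.WeakIdomain.dvdpP[[c1 r1] /= c10 e1] := dvdp_gcdl p' a.
have /Pdiv.WeakIdomain.dvdpP[[c3 r3] /= c30 e3] := dvdp_gcdr p' a.
set g := gcdp p' a in e1 e3.
have [x1 [x2 [r [h [x10 x20 rE gE p'E]]]]] := peel_primes c10 e1.
have nz0 : r * h != 0 by rewrite -p'E; apply: contraNneq p0 => e; rewrite pE e scaler0.
have [r0 h0] : r != 0 /\ h != 0.
  by split; apply: contraNneq nz0 => ->; rewrite ?mul0r ?mulr0.
have srh : (size r + size h = (size p').+1)%N.
  by rewrite p'E size_mul // prednK // addn_gt0 size_poly_gt0 r0.
have [hs|hs] := leqP (size p') (size h).
  left; have sr : size r = 1%N.
    apply/eqP; rewrite eqn_leq size_poly_gt0 r0 andbT.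
    by rewrite -(leq_add2r (size h)) srh add1n ltnS.
  have [y yE] : exists y, r = y%:P by exists r`_0; apply: size1_polyC; rewrite sr.
  have y0 : y != 0 by apply: contraNneq r0 => e; rewrite yE e.
  have [z zE] : dv y 1.
    by apply: (unit_of_primitive y0 _ pp); rewrite p'E yE mul_polyC.
  apply: (primitive_dv c30 pp (a := (x2 * z) *: r3)).
  rewrite e3 gE p'E yE mul_polyC -scalerAl -!scalerAr scalerA -mulrA; congr (_ *: _).
  by rewrite [z * y]mulrC -zE mulr1.
have /Pdiv.WeakIdomain.dvdpP[[c4 r4] /= c40 e4] : p' %| b.
  have cop : coprimep p' a.
    rewrite coprimep_def -/g gE size_scale //; apply/eqP.
    case: (leqP (size p') (size r)) => sr.
      apply/eqP; rewrite eqn_leq size_poly_gt0 h0 andbT.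
      by rewrite -(leq_add2l (size r)) srh addn1 ltnS.
    case: irr; exists (c *: r), h; split; rewrite ?size_scale -?sp' //.
    by rewrite pE p'E scalerAl.
  rewrite -(Gauss_dvdpr b cop); apply/Pdiv.WeakIdomain.dvdpP; exists (1, w) => /=.
    exact: oner_neq0.
  by rewrite scale1r wE mulrC.
by right; apply: primitive_dv e4.
Qed.

End FactorialPoly.

Lemma factorial_mpoly (F : fieldType) n : factorial_ring {mpoly F[n]}.
Proof.
elim: n => [|n IH].
  move=> a a0; exists a, [::]; split=> //; last by rewrite big_nil mulr1.
  have e := nvar0_mpolyC a; have a00 : a@_0%MM != 0.
    by apply: contraNneq a0 => z; rewrite e z mpolyC0.
  by exists (a@_0%MM)^-1%:MP; rewrite {1}e -mpolyCM mulfV.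
apply: (@factorial_iso _ _ (@ptom F n ord0) (@mtop F n ord0)); last exact: factorial_poly.
  exact: ptomK.
exact: mtopK.
Qed.

Lemma prime_mtop (F : fieldType) n (l : 'I_n.+1) (p : {mpoly F[n.+1]}) :
  prime_elt p -> prime_elt (mtop l p).
Proof.
by apply: (@prime_iso _ _ (@mtop F n l) (@ptom F n l)); [apply: mtopK|apply: ptomK].
Qed.

(** * The Nullstellensatz for a prime hypersurface *)

Section Vanishing.
Variable F : closedFieldType.
Hypothesis Finf : forall s : seq F, exists x, x \notin s.

Lemma prime_polyC_inv (R : idomainType) (c : R) : prime_elt c%:P -> prime_elt c.
Proof.
have CdvE (a b : R) : dv a%:P b%:P -> dv a b.
  by move=> /dvC_lead; rewrite lead_coefC.
case=> c0 nc1 cM; split; first by rewrite -polyC_eq0.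
  by move=> h; apply: nc1; apply: (dv_iso polyC) h.
by move=> a b /(dv_iso polyC); rewrite /= polyCM => /cM[] /CdvE; auto.
Qed.

(** If [p] does not involve the first variable, induction applies to the coefficients of [w].
    Otherwise, were [w] not a multiple of [p], a Bezout relation would give a nonzero combination
    [c] of both in the other variables, which must vanish wherever [p] has a root. *)
Lemma prime_vanish n (p w : {mpoly F[n]}) : prime_elt p ->
  (forall x, p.@[x] = 0 -> w.@[x] = 0) -> dv p w.
Proof.
elim: n p w => [|n IH] p w pP pw.
  have [p0 np1 _] := pP; case: np1; have e := nvar0_mpolyC p.
  have p00 : p@_0%MM != 0 by apply: contraNneq p0 => z; rewrite e z mpolyC0.
  by exists (p@_0%MM)^-1%:MP; rewrite {1}e -mpolyCM mulfV.
have qP := prime_mtop ord0 pP; set q := mtop ord0 p in qP.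
have back : dv q (mtop ord0 w) -> dv p w.
  by move=> [c e]; exists (ptom ord0 c); rewrite -[w](mtopK ord0) e ptomM mtopK.
apply: back; have [q0 nq1 qM] := qP.
have [s1|s1] := leqP (size q) 1.
  have qE := size1_polyC s1; rewrite qE in qP *.
  have cP := prime_polyC_inv qP; set c := q`_0 in qE cP *.
  have [|r ->] := @polyC_dv _ c (mtop ord0 w); last by rewrite -mul_polyC; eexists.
  move=> i; apply: IH => // a ca; rewrite -mfib_coef.
  suff -> : mfib ord0 a w = 0 by rewrite coef0.
  apply/eqP/negPn/negP => /(poly_nonroot Finf)[b].
  rewrite mfibE pw ?eqxx // -mfibE; suff -> : mfib ord0 a p = 0 by rewrite horner0.
  by apply/polyP => k; rewrite mfib_coef -/q qE coef0 coefC; case: k => [|k] /=; rewrite ?meval0.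
apply: NNPP => nw; set r := mtop ord0 w in nw.
have cop : coprimep q r.
  have /Pdiv.WeakIdomain.dvdpP[[c1 r1] /= c10 e1] := dvdp_gcdl q r.
  have /Pdiv.WeakIdomain.dvdpP[[c3 r3] /= c30 e3] := dvdp_gcdr q r.
  rewrite coprimep_def; set g := gcdp q r in e1 e3 *.
  have /qM[[z zE]|[z zE]] : dv q (r1 * g) by rewrite -e1 -mul_polyC mulrC; eexists.
    have e : c1%:P = z * g.
      by apply: (mulfI q0); rewrite mulrC mul_polyC e1 zE mulrA.
    have : size (z * g) == 1%N by rewrite -e size_polyC c10.
    by rewrite size_mul_eq1 => /andP[].
  case: nw; have /qM[[y yE]|//] : dv q (c3%:P * r).
    by rewrite mul_polyC e3 zE mulrCA; eexists.
  have : (size (c3%:P : {poly {mpoly F[n]}}) <= 1)%N by rewrite size_polyC c30.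
  have y0 : y != 0 by apply: contraNneq c30 => y0; rewrite -polyC_eq0 yE y0 mulr0.
  rewrite yE size_mul // leqNgt => /negP[]; apply: (leq_trans s1).
  by rewrite -[size y]prednK ?size_poly_gt0 // addnS leq_addr.
have /Bezout_coprimepP[[u v] /=] := cop.
rewrite -size_poly_eq1 => /eqP s2.
have [c cE] : exists c, u * q + v * r = c%:P by eexists; apply: size1_polyC; rewrite s2.
have c0 : c != 0 by apply: contra_eq_neq s2 => c0; rewrite cE c0 size_poly0.
have l0 : lead_coef q != 0 by rewrite lead_coef_eq0.
(* Over this [a] the combination [c] is nonzero, and [p] keeps its degree, so that it has a root
   there. *)
have [a ha] := mpoly_nonroot Finf (mulf_neq0 c0 l0).
move: ha; rewrite mevalM mulf_eq0 negb_or => /andP[ca la].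
have sz : size (mfib ord0 a p) != 1%N.
  apply/eqP => s3; have : (mfib ord0 a p)`_(size q).-1 = 0.
    by rewrite nth_default // s3 -ltnS prednK // (ltn_trans _ s1).
  by rewrite mfib_coef => /eqP; rewrite -[_`_ _]/(lead_coef q) (negPf la).
have [b /rootP hb] := closed_rootP _ sz.
have pb : p.@[mins ord0 a b] = 0 by rewrite -mfibE.
have wb := pw _ pb.
have eC : ptom ord0 c%:P = ptom ord0 u * p + ptom ord0 v * w.
  by rewrite -cE ptomD (ptomM _ u q) (ptomM _ v r) (mtopK ord0 p) (mtopK ord0 w).
have /eqP := congr1 (meval (mins ord0 a b)) eC.
by rewrite mevalD !mevalM pb wb !mulr0 addr0 -mfibE mfib_ptomC hornerC (negPf ca).
Qed.

End Vanishing.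

Lemma fun_choice (A B : Type) (Q : A -> B -> Prop) :
  (forall a, exists b, Q a b) -> exists f : A -> B, forall a, Q a (f a).
Proof.
move=> h; exists (fun a => proj1_sig (constructive_indefinite_description _ (h a))).
by move=> a; case: constructive_indefinite_description.
Qed.

(** * Algebraic dependence by counting *)

Section Pigeonhole.
Variable F : fieldType.

Lemma left_kernel a b (c : 'M[F]_(a, b)) : (b < a)%N ->
  exists2 l : 'rV[F]_a, l != 0 & l *m c = 0.
Proof.
move=> ba; have : kermx c != 0.
  by rewrite -mxrank_eq0 mxrank_ker subn_eq0 -ltnNge (leq_ltn_trans (rank_leq_col c)).
by move=> /rowV0Pn[v /sub_kermxP vc v0]; exists v.
Qed.

Lemma linear_dependence (I J : finType) (c : I -> J -> F) : (#|J| < #|I|)%N ->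
  exists2 l : I -> F, (exists i, l i != 0) & forall j, \sum_i l i * c i j = 0.
Proof.
move=> h; have [l l0 lc] := left_kernel (\matrix_(i, j) c (enum_val i) (enum_val j)) h.
exists (fun i => l 0 (enum_rank i)).
  have /rV0Pn[k lk] := l0; exists (enum_val k).
  by rewrite enum_valK.
move=> j; transitivity (\sum_(k < #|I|) l 0 k * c (enum_val k) j).
  rewrite (reindex (@enum_val I I)) /=; first by apply: eq_bigr => k _; rewrite enum_valK.
  exact/onW_bij/enum_val_bij.
have /matrixP/(_ 0 (enum_rank j)) := lc; rewrite mxE [RHS]mxE => e; rewrite -[RHS]e.
by apply: eq_bigr => k _; rewrite mxE enum_rankK.
Qed.

Definition idealP (R : comNzRingType) (W : R -> Prop) :=
  [/\ W 0, (forall a b, W a -> W b -> W (a + b)) & forall a b, W a -> W (b * a)].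

Lemma ideal_sum (R : comNzRingType) (W : R -> Prop) I (r : seq I) (Q : pred I) (E : I -> R) :
  idealP W -> (forall i, Q i -> W (E i)) -> W (\sum_(i <- r | Q i) E i).
Proof. by case=> W0 WD _ h; apply: (big_ind W). Qed.

Lemma idealN (R : comNzRingType) (W : R -> Prop) a : idealP W -> W a -> W (- a).
Proof. by case=> _ _ WM h; rewrite -mulN1r; apply: WM. Qed.

Lemma idealB (R : comNzRingType) (W : R -> Prop) a b : idealP W -> W a -> W b -> W (a - b).
Proof. by move=> iW ha hb; have [_ WD _] := iW; apply: WD => //; apply: idealN. Qed.

Lemma idealZ n (W : {mpoly F[n]} -> Prop) c a : idealP W -> W a -> W (c *: a).
Proof. by case=> _ _ WM h; rewrite -mul_mpolyC; apply: WM. Qed.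

Lemma linear_dependence_mod n (W : {mpoly F[n]} -> Prop) (I J : finType) (A : I -> {mpoly F[n]})
  (E : J -> {mpoly F[n]}) : idealP W -> (#|J| < #|I|)%N ->
  (forall i, exists c : J -> F, W (A i - \sum_j c j *: E j)) ->
  exists2 l : I -> F, (exists i, l i != 0) & W (\sum_i l i *: A i).
Proof.
move=> iW h /fun_choice[c cP]; have [l l0 lP] := linear_dependence c h.
exists l => //; have -> : \sum_i l i *: A i = \sum_i l i *: (A i - \sum_j c i j *: E j).
  apply/eqP; rewrite -subr_eq0 -sumrB.
  under eq_bigr => i _ do rewrite -scalerBr opprB addrC subrK scaler_sumr.
  rewrite exchange_big big1 //= => j _.
  under eq_bigr => i _ do rewrite scalerA.
  by rewrite -scaler_suml lP scale0r.
by apply: ideal_sum => // i _; apply: idealZ.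
Qed.

(** The base is at most [(m * V + 1) * s], so because of [m > r] it suffices that [s] exceed
    [K * (m * V + 1) ^ r]. *)
Lemma growth_gap K V r m : (r < m)%N -> exists2 s, (0 < s)%N & (K * (m * s * V).+1 ^ r < s ^ m)%N.
Proof.
move=> rm; pose s := (K * (m * V).+1 ^ r).+1; exists s => //.
have mono x y k : (x <= y)%N -> (x ^ k <= y ^ k)%N.
  by move=> xy; elim: k => // k IH; rewrite !expnS leq_mul.
apply: (@leq_ltn_trans (K * ((m * V).+1 * s) ^ r)).
  rewrite leq_mul2l mono ?orbT // mulSn mulnAC -addn1 addnC leq_add2r.
  by rewrite /s.
rewrite expnMn mulnA -(subnK rm) expnD expnS.
apply: (@leq_trans (s * s ^ r)); last by rewrite leq_pmull // expn_gt0.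
by rewrite ltn_pmul2r ?expn_gt0 ?/s ?subnK.
Qed.

Lemma msizeM_pred n (p q : {mpoly F[n]}) : (msize (p * q) <= (msize p + msize q).-1)%N.
Proof.
have [->|p0] := eqVneq p 0; first by rewrite mul0r msize0.
have [->|q0] := eqVneq q 0; first by rewrite mulr0 msize0.
by rewrite msizeM.
Qed.

Section AlgDep.
Variables (n : nat) (W : {mpoly F[n]} -> Prop) (r : nat) (y : 'I_r -> {mpoly F[n]}) (L : nat).
Hypothesis iW : idealP W.
Hypothesis WL : forall m : 'X_{1..n}, mdeg m = L ->
  exists2 b : 'I_r -> {mpoly F[n]}, (forall j, (msize (b j) <= L)%N)
                                 & W ('X_[m] - \sum_j y j * b j).

(** The spanning family over the field: small monomials times power products of the parameters. The
    degrees of the [y j] are not tracked, only their exponents, since each extraction of a [y j]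
    lowers the degree of what remains. *)
Let E D (k : 'X_{1..n < L} * {ffun 'I_r -> 'I_D.+1}) :=
  'X_[k.1] * \prod_j y j ^+ k.2 j.

Let spanned D (A : {mpoly F[n]}) := exists c, W (A - \sum_k c k *: @E D k).

Lemma mdeg_split (m : 'X_{1..n}) k : (k <= mdeg m)%N ->
  exists m1 m2, [/\ m = (m1 + m2)%MM, mdeg m1 = k & mdeg m2 = (mdeg m - k)%N].
Proof.
elim: k => [|k IH] hk.
  by exists 0%MM, m; rewrite add0m mdeg0 subn0.
have [m1 [m2 [mE e1 e2]]] := IH (ltnW hk).
have : mdeg m2 != 0%N by rewrite e2 subn_eq0 -ltnNge.
rewrite mdeg_eq0 => m20.
have [i mi] : exists i, m2 i != 0%N.
  apply: NNPP => h; case/eqP: m20; apply/mnmP => i; rewrite mnm0E.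
  by apply/eqP/negPn/negP => hi; apply: h; exists i.
have le : (U_(i) <= m2)%MM by rewrite lep1mP.
exists (m1 + U_(i))%MM, (m2 - U_(i))%MM; split.
- by rewrite -addmA [(U_(i) + _)%MM]addmC submK.
- by rewrite mdegD e1 mdeg1 addn1.
- have := congr1 mdeg (submK le); rewrite mdegD mdeg1 e2 addn1 => e3.
  by rewrite subnS -e3.
Qed.

Let spannedD D A B : spanned D A -> spanned D B -> spanned D (A + B).
Proof.
move=> [c cP] [c' cP']; exists (fun k => c k + c' k).
under eq_bigr => k _ do rewrite scalerDl.
have [_ WD _] := iW; rewrite big_split /= opprD addrACA; exact: WD.
Qed.

Let spannedZ D a A : spanned D A -> spanned D (a *: A).
Proof.
move=> [c cP]; exists (fun k => a * c k).
under eq_bigr => k _ do rewrite -scalerA.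
by rewrite -scaler_sumr -scalerBr; apply: idealZ.
Qed.

Let spanned_W D A : W A -> spanned D A.
Proof. by move=> h; exists (fun=> 0); rewrite big1 ?subr0 // => k _; rewrite scale0r. Qed.

Let spanned0 D : spanned D 0.
Proof. by case: iW => W0 _ _; apply: spanned_W. Qed.

Let spanned_sum D I (s : seq I) (Q : pred I) (A : I -> {mpoly F[n]}) :
  (forall i, Q i -> spanned D (A i)) -> spanned D (\sum_(i <- s | Q i) A i).
Proof. by move=> h; apply: (big_ind (spanned D)) => [|A1 A2|i];
  [exact: spanned0|exact: spannedD|exact: h]. Qed.

Let spanned_E D k : spanned D (@E D k).
Proof.
exists (fun k' => (k' == k)%:R); rewrite (bigD1 k) //= eqxx scale1r big1 => [|k' /negPf->].
  by rewrite addr0 subrr; case: iW.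
by rewrite scale0r.
Qed.

Let spanned_eqW D A B : W (A - B) -> spanned D B -> spanned D A.
Proof. by move=> h hB; rewrite -[A](subrK B); apply: spannedD => //; apply: spanned_W. Qed.

Let spanned_y D j A : spanned D A -> spanned D.+1 (y j * A).
Proof.
move=> [c cP]; apply: (@spanned_eqW _ _ (\sum_k c k *: (y j * @E D k))).
  have -> : \sum_k c k *: (y j * @E D k) = y j * \sum_k c k *: @E D k.
    by rewrite mulr_sumr; apply: eq_bigr => k _; rewrite scalerAr.
  by rewrite -mulrBr; case: iW => _ _; apply.
apply: spanned_sum => -[a g] _; apply: spannedZ.
have lt i : (g i + (i == j) < D.+2)%N.
  by have := ltn_ord (g i); case: (i == j); rewrite ?addn1 ?addn0 ?ltnS // => /leqW.
have -> : y j * E (a, g) = @E D.+1 (a, [ffun i => Ordinal (lt i)]).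
  rewrite /E /= mulrCA; congr (_ * _).
  rewrite (bigD1 j) //= [in RHS](bigD1 j) //= ffunE /= eqxx addn1 exprS -mulrA; congr (_ * (_ * _)).
  by apply: eq_bigr => i /negPf ij; rewrite ffunE /= ij addn0.
exact: spanned_E.
Qed.

Lemma span_mod D A : (msize A <= D.+1)%N -> spanned D A.
Proof.
have [_ WD WM] := iW.
(* For [L = 0] the coefficients [b j] vanish, so [W] contains [1] and everything. *)
have [L0|Lp] := posnP L.
  move=> _; apply: spanned_W.
  have [|b hb] := WL (m := 0%MM); first by rewrite mdeg0 L0.
  rewrite mpolyX0 big1 ?subr0 => [h|j _]; first by rewrite -[A]mulr1; apply: WM.
  have := hb j; rewrite L0 leqn0 msize_poly_eq0 => /eqP ->; exact: mulr0.
have small D' m (mL : (mdeg m < L)%N) : spanned D' 'X_[m].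
  have -> : 'X_[m] = @E D' (BMultinom mL, [ffun=> ord0]).
    by rewrite /E /= big1 ?mulr1 // => j _; rewrite ffunE expr0.
  exact: spanned_E.
elim: D A => [|D IH] A hA; rewrite [A]mpolyE big_seq; apply: spanned_sum => m mA;
  apply: spannedZ; have := leq_trans (msize_mdeg_lt mA) hA; rewrite ltnS => hm;
  have [mL|mL] := ltnP (mdeg m) L; try exact: small.
  by apply: small; rewrite (leq_ltn_trans hm).
have [m1 [m2 [mE e1 e2]]] := mdeg_split mL.
have [b hb hW] := WL e1.
apply: (@spanned_eqW _ _ (\sum_j y j * (b j * 'X_[m2]))).
  have -> : \sum_j y j * (b j * 'X_[m2]) = 'X_[m2] * \sum_j y j * b j.
    by rewrite mulr_sumr; apply: eq_bigr => j _; rewrite mulrA mulrC.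
  by rewrite mE mpolyXD mulrC -mulrBr; apply: WM.
apply: spanned_sum => j _; apply: spanned_y; apply: IH.
(* The coefficient [b j] has degree less than [L], the degree of the monomial [m1] it comes from, so
   the cofactor of [y j] has smaller degree than [m]. *)
apply: leq_trans (msizeM_pred _ _) _; rewrite msizeX e2 addnS /=.
apply: leq_trans (leq_add (hb j) (leqnn _)) _.
by rewrite subnKC.
Qed.

(* Modulo [W], polynomials are finite over [r] parameters, so [m > r] of them are algebraically
   dependent: there are more monomials in them than room. *)
Lemma alg_dependence m (h : 'I_m -> {mpoly F[n]}) : (r < m)%N ->
  exists2 G : {mpoly F[m]}, G != 0 & W (msub h G).
Proof.
move=> rm; pose V := \max_i msize (h i).
have [s s0 hs] := growth_gap #|{: 'X_{1..n < L}}| V rm.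
pose D := (m * s * V)%N.
pose A (b : {ffun 'I_m -> 'I_s}) := \prod_i h i ^+ b i.
have szX (p : {mpoly F[n]}) k : (msize p <= V -> msize (p ^+ k) <= (k * V).+1)%N.
  move=> hp; elim: k => [|k IH]; first by rewrite expr0 msize1.
  rewrite exprS mulSn; apply: leq_trans (msizeM_pred _ _) _.
  by apply: leq_trans (leq_pred _) _; rewrite -addnS leq_add.
have szA b : (msize (A b) <= D.+1)%N.
  rewrite /A /D -mulnA -[X in (X * _)%N](card_ord m) -sum1_card big_distrl /=.
  elim/big_ind2: _ => [|k1 p1 k2 p2 h1 h2|i _]; first by rewrite msize1.
    apply: leq_trans (msizeM_pred _ _) _; have := leq_add h1 h2.
    by rewrite addSn addnS; case: (_ + msize p2)%N.
  apply: leq_trans (szX _ _ (leq_bigmax i)) _.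
  by rewrite ltnS mul1n leq_mul2r (ltnW (ltn_ord _)) orbT.
have [||l [b0 lb0] hW] := @linear_dependence_mod n W _ _ A (@E D) iW.
- by rewrite card_prod !card_ffun !card_ord.
- by move=> b; apply: span_mod.
pose mon (b : {ffun 'I_m -> 'I_s}) := [multinom (b i : nat) | i < m].
exists (\sum_b l b *: 'X_[mon b]).
  apply/eqP => /(congr1 (mcoeff (mon b0))); rewrite mcoeff0 raddf_sum /= (bigD1 b0) //=.
  rewrite mcoeffZ mcoeffX eqxx mulr1 big1 ?addr0 => [/eqP|b bb0]; first by rewrite (negPf lb0).
  rewrite mcoeffZ mcoeffX; case: eqP => [e|_]; last by rewrite mulr0.
  case/eqP: bb0; apply/ffunP => i; apply: val_inj.
  by move/mnmP/(_ i): e; rewrite !mnmE.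
rewrite (raddf_sum (msub h)) /=; congr W: hW; apply: eq_bigr => b _.
rewrite msubZ msubX; congr (_ *: _); apply: eq_bigr => i _.
by rewrite mnmE.
Qed.

End AlgDep.
End Pigeonhole.

(** * Homogeneous components and ideals *)

Notation hcomp d := (pihomog mdeg d).

Section Homogeneous.
Variable F : fieldType.


Lemma dhomog_scale n d (p : {mpoly F[n]}) c x :
  p \is d.-homog -> p.@[fun i => c * x i] = c ^+ d * p.@[x].
Proof.
move=> /dhomogP hp; rewrite !mevalE mulr_sumr big_seq [RHS]big_seq; apply: eq_bigr => m mp.
rewrite mulrCA; congr (_ * _); have /= <- := hp _ mp; rewrite mdegE -prodrXr -big_split /=.
by apply: eq_bigr => i _; rewrite exprMn.
Qed.

Lemma dhomog_exp n d (p : {mpoly F[n]}) k : p \is d.-homog -> p ^+ k \is (d * k).-homog.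
Proof. exact: dhomogMn. Qed.

Lemma dhomog_msub n m d e (p : {mpoly F[n]}) (h : 'I_n -> {mpoly F[m]}) :
  p \is d.-homog -> (forall i, h i \is e.-homog) -> msub h p \is (d * e).-homog.
Proof.
move=> /dhomogP hp hh; rewrite [p]mpolyE raddf_sum big_seq /=.
apply: rpred_sum => k kp; rewrite msubZ rpredZ // msubX; have /= <- := hp _ kp; rewrite mdegE big_distrl /=.
elim/big_ind2: _ => [|d1 q1 d2 q2 h1 h2|i _]; first exact: dhomog1.
  exact: dhomogM.
by rewrite mulnC; apply: dhomog_exp.
Qed.

Lemma hcompM n d e (p q : {mpoly F[n]}) : q \is e.-homog ->
  hcomp d (p * q) = if (e <= d)%N then hcomp (d - e)%N p * q else 0.
Proof.
move=> hq; rewrite {1}[p]mpolyE mulr_suml linear_sum /=.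
have mon m : m \in msupp p -> hcomp d (p@_m *: 'X_[m] * q) =
    if (mdeg m + e == d)%N then p@_m *: 'X_[m] * q else 0.
  move=> mp; have h : p@_m *: 'X_[m] * q \is (mdeg m + e).-homog.
    by apply: dhomogM => //; rewrite rpredZ // dhomogX.
  case: eqP => [<-|/eqP ne]; first by rewrite pihomog_dE.
  by rewrite (pihomog_ne0 ne h).
rewrite big_seq (eq_bigr _ mon) -big_seq /=.
case: leqP => ed; last first.
  rewrite big1 // => m _; case: eqP => // e1.
  by move: ed; rewrite -e1 ltnNge leq_addl.
rewrite pihomogE mulr_suml big_mkcond /= [RHS]big_mkcond /=; apply: eq_bigr => m _.
by have <- : (mdeg m + e == d)%N = (mdeg m == d - e)%N by rewrite -(eqn_add2r e (mdeg m)) subnK.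
Qed.

Lemma hcomp_sum n (p : {mpoly F[n]}) k : (msize p <= k)%N ->
  p = \sum_(d < k) hcomp d p.
Proof. exact: pihomog_partitionE. Qed.

Lemma msize_homog n d (p : {mpoly F[n]}) : p \is d.-homog -> (msize p <= d.+1)%N.
Proof. by move=> /dhomogP hp; rewrite msizeE; apply/bigmax_leqP_seq => m mp _; rewrite hp. Qed.

Definition inI n r (h : 'I_r -> {mpoly F[n]}) (A : {mpoly F[n]}) :=
  exists c, A = \sum_i c i * h i.

Lemma inI_ideal n r (h : 'I_r -> {mpoly F[n]}) : idealP (inI h).
Proof.
split; first by exists (fun=> 0); rewrite big1 // => i _; rewrite mul0r.
  move=> a b [c ->] [c' ->]; exists (fun i => c i + c' i).
  by rewrite -big_split; apply: eq_bigr => i _; rewrite mulrDl.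
move=> a b [c ->]; exists (fun i => b * c i).
by rewrite mulr_sumr; apply: eq_bigr => i _; rewrite mulrA.
Qed.

Lemma inI_gen n r (h : 'I_r -> {mpoly F[n]}) i : inI h (h i).
Proof.
exists (fun j => (j == i)%:R); rewrite (bigD1 i) //= eqxx mul1r big1 ?addr0 // => j /negPf->.
by rewrite mul0r.
Qed.

Lemma inI_hcomp n r (h : 'I_r -> {mpoly F[n]}) (dg : 'I_r -> nat) d A :
  (forall i, h i \is (dg i).-homog) -> inI h A -> inI h (hcomp d A).
Proof.
move=> hh [c ->]; rewrite linear_sum /=; apply: ideal_sum; first exact: inI_ideal.
move=> i _; rewrite (hcompM _ _ (hh i)); have [I0 _ IM] := inI_ideal h.
by case: ifP => _ //; apply: IM; apply: inI_gen.
Qed.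

Lemma inI_eval n r (h : 'I_r -> {mpoly F[n]}) A x :
  inI h A -> (forall i, (h i).@[x] = 0) -> A.@[x] = 0.
Proof.
move=> [c ->] hx; rewrite raddf_sum big1 //= => i _.
by rewrite mevalM hx mulr0.
Qed.

Definition mrest n (l : 'I_n.+1) : {mpoly F[n.+1]} -> {mpoly F[n]} :=
  msub (fun i => if unlift l i is Some j then 'X_j else 0).

Lemma meval_mrest n (l : 'I_n.+1) p a : (mrest l p).@[a] = p.@[mins l a 0].
Proof.
rewrite /mrest meval_msub; apply: meval_eq => i; rewrite /mins.
by case: unlift => [j|]; rewrite ?mevalXU ?meval0.
Qed.

Lemma mrest_dv n (l : 'I_n.+1) p : exists q, p = mlft l (mrest l p) + 'X_l * q.
Proof.
elim/mpoly_ring_ind: p => [c|i|p q [p' pE] [q' qE]|p q [p' pE] [q' qE]].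
- by exists 0; rewrite /mrest /mlft !msubC mulr0 addr0.
- rewrite /mrest msubXU; case: unliftP => [j ->|->].
    by exists 0; rewrite /mlft msubXU mulr0 addr0.
  by exists 1; rewrite (rmorph0 (mlft l)) add0r mulr1.
- exists (p' + q'); rewrite /mrest msubD mlftD -/(mrest l p) -/(mrest l q).
  by rewrite {1}pE {1}qE mulrDr addrACA.
- exists (mlft l (mrest l p) * q' + p' * q); rewrite /mrest msubM mlftM -/(mrest l p) -/(mrest l q).
  rewrite {1}pE mulrDl {1}qE; ring.
Qed.

Lemma dhomog_mrest n (l : 'I_n.+1) d p : p \is d.-homog -> mrest l p \is d.-homog.
Proof.
move=> hp; rewrite -[d]muln1; apply: dhomog_msub => // i.
by case: unlift => [j|]; rewrite ?rpred0 ?dhomogX /= ?mdeg1.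
Qed.

Definition idealAdd n (J : {mpoly F[n]} -> Prop) u (a : {mpoly F[n]}) := exists b, J (a - b * u).

Lemma idealAdd_ideal n (J : {mpoly F[n]} -> Prop) u : idealP J -> idealP (idealAdd J u).
Proof.
move=> iJ; have [J0 JD JM] := iJ; split; first by exists 0; rewrite mul0r subr0.
  by move=> a b [c ca] [c' cb]; exists (c + c'); rewrite mulrDl opprD addrACA; apply: JD.
by move=> a b [c ca]; exists (b * c); rewrite -mulrA -mulrBr; apply: JM.
Qed.

Lemma idealAdd_sub n (J : {mpoly F[n]} -> Prop) u a : J a -> idealAdd J u a.
Proof. by exists 0; rewrite mul0r subr0. Qed.

Lemma idealAdd_gen n (J : {mpoly F[n]} -> Prop) u : idealP J -> idealAdd J u u.
Proof. by move=> [J0 _ _]; exists 1; rewrite mul1r subrr. Qed.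

Lemma ideal_trans n (J : {mpoly F[n]} -> Prop) a b c :
  idealP J -> J (a - b) -> J (b - c) -> J (a - c).
Proof. by move=> [_ JD _] h1 h2; rewrite -(subrK b a) -addrA; apply: JD. Qed.

Lemma ideal_mul n (J : {mpoly F[n]} -> Prop) a b a' b' :
  idealP J -> J (a - b) -> J (a' - b') -> J (a * a' - b * b').
Proof.
move=> iJ h1 h2; have [_ JD JM] := iJ; apply: (@ideal_trans _ _ _ (b * a')) => //.
  by rewrite -mulrBl mulrC; apply: JM.
by rewrite -mulrBr; apply: JM.
Qed.

(** If each ideal [J + (u - r)] contained [1], the product of these relations would put [1] in
    [J]. *)
Lemma ideal_prod_split n (J : {mpoly F[n]} -> Prop) (rs : seq F) u : idealP J -> ~ J 1 ->
  J (\prod_(r <- rs) (u - r%:MP)) -> exists r, ~ idealAdd J (u - r%:MP) 1.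
Proof.
move=> iJ J1 h; apply: NNPP => H; apply: J1.
have {}H r : exists b, J (1 - b * (u - r%:MP)).
  by apply: NNPP => H'; apply: H; exists r.
have [b hb] := fun_choice H; have [J0 JD JM] := iJ.
suff: J (1 - (\prod_(r <- rs) b r) * \prod_(r <- rs) (u - r%:MP)).
  move=> h1; rewrite -(subrK ((\prod_(r <- rs) b r) * \prod_(r <- rs) (u - r%:MP)) 1).
  by apply: JD => //; apply: JM.
rewrite -big_split; elim: (rs) => [|r s IH]; first by rewrite big_nil subrr.
by rewrite big_cons /= -{1}[1]mulr1; apply: ideal_mul.
Qed.

End Homogeneous.

(** * The homogeneous Nullstellensatz *)

Section Nullstellensatz.
Variable F : closedFieldType.
Hypothesis Finf : forall s : seq F, exists x, x \notin s.

Lemma ideal_point_const n (J : {mpoly F[n]} -> Prop) x (a : {mpoly F[n]}) : idealP J ->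
  (forall i, J ('X_i - (x i)%:MP)) -> J (a - (a.@[x])%:MP).
Proof.
move=> iJ hx; have [J0 JD JM] := iJ.
elim/mpoly_ring_ind: a => [c|i|p q hp hq|p q hp hq].
- by rewrite mevalC subrr.
- by rewrite mevalXU.
- by rewrite mevalD mpolyCD opprD addrACA; apply: JD.
- by rewrite mevalM mpolyCM; apply: ideal_mul.
Qed.

(** The variables are fixed one at a time: for each, some linear factor can be added to the ideal
    without making it the unit ideal. In the end every polynomial is congruent to its value at
    [x]. *)
Lemma zerodim_point n (J : {mpoly F[n]} -> Prop) : idealP J -> ~ J 1 ->
  (forall j, exists rs : seq F, J (\prod_(r <- rs) ('X_j - r%:MP))) ->
  exists x, forall a, J a -> a.@[x] = 0.
Proof.
move=> iJ J1 hJ.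
have step k : (k <= n)%N -> exists (K : {mpoly F[n]} -> Prop) (x : 'I_n -> F),
    [/\ idealP K, ~ K 1, forall a, J a -> K a
      & forall i : 'I_n, (i < k)%N -> K ('X_i - (x i)%:MP)].
  elim: k => [|k IH] kn; first by exists J, (fun=> 0); split.
  have [K [x [iK K1 JK hx]]] := IH (ltnW kn).
  have [rs hrs] := hJ (Ordinal kn).
  have [r hr] := ideal_prod_split iK K1 (JK _ hrs).
  exists (idealAdd K ('X_(Ordinal kn) - r%:MP)), (fun i : 'I_n => if (i < k)%N then x i else r).
  split => //; first exact: idealAdd_ideal.
    by move=> a Ja; apply: idealAdd_sub; apply: JK.
  move=> i; rewrite ltnS leq_eqVlt => /orP[/eqP ik|ik].
    have -> : i = Ordinal kn by apply: val_inj.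
    by rewrite /= ltnn; apply: idealAdd_gen.
  by rewrite ik; apply: idealAdd_sub; apply: hx.
have [K [x [iK K1 JK hx]]] := step n (leqnn n); exists x => a Ja.
apply/eqP/negP => /negP nz; apply: K1.
have [K0 KD KM] := iK.
have h : K (a.@[x])%:MP.
  rewrite -[X in K X]opprK -[in X in K (- X)](addKr a (- _)); apply: idealN => //.
  apply: KD; first by apply: idealN => //; apply: JK.
  by apply: ideal_point_const => // i; apply: hx.
have -> : 1 = (a.@[x])^-1%:MP * (a.@[x])%:MP :> {mpoly F[n]} by rewrite -mpolyCM mulVf.
exact: KM.
Qed.

Section Chart.
Variables (n r : nat) (h : 'I_r -> {mpoly F[n.+1]}) (dg : 'I_r -> nat) (l : 'I_n.+1) (L0 : nat).
Hypothesis hh : forall i, h i \is (dg i).-homog.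
Hypothesis L0p : (0 < L0)%N.
Hypothesis red : forall p, p \is L0.-homog -> exists2 q, q \is (L0.-1).-homog & inI h (p - 'X_l * q).
Let J := idealAdd (inI h) ('X_l - 1%:MP).

(** Putting [X_l = 1] turns [red] into a reduction to degree less than [L0]. The quotient by [J] is
    thus finite-dimensional, the powers of [X_j] are dependent modulo [J], and the dependence
    factors into linear terms over a closed field. *)
Lemma chart_split j : exists rs : seq F, J (\prod_(r <- rs) ('X_j - r%:MP)).
Proof.
have iI : idealP (inI h) := inI_ideal h; have [I0 ID IM] := iI.
have iJ : idealP J := idealAdd_ideal _ iI; have [J0 JD JM] := iJ.
have WL m : mdeg m = L0 -> exists2 b : 'I_1 -> {mpoly F[n.+1]},
    (forall j, (msize (b j) <= L0)%N) & J ('X_[m] - \sum_j 1 * b j).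
  move=> mE; have [|q hq Hq] := red (p := 'X_[m]); first by rewrite dhomogX /= mE.
  exists (fun=> q) => [_|]; first by have := msize_homog hq; rewrite prednK.
  rewrite big_ord1 mul1r; apply: (@ideal_trans _ _ _ _ ('X_l * q)) => //.
    exact: idealAdd_sub.
  exists q; rewrite mpolyC1 mulrBr mulr1 [q * _]mulrC subrr; exact: I0.
have sp A : exists c : 'X_{1..n.+1 < L0} -> F, J (A - \sum_m c m *: 'X_[m]).
  have [c hc] := span_mod iJ WL (leqnSn (msize A)).
  exists (fun m => \sum_g c (m, g)).
  suff -> : \sum_m (\sum_g c (m, g)) *: 'X_[m] =
    \sum_k c k *: ('X_[k.1] * \prod_(j < 1) (1 : {mpoly F[n.+1]}) ^+ (k.2 j)) by [].
  transitivity (\sum_(m : 'X_{1..n.+1 < L0}) \sum_g c (m, g) *: ('X_[m] : {mpoly F[n.+1]})).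
    by apply: eq_bigr => m _; rewrite scaler_suml.
  rewrite pair_bigA /=; apply: eq_bigr => -[m g] _ /=.
  by rewrite big_ord1 expr1n mulr1.
pose V := #|{: 'X_{1..n.+1 < L0}}|.
have [||lam [i0 li0] hl] := @linear_dependence_mod F n.+1 J 'I_V.+1 {: 'X_{1..n.+1 < L0}}
  (fun i => 'X_j ^+ i) (fun m => 'X_[m]) iJ; first by rewrite card_ord.
  by move=> i; apply: sp.
pose g := \poly_(i < V.+1) lam (inord i).
have gn0 : g != 0.
  apply/eqP => /(congr1 (fun q : {poly F} => q`_i0)); rewrite coef0 coef_poly ltn_ord inord_val => e.
  by rewrite e eqxx in li0.
have [rs gE] := closed_field_poly_normal g; exists rs.
have E : \sum_i lam i *: 'X_j ^+ i = (map_poly (@mpolyC n.+1 F) g).['X_j].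
  rewrite (@horner_coef_wide _ V.+1); last first.
    by apply: leq_trans (size_poly _ _) _; apply: size_poly.
  by apply: eq_bigr => i _; rewrite coef_map coef_poly ltn_ord inord_val mul_mpolyC.
move: hl; rewrite E gE map_polyZ rmorph_prod hornerZ horner_prod /= => hl.
have lc : lead_coef g != 0 by rewrite lead_coef_eq0.
suff -> : \prod_(r <- rs) ('X_j - r%:MP) = (lead_coef g)^-1%:MP * ((lead_coef g)%:MP *
  \prod_(i <- rs) (map_poly (mpolyC n.+1 (R:=F)) ('X - i%:P)).['X_j]).
  exact: JM.
rewrite mulrA -mpolyCM mulVf // mul1r; apply: eq_bigr => r0 _.
by rewrite rmorphB /= map_polyX map_polyC hornerXsubC.
Qed.

(** The element [a] of [I] agrees with [p] on [X_l = 1]. Its homogenisation [B] stays in the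
    homogeneous ideal [I] and equals [p] up to powers of [X_l]. *)
Lemma chart_homogenize d p : p \is d.-homog -> J p -> exists B, inI h ('X_l ^+ B * p).
Proof.
have iI : idealP (inI h) := inI_ideal h; have [I0 ID IM] := iI.
move=> hp [b hb]; pose a := p - b * ('X_l - 1%:MP); pose M := msize a; exists M.
pose B := \sum_(j < M) 'X_l ^+ (M - j) * hcomp j a.
have IB : inI h B.
  by apply: ideal_sum => // j _; apply: IM; apply: inI_hcomp hb.
suff -> : 'X_l ^+ M * p = 'X_l ^+ d * B by apply: IM.
(* The identity is checked pointwise; the extra factor [X_l] disposes of the points with
   [x l = 0]. *)
apply: (@mulfI _ ('X_l : {mpoly F[n.+1]})).
  by rewrite -msize_poly_eq0 msizeX.
apply: (mpoly_eval_inj Finf) => x; rewrite !mevalM mevalXU.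
case: (eqVneq (x l) 0) => [->|xl]; first by rewrite !mul0r.
congr (_ * _); rewrite (raddf_sum (meval x)) !rmorphXn /= mevalXU.
pose x' i := (x l)^-1 * x i.
have ax : a.@[x'] = p.@[x'].
  by rewrite mevalB mevalM mevalB mevalXU !mevalC /x' mulVf // subrr mulr0 subr0.
have -> : p.@[x] = x l ^+ d * a.@[x'].
  rewrite ax (dhomog_scale _ _ hp) mulrA -exprMn mulfV // expr1n mul1r //.
rewrite mulrCA; congr (_ * _); rewrite {1}(hcomp_sum (leqnn M)) (raddf_sum (meval x')) mulr_sumr /=.
apply: eq_bigr => j _; rewrite mevalM rmorphXn /= mevalXU (dhomog_scale _ _ (pihomogP mdeg j a)).
rewrite mulrA; congr (_ * _); rewrite exprVn -{1}(subnK (ltnW (ltn_ord j))) exprD mulfK //.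
by rewrite expf_neq0.
Qed.

End Chart.

(** Induction on the hyperplane [X_l = 0]: there all forms of degree [L0] lie in the ideal, so in
    the full space they are [X_l] times a smaller form modulo [I]. In the chart [X_l = 1] the ideal
    has no zero, hence contains [1], and [I] contains a power of [X_l]. *)
Lemma nullstellensatz_homog n r (h : 'I_r -> {mpoly F[n]}) (dg : 'I_r -> nat) :
  (forall i, h i \is (dg i).-homog) ->
  (forall x, (forall i, (h i).@[x] = 0) -> forall j, x j = 0) ->
  exists2 L, (0 < L)%N & forall p, p \is L.-homog -> inI h p.
Proof.
elim: n h => [|n IH] h hh hz.
  exists 1%N => // p /dhomogP hp; suff -> : p = 0 by case: (inI_ideal h).
  apply/mpolyP => m; rewrite mcoeff0; apply: memN_msupp_eq0; apply/negP => /hp /=.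
  by rewrite mdegE big_ord0.
pose l : 'I_n.+1 := ord0.
have [||L0 L0p hL0] := IH (fun i => mrest l (h i)).
- by move=> i; apply: dhomog_mrest.
- move=> a ha j; rewrite -(mins_lift l a 0 j); apply: hz => i.
  by rewrite -meval_mrest.
pose I := inI h; have iI : idealP I := inI_ideal h; have [I0 ID IM] := iI.
have red p : p \is L0.-homog -> exists2 q, q \is (L0.-1).-homog & I (p - 'X_l * q).
  move=> hp; have [c hc] := hL0 _ (dhomog_mrest l hp).
  have [q pE] := mrest_dv l p.
  have /fun_choice[qq hq] : forall i, exists q, h i = mlft l (mrest l (h i)) + 'X_l * q.
    by move=> i; apply: mrest_dv.
  pose q' := q - \sum_i mlft l (c i) * qq i.
  have E : I (p - 'X_l * q').
    exists (fun i => mlft l (c i)).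
    transitivity (mlft l (mrest l p) + 'X_l * \sum_i mlft l (c i) * qq i).
      by rewrite {1}pE /q'; ring.
    rewrite hc.
    rewrite (rmorph_sum (mlft l)) mulr_sumr -big_split /=; apply: eq_bigr => i _.
    by rewrite mlftM [in RHS](hq i) mulrDr mulrCA.
  exists (hcomp L0.-1 q'); first exact: pihomogP.
  have := inI_hcomp L0 hh E; rewrite raddfB /= pihomog_dE // mulrC.
  have hX : ('X_l : {mpoly F[n.+1]}) \is 1.-homog by rewrite dhomogX /= mdeg1.
  by rewrite (hcompM _ _ hX) L0p subn1 mulrC.
suff [M hM] : exists M, I ('X_l ^+ M).
  (* Each block of degree [L0] in a monomial yields one factor [X_l], so degree [L0 * M.+1] yields
     more than the power [X_l ^+ M] that lies in [I]. *)
  have pw j m : mdeg m = (L0 * j)%N -> exists q, I ('X_[m] - 'X_l ^+ j * q).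
    elim: j m => [|j IHj] m mE; first by exists 'X_[m]; rewrite mul1r subrr.
    have [|m1 [m2 [mm m1E m2E]]] := @mdeg_split _ m L0; first by rewrite mE mulnS leq_addr.
    have [|q1 hq1] := IHj m2; first by rewrite m2E mE mulnS addKn.
    have [|q2 _ hq2] := red 'X_[m1]; first by rewrite dhomogX /= m1E.
    by exists (q2 * q1); rewrite mm mpolyXD exprS mulrACA; apply: ideal_mul.
  exists (L0 * M.+1)%N => [|p hp]; first by rewrite muln_gt0 L0p.
  rewrite [p]mpolyE big_seq; apply: ideal_sum => // m mp; apply: idealZ => //.
  have [|q hq] := pw M.+1 m; first by move/dhomogP: hp => /(_ _ mp).
  rewrite -(subrK ('X_l ^+ M.+1 * q) 'X_[m]); apply: ID => //.
  by rewrite exprSr -mulrA mulrC; apply: IM.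
pose J := idealAdd I ('X_l - 1%:MP); have iJ : idealP J := idealAdd_ideal _ iI.
case: (classic (J 1)) => [J1|J1]; last first.
  have [|x hx] := zerodim_point iJ J1; first by move=> j; apply: (chart_split L0p red).
  have x0 : forall j, x j = 0.
    by apply: hz => i; apply: hx; apply: idealAdd_sub; apply: inI_gen.
  have := hx _ (idealAdd_gen ('X_l - 1%:MP) iI).
  by rewrite mevalB mevalXU mevalC x0 sub0r => /eqP; rewrite oppr_eq0 oner_eq0.
have h1 : (1 : {mpoly F[n.+1]}) \is 0.-homog by apply: dhomog1.
by have [M hM] := chart_homogenize hh h1 J1; exists M; rewrite mulr1 in hM.
Qed.

End Nullstellensatz.

(** * Generic polynomial maps *)

Section PolyFun.
Variables (F : fieldType) (K : nat).

Definition polyfun (u : ('I_K -> F) -> F) := exists p : {mpoly F[K]}, forall c, u c = p.@[c].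

Lemma pf_const a : polyfun (fun=> a).
Proof. by exists a%:MP => c; rewrite mevalC. Qed.

Lemma pf_coord j : polyfun (fun c => c j).
Proof. by exists 'X_j => c; rewrite mevalXU. Qed.

Lemma pf_ext u v : u =1 v -> polyfun u -> polyfun v.
Proof. by move=> uv [p hp]; exists p => c; rewrite -uv. Qed.

Lemma pf_add u v : polyfun u -> polyfun v -> polyfun (fun c => u c + v c).
Proof. by move=> [p hp] [q hq]; exists (p + q) => c; rewrite mevalD hp hq. Qed.

Lemma pf_opp u : polyfun u -> polyfun (fun c => - u c).
Proof. by move=> [p hp]; exists (- p) => c; rewrite mevalN hp. Qed.

Lemma pf_mul u v : polyfun u -> polyfun v -> polyfun (fun c => u c * v c).
Proof. by move=> [p hp] [q hq]; exists (p * q) => c; rewrite mevalM hp hq. Qed.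

Lemma pf_sum I (r : seq I) (Q : pred I) (u : I -> ('I_K -> F) -> F) :
  (forall i, polyfun (u i)) -> polyfun (fun c => \sum_(i <- r | Q i) u i c).
Proof.
move=> hu; elim: r => [|i r IH].
  by apply: (pf_ext _ (pf_const 0)) => c; rewrite big_nil.
case Qi: (Q i); last by apply: (pf_ext _ IH) => c; rewrite big_cons Qi.
by apply: (pf_ext _ (pf_add (hu i) IH)) => c; rewrite big_cons Qi.
Qed.

Lemma pf_prod I (r : seq I) (Q : pred I) (u : I -> ('I_K -> F) -> F) :
  (forall i, polyfun (u i)) -> polyfun (fun c => \prod_(i <- r | Q i) u i c).
Proof.
move=> hu; elim: r => [|i r IH].
  by apply: (pf_ext _ (pf_const 1)) => c; rewrite big_nil.
case Qi: (Q i); last by apply: (pf_ext _ IH) => c; rewrite big_cons Qi.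
by apply: (pf_ext _ (pf_mul (hu i) IH)) => c; rewrite big_cons Qi.
Qed.

Lemma pf_exp u k : polyfun u -> polyfun (fun c => u c ^+ k).
Proof. by move=> [p hp]; exists (p ^+ k) => c; rewrite rmorphXn hp. Qed.

Lemma pf_det q (A : 'I_q -> 'I_q -> ('I_K -> F) -> F) :
  (forall i j, polyfun (A i j)) -> polyfun (fun c => \det (\matrix_(i, j) A i j c)).
Proof.
move=> hA; apply: (@pf_ext (fun c : 'I_K -> F => \sum_(s : 'S_q) (-1) ^+ s * \prod_i A i (s i) c)).
  move=> c; apply: eq_bigr => s _; congr (_ * _); by apply: eq_bigr => i _; rewrite mxE.
by apply: pf_sum => s; apply: pf_mul; [apply: pf_const|apply: pf_prod].
Qed.

End PolyFun.

Section Generic.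
Variables (F : closedFieldType) (n d : nat).
Hypothesis hchar : [pchar F] =i pred0.

Let K := #|{: coef_index n d}|.
Let Finf := closed_infinite hchar.

Definition fc (c : 'I_K -> F) : polymap F n := fun i =>
  \sum_(m : 'X_{1..n.+1 < d.+1} | mdeg m == d) c (enum_rank (i, m)) *: 'X_[m].

Lemma is_homogE (p : {mpoly F[n.+1]}) : is_homog d p <-> p \is d.-homog.
Proof.
split=> [h|/dhomogP h m]; first by apply/dhomogP => m; rewrite mcoeff_msupp => /h.
by rewrite -mcoeff_msupp => /h.
Qed.

Lemma fc_homog c i : fc c i \is d.-homog.
Proof. by apply: rpred_sum => m md; rewrite rpredZ // dhomogX. Qed.

Lemma fcK f : (forall i, f i \is d.-homog) -> fc (coef_vec (d := d) f) = f.
Proof.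
move=> hf; apply: functional_extensionality => i; apply/mpolyP => m.
rewrite /fc raddf_sum /=.
have E (k : 'X_{1..n.+1 < d.+1}) : (coef_vec (d := d) f (enum_rank (i, k)) *: 'X_[k])@_m =
    if bmnm k == m then (f i)@_m else 0.
  rewrite mcoeffZ mcoeffX /coef_vec enum_rankK.
  by case: eqP => [<-|_]; rewrite ?mulr1 ?mulr0.
rewrite (eq_bigr _ (fun k _ => E k)) -big_mkcondr /=.
case: (eqVneq (mdeg m) d) => [md|nd].
  have lt : (mdeg m < d.+1)%N by rewrite md.
  rewrite (big_pred1 (BMultinom lt)) //= => k; rewrite -[RHS](inj_eq val_inj) /=.
  by case: (eqVneq (bmnm k) m) => [->|]; rewrite ?md ?eqxx ?andbF.
rewrite big_pred0 => [|k]; last first.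
  by apply/negbTE/negP => /andP[/eqP kd /eqP km]; rewrite -km kd eqxx in nd.
apply/esym/memN_msupp_eq0/negP => /(dhomogP _ _ _ (hf i)) /= md.
by rewrite md eqxx in nd.
Qed.

(** The parameter [c] ranges over the whole coefficient space, although [fc] reads only the
    coordinates of degree [d]; [gen_final] deals with the others. *)
Definition gen (Q : polymap F n -> Prop) :=
  exists2 G : {mpoly F[K]}, G != 0 & forall c, G.@[c] != 0 -> Q (fc c).

Lemma gen_and Q1 Q2 : gen Q1 -> gen Q2 -> gen (fun f => Q1 f /\ Q2 f).
Proof.
move=> [G1 n1 h1] [G2 n2 h2]; exists (G1 * G2); first by rewrite mulf_neq0.
by move=> c; rewrite mevalM mulf_eq0 negb_or => /andP[/h1 ? /h2 ?].
Qed.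

Lemma gen_weak (Q1 Q2 : polymap F n -> Prop) :
  (forall f, (forall i, f i \is d.-homog) -> Q1 f -> Q2 f) -> gen Q1 -> gen Q2.
Proof. by move=> h [G n1 h1]; exists G => // c /h1; apply: h => i; apply: fc_homog. Qed.

Lemma gen_forall (I : finType) (Q : I -> polymap F n -> Prop) :
  (forall i, gen (Q i)) -> gen (fun f => forall i, Q i f).
Proof.
move=> hQ; have /fun_choice[G0 hG] : forall i, exists G : {mpoly F[K]}, G != 0 /\
    forall c, G.@[c] != 0 -> Q i (fc c).
  by move=> i; have [G ? ?] := hQ i; exists G.
 exists (\prod_i G0 i); first by apply/prodf_neq0 => i _; case: (hG i).
move=> c; rewrite rmorph_prod => /prodf_neq0 h i; case: (hG i) => _; apply.
exact: h.
Qed.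

Lemma gen_pf (u : ('I_K -> F) -> F) f0 (Q : polymap F n -> Prop) : polyfun u ->
  (forall i, f0 i \is d.-homog) -> u (coef_vec (d := d) f0) != 0 ->
  (forall c, u c != 0 -> Q (fc c)) -> gen Q.
Proof.
move=> [G hG] hf u0 hQ; exists G; last by move=> c; rewrite -hG; apply: hQ.
by apply: contraNneq u0 => G0; rewrite hG G0 meval0.
Qed.

(** [G] could vanish on every vector [coef_vec f], whose coordinates of degree below [d] are zero.
    These coordinates are therefore frozen at the values they have in a point [c0] with [G] nonzero,
    which does not change [fc]. *)
Lemma gen_final (Q B : polymap F n -> Prop) : gen Q ->
  (forall f, Q f -> is_endo d f) -> (forall f, Q f -> is_endo d f -> B f -> False) ->
  exists G : {mpoly F[K]},
    (exists f0 : polymap F n, is_endo d f0 /\ G.@[coef_vec (d:=d) f0] != 0) /\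
    (forall f : polymap F n, is_endo d f -> B f -> G.@[coef_vec (d:=d) f] = 0).
Proof.
move=> [G G0 hG] hE hB; have [c0 hc0] := mpoly_nonroot Finf G0.
pose top (j : 'I_K) := mdeg (enum_val j).2 == d.
pose G' := msub (fun j => if top j then 'X_j else (c0 j)%:MP) G.
have G'E c : G'.@[c] = G.@[fun j => if top j then c j else c0 j].
  by rewrite /G' meval_msub; apply: meval_eq => j; case: (top j); rewrite ?mevalXU ?mevalC.
have fcE c : fc (fun j => if top j then c j else c0 j) = fc c.
  apply: functional_extensionality => i; apply: eq_bigr => m md.
  by rewrite /top enum_rankK md.
exists G'; split.
  exists (fc c0); split; first by apply: hE; apply: hG.
  rewrite G'E; suff -> : G.@[fun j => if top j then coef_vec (d:=d) (fc c0) j else c0 j] = G.@[c0].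
    by [].
  apply: meval_eq => j; case: ifP => // tj; rewrite /coef_vec; move: tj; rewrite /top.
  case ej: (enum_val j) => [i m] /= md; rewrite /fc raddf_sum /= (bigD1 m) //=.
  rewrite mcoeffZ mcoeffX eqxx mulr1 -ej enum_valK big1 ?addr0 // => k /andP[_ km].
  by rewrite mcoeffZ mcoeffX (inj_eq val_inj) (negPf km) mulr0.
move=> f ef Bf; apply/eqP/negP => /negP; rewrite G'E => /hG; rewrite fcE fcK => [Qf|i].
  exact: hB Qf ef Bf.
by apply/is_homogE; case: ef.
Qed.

Lemma pf_meval_fc i (x : 'I_n.+1 -> ('I_K -> F) -> F) : (forall j, polyfun (x j)) ->
  polyfun (fun c => (fc c i).@[fun j => x j c]).
Proof.
move=> hx; apply: (@pf_ext _ _ (fun c => \sum_(k : 'X_{1..n.+1 < d.+1} | mdeg k == d)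
  c (enum_rank (i, k)) * \prod_j x j c ^+ bmnm k j)).
  by move=> c; rewrite /fc raddf_sum /=; apply: eq_bigr => k _; rewrite mevalZ mevalX.
apply: pf_sum => k; apply: pf_mul; first exact: pf_coord.
by apply: pf_prod => j; apply: pf_exp.
Qed.

Lemma pf_meval m (p : {mpoly F[m]}) (x : 'I_m -> ('I_K -> F) -> F) : (forall j, polyfun (x j)) ->
  polyfun (fun c => p.@[fun j => x j c]).
Proof.
move=> hx; apply: (@pf_ext _ _ (fun c => \sum_(k <- msupp p) p@_k * \prod_j x j c ^+ k j)).
  by move=> c; rewrite mevalE.
by apply: pf_sum => k; apply: pf_mul; [apply: pf_const|apply: pf_prod => j; apply: pf_exp].
Qed.

Lemma pf_mderiv_fc i l (x : 'I_n.+1 -> ('I_K -> F) -> F) : (forall j, polyfun (x j)) ->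
  polyfun (fun c => ((fc c i)^`M(l)).@[fun j => x j c]).
Proof.
move=> hx; apply: (@pf_ext _ _ (fun c => \sum_(k : 'X_{1..n.+1 < d.+1} | mdeg k == d)
  c (enum_rank (i, k)) * (('X_[k])^`M(l)).@[fun j => x j c])).
  move=> c; rewrite /fc (raddf_sum (mderiv l)) (raddf_sum (meval _)) /=; apply: eq_bigr => k _.
  by rewrite linearZ mevalZ.
by apply: pf_sum => k; apply: pf_mul; [apply: pf_coord|apply: pf_meval].
Qed.

End Generic.

Section Jacobian.
Variables (F : comNzRingType) (n : nat).

Definition jac (f : polymap F n) : {mpoly F[n.+1]} := \det (\matrix_(i, j) (f i)^`M(j)).

Lemma meval_jac f x : (jac f).@[x] = \det (\matrix_(i, j) ((f i)^`M(j)).@[x]).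
Proof.
rewrite /jac -det_map_mx; congr (\det _); apply/matrixP => i j; by rewrite !mxE.
Qed.

End Jacobian.

Lemma mderiv_exp (F : comNzRingType) n (p : {mpoly F[n]}) k j :
  (p ^+ k)^`M(j) = p ^+ k.-1 * p^`M(j) *+ k.
Proof.
elim: k => [|k IH]; first by rewrite expr0 -mpolyC1 mderivC mulr0n.
rewrite exprS mderivM IH /= mulrSr addrC [X in _ + X]mulrC; congr (_ + _).
case: k {IH} => [|k]; first by rewrite !mulr0n mulr0.
by rewrite -mulrnAr mulrA -exprS mulrnAr.
Qed.

Section CoordinatePoints.
Variables (F : closedFieldType) (n d : nat).
Hypothesis hchar : [pchar F] =i pred0.
Hypothesis d1 : (1 < d)%N.

Definition pt (l : 'I_n.+1) : 'I_n.+1 -> F := fun i => (i == l)%:R.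

(** This makes the Jacobian form monic up to a constant in every variable, as the conductor argument
    requires. For the witness [f0] the Jacobian matrix at [pt l] is diagonal with entries [1] and
    [d]. *)
Lemma gen_jac_pt : gen d (fun f : polymap F n => forall l, (jac f).@[pt l] != 0).
Proof.
apply: (@gen_forall _ _ _ 'I_n.+1 (fun l f => (jac f).@[pt l] != 0)) => l.
pose f0 : polymap F n := fun i => 'X_i * 'X_l ^+ d.-1.
have hf0 i : f0 i \is d.-homog.
  have : f0 i \is (1 + 1 * d.-1).-homog.
    by apply: dhomogM; last apply: dhomog_exp; rewrite dhomogX /= mdeg1.
  by rewrite mul1n add1n prednK // ltnW.
apply: (@gen_pf F n d (fun c => \det (\matrix_(i, j) ((fc c i)^`M(j)).@[pt l])) f0).
- by apply: pf_det => i j; apply: pf_mderiv_fc => k; apply: pf_const.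
- exact: hf0.
- rewrite fcK; last exact: hf0.
  have -> : (\matrix_(i, j) ((f0 i)^`M(j)).@[pt l]) =
      diag_mx (\row_i (if i == l then d%:R else 1)) :> 'M[F]_n.+1.
    apply/matrixP => i j; rewrite !mxE /f0 mderivM mderiv_exp mderivXU.
    rewrite mevalD !mevalM rmorph_nat (rmorphMn (meval _)) /= mevalM rmorphXn /= !mevalXU rmorphXn /=.
    rewrite mevalXU mderivXU !rmorph_nat /pt eqxx !expr1n mulr1 mul1r.
    have [il|il] := eqVneq i l; last by rewrite mul0r addr0.
    rewrite il mul1r eq_sym; case: (j == l); last by rewrite !(mulr0n, mul0rn, addr0, mulr0).
    by rewrite [RHS]mulr1n -{2}(prednK (ltnW d1)) -add1n natrD.
  rewrite det_diag; apply/prodf_neq0 => i _; rewrite mxE; case: (i == l); last by rewrite oner_eq0.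
  by apply: natr_neq0 => //; rewrite -lt0n; apply: ltnW.
- by move=> c; rewrite meval_jac.
Qed.

End CoordinatePoints.

(** * Spanning families and determinants of coefficients *)

Section Coordinates.
Variables (F : fieldType) (n s : nat).
Notation T := 'X_{1..n < s.+1}.

Definition cv (A : {mpoly F[n]}) : 'rV[F]_#|{: T}| := \row_j A@_(bmnm (enum_val j)).

Lemma cv_sum (I : finType) (l : I -> F) (A : I -> {mpoly F[n]}) :
  cv (\sum_i l i *: A i) = \sum_i l i *: cv (A i).
Proof.
apply/rowP => j; rewrite mxE raddf_sum summxE /=; apply: eq_bigr => i _.
by rewrite mcoeffZ !mxE.
Qed.

Lemma cv_inj A : (msize A <= s.+1)%N -> cv A = 0 -> A = 0.
Proof.
move=> sA /rowP cA; apply/mpolyP => m; rewrite mcoeff0.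
case: (ltnP (mdeg m) s.+1) => ms.
  by have := cA (enum_rank (BMultinom ms)); rewrite !mxE enum_rankK.
exact: memN_msupp_eq0 (msize_mdeg_ge (leq_trans sA ms)).
Qed.

Definition cvM (rho : T -> {mpoly F[n]}) : 'M[F]_#|{: T}| :=
  \matrix_(i, j) (rho (enum_val i))@_(bmnm (enum_val j)).

Lemma row_cvM rho i : row i (cvM rho) = cv (rho (enum_val i)).
Proof. by apply/rowP => j; rewrite !mxE. Qed.

Lemma span_of_det rho : \det (cvM rho) != 0 -> (forall t, (msize (rho t) <= s.+1)%N) ->
  forall A, (msize A <= s.+1)%N -> exists l : T -> F, A = \sum_t l t *: rho t.
Proof.
move=> dn0 hr A sA.
have uM : cvM rho \in unitmx by rewrite unitmxE unitfE.
pose v := cv A *m invmx (cvM rho); exists (fun t => v 0 (enum_rank t)).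
apply/eqP; rewrite -subr_eq0; apply/eqP; apply: cv_inj.
  apply: leq_trans (msizeD_le _ _) _; rewrite geq_max sA msizeN.
  apply: leq_trans (msize_sum _ _ _) _; apply/bigmax_leqP => t _.
  exact: leq_trans (msizeZ_le _ _) _.
have -> : cv (A - \sum_t v 0 (enum_rank t) *: rho t) = cv A - cv (\sum_t v 0 (enum_rank t) *: rho t).
  by apply/rowP => j; rewrite !mxE mcoeffB.
rewrite cv_sum; suff -> : \sum_t v 0 (enum_rank t) *: cv (rho t) = v *m cvM rho.
  by rewrite /v mulmxKV // subrr.
rewrite mulmx_sum_row (reindex_onto enum_rank enum_val) /= => [|i _]; last by rewrite enum_valK.
apply: eq_big => [t|t _]; first by rewrite enum_rankK eqxx.
by rewrite row_cvM enum_rankK.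
Qed.

(** A spanning family with as many members as the dimension is independent: its matrix has a left
    inverse, which for a square matrix is also a right inverse. *)
Lemma indep_of_span rho : (forall m : T, exists l : T -> F, 'X_[m] = \sum_t l t *: rho t) ->
  forall l : T -> F, \sum_t l t *: rho t = 0 -> forall t, l t = 0.
Proof.
move=> /fun_choice[L hL] l l0.
pose La : 'M[F]_#|{: T}| := \matrix_(i, j) L (enum_val i) (enum_val j).
have comb (w : T -> F) : (\row_i w (enum_val i)) *m cvM rho = cv (\sum_t w t *: rho t).
  rewrite cv_sum mulmx_sum_row (reindex_onto enum_rank enum_val) /= => [|i _]; last first.
    by rewrite enum_valK.
  apply: eq_big => [t|t _]; first by rewrite enum_rankK eqxx.
  by rewrite row_cvM mxE enum_rankK.
have LM : La *m cvM rho = 1%:M.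
  apply/row_matrixP => i; rewrite row_mul.
  have -> : row i La = \row_j L (enum_val i) (enum_val j) by apply/rowP => j; rewrite !mxE.
  rewrite comb -hL; apply/rowP => j; rewrite !mxE mcoeffX.
  by rewrite (inj_eq val_inj) (inj_eq enum_val_inj).
have ML := mulmx1C LM.
have : (\row_i l (enum_val i)) *m cvM rho = 0.
  by rewrite comb l0; apply/rowP => j; rewrite !mxE mcoeff0.
move=> /(congr1 (mulmx^~ La)); rewrite -mulmxA ML mulmx1 mul0mx => /rowP h t.
by have := h (enum_rank t); rewrite !mxE enum_rankK.
Qed.

End Coordinates.

(** * Freeness over the subring generated by [f] *)

Section FreeBasis.
Variable F : fieldType.

(** The [q k] are unique as polynomials, so the second clause also contains the algebraic
    independence of the [h i]. *)
Definition free_basis n m (B : finType) (b : B -> {mpoly F[n]}) (h : 'I_m -> {mpoly F[n]}) :=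
  (forall A, exists q : B -> {mpoly F[m]}, A = \sum_k b k * msub h (q k)) /\
  (forall q : B -> {mpoly F[m]}, \sum_k b k * msub h (q k) = 0 -> forall k, q k = 0).

Lemma free_comp n m r (B B' : finType) (b : B -> {mpoly F[n]}) (b' : B' -> {mpoly F[m]})
  (f : 'I_m -> {mpoly F[n]}) (g : 'I_r -> {mpoly F[m]}) :
  free_basis b f -> free_basis b' g ->
  free_basis (fun k : B * B' => b k.1 * msub f (b' k.2)) (fun i => msub f (g i)).
Proof.
move=> [sf jf] [sg jg].
have E (q : B -> B' -> {mpoly F[r]}) : \sum_k b k * msub f (\sum_k' b' k' * msub g (q k k')) =
    \sum_(k : B * B') b k.1 * msub f (b' k.2) * msub (fun i => msub f (g i)) (q k.1 k.2).
  rewrite -(pair_bigA _ (fun k k' => b k * msub f (b' k') * msub (fun i => msub f (g i)) (q k k'))).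
  apply: eq_bigr => k _; rewrite (rmorph_sum (msub f)) mulr_sumr /=; apply: eq_bigr => k' _.
  by rewrite msubM msub_msub mulrA.
split=> [A|q q0 [k k']].
  have [q ->] := sf A; have /fun_choice[r0 hr] := fun k => sg (q k).
  exists (fun k => r0 k.1 k.2); rewrite -E; apply: eq_bigr => k _; by rewrite -hr.
have := E (fun k k' => q (k, k')); rewrite [RHS](_ : _ = 0); last first.
  by rewrite -[RHS]q0; apply: eq_bigr => -[].
by move=> /jf /(_ k) /jg /(_ k').
Qed.

Lemma free_id n : free_basis (fun _ : unit => (1 : {mpoly F[n]})) (fun i => 'X_i).
Proof.
have sumu (E : unit -> {mpoly F[n]}) : \sum_k E k = E tt.
  by rewrite (big_pred1 tt) // => -[].
split=> [A|q]; first by exists (fun=> A); rewrite sumu mul1r msub_id.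
by rewrite sumu mul1r msub_id => h [].
Qed.

Fixpoint fiter n (f : polymap F n) k : polymap F n :=
  if k is k'.+1 then fun i => msub (fiter f k') (f i) else fun i => 'X_i.

Lemma fiter_eval n (f : polymap F n) k x i : (fiter f k i).@[x] = iter k (peval f) x i.
Proof.
elim: k i => [|k IH] i /=; first by rewrite mevalXU.
by rewrite meval_msub /peval; apply: meval_eq => j; apply: IH.
Qed.

Lemma fiter_homog n d (f : polymap F n) k : (forall i, f i \is d.-homog) ->
  forall i, fiter f k i \is (d ^ k).-homog.
Proof.
move=> hf; elim: k => [|k IH] i /=; first by rewrite dhomogX /= mdeg1.
by rewrite expnS; apply: dhomog_msub.
Qed.

Lemma free_iter n (B : finType) (b : B -> {mpoly F[n.+1]}) (f : polymap F n) k :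
  free_basis b f -> exists (B' : finType) (b' : B' -> {mpoly F[n.+1]}), free_basis b' (fiter f k).
Proof.
move=> hf; elim: k => [|k [B' [b' IH]]]; first by exists unit, (fun=> 1); apply: free_id.
exists (B' * B)%type, (fun k0 => b' k0.1 * msub (fiter f k) (b k0.2)).
exact: free_comp IH hf.
Qed.

End FreeBasis.

Section GenericFree.
Variables (F : closedFieldType) (n d : nat).
Hypothesis hchar : [pchar F] =i pred0.
Hypothesis d0 : (0 < d)%N.
Notation N := n.+1.
(** The least degree in which every monomial is divisible by some [x_i^d]. *)
Let s0 := (N * d.-1).+1.

(* [m] with [x_i^d] traded for [f_i] at the first variable where this is possible. *)
Definition rhof (f : polymap F n) (m : 'X_{1..N}) : {mpoly F[N]} :=
  if [pick i | d <= m i]%N is Some i then f i * 'X_[[multinom m j - d * (j == i) | j < N]]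
  else 'X_[m].

(** With [m = r + d q] and all entries of [r] below [d], this is [x^r f^q]. Over the field these
    products will form a basis, so the [x^r] form one over the subring generated by [f]. *)
Definition rhob (f : polymap F n) (m : 'X_{1..N}) : {mpoly F[N]} :=
  'X_[[multinom m i %% d | i < N]] * \prod_i f i ^+ (m i %/ d).

Definition freedet (f : polymap F n) := \det (cvM (s := s0) (fun t => rhof f t)).

Lemma mnm_sub_pow (m : 'X_{1..N}) i : (d <= m i)%N ->
  m = ([multinom m j - d * (j == i) | j < N] + U_(i) *+ d)%MM.
Proof.
move=> di; apply/mnmP => j; rewrite mnmDE mulmnE mnm1E mnmE.
case: (eqVneq i j) => [<-|ij]; first by rewrite muln1 mul1n subnK.
by rewrite muln0 subn0 mul0n addn0.
Qed.

Lemma mdeg_sub_pow (m : 'X_{1..N}) i : (d <= m i)%N ->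
  (mdeg [multinom m j - d * (j == i) | j < N] + d = mdeg m)%N.
Proof. by move=> di; rewrite {2}(mnm_sub_pow di) mdegD mdegMn mdeg1 mul1n. Qed.

Lemma rhof_pow m : rhof (fun i => 'X_i ^+ d) m = 'X_[m].
Proof.
rewrite /rhof; case: pickP => [i di|//].
by rewrite [in RHS](mnm_sub_pow di) mpolyXD mulrC mpolyXn.
Qed.

(** For the power map [rhof] fixes every monomial, so its determinant is [1]. *)
Lemma gen_freedet : gen d (fun f : polymap F n => freedet f != 0).
Proof.
have hpow (i : 'I_N) : ('X_i : {mpoly F[N]}) ^+ d \is d.-homog.
  by rewrite -[X in X.-homog](mul1n d); apply: dhomog_exp; rewrite dhomogX /= mdeg1.
apply: (@gen_pf F n d (fun c => freedet (fc c)) (fun i => 'X_i ^+ d)) => //.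
  apply: pf_det => i j; rewrite /rhof; case: pickP => [l _|_]; last exact: pf_const.
  apply: (@pf_ext _ _ (fun c => \sum_(m : 'X_{1..N < d.+1} | mdeg m == d) c (enum_rank (l, m)) *
   ('X_[m] * 'X_[[multinom (enum_val i) j - d * (j == l) | j < N]] : {mpoly F[N]})@_(enum_val j))).
    move=> c; rewrite /fc mulr_suml raddf_sum /=; apply: eq_bigr => m _.
    by rewrite -scalerAl mcoeffZ.
  by apply: pf_sum => m; apply: pf_mul; [apply: pf_coord|apply: pf_const].
rewrite fcK // /freedet; suff -> : cvM (s := s0) (fun t => rhof (fun i => 'X_i ^+ d) t) = 1%:M.
  by rewrite det1 oner_neq0.
apply/matrixP => i j; rewrite !mxE rhof_pow mcoeffX (inj_eq val_inj).
by rewrite (inj_eq enum_val_inj).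
Qed.

Section Consequences.
Variable f : polymap F n.
Hypothesis hf : forall i, f i \is d.-homog.
Hypothesis dn0 : freedet f != 0.

Lemma rhof_homog m : rhof f m \is (mdeg m).-homog.
Proof.
rewrite /rhof; case: pickP => [i di|_]; last by rewrite dhomogX.
by rewrite -(mdeg_sub_pow di) addnC; apply: dhomogM => //; rewrite dhomogX.
Qed.

Lemma monomial_reduce (m : 'X_{1..N}) : (mdeg m <= s0)%N ->
  exists l : 'X_{1..N < s0.+1} -> F, 'X_[m] = \sum_(t : 'X_{1..N < s0.+1} | mdeg t == mdeg m) l t *: rhof f t.
Proof.
move=> ms; have [||l hl] := @span_of_det _ _ _ _ dn0 _ 'X_[m].
- by move=> t; apply: leq_trans (msize_homog (rhof_homog t)) _; exact: bmdeg.
- by rewrite msizeX.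
exists l; have h : ('X_[m] : {mpoly F[N]}) \is (mdeg m).-homog by rewrite dhomogX.
rewrite -[LHS](pihomog_dE h) hl linear_sum [RHS]big_mkcond /=; apply: eq_bigr => t _.
rewrite linearZ /=; case: eqP => [<-|/eqP ne]; first by rewrite pihomog_dE // rhof_homog.
by rewrite (pihomog_ne0 ne (rhof_homog t)) scaler0.
Qed.

(** In degree [s0] some exponent reaches [d], so every [rhof] of that degree carries a factor
    [f i]. *)
Lemma pow_inI j : inI f ('X_j ^+ s0).
Proof.
have [I0 ID IM] := inI_ideal f.
rewrite mpolyXn; have [|l ->] := @monomial_reduce (U_(j) *+ s0)%MM.
  by rewrite mdegMn mdeg1 mul1n.
apply: ideal_sum; first exact: inI_ideal.
move=> t /eqP; rewrite mdegMn mdeg1 mul1n => ts; apply: idealZ; first exact: inI_ideal.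
rewrite /rhof; case: pickP => [i di|no]; first by rewrite mulrC; apply: IM; apply: inI_gen.
suff : (mdeg t <= N * d.-1)%N by rewrite ts /s0 ltnn.
rewrite mdegE -[X in (X * _)%N]card_ord -sum_nat_const; apply: leq_sum => i _.
by have := no i; rewrite leqNgt => /negbFE; case: (d) d0.
Qed.

Lemma freedet_endo : is_endo d f.
Proof.
split=> [i|x hx j]; first by apply/is_homogE.
have := inI_eval (pow_inI j) hx; rewrite rmorphXn /= mevalXU => /eqP.
by rewrite expf_eq0 => /andP[_ /eqP].
Qed.

Definition Sp s A := exists l : 'X_{1..N < s.+1} -> F, A = \sum_t l t *: rhob f t.

Lemma Sp_sum s I (r : seq I) (Q : pred I) (E : I -> {mpoly F[N]}) :
  (forall i, Q i -> Sp s (E i)) -> Sp s (\sum_(i <- r | Q i) E i).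
Proof.
move=> h; elim/big_ind: _ => [|_ _ [l ->] [l' ->]|//].
  by exists (fun=> 0); rewrite big1 // => t _; rewrite scale0r.
exists (fun t => l t + l' t); rewrite -big_split /=.
by apply: eq_bigr => t _; rewrite scalerDl.
Qed.

Lemma SpZ s c A : Sp s A -> Sp s (c *: A).
Proof.
move=> [l ->]; exists (fun t => c * l t); rewrite scaler_sumr.
by apply: eq_bigr => t _; rewrite scalerA.
Qed.

Lemma Sp_rhob s (t : 'X_{1..N}) : (mdeg t <= s)%N -> Sp s (rhob f t).
Proof.
move=> ts; have ts1 : (mdeg t < s.+1)%N by [].
exists (fun t' => (t' == BMultinom ts1)%:R); rewrite (bigD1 (BMultinom ts1)) //= eqxx scale1r.
by rewrite big1 ?addr0 // => t' /negPf->; rewrite scale0r.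
Qed.

Lemma rhob_mulf (t : 'X_{1..N}) i : f i * rhob f t = rhob f (t + U_(i) *+ d)%MM.
Proof.
rewrite /rhob mulrCA; congr (_ * _).
  congr 'X_[_]; apply/mnmP => j; rewrite !(mnmE, mnmDE, mulmnE, mnm1E).
  by case: (i == j); rewrite ?mul1n ?modnDr ?mul0n ?addn0.
rewrite [RHS](bigD1 i) // [in LHS](bigD1 i) //= mnmDE mulmnE mnm1E eqxx mul1n divnDr ?dvdnn //.
rewrite divnn d0 addn1 exprS mulrA; congr (_ * _); apply: eq_bigr => j ji.
by rewrite mnmDE mulmnE mnm1E eq_sym (negPf ji) mul0n addn0.
Qed.

Lemma Sp_mulf s A i : Sp s A -> Sp (s + d) (f i * A).
Proof.
move=> [l ->]; rewrite mulr_sumr; apply: Sp_sum => t _; rewrite -scalerAr; apply: SpZ.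
rewrite rhob_mulf; apply: Sp_rhob; rewrite mdegD mdegMn mdeg1 mul1n leq_add2r.
by have := bmdeg t; rewrite ltnS.
Qed.

Lemma rhob_box (t : 'X_{1..N}) : (forall i, t i < d)%N -> rhob f t = 'X_[t].
Proof.
move=> h; rewrite /rhob big1 => [|i _]; last by rewrite divn_small.
by rewrite mulr1; congr 'X_[_]; apply/mnmP => i; rewrite mnmE modn_small.
Qed.

(** Strong induction on the degree. A block of degree at most [s0] is rewritten through [rhof].
    Terms with a factor [f i] have a cofactor of lower degree; in the others all exponents of the
    block are below [d], which forces the block to be the whole monomial. *)
Lemma Sp_monomial s (m : 'X_{1..N}) : mdeg m = s -> Sp s 'X_[m].
Proof.
elim/ltn_ind: s m => s IH m ms.
have [|m1 [m2 [mE m1E m2E]]] := @mdeg_split _ m (minn s s0); first by rewrite ms geq_minl.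
have [|l hl] := @monomial_reduce m1; first by rewrite m1E geq_minr.
rewrite mE mpolyXD hl mulr_suml; apply: Sp_sum => t /eqP tE; rewrite -scalerAl; apply: SpZ.
rewrite /rhof; case: pickP => [i di|no].
  have dt := mdeg_sub_pow di; rewrite -mulrA -mpolyXD.
  have E : (mdeg [multinom t j - d * (j == i) | j < N] + mdeg m2 + d = s)%N.
    by rewrite addnAC dt tE m1E m2E ms subnKC // geq_minl.
  rewrite -E; apply: Sp_mulf; apply: IH; last by rewrite mdegD.
  by rewrite -E -{1}[X in (X < _)%N]addn0 ltn_add2l.
have lt : (mdeg t < s0)%N.
  rewrite ltnS mdegE -[X in (X * _)%N]card_ord -sum_nat_const; apply: leq_sum => i _.
  by have := no i; rewrite leqNgt => /negbFE; case: (d) d0.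
have ss : (s <= s0)%N by move: lt; rewrite tE m1E; lia.
have m20 : m2 = 0%MM.
  by apply/eqP; rewrite -mdeg_eq0 m2E ms (minn_idPl ss) subnn.
rewrite m20 mpolyX0 mulr1 -rhob_box => [|i]; last by have := no i; rewrite leqNgt => /negbFE.
by apply: Sp_rhob; rewrite tE m1E geq_minl.
Qed.

Definition boxm (a : {ffun 'I_N -> 'I_d}) : 'X_{1..N} := [multinom (a i : nat) | i < N].

(** Independence is a count: in each bounded degree there are as many [rhob] as monomials, and they
    span, so they are independent. *)
Lemma free_of_freedet : free_basis (fun a : {ffun 'I_N -> 'I_d} => 'X_[boxm a]) f.
Proof.
pose md (t : 'X_{1..N}) : {ffun 'I_N -> 'I_d} := [ffun i => Ordinal (ltn_pmod (t i) d0)].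
pose dv0 (t : 'X_{1..N}) : 'X_{1..N} := [multinom t i %/ d | i < N].
have rE t : rhob f t = 'X_[boxm (md t)] * msub f 'X_[dv0 t].
  rewrite /rhob msubX; congr ('X_[_] * _); last by apply: eq_bigr => i _; rewrite mnmE.
  by apply/mnmP => i; rewrite !mnmE ffunE.
split=> [A|q q0].
  rewrite [A]mpolyE; elim/big_ind: _ => [|_ _ [q1 ->] [q2 ->]|m _].
  - by exists (fun=> 0); rewrite big1 // => k _; rewrite (rmorph0 (msub f)) mulr0.
  - by exists (fun k => q1 k + q2 k); rewrite -big_split; apply: eq_bigr => k _; rewrite msubD mulrDr.
  have [l ->] := @Sp_monomial _ m (erefl _); rewrite scaler_sumr.
  elim/big_ind: _ => [|_ _ [q1 ->] [q2 ->]|t _].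
  - by exists (fun=> 0); rewrite big1 // => k _; rewrite (rmorph0 (msub f)) mulr0.
  - by exists (fun k => q1 k + q2 k); rewrite -big_split; apply: eq_bigr => k _; rewrite msubD mulrDr.
  rewrite scalerA rE; exists (fun k => if k == md t then (A@_m * l t) *: 'X_[dv0 t] else 0).
  rewrite (bigD1 (md t)) //= eqxx msubZ -scalerAr big1 ?addr0 // => k /negPf->.
  by rewrite (rmorph0 (msub f)) mulr0.
pose D := \max_k msize (q k).
pose s := (N * d + d * D)%N.
(* Division with remainder by [d] in each exponent identifies pairs of a box vector and a monomial
   with monomials. *)
pose phim (k : {ffun 'I_N -> 'I_d} * 'X_{1..N < D}) : 'X_{1..N} := [multinom k.1 i + d * bmnm k.2 i | i < N].
have phis k : (mdeg (phim k) < s.+1)%N.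
  rewrite ltnS mdegE; under eq_bigr do rewrite mnmE; rewrite big_split /= -big_distrr /= -mdegE.
  rewrite leq_add ?leq_mul2l //; last by rewrite (ltnW (bmdeg _)) orbT.
  by rewrite -[X in (X * _)%N]card_ord -sum_nat_const; apply: leq_sum => i _; apply: ltnW.
pose phi k := BMultinom (phis k).
have mdphi k : md (phim k) = k.1.
  by apply/ffunP => i; apply: val_inj; rewrite ffunE /= mnmE addnC mulnC modnMDl modn_small.
have dvphi k : dv0 (phim k) = bmnm k.2.
  apply/mnmP => i; rewrite !mnmE addnC mulnC divnMDl // divn_small ?addn0 //.
have phi_inj : injective phi.
  move=> [a m] [a' m'] /(congr1 (@bmnm _ _)) /= e.
  have := mdphi (a, m); have := dvphi (a, m); rewrite e mdphi dvphi /= => /val_inj -> ->.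
  by [].
pose mu (k : {ffun 'I_N -> 'I_d} * 'X_{1..N < D}) := (q k.1)@_(bmnm k.2).
have E : \sum_k 'X_[boxm k] * msub f (q k) = \sum_(k : {ffun 'I_N -> 'I_d} * 'X_{1..N < D}) mu k *: rhob f (phi k).
  rewrite -(pair_bigA _ (fun a m => mu (a, m) *: rhob f (phi (a, m)))) /=.
  apply: eq_bigr => a _.
  have E0 : q a = \sum_(m : 'X_{1..N < D}) (q a)@_m *: 'X_[m].
    by apply: mpolywE; apply: (leq_bigmax a).
  rewrite {1}E0 (rmorph_sum (msub f)) mulr_sumr /=; apply: eq_bigr => m _.
  by rewrite rE mdphi dvphi msubZ -scalerAr /mu /=.
move: q0; rewrite E (partition_big phi predT) //= => h.
have := @indep_of_span F N s (fun t => rhob f t) _ (fun t => \sum_(k | phi k == t) mu k).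
move=> /(_ _ _)/wrap[] => [m||H].
- have [l ->] := Sp_monomial (erefl (mdeg m)).
  apply: (@Sp_sum s) => t _; apply: SpZ; apply: Sp_rhob.
  by have := bmdeg t; have := bmdeg m; rewrite !ltnS => h1 h2; apply: leq_trans h2 h1.
- rewrite -[RHS]h; apply: eq_bigr => t _; rewrite scaler_suml.
  by apply: eq_bigr => k /eqP <-.
move=> k; apply/mpolyP => m; rewrite mcoeff0; case: (ltnP (mdeg m) D) => mD.
  have := H (phi (k, BMultinom mD)); rewrite (big_pred1 (k, BMultinom mD)) //.
  by move=> k' /=; rewrite (inj_eq phi_inj).
by apply: memN_msupp_eq0; apply: msize_mdeg_ge; apply: leq_trans mD; apply: (leq_bigmax k).
Qed.

End Consequences.
End GenericFree.

(** * Extension of functions on the critical locus *)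

Section Extension.
Variables (R S : idomainType) (eps : {rmorphism {poly R} -> S}) (B : finType) (b : B -> S).
Hypothesis spS : forall s, exists q : B -> {poly R}, s = \sum_k b k * eps (q k).
Hypothesis inS : forall q : B -> {poly R}, \sum_k b k * eps (q k) = 0 -> forall k, q k = 0.
Hypothesis fR : factorial_ring R.

Definition in2 (T : comNzRingType) (a c x : T) := exists u v, x = u * a + v * c.

Lemma coord_mul (A C : {poly R}) (x y : B -> {poly R}) :
  eps A * (\sum_k b k * eps (x k)) = eps C * (\sum_k b k * eps (y k)) ->
  forall k, A * x k = C * y k.
Proof.
move=> e k; apply/eqP; rewrite -subr_eq0; apply/eqP.
apply: (inS (q := fun k => A * x k - C * y k)).
rewrite -[RHS](subrr (eps A * (\sum_k b k * eps (x k)))) {2}e !mulr_sumr -sumrB.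
apply: eq_bigr => i _; rewrite rmorphB !rmorphM mulrBr.
ring.
Qed.

Lemma eps_neq0 A : A != 0 -> eps A != 0.
Proof.
move=> nz; apply/eqP => e0; have [u u1] := spS 1.
have h k : A * u k = 0 * u k by apply: coord_mul; rewrite e0 rmorph0.
have u0 k : u k = 0 by have /eqP := h k; rewrite mul0r mulf_eq0 (negPf nz) => /eqP.
move: (oner_neq0 S); rewrite u1 big1 ?eqxx // => k _; by rewrite u0 rmorph0 mulr0.
Qed.

(* Divisibility by [eps A] is tested on the coordinates with respect to a basis of [S]. *)
Lemma prime_coord A C x y : prime_elt A -> ~ dv A C -> eps A * x = eps C * y -> dv (eps A) y.
Proof.
move=> [_ _ pA] nAC; have [x' ->] := spS x; have [y' ->] := spS y => e.
have /fun_choice[w hw] k : dv A (y' k).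
  have h : dv A (C * y' k) by exists (x' k); rewrite (coord_mul e).
  by case: (pA _ _ h).
exists (\sum_k b k * eps (w k)); rewrite mulr_sumr; apply: eq_bigr => k _.
by rewrite hw rmorphM mulrCA.
Qed.

Variables (P : S) (N : {poly R}).
Hypothesis pP : prime_elt P.
Hypothesis pN : prime_elt N.
Hypothesis lN : dv (lead_coef N) 1.
Hypothesis PN : dv P (eps N).

Lemma coprime_image A C : prime_elt A -> ~ dv A C -> dv P (eps A) -> ~ dv P (eps C).
Proof.
move=> pA nAC [x xE] [y yE]; have [A0 _ _] := pA.
have e : eps A * y = eps C * x by rewrite xE yE mulrAC.
have [w wE] := prime_coord pA nAC e.
have [_ nu _] := pP; apply: nu; exists w.
apply: (mulfI (eps_neq0 A0)); rewrite mulr1 {1}xE wE; ring.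
Qed.

Lemma size_N : (1 < size N)%N.
Proof.
rewrite ltnNge; apply/negP => sN; have [N0 nu _] := pN; apply: nu.
have NE := size1_polyC sN; have [c hc] := lN; exists c%:P.
by rewrite NE -polyCM; move: hc; rewrite {1}NE lead_coefC => <-.
Qed.

Lemma const_image (c : R) : c != 0 -> ~ dv P (eps c%:P).
Proof.
move=> c0; apply: (coprime_image pN) => // -[q qE].
have := size_N; have q0 : q != 0.
  by apply: contraNneq c0 => q0; rewrite -polyC_eq0 qE q0 mulr0.
have [N0 _ _] := pN; have := size_polyC_leq1 c; rewrite qE size_mul //.
by move: q0; rewrite -size_poly_gt0; case: (size q) => // k _; rewrite addnS /= => h1 h2;
  have := leq_trans h2 (leq_trans (leq_addr k _) h1).
Qed.

Lemma in2_poly (a c : R) (q : {poly R}) : in2 a%:P c%:P q <-> forall i, in2 a c q`_i.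
Proof.
split=> [[u [v ->]] i|]; first by exists u`_i, v`_i; rewrite coefD !coefMC.
move=> /fun_choice[u /fun_choice[v h]].
exists (\poly_(i < size q) u i), (\poly_(i < size q) v i).
apply/polyP => i; rewrite coefD !coefMC !coef_poly; case: ltnP => iq; first by rewrite -h.
by rewrite nth_default // !mul0r addr0.
Qed.

Lemma in2D (T : comNzRingType) (a c x y : T) : in2 a c x -> in2 a c y -> in2 a c (x + y).
Proof. by move=> [u [v ->]] [u' [v' ->]]; exists (u + u'), (v + v'); ring. Qed.

Lemma in2M (T : comNzRingType) (a c x y : T) : in2 a c x -> in2 a c (y * x).
Proof. by move=> [u [v ->]]; exists (y * u), (y * v); ring. Qed.

(** Since the leading coefficient of [N] is a unit, that of [q] lies in the ideal of [a] and [c],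
    and the leading term of [q] can be removed. *)
Lemma monic_nzd_mod (a c : R) (q : {poly R}) : in2 a%:P c%:P (N * q) -> in2 a%:P c%:P q.
Proof.
elim: {q}(size q) {-2}q (leqnn (size q)) => [|s IH] q sq h.
  by move: sq; rewrite leqn0 size_poly_eq0 => /eqP->; exists 0, 0; rewrite !mul0r addr0.
have [u uE] := lN; have lq : in2 a c (lead_coef q).
  have -> : lead_coef q = u * (N * q)`_(size (N * q)%R).-1.
    by rewrite -[X in u * X]/(lead_coef (N * q)) lead_coefM mulrA [u * _]mulrC -uE mul1r.
  by apply: in2M; move/in2_poly: h.
pose sz := (size q).-1; pose t := lead_coef q *: 'X^sz.
have ht : in2 a%:P c%:P t.
  rewrite /t; have [v [w ->]] := lq; exists (v *: 'X^sz), (w *: 'X^sz).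
  by rewrite -!mul_polyC polyCD !polyCM; ring.
rewrite -(subrK t q); apply: in2D => //; apply: IH.
  apply/leq_sizeP => j sj; rewrite coefB coefZ coefXn.
  case: (eqVneq j sz) => [->|jq]; first by rewrite mulr1 subrr.
  rewrite mulr0 subr0 nth_default //.
  move: sq sj jq; rewrite /sz; case: (size q) => // k /=; rewrite ltnS => h1 h2 h3.
  by rewrite ltn_neqAle eq_sym h3 (leq_trans h1 h2).
have -> : N * (q - t) = N * q + - N * t by ring.
by apply: in2D => //; apply: in2M.
Qed.

(** The coprime constants [p] and [a] form a regular sequence on [S / P]: if [w a - w' p = P g],
    multiplying by the cofactor of [P] in [eps N] and comparing coordinates puts [g] in [(a, p)], so
    [p] divides [w] modulo [P]. Then [Om - Z * w2] is killed by [p] modulo [P]. *)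
Lemma ext_step (Z Om : S) (p a : R) : prime_elt p -> ~ dv p a -> ~ dv P Z ->
  in2 Z P (Om * eps p%:P) -> in2 Z P (Om * eps a%:P) -> in2 Z P Om.
Proof.
move=> pp npa nPZ [w [t e1]] [w' [t' e2]].
have pC := prime_polyC pp.
have npaC : ~ dv p%:P a%:P.
  by move=> [q /(congr1 (fun r : {poly R} => r`_0))]; rewrite coefC coefCM /= => e; apply: npa; exists q`_0.
have [g gE] : dv P (w * eps a%:P - w' * eps p%:P).
  have h : dv P ((w * eps a%:P - w' * eps p%:P) * Z).
    exists (t' * eps p%:P - t * eps a%:P).
    have -> : (w * eps a%:P - w' * eps p%:P) * Z =
       (w * Z + t * P) * eps a%:P - (w' * Z + t' * P) * eps p%:P
        + P * (t' * eps p%:P - t * eps a%:P) by ring.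
    by rewrite -e1 -e2; ring.
  by case: pP => _ _ /(_ _ _ h)[].
have [N' NE] := PN; have [gk gkE] := spS g.
have hg k : in2 a%:P p%:P (gk k).
  apply: monic_nzd_mod.
  have [wk wkE] := spS (N' * w); have [wk' wkE'] := spS (N' * w').
  exists (wk k), (- wk' k); apply/eqP; rewrite -subr_eq0; apply/eqP.
  apply: (inS (q := fun k => N * gk k - (wk k * a%:P + - wk' k * p%:P))).
  transitivity (eps N * g - (N' * w * eps a%:P - N' * w' * eps p%:P)).
    rewrite gkE wkE wkE' mulr_sumr !mulr_suml -!sumrB; apply: eq_bigr => i _.
    by rewrite !(rmorphB, rmorphD, rmorphM, rmorphN); ring.
  have -> : N' * w * eps a%:P - N' * w' * eps p%:P = N' * (w * eps a%:P - w' * eps p%:P) by ring.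
  by rewrite gE NE; ring.
have [al [be gE2]] : in2 (eps a%:P) (eps p%:P) g.
  have /fun_choice[u /fun_choice[v huv]] := hg.
  exists (\sum_k b k * eps (u k)), (\sum_k b k * eps (v k)).
  rewrite gkE !mulr_suml -big_split; apply: eq_bigr => k _ /=.
  by rewrite huv rmorphD !rmorphM; ring.
have [w2 w2E] : dv (eps p%:P) (w - P * al).
  apply: (prime_coord pC npaC (x := w' + P * be)).
  have : w * eps a%:P - w' * eps p%:P = P * (al * eps a%:P + be * eps p%:P) by rewrite gE gE2.
  move=> h; have -> : eps a%:P * (w - P * al) = (w * eps a%:P - w' * eps p%:P) + w' * eps p%:P - P * al * eps a%:P by ring.
  by rewrite h; ring.
have : dv P ((Om - Z * w2) * eps p%:P).
  exists (t + Z * al).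
  have -> : (Om - Z * w2) * eps p%:P = Om * eps p%:P - Z * (eps p%:P * w2) by ring.
  by rewrite e1 -w2E; ring.
case: pP => _ _ H /H[[r rE]|h]; last by have [p0 _ _] := pp; case: (const_image p0 h).
exists w2, r; rewrite -(subrK (Z * w2) Om) rE; ring.
Qed.

(** The fraction [Om / Z] is regular off the common zeros of the [a i], which have codimension at
    least two, hence regular. The prime factors of [a i0 ^+ M] are cancelled one at a time, each
    against some [a i] it does not divide. *)
Lemma ext_regular (I : Type) (a : I -> R) (i0 : I) (M : nat) (Z Om : S) : a i0 != 0 ->
  (forall p, prime_elt p -> exists i, ~ dv p (a i)) -> ~ dv P Z ->
  (forall i, in2 Z P (Om * eps (a i)%:P ^+ M)) -> in2 Z P Om.
Proof.
move=> a0 ha nPZ h; have [u [s [[u' uu] sp aE]]] : exists u s, [/\ dv u 1,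
    forall p, List.In p s -> prime_elt p & a i0 ^+ M = u * \prod_(p <- s) p].
  by apply: fR; rewrite expf_neq0.
have : in2 Z P (Om * eps (\prod_(p <- s) p)%:P).
  have := in2M (eps u'%:P) (h i0); rewrite -rmorphXn -polyC_exp aE polyCM rmorphM.
  move=> h1; suff <- : eps u'%:P * (Om * (eps u%:P * eps (\prod_(p <- s) p)%:P)) =
    Om * eps (\prod_(p <- s) p)%:P by [].
  have -> : eps u'%:P * (Om * (eps u%:P * eps (\prod_(p <- s) p)%:P)) =
      (eps u%:P * eps u'%:P) * (Om * eps (\prod_(p <- s) p)%:P) by ring.
  by rewrite -rmorphM -polyCM -uu rmorph1 mul1r.
elim: s sp {aE} => [|p s IH] sp; first by rewrite big_nil rmorph1 mulr1.
rewrite big_cons polyCM rmorphM mulrA mulrAC => h1; apply: IH => [q qs|]; first by apply: sp; right.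
have pp : prime_elt p by apply: sp; left.
have [i hi] := ha p pp; apply: (ext_step (p := p) (a := a i ^+ M)) => //.
  by move=> h2; apply: hi; apply: prime_dv_exp h2.
by rewrite polyC_exp rmorphXn mulrAC mulrC; apply: in2M; apply: h.
Qed.

End Extension.

Lemma euclid_unit (R : idomainType) (P A : {poly R}) : dv (lead_coef P) 1 ->
  exists q r, A = P * q + r /\ (size r < size P)%N.
Proof.
move=> lP; have [u uE] := lP.
have P0 : P != 0.
  by apply/eqP => e; move: uE; rewrite e lead_coef0 mul0r => /eqP; rewrite oner_eq0.
elim: {A}(size A) {-2}A (leqnn (size A)) => [|s IH] A sA.
  exists 0, 0; rewrite mulr0 addr0 size_poly0 size_poly_gt0; split=> //.
  by apply/eqP; rewrite -size_poly_eq0 -leqn0.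
case: (ltnP (size A) (size P)) => h; first by exists 0, A; rewrite mulr0 add0r.
pose k := (size A - size P)%N; pose t := (u * lead_coef A) *: 'X^k.
have [|q [r [E sr]]] := IH (A - P * t); last first.
  by exists (q + t), r; split=> //; rewrite mulrDr addrAC -E subrK.
have kE : (k + (size P).-1 = (size A).-1)%N.
  rewrite /k; move: h P0; rewrite -size_poly_gt0; case: (size P) => // p h _.
  by case: (size A) h => // a; rewrite subSS ltnS => h; rewrite subnK.
apply/leq_sizeP => j sj; rewrite coefB /t -scalerAr coefZ coefMXn.
have jA : ((size A).-1 <= j)%N by apply: leq_trans sj; case: (size A) sA.
have jk : (k <= j)%N by apply: leq_trans jA; rewrite -kE leq_addr.
rewrite ltnNge jk /=; case: (eqVneq j (size A).-1) => [->|ne].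
  rewrite -kE addKn -[P`_ _]/(lead_coef P) kE -[A`_ _]/(lead_coef A).
  by rewrite mulrAC -[u * _]mulrC -uE mul1r subrr.
have jA1 : (size A <= j)%N.
  have : ((size A).-1 < j)%N by rewrite ltn_neqAle eq_sym ne.
  by case: (size A).
rewrite [A`_j]nth_default // [P`_ _]nth_default ?mulr0 ?subr0 //.
by move: jA1; rewrite leq_subRL // addnC /k; move: h => h jA1; rewrite subnKC.
Qed.

Lemma dvp_prod_deriv (F : fieldType) (rs : seq F) (u : {poly F}) :
  (forall r, r \in rs -> root u r) ->
  dv (\prod_(r <- rs) ('X - r%:P)) ((\prod_(r <- rs) ('X - r%:P))^`() * u).
Proof.
elim: rs => [|r s IH] h; first by rewrite big_nil; exists (1^`() * u); rewrite mul1r.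
rewrite big_cons; set Q := \prod_(j <- s) _.
have -> : (('X - r%:P) * Q)^`() * u = Q * u + ('X - r%:P) * (Q^`() * u).
  by rewrite derivM derivXsubC; ring.
have [v vE] : dv ('X - r%:P) u.
  by have /factor_theorem[v ->] := h r (mem_head _ _); exists v; rewrite mulrC.
have [w wE] : dv Q (Q^`() * u).
  by apply: IH => q qs; apply: h; rewrite in_cons qs orbT.
apply: dvD; first by exists v; rewrite {1}vE; ring.
by exists w; rewrite wE mulrA.
Qed.

Lemma dvp_deriv_of_exp (F : closedFieldType) (p u : {poly F}) M : p != 0 ->
  dv p (u ^+ M) -> (0 < M)%N -> dv p (p^`() * u).
Proof.
move=> p0 [v vE] M0; have [rs pE] := closed_field_poly_normal p.
have lp : lead_coef p != 0 by rewrite lead_coef_eq0.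
have hr r : r \in rs -> root u r.
  move=> rrs; have rp : root p r.
    by rewrite pE rootZ // root_prod_XsubC.
  have : root (u ^+ M) r by rewrite vE rootM rp.
  by rewrite /root horner_exp expf_eq0 => /andP[].
have [w wE] := dvp_prod_deriv hr.
rewrite {2}pE derivZ -scalerAl wE; exists w.
by rewrite {2}pE scalerAl.
Qed.

(** * Derivatives of [P] and the normalisation of the quotient by [P] *)

Section Conductor.
Variable F : closedFieldType.
Hypothesis Finf : forall s : seq F, exists x, x \notin s.
Variables (n : nat) (P : {poly {mpoly F[n]}}).
Notation R := {mpoly F[n]}.
Hypothesis pP : prime_elt P.
Hypothesis lP : dv (lead_coef P) 1.

Let fib (a : 'I_n -> F) : {rmorphism {poly R} -> {poly F}} := map_poly (meval a).

Lemma size_fib a : size (fib a P) = size P.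
Proof.
have [u uE] := lP; apply: size_map_poly_id0; apply/eqP => e.
by have := congr1 (meval a) uE; rewrite rmorph1 rmorphM /= e mul0r => /eqP; rewrite oner_eq0.
Qed.

Lemma sizeP1 : (1 < size P)%N.
Proof.
rewrite ltnNge; apply/negP => sN; have [N0 nu _] := pP; apply: nu.
have NE := size1_polyC sN; have [c hc] := lP; exists c%:P.
by rewrite NE -polyCM; move: hc; rewrite {1}NE lead_coefC => <-.
Qed.

Lemma ndvP_small (A : {poly R}) : A != 0 -> (size A < size P)%N -> ~ dv P A.
Proof.
move=> A0 sA [q qE]; have [P0 _ _] := pP.
have q0 : q != 0 by apply: contraNneq A0 => q0; rewrite qE q0 mulr0.
move: sA; rewrite qE size_mul // -subn1 ltnNge leq_subRL.
  by rewrite addnC leq_add2l size_poly_gt0 q0.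
by rewrite (leq_trans _ (leq_addr _ _)) // size_poly_gt0.
Qed.

Lemma ndvP_const (c : R) : c != 0 -> ~ dv P c%:P.
Proof.
move=> c0; apply: ndvP_small; first by rewrite polyC_eq0.
by apply: leq_ltn_trans sizeP1; apply: size_polyC_leq1.
Qed.

(** At a point where [p] vanishes the equation says that the fibre of [P] divides a power of that of
    [u], hence divides that of [P^]() * u[. So the remainder of]P^[() * u] by [P] vanishes there for
    reasons of size, and [p] divides its coefficients. *)
Lemma conductor_step (p rho : R) (u : {poly R}) M (c : nat -> {poly R}) : prime_elt p -> dv p rho ->
  dv P (u ^+ M + \sum_(i < M) c i * rho%:P ^+ (M - i) * u ^+ i) ->
  exists u1, dv P (P^`() * u - p%:P * u1).
Proof.
move=> pp [rho1 rhoE] [v vE].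
have M0 : (0 < M)%N.
  rewrite lt0n; apply/eqP => e; move: vE; rewrite e big_ord0 addr0 expr0 => e1.
  by have [_ nu _] := pP; apply: nu; exists v.
have [q [r [E sr]]] := euclid_unit (P^`() * u) lP.
suff h i : dv p r`_i.
  have [r1 r1E] := polyC_dv h; exists r1, q.
  by rewrite E r1E -mul_polyC addrK.
apply: (prime_vanish Finf) => // a pa.
have rho0 : rho.@[a] = 0 by rewrite rhoE mevalM pa mul0r.
have fP0 : fib a P != 0 by rewrite -size_poly_gt0 size_fib (ltnW sizeP1).
have d1 : dv (fib a P) (fib a u ^+ M).
  exists (fib a v); rewrite -rmorphM -vE rmorphD rmorphXn rmorph_sum big1 ?addr0 // => j _.
  rewrite !rmorphM rmorphXn /= map_polyC /= rho0 expr0n subn_eq0 leqNgt ltn_ord /=.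
  by rewrite mulr0 mul0r.
have [w wE] := dvp_deriv_of_exp fP0 d1 M0.
have rE : fib a r = fib a P * (w - fib a q).
  have /(congr1 (fib a)) := E; rewrite rmorphD !rmorphM /=.
  have -> : map_poly (meval a) P^`() = (fib a P)^`() by rewrite /= deriv_map.
  rewrite [in X in X = _]wE mulrBr => ->; ring.
have fr0 : fib a r = 0.
  apply/eqP; apply/negP => /negP nz.
  have w0 : w - fib a q != 0 by apply: contraNneq nz => w0; rewrite rE w0 mulr0.
  have h1 : (size (fib a r) < size P)%N by apply: leq_ltn_trans (size_poly _ _) sr.
  move: h1; rewrite rE size_mul // size_fib -subn1 ltnNge leq_subRL.
    by rewrite addnC leq_add2l size_poly_gt0 w0.
  by rewrite (leq_trans _ (leq_addr _ _)) // (ltnW sizeP1).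
by have := congr1 (fun q : {poly F} => q`_i) fr0; rewrite /= coef_map coef0.
Qed.

(** Each prime factor of [rho] costs one factor [P^]()[. The quotient]u1[satisfies an equation of
    the same shape for the remaining factors, with coefficients scaled by powers of]P^[()]. *)
Lemma conductor_const (rho : R) (u : {poly R}) M (c : nat -> {poly R}) : rho != 0 ->
  dv P (u ^+ M + \sum_(i < M) c i * rho%:P ^+ (M - i) * u ^+ i) ->
  exists M' w, dv P (P^`() ^+ M' * u - rho%:P * w).
Proof.
move=> rho0; have [e [s [[e' ee] sp rhoE]]] := factorial_mpoly rho0.
rewrite rhoE; elim: s sp u c {rho rho0 rhoE} => [|p s IH] sp u c.
  move=> _; exists 0%N, (e'%:P * u); rewrite big_nil mulr1 expr0 mul1r mulrA -polyCM -ee mul1r subrr.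
  exact: dv0.
rewrite big_cons; set rho := e * _ => hu.
have pp : prime_elt p by apply: sp; left.
have rhoE : rho = p * (e * \prod_(j <- s) j) by rewrite /rho mulrCA.
have [|u1 hu1] := @conductor_step p rho u M c pp _ hu; first by exists (e * \prod_(j <- s) j).
set rho1 := e * \prod_(j <- s) j.
have [||M' [w [v vE]]] := IH _ u1 (fun i => c i * P^`() ^+ (M - i)).
- by move=> q qs; apply: sp; right.
- rewrite -/rho1; set X := (X in dv P X).
  have pM : ~ dv P (p%:P ^+ M).
    move=> h; have := prime_dv_exp pP h; apply: ndvP_const; by case: pp.
  suff h : dv P (p%:P ^+ M * X) by case: pP => _ _ /(_ _ _ h)[].
  have cong a b k : dv P (a - b) -> dv P (a ^+ k - b ^+ k).
    by move=> h; rewrite subrXX; apply: dv_mulr.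
  have E1 : dv P (P^`() ^+ M * (u ^+ M + \sum_(i < M) c i * rho%:P ^+ (M - i) * u ^+ i)).
    exact: dv_mull.
  suff h : dv P (P^`() ^+ M * (u ^+ M + \sum_(i < M) c i * rho%:P ^+ (M - i) * u ^+ i) - p%:P ^+ M * X).
    by have := dvB E1 h; rewrite opprB addrCA subrr addr0.
  rewrite /X !mulrDr !mulr_sumr opprD addrACA; apply: dvD.
    by rewrite -!exprMn; apply: cong.
  rewrite -sumrB; apply: dv_sum => i _.
  have Mi : (M = (M - i) + i)%N by rewrite subnK // ltnW.
  have -> : P^`() ^+ M * (c i * rho%:P ^+ (M - i) * u ^+ i) -
      p%:P ^+ M * (c i * P^`() ^+ (M - i) * rho1%:P ^+ (M - i) * u1 ^+ i) =
      c i * P^`() ^+ (M - i) * rho%:P ^+ (M - i) * ((P^`() * u) ^+ i - (p%:P * u1) ^+ i).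
    have EM (x : {poly R}) : x ^+ M = x ^+ (M - i) * x ^+ i by rewrite -exprD -Mi.
    rewrite (EM P^`()) (EM p%:P) rhoE polyCM -/rho1 !exprMn.
    move: (P^`() ^+ (M - i)) (P^`() ^+ i) (p%:P ^+ (M - i)) (p%:P ^+ i) (rho1%:P ^+ (M - i)).
    by move: (u ^+ i) (u1 ^+ i) => ? ? ? ? ? ? ?; ring.
  by apply: dv_mull; apply: cong.
exists M'.+1, w; rewrite rhoE polyCM -/rho1.
have -> : P^`() ^+ M'.+1 * u - p%:P * rho1%:P * w =
   P^`() ^+ M' * (P^`() * u - p%:P * u1) + p%:P * (P^`() ^+ M' * u1 - rho1%:P * w).
  by rewrite exprSr; move: (P^`() ^+ M') => ?; ring.
by apply: dvD; apply: dv_mull => //; exists v.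
Qed.

(** The constant is the resultant of [P] and [s]; if it vanished, they would have a nonconstant gcd,
    and the prime [P] would divide [s]. *)
Lemma const_multiple (s : {poly R}) : ~ dv P s ->
  exists rho t, rho != 0 /\ dv P (s * t - rho%:P).
Proof.
move=> nPs; case: (leqP (size s) 1) => ss.
  exists s`_0, 1; rewrite mulr1 {2}(size1_polyC ss) subrr; split; last exact: dv0.
  by apply/eqP => e; apply: nPs; rewrite (size1_polyC ss) e; apply: dv0.
have [[u v] _ /= E] := resultant_in_ideal sizeP1 ss.
exists (resultant P s), v; split; last first.
  by exists (- u); rewrite E; ring.
rewrite resultant_eq0 -leqNgt leqNgt; apply/negP => gs.
pose g := gcdp P s; have g0 : g != 0 by rewrite gcdp_eq0 negb_and; case: pP => ->.
have /Pdiv.Idomain.dvdpP := dvdp_gcdl P s; rewrite -/g => -[[c q] /= c0 e].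
have /Pdiv.Idomain.dvdpP := dvdp_gcdr P s; rewrite -/g => -[[c' q'] /= c0' e'].
have h : dv P (q * g) by exists c%:P; rewrite -e -mul_polyC mulrC.
have [P0 _ pr] := pP; case: (pr _ _ h) => [[w wE]|hg].
  have q0 : q != 0.
    apply/eqP => q0; move: e; rewrite q0 mul0r => /eqP.
    by rewrite -mul_polyC mulf_eq0 polyC_eq0 (negPf c0) (negPf P0).
  have : size (c *: P) = size (q * g) by rewrite e.
  have w0 : w != 0 by apply: contraNneq q0 => w0; rewrite wE w0 mulr0.
  rewrite size_scale // wE !size_mul ?mulf_neq0 //.
  have H (x y z : nat) : (1 < x)%N -> (0 < y)%N -> (0 < z)%N -> z = ((z + y).-1 + x).-1 -> False by lia.
  by apply: H; rewrite ?size_poly_gt0.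
have : dv P (c' *: s) by rewrite e'; apply: dv_mull.
by rewrite -mul_polyC => /pr[/ndvP_const|//]; apply.
Qed.

(* The derivative of [P] lies in the conductor of the normalisation of [R[X]/P]. *)
Lemma conductor (s u : {poly R}) M (c : nat -> {poly R}) : ~ dv P s ->
  dv P (u ^+ M + \sum_(i < M) c i * s ^+ (M - i) * u ^+ i) ->
  exists M' w, dv P (P^`() ^+ M' * u - s * w).
Proof.
move=> nPs hu; have [rho [t [rho0 [v vE]]]] := const_multiple nPs.
have cong a b k : dv P (a - b) -> dv P (a ^+ k - b ^+ k).
  by move=> h; rewrite subrXX; apply: dv_mulr.
have st : dv P (s * t - rho%:P) by exists v.
(* Multiplying the equation by [t ^+ M] replaces the denominator [s] by the constant [rho],
   congruent to [s * t]. *)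
have [|M' [w hw]] := @conductor_const rho (u * t) M c rho0.
  have E : dv P (t ^+ M * (u ^+ M + \sum_(i < M) c i * s ^+ (M - i) * u ^+ i)) by apply: dv_mull.
  suff h : dv P (t ^+ M * (u ^+ M + \sum_(i < M) c i * s ^+ (M - i) * u ^+ i) -
      ((u * t) ^+ M + \sum_(i < M) c i * rho%:P ^+ (M - i) * (u * t) ^+ i)).
    by have := dvB E h; rewrite opprB addrCA subrr addr0.
  rewrite mulrDr mulr_sumr exprMn mulrC opprD addrACA subrr add0r -sumrB.
  apply: dv_sum => i _; have Mi : (M = (M - i) + i)%N by rewrite subnK // ltnW.
  have -> : t ^+ M * (c i * s ^+ (M - i) * u ^+ i) - c i * rho%:P ^+ (M - i) * (u * t) ^+ i =
      c i * (u * t) ^+ i * ((s * t) ^+ (M - i) - rho%:P ^+ (M - i)).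
    have EM (x : {poly R}) : x ^+ M = x ^+ (M - i) * x ^+ i by rewrite -exprD -Mi.
    rewrite (EM t) !exprMn; move: (t ^+ (M - i)) (t ^+ i) (s ^+ (M - i)) (u ^+ i) (rho%:P ^+ (M - i)).
    by move=> ? ? ? ? ?; ring.
  by apply: dv_mull; apply: cong.
exists M', w; have nPt : ~ dv P t.
  move=> h; have : dv P rho%:P.
    by have := dvB (dv_mull s h) st; rewrite opprB addrCA subrr addr0.
  exact: ndvP_const.
suff h : dv P (t * (P^`() ^+ M' * u - s * w)) by case: pP => _ _ /(_ _ _ h)[].
have -> : t * (P^`() ^+ M' * u - s * w) =
  (P^`() ^+ M' * (u * t) - rho%:P * w) - w * (s * t - rho%:P) by ring.
by apply: dvB => //; apply: dv_mull.
Qed.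

End Conductor.

Lemma List_In_mem (T : eqType) (x : T) (s : seq T) : List.In x s -> x \in s.
Proof.
elim: s => // y s IH /= [->|/IH h]; first exact: mem_head.
by rewrite in_cons h orbT.
Qed.

(** * Homogeneous primes and relations modulo them *)

Section HomogFactor.
Variables (F : fieldType) (n : nat).
Implicit Types U V P : {mpoly F[n]}.

Lemma hcomp_mul k U V : hcomp k (U * V) = \sum_(i < msize U)
  if (i <= k)%N then hcomp i U * hcomp (k - i) V else 0.
Proof.
rewrite {1}(hcomp_sum (leqnn (msize U))) mulr_suml linear_sum /=; apply: eq_bigr => i _.
by rewrite mulrC (hcompM _ _ (pihomogP _ i U)); case: ifP => // _; rewrite mulrC.
Qed.

Lemma hcomp_range U : U != 0 -> exists a b, [/\ hcomp a U != 0, hcomp b U != 0 &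
  forall i, hcomp i U != 0 -> (a <= i <= b)%N].
Proof.
move=> U0; have ex : exists i, hcomp i U != 0.
  apply: NNPP => h; case/negP: U0; rewrite (hcomp_sum (leqnn (msize U))) big1 // => i _.
  by apply/eqP/negP => /negP nz; apply: h; exists (i : nat).
have bd i : hcomp i U != 0 -> (i <= msize U)%N.
  move=> nz; rewrite leqNgt; apply/negP => lt; case/negP: nz.
  rewrite pihomogE big_seq_cond big_pred0 // => m; apply/negP => /andP[/msize_mdeg_lt h /eqP e].
  by move: h; rewrite e ltnNge (ltnW lt).
case: (ex_minnP ex) => a ha mina; case: (ex_maxnP ex bd) => b hb maxb.
by exists a, b; split=> // i hi; rewrite mina //= maxb.
Qed.

(** The products of the lowest components and of the highest components of the two factors are both
    nonzero, so they have the same degree. *)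
Lemma homog_factor e U V : U * V \is e.-homog -> U * V != 0 -> exists a, U \is (a).-homog.
Proof.
move=> hUV nz; have [U0 V0] : U != 0 /\ V != 0.
  by move: nz; rewrite mulf_eq0 negb_or => /andP.
have [a [b [ha hb rU]]] := hcomp_range U0; have [a' [b' [ha' hb' rV]]] := hcomp_range V0.
have deg k : hcomp k (U * V) != 0 -> k = e.
  move=> h; apply/eqP/negP => /negP; rewrite eq_sym => ne.
  by case/negP: h; rewrite (pihomog_ne0 ne hUV).
have zU i : (i < a)%N || (b < i)%N -> hcomp i U = 0.
  move=> h; apply/eqP/negP => /negP /rU; move: h; lia.
have zV i : (i < a')%N || (b' < i)%N -> hcomp i V = 0.
  move=> h; apply/eqP/negP => /negP /rV; move: h; lia.
have inU k : hcomp k U != 0 -> (k < msize U)%N.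
  move=> nzk; rewrite ltnNge; apply/negP => le; case/negP: nzk.
  rewrite pihomogE big_seq_cond big_pred0 // => m; apply/negP => /andP[/msize_mdeg_lt h /eqP ee].
  by move: h; rewrite ee ltnNge le.
have e1 : (a + a' = e)%N.
  apply: deg; rewrite hcomp_mul (bigD1 (Ordinal (inU _ ha))) //= leq_addr addKn big1 ?addr0.
    by rewrite mulf_neq0.
  move=> i ia; have {}ia : (i != a :> nat) by apply: contraNneq ia => ia; apply/eqP/val_inj.
  case: ifP => // ile; case: (ltnP i a) => h; first by rewrite zU ?h ?mul0r.
  by rewrite (zV (a + a' - i)%N) ?mulr0 //; move: ia h ile; lia.
have e2 : (b + b' = e)%N.
  apply: deg; rewrite hcomp_mul (bigD1 (Ordinal (inU _ hb))) //= leq_addr addKn big1 ?addr0.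
    by rewrite mulf_neq0.
  move=> i ia; have {}ia : (i != b :> nat) by apply: contraNneq ia => ia; apply/eqP/val_inj.
  case: ifP => // ile; case: (ltnP b i) => h; first by rewrite zU ?h ?orbT ?mul0r.
  by rewrite (zV (b + b' - i)%N) ?mulr0 //; move: ia h ile; lia.
have ab : a = b by move: (rU _ ha) (rV _ ha') (rU _ hb) (rV _ hb'); lia.
exists a; rewrite (hcomp_sum (leqnn (msize U))); apply: rpred_sum => i _.
case: (eqVneq (i : nat) a) => [->|ne]; first exact: pihomogP.
by rewrite zU ?rpred0 //; move: ne; lia.
Qed.

Lemma dhomog_mderiv d P j : P \is d.-homog -> P^`M(j) \is (d.-1).-homog.
Proof.
move=> /dhomogP hP; rewrite [P]mpolyE linear_sum big_seq /=; apply: rpred_sum => m mP.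
rewrite linearZ /= mderivX rpredZ //; case: (posnP (m j)) => [->|mj].
  by rewrite mulr0n scale0r rpred0.
rewrite rpredZ // dhomogX /=; have /= <- := hP _ mP.
have le : (U_(j) <= m)%MM by apply/mnm_lepP => i; rewrite mnm1E; case: eqP => [<-|].
by apply/eqP; rewrite -[in RHS](submK le) mdegD mdeg1 addn1.
Qed.

Lemma hcomp_msub m v w (h : 'I_m -> {mpoly F[n]}) (G : {mpoly F[m]}) : (0 < v)%N ->
  (forall i, h i \is v.-homog) -> hcomp (w * v) (msub h G) = msub h (hcomp w G).
Proof.
move=> v0 hh; rewrite {1}(hcomp_sum (leqnn (msize G))) (raddf_sum (msub h)) linear_sum /=.
have E (i : nat) : hcomp (w * v) (msub h (hcomp i G)) = if i == w then msub h (hcomp w G) else 0.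
  have hi : msub h (hcomp i G) \is (i * v).-homog by apply: dhomog_msub => //; apply: pihomogP.
  case: eqP => [e|/eqP ne]; first by rewrite -e pihomog_dE.
  by rewrite (pihomog_ne0 _ hi) // eqn_pmul2r.
rewrite (eq_bigr (fun i : 'I_(msize G) => if (i : nat) == w then msub h (hcomp w G) else 0)) => [|i _]; last exact: E.
rewrite -big_mkcond /=; case: (ltnP w (msize G)) => lt; first by rewrite (big_pred1 (Ordinal lt)).
rewrite big_pred0 => [|i]; last by apply/negbTE; rewrite neq_ltn (leq_trans (ltn_ord i) lt).
have -> : hcomp w G = 0.
  rewrite pihomogE big_seq_cond big_pred0 // => k; apply/negP => /andP[/msize_mdeg_lt h1 /eqP h2].
  by move: h1; rewrite h2 ltnNge lt.
by rewrite (rmorph0 (msub h)).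
Qed.

Lemma homog0_const U : U \is 0.-homog -> exists c, U = c%:MP.
Proof.
move=> /dhomogP hU; exists U@_0; apply/mpolyP => m; rewrite mcoeffC.
case: (eqVneq 0%MM m) => [<-|ne]; first by rewrite mulr1.
rewrite mulr0; apply: memN_msupp_eq0; apply/negP => /hU /= /eqP; rewrite mdeg_eq0 => /eqP e.
by rewrite e eqxx in ne.
Qed.

Lemma homog_origin e U : (0 < e)%N -> U \is e.-homog -> U.@[fun=> 0] = 0.
Proof.
move=> e0 hU; transitivity (U.@[fun=> 0 * 0]).
  by apply: meval_eq => i; rewrite mul0r.
by rewrite (dhomog_scale 0 (fun=> 0) hU) expr0n eqn0Ngt e0 /= mul0r.
Qed.

Lemma homog_nonunit e U : (0 < e)%N -> U \is e.-homog -> ~ dv U 1.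
Proof.
move=> e0 hU [c /(congr1 (meval (fun=> 0)))]; rewrite rmorph1 mevalM (homog_origin e0 hU) mul0r.
by move/eqP; rewrite oner_eq0.
Qed.

Lemma homog_prime e P : (0 < e)%N -> P \is e.-homog -> P != 0 ->
  (forall a b U V, (0 < a)%N -> (0 < b)%N -> U \is (a).-homog -> V \is b.-homog -> P = U * V -> False) ->
  prime_elt P.
Proof.
move=> e0 hP P0 irr; have [u [[|p s] [[u' uu] sp PE]]] := factorial_mpoly P0.
  by case: (homog_nonunit e0 hP); exists u'; rewrite PE big_nil mulr1.
rewrite big_cons mulrCA in PE; set V := u * _ in PE.
have pp : prime_elt p by apply: sp; left.
have hPV : p * V \is e.-homog by rewrite -PE.
have nz : p * V != 0 by rewrite -PE.
have [a ha] := homog_factor hPV nz.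
have [b hb] : exists b, V \is b.-homog by apply: (@homog_factor e V p); rewrite mulrC.
have a0 : (0 < a)%N.
  rewrite lt0n; apply/eqP => a0; rewrite a0 in ha; have [c cE] := homog0_const ha.
  have [p0 nu _] := pp; apply: nu; exists c^-1%:MP; rewrite cE -mpolyCM mulfV //.
  by apply: contraNneq p0 => c0; rewrite cE c0.
case: (posnP b) => [b0|b0]; last by case: (irr a b p V).
rewrite b0 in hb; have [c cE] := homog0_const hb.
have c0 : c != 0 by apply: contraNneq nz => c0; rewrite cE c0 mpolyC0 mulr0.
have PE' : P = p * c%:MP by rewrite PE cE.
have dE x : dv P x <-> dv p x.
  split=> [[y ->]|[y ->]]; first by exists (c%:MP * y); rewrite PE' mulrA.
  by exists (c^-1%:MP * y); rewrite PE' -mulrA [c%:MP * _]mulrA -mpolyCM mulfV // mul1r.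
have [_ nu pr] := pp; split=> //; first by move/dE.
by move=> x y /dE /pr[]/dE; [left|right].
Qed.

End HomogFactor.

(** * Consequences of smoothness on a plane *)

Section Plane.
Variable F : closedFieldType.
Hypothesis Finf : forall s : seq F, exists x, x \notin s.

(** Otherwise the polynomial ring would be finite over [U] and [V], and the three variables would be
    algebraically dependent. *)
Lemma two_forms_common_zero a b (U V : {mpoly F[3]}) : (0 < a)%N -> (0 < b)%N ->
  U \is (a).-homog -> V \is b.-homog ->
  exists2 x, (exists i, x i != 0) & U.@[x] = 0 /\ V.@[x] = 0.
Proof.
move=> a0 b0 hU hV; apply: NNPP => no.
pose y (j : 'I_2) := if j == 0 then U else V.
pose dg (j : 'I_2) := if j == 0 then a else b.
have hy j : y j \is (dg j).-homog by rewrite /y /dg; case: ifP.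
have dg0 j : (0 < dg j)%N by rewrite /dg; case: ifP.
have [x hx j|L L0 hL] := nullstellensatz_homog Finf hy.
  apply/eqP/negP => /negP xj; apply: no; exists x; first by exists j.
  by split; [have := hx 0|have := hx 1].
have iW : idealP (fun A : {mpoly F[3]} => A = 0).
  by split=> [//|? ? -> ->|? ? ->]; rewrite ?addr0 ?mulr0.
have [|G G0 GE] := @alg_dependence F 3 (fun A => A = 0) 2 y L iW _ 3 (fun i => 'X_i) (ltnSn _).
  move=> m mE; have hm : ('X_[m] : {mpoly F[3]}) \is L.-homog by rewrite dhomogX /= mE.
  have [c cE] := hL _ hm.
  exists (fun j => if (dg j <= L)%N then hcomp (L - dg j) (c j) else 0) => [j|].
    case: ifP => h; last by rewrite msize0.
    apply: leq_trans (msize_homog (pihomogP _ _ _)) _.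
    by move: (dg0 j) h; lia.
  rewrite -(pihomog_dE hm) cE linear_sum /= -sumrB big1 // => j _.
  rewrite (hcompM _ _ (hy j)); case: ifP => _; last by rewrite mulr0 subrr.
  by rewrite mulrC subrr.
by move: G0; rewrite -[G]msub_id GE eqxx.
Qed.

Variable n : nat.
Hypothesis n2 : (2 <= n)%N.
Variables (e : nat) (P : {mpoly F[n.+1]}).
Hypothesis e0 : (0 < e)%N.
Hypothesis hP : P \is e.-homog.
Hypothesis P0 : P != 0.
Hypothesis smooth : forall x : 'I_n.+1 -> F, (forall i : 'I_n.+1, (3 <= i)%N -> x i = 0) ->
  (forall j, (P^`M(j)).@[x] = 0) -> forall i, x i = 0.

Let plane (a : 'I_3 -> F) : 'I_n.+1 -> F := fun i => if (i < 3)%N then a (inord i) else 0.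
Let rP := @msub F n.+1 3 (fun i => if (i < 3)%N then 'X_(inord i) else 0).

(** Two factors of positive degree would have a common zero in the plane, and the gradient of their
    product vanishes there. *)
Lemma smooth_plane_prime : prime_elt P.
Proof.
apply: (homog_prime e0 hP P0) => a b U V a0 b0 hU hV PE.
have hr d Q : Q \is d.-homog -> rP Q \is d.-homog.
  move=> hQ; rewrite -[d]muln1; apply: dhomog_msub => // i.
  by case: ifP; rewrite ?rpred0 // dhomogX /= mdeg1.
have rE Q x : (rP Q).@[x] = Q.@[plane x].
  rewrite meval_msub; apply: meval_eq => i; rewrite /plane.
  by case: ifP; rewrite ?mevalXU ?meval0.
have [x [i xi] [Ux Vx]] := two_forms_common_zero a0 b0 (hr _ _ hU) (hr _ _ hV).
rewrite !rE in Ux Vx.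
have i3 : (i < n.+1)%N by apply: leq_trans (ltn_ord i) _.
have := @smooth (plane x) _ _ (Ordinal i3); rewrite /plane /= ltn_ord inord_val => h.
case/negP: xi; apply/eqP; apply: h => [j|j]; first by rewrite leqNgt => /negPf->.
by rewrite PE mderivM mevalD !mevalM [U.@[_]]Ux [V.@[_]]Vx mulr0 mul0r addr0.
Qed.

(** The partial derivatives together with the variables from the fourth on have no common zero, so
    modulo the gradient ideal everything is finite over [n - 2] variables. More than [n - 2] forms
    are therefore dependent modulo that ideal: the image of the singular locus lies on [a = 0]. *)
Lemma gradient_relation n' v (h : 'I_n' -> {mpoly F[n.+1]}) : (n - 2 < n')%N -> (0 < v)%N ->
  (forall i, h i \is v.-homog) ->
  exists a w, [/\ a != 0, a \is w.-homog & inI (fun j => P^`M(j)) (msub h a)].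
Proof.
move=> n'r v0 hh; pose y (j : 'I_(n - 2)) : {mpoly F[n.+1]} := 'X_(inord (j + 3)).
pose g := (fun j : 'I_n.+1 => P^`M(j)).
pose H (k : 'I_(n.+1 + (n - 2))) := match split k with inl j => g j | inr j => y j end.
pose dg (k : 'I_(n.+1 + (n - 2))) := match split k with inl j => e.-1 | inr j => 1%N end.
have hH k : H k \is (dg k).-homog.
  rewrite /H /dg; case: (split k) => j; last by rewrite dhomogX /= mdeg1.
  exact: dhomog_mderiv.
have [x hx j|L L0 hL] := nullstellensatz_homog Finf hH.
  apply: smooth => [i i3|i].
    have lt : (i - 3 < n - 2)%N by have := ltn_ord i; lia.
    have := hx (rshift _ (Ordinal lt)); rewrite /H (unsplitK (inr _)) mevalXU /=.
    by rewrite subnK // inord_val.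
  by have := hx (lshift _ i); rewrite /H (unsplitK (inl _)).
have [|G G0 GE] := @alg_dependence F n.+1 (inI g) (n - 2) y L (inI_ideal g) _ n' h n'r.
  move=> m mE; have hm : ('X_[m] : {mpoly F[n.+1]}) \is L.-homog by rewrite dhomogX /= mE.
  have [c cE] := hL _ hm; rewrite big_split_ord /= in cE.
  exists (fun j => hcomp L.-1 (c (rshift n.+1 j))) => [j|].
    by apply: leq_trans (msize_homog (pihomogP _ _ _)) _; rewrite prednK.
  have hg j : g j \is (e.-1).-homog by apply: dhomog_mderiv.
  have h1 : inI g (\sum_(i < n.+1) c (lshift (n - 2) i) * H (lshift (n - 2) i)).
    exists (fun i => c (lshift (n - 2) i)); apply: eq_bigr => i _.
    by rewrite /H (unsplitK (inl _)).
  suff -> : 'X_[m] - \sum_j y j * hcomp L.-1 (c (rshift n.+1 j)) =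
     hcomp L (\sum_(i < n.+1) c (lshift (n - 2) i) * H (lshift (n - 2) i)).
    exact: (inI_hcomp _ hg h1).
  rewrite -{1}(pihomog_dE hm) cE linearD /= -addrA; set X := (X in _ + X).
  suff -> : X = 0 by rewrite addr0.
  rewrite /X linear_sum -sumrB big1 //= => j _.
  have hy : y j \is 1.-homog by rewrite dhomogX /= mdeg1.
  rewrite /H (unsplitK (inr _)) (hcompM _ _ hy) L0 subn1 mulrC subrr //.
have [w [_ [Gw _ _]]] := hcomp_range G0.
exists (hcomp w G), w; split=> //; first exact: pihomogP.
have hg j : g j \is (e.-1).-homog by apply: dhomog_mderiv.
by rewrite -(hcomp_msub _ _ v0 hh); apply: (inI_hcomp _ hg GE).
Qed.

End Plane.

(** * Leading coefficients and a monic relation modulo [P] *)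

Section TopCoefficient.
Variables (F : closedFieldType) (n : nat).

(** [k] is only a formal degree and [c] may be zero, which lets the notion pass to sums and products
    without conditions. *)
Definition topc k (c : {mpoly F[n]}) (q : {poly {mpoly F[n]}}) := (size q <= k.+1)%N /\ q`_k = c.

Lemma topcM k c q k' c' q' : topc k c q -> topc k' c' q' -> topc (k + k') (c * c') (q * q').
Proof.
move=> [sq <-] [sq' <-]; split.
  apply: leq_trans (size_polyMleq _ _) _; move: sq sq'; lia.
have [lt|ge] := ltnP (size q) k.+1.
  have q0 : q`_k = 0 by rewrite nth_default.
  rewrite q0 mul0r nth_default //; apply: leq_trans (size_polyMleq _ _) _; move: lt sq'; lia.
have [lt'|ge'] := ltnP (size q') k'.+1.
  have q0 : q'`_k' = 0 by rewrite nth_default.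
  rewrite q0 mulr0 nth_default //; apply: leq_trans (size_polyMleq _ _) _; move: lt' sq; lia.
rewrite coefM (bigD1 (inord k)) //= inordK ?ltnS ?leq_addr // addKn big1 ?addr0 // => i ik.
have {}ik : (i != k :> nat).
  by apply: contraNneq ik => ik; apply/eqP/val_inj; rewrite /= inordK ?ltnS ?leq_addr.
have [lt|gt] := ltnP i k; last first.
  by rewrite nth_default ?mul0r //; apply: leq_trans sq _; rewrite ltn_neqAle eq_sym ik gt.
rewrite (nth_default _ (n := (k + k' - i)%N)) ?mulr0 //.
by apply: leq_trans sq' _; move: lt; lia.
Qed.

Lemma topc_sum k I (r : seq I) (c : I -> {mpoly F[n]}) (q : I -> {poly {mpoly F[n]}}) :
  (forall i, List.In i r -> topc k (c i) (q i)) ->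
  topc k (\sum_(i <- r) c i) (\sum_(i <- r) q i).
Proof.
elim: r => [|i r IH] h; first by rewrite !big_nil; split; rewrite ?size_poly0 ?coef0.
rewrite !big_cons; have [s1 c1] := h i (or_introl erefl).
have [|s2 c2] := IH; first by move=> j jr; apply: h; right.
split; last by rewrite coefD c1 c2.
by apply: leq_trans (size_polyD _ _) _; rewrite geq_max s1.
Qed.

Lemma topcX k c q m : topc k c q -> topc (k * m) (c ^+ m) (q ^+ m).
Proof.
move=> h; elim: m => [|m IH]; first by rewrite muln0 !expr0; split; rewrite ?size_poly1 ?coef1.
by rewrite mulnS !exprS; apply: topcM.
Qed.

Lemma topc_homog e l (A : {mpoly F[n.+1]}) : A \is e.-homog -> topc e (A.@[pt F l])%:MP (mtop l A).
Proof.
move=> /dhomogP hA; rewrite [X in mtop l X]mpolyE mevalE (raddf_sum (@mtop F n l)) (raddf_sum (@mpolyC n F)) /=.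
apply: topc_sum => m /(@List_In_mem _ _ _) mA; have /= <- := hA _ mA.
suff [s1 c1] : topc (mdeg m) ((\prod_i (pt F l i) ^+ m i)%:MP) (mtop l 'X_[m]).
  rewrite -mul_mpolyC mtopM mtopC mul_polyC; split; first exact: leq_trans (size_scale_leq _ _) s1.
  by rewrite coefZ c1 mpolyCM.
rewrite mpolyXE_id (rmorph_prod (@mtop F n l)) /= mdegE (rmorph_prod (@mpolyC n F)) /=.
have h i : topc (m i) ((pt F l i ^+ m i)%:MP) (mtop l ('X_i ^+ m i)).
  rewrite (rmorphXn (@mtop F n l)) (rmorphXn (@mpolyC n F)) -[X in topc X](mul1n (m i)).
  apply: topcX; rewrite /= mtopX /pt; case: unliftP => [j ->|->]; last first.
    by rewrite eqxx; split; rewrite ?size_polyX // coefX.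
  by rewrite eq_sym (negPf (neq_lift l j)) /=; split; rewrite ?coefC // ltnW // ltnS size_polyC_leq1.
elim: (index_enum _) => [|i s IH]; first by rewrite !big_nil; split; rewrite ?size_poly1 ?coef1.
by rewrite !big_cons; apply: topcM.
Qed.

Lemma lead_mtop e l (A : {mpoly F[n.+1]}) : A \is e.-homog -> A.@[pt F l] != 0 ->
  lead_coef (mtop l A) = (A.@[pt F l])%:MP.
Proof.
move=> hA A0; have [sg cg] := topc_homog l hA.
rewrite -cg lead_coefE; congr (_`_ _); apply/eqP; rewrite eqn_leq; apply/andP; split.
  by case: (size _) sg.
have hD : (e < size (mtop l A))%N.
  by rewrite ltnNge; apply/negP => /(nth_default 0); rewrite cg => /eqP; rewrite mpolyC_eq0 (negPf A0).
by case: (size _) hD.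
Qed.

End TopCoefficient.

Section MonicRelation.
Variable F : closedFieldType.
Hypothesis Finf : forall s : seq F, exists x, x \notin s.
Variables (n : nat) (e : nat) (P : {mpoly F[n.+1]}).
Hypothesis hP : P \is e.-homog.
Hypothesis P0 : P.@[pt F (ord0 : 'I_n.+1)] != 0.
Hypothesis pP : prime_elt P.

Lemma homog_split0 (A : {mpoly F[n.+1]}) : A \is e.-homog ->
  exists2 b : 'I_n -> {mpoly F[n.+1]}, (forall j, (msize (b j) <= e)%N) &
    A = A.@[pt F ord0] *: 'X_ord0 ^+ e + \sum_j 'X_(lift ord0 j) * b j.
Proof.
move=> hA; suff : forall (c : 'X_{1..n.+1} -> F) s, (forall m, m \in s -> mdeg m = e) ->
    exists2 b : 'I_n -> {mpoly F[n.+1]}, (forall j, (msize (b j) <= e)%N) &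
    \sum_(m <- s) c m *: 'X_[m] = (\sum_(m <- s) c m * \prod_i pt F ord0 i ^+ m i) *: 'X_ord0 ^+ e
      + \sum_j 'X_(lift ord0 j) * b j.
  move=> /(_ (fun m => A@_m) (msupp A))[m /(dhomogP _ _ _ hA) //|b sb bE].
  by exists b => //; rewrite mevalE -bE -mpolyE.
move=> c; elim=> [|m s IH] hm.
  exists (fun=> 0) => [j|]; first by rewrite msize0.
  by rewrite !big_nil scale0r add0r big1 // => j _; rewrite mulr0.
have [|b sb IHE] := IH; first by move=> k ks; apply: hm; rewrite in_cons ks orbT.
have mE : mdeg m = e by apply: hm; rewrite mem_head.
rewrite !big_cons IHE.
have [b' sb' ->] : exists2 b' : 'I_n -> {mpoly F[n.+1]}, (forall j, (msize (b' j) <= e)%N) &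
    'X_[m] = (\prod_(i < n.+1) pt F ord0 i ^+ m i) *: 'X_ord0 ^+ e + \sum_j 'X_(lift ord0 j) * b' j.
  case: (pickP (fun j : 'I_n => (0 < m (lift ord0 j))%N)) => [j mj|no].
    have le : (U_(lift ord0 j) <= m)%MM by apply/mnm_lepP => i; rewrite mnm1E; case: eqP => [<-|].
    exists (fun k => if k == j then 'X_[(m - U_(lift ord0 j))%MM] else 0) => [k|].
      case: ifP => _; rewrite ?msize0 // msizeX.
      by rewrite -mE -[in X in (_ <= X)%N](submK le) mdegD mdeg1 addn1.
    rewrite (bigD1 j) //= eqxx [X in _ + (_ + X)]big1 ?addr0 => [|k /negPf->]; last by rewrite mulr0.
    rewrite (bigD1 (lift ord0 j)) //= /pt -(inj_eq val_inj) /= expr0n eqn0Ngt mj mul0r scale0r add0r.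
    by rewrite -mpolyXD addmC submK.
  have m0 j : m (lift ord0 j) = 0%N by have := no j; rewrite lt0n => /negbFE/eqP.
  exists (fun=> 0) => [j|]; first by rewrite msize0.
  rewrite [X in _ + X]big1 ?addr0 => [|j _]; last by rewrite mulr0.
  have -> : m = (U_(ord0) *+ e)%MM.
    have e' : m ord0 = e by rewrite -mE mdegE big_ord_recl /= big1 ?addn0 // => i _; rewrite m0.
    apply/mnmP => i; rewrite mulmnE mnm1E; case: (unliftP ord0 i) => [j ->|->].
      by rewrite m0 -(inj_eq val_inj).
    by rewrite e' eqxx mul1n.
  rewrite big1 ?scale1r ?mpolyXn // => i _; rewrite /pt mulmnE mnm1E eq_sym.
  by case: eqP => _; rewrite ?expr1n // mul0n expr0.
exists (fun j => c m *: b' j + b j) => [j|].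
  apply: leq_trans (msizeD_le _ _) _; rewrite geq_max sb andbT.
  exact: leq_trans (msizeZ_le _ _) _.
have -> : \sum_j 'X_(lift ord0 j) * (c m *: b' j + b j) =
    c m *: (\sum_j 'X_(lift ord0 j) * b' j) + \sum_j 'X_(lift ord0 j) * b j.
  rewrite scaler_sumr -big_split; apply: eq_bigr => j _ /=.
  by rewrite mulrDr -scalerAr.
by rewrite scalerDr scalerA scalerDl addrACA.
Qed.

(** As [P] is monic in the variable [0] up to a constant, the quotient by [P] is finite over the
    other [n] variables, so [n.+1] elements are dependent. *)
Lemma relation_mod (h : 'I_n.+1 -> {mpoly F[n.+1]}) :
  exists2 G : {mpoly F[n.+1]}, G != 0 & dv P (msub h G).
Proof.
have iW : idealP (dv P) by split; [exact: dv0|exact: dvD|move=> *; exact: dv_mull].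
apply: (@alg_dependence F n.+1 (dv P) n (fun j => 'X_(lift ord0 j)) e iW _ n.+1 h (ltnSn n)).
move=> m mE; have hm : ('X_[m] : {mpoly F[n.+1]}) \is e.-homog by rewrite dhomogX /= mE.
have [b sb bE] := homog_split0 hm; have [c sc cE] := homog_split0 hP.
set u := (X in X *: _) in bE; pose v := u / P.@[pt F (ord0 : 'I_n.+1)].
exists (fun j => b j - v *: c j) => [j|].
  apply: leq_trans (msizeD_le _ _) _; rewrite geq_max sb msizeN.
  exact: leq_trans (msizeZ_le _ _) _.
exists v%:MP; rewrite mulrC mul_mpolyC cE scalerDr scalerA /v divfK // bE.
have -> : \sum_j 'X_(lift ord0 j) * (b j - (u / P.@[pt F ord0]) *: c j) =
   \sum_j 'X_(lift ord0 j) * b j - (u / P.@[pt F ord0]) *: (\sum_j 'X_(lift ord0 j) * c j).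
  rewrite scaler_sumr -sumrB; apply: eq_bigr => j _ /=.
  by rewrite mulrBr -scalerAr.
by rewrite opprB addrACA subrr addr0.
Qed.

(** The linear change of target coordinates of Noether normalisation: a suitable [p] makes a
    relation between the [h i] monic in the variable [0]. *)
Definition shear (p : 'I_n -> F) (h : 'I_n.+1 -> {mpoly F[n.+1]}) : 'I_n.+1 -> {mpoly F[n.+1]} :=
  fun i => if unlift ord0 i is Some j then h i - p j *: h ord0 else h ord0.

Definition unshear (p : 'I_n -> F) : 'I_n.+1 -> {mpoly F[n.+1]} :=
  fun i => if unlift ord0 i is Some j then 'X_i + p j *: 'X_ord0 else 'X_ord0.

Lemma unshearK p h i : msub (shear p h) (unshear p i) = h i.
Proof.
rewrite /unshear; case: unliftP => [j ->|->]; last by rewrite msubXU /shear unlift_none.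
by rewrite msubD msubZ !msubXU /shear unlift_none liftK subrK.
Qed.

Lemma shearK p i : msub (unshear p) (shear p (fun i => 'X_i) i) = 'X_i.
Proof.
rewrite /shear; case: unliftP => [j ->|->]; last by rewrite msubXU /unshear unlift_none.
rewrite (rmorphB (msub (unshear p))) /= msubZ !msubXU /unshear unlift_none liftK addrK //.
Qed.

Lemma msub_shear p h q : msub (shear p h) (msub (unshear p) q) = msub h q.
Proof. by rewrite msub_msub; apply: eq_msub => i; apply: unshearK. Qed.

Lemma shear_msub p h i : shear p h i = msub h (shear p (fun i => 'X_i) i).
Proof.
rewrite /shear; case: unliftP => [j ->|_]; last by rewrite msubXU.
by rewrite (rmorphB (msub h)) /= msubZ !msubXU.
Qed.

Lemma free_shear (B : finType) (b : B -> {mpoly F[n.+1]}) p h :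
  free_basis b h -> free_basis b (shear p h).
Proof.
move=> [sp ind]; split=> [A|q q0].
  have [q ->] := sp A; exists (fun k => msub (unshear p) (q k)).
  by apply: eq_bigr => k _; rewrite msub_shear.
have E r : msub (shear p h) r = msub h (msub (shear p (fun i => 'X_i)) r).
  by rewrite msub_msub; apply: eq_msub => i; rewrite shear_msub.
have h0 k : msub (shear p (fun i => 'X_i)) (q k) = 0.
  by apply: (ind (fun k => msub (shear p (fun i => 'X_i)) (q k))); rewrite -[RHS]q0; apply: eq_bigr => i _; rewrite -E.
move=> k; rewrite -[q k]msub_id -(eq_msub _ (shearK p)) -msub_msub h0.
exact: (rmorph0 (msub (unshear p))).
Qed.

Lemma topc_monomial p (m : 'X_{1..n.+1}) :
  topc (mdeg m) ((\prod_i (mins ord0 p 1 i) ^+ m i)%:MP) (mtop ord0 (msub (unshear p) 'X_[m])).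
Proof.
rewrite msubX (rmorph_prod (@mtop F n ord0)) /= mdegE (rmorph_prod (@mpolyC n F)) /=.
rewrite (big_morph id (id1 := 0%N) (op1 := addn) (fun _ _ => erefl) erefl).
have h i : topc (m i) ((mins ord0 p 1 i ^+ m i)%:MP) (mtop ord0 (unshear p i ^+ m i)).
  rewrite (rmorphXn (@mtop F n ord0)) (rmorphXn (@mpolyC n F)) -[X in topc X](mul1n (m i)).
  apply: topcX; rewrite /unshear /mins; case: unliftP => [j ->|_] /=.
    rewrite mtopD -mul_mpolyC mtopM mtopC !mtopX liftK unlift_none; split.
      by rewrite addrC size_MXaddC; case: ifP => // _; rewrite ltnS size_polyC_leq1.
    by rewrite coefD coefC coefMX coefC /= add0r.
  by rewrite mtopX unlift_none; split; rewrite ?size_polyX // coefX.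
elim: (index_enum _) => [|i s IH]; first by rewrite !big_nil; split; rewrite ?size_poly1 ?coef1.
by rewrite !big_cons; apply: topcM.
Qed.

(** The vector [(1, p)] is chosen off the zeros of the top form of a relation [G]; the value there
    becomes the leading coefficient after the change of coordinates. [P] divides the value of some
    prime factor, whose leading coefficient divides that constant. *)
Lemma monic_relation (h : 'I_n.+1 -> {mpoly F[n.+1]}) :
  exists p (Nq : {poly {mpoly F[n]}}), [/\ prime_elt Nq, dv (lead_coef Nq) 1 &
    dv P (msub (shear p h) (ptom ord0 Nq))].
Proof.
have [G G0 hG] := relation_mod h.
pose D := (msize G).-1; pose T := hcomp D G.
have D1 : msize G = D.+1 by rewrite prednK // lt0n msize_poly_eq0.
have TE : T = \sum_(m <- msupp G | mdeg m == D) G@_m *: 'X_[m] by rewrite /T pihomogE.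
have T0 : T != 0.
  apply/eqP => e0; have := congr1 (mcoeff (mlead G)) e0; rewrite mcoeff0 TE raddf_sum big_mkcond /=.
  have md : mdeg (mlead G) == D by apply/eqP/succn_inj; rewrite mlead_deg.
  rewrite (bigD1_seq (mlead G)) ?mlead_supp ?msupp_uniq //= md mcoeffZ mcoeffX eqxx mulr1.
  rewrite big1 ?addr0 => [/eqP|m /negPf ne].
    by rewrite mleadc_eq0 (negPf G0).
  by case: ifP => // _; rewrite mcoeffZ mcoeffX ne mulr0.
have [p Tp] : exists p, T.@[mins ord0 p 1] != 0.
  have XT : 'X_ord0 * T != 0 by rewrite mulf_neq0 // -msize_poly_eq0 msizeX.
  have [x] := mpoly_nonroot Finf XT; rewrite mevalM mevalXU mulf_eq0 negb_or => /andP[x0 Tx].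
  exists (fun j => (x ord0)^-1 * x (lift ord0 j)).
  have -> : T.@[mins ord0 (fun j => (x ord0)^-1 * x (lift ord0 j)) 1] = T.@[fun i => (x ord0)^-1 * x i].
    apply: meval_eq => i; rewrite /mins; case: unliftP => [j ->|->] //.
    by rewrite mulVf.
  by rewrite (dhomog_scale _ _ (pihomogP _ D G)) mulf_neq0 // expf_neq0 // invr_eq0.
pose g := mtop ord0 (msub (unshear p) G).
have [sg cg] : topc D (T.@[mins ord0 p 1])%:MP g.
  have -> : g = \sum_(m <- msupp G) (G@_m)%:MP%:P * mtop ord0 (msub (unshear p) 'X_[m]).
    rewrite /g {1}[G]mpolyE (raddf_sum (msub (unshear p))) (raddf_sum (@mtop F n ord0)) /=.
    by apply: eq_bigr => m _; rewrite msubZ -mul_mpolyC mtopM mtopC.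
  have -> : (T.@[mins ord0 p 1])%:MP = \sum_(m <- msupp G)
      if mdeg m == D then (G@_m * \prod_i mins ord0 p 1 i ^+ m i)%:MP else 0 :> {mpoly F[n]}.
    rewrite TE -big_mkcond (raddf_sum (meval _)) (raddf_sum (@mpolyC n F)) /=.
    by apply: eq_bigr => m _; rewrite mevalZ mevalX.
  apply: topc_sum => m /(@List_In_mem _ _ _) mG; have [s1 c1] := topc_monomial p m.
  have mD : (mdeg m <= D)%N by have := msize_mdeg_lt mG; rewrite D1.
  have sz : (size ((G@_m)%:MP%:P * mtop ord0 (msub (unshear p) 'X_[m]) : {poly {mpoly F[n]}})%R <= (mdeg m).+1)%N.
    rewrite mul_polyC; exact: leq_trans (size_scale_leq _ _) s1.
  split; first by apply: leq_trans sz _.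
  case: eqP => [<-|/eqP ne]; first by rewrite coefCM c1 mpolyCM.
  by rewrite nth_default //; apply: leq_trans sz _; rewrite ltn_neqAle ne.
have lg : lead_coef g = (T.@[mins ord0 p 1])%:MP.
  rewrite -cg lead_coefE; congr (_`_ _); apply/eqP; rewrite eqn_leq; apply/andP; split.
    by case: (size g) sg.
  have hD : (D < size g)%N.
    by rewrite ltnNge; apply/negP => /(nth_default 0); rewrite cg => /eqP; rewrite mpolyC_eq0 (negPf Tp).
  by case: (size g) hD.
have g0 : g != 0 by rewrite -lead_coef_eq0 lg mpolyC_eq0.
have [u [s [uu sp gE]]] := factorial_poly (@factorial_mpoly F n) g0.
have PU : dv P (msub (shear p h) (ptom ord0 g)) by rewrite /g mtopK msub_shear.
pose eps : {rmorphism {poly {mpoly F[n]}} -> {mpoly F[n.+1]}} := msub (shear p h) \o ptom ord0.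
have PU' : dv P (eps g) by [].
move: PU'; rewrite gE rmorphM; have [_ nu pr] := pP => /pr[PU'|].
  have [u' uE] := uu; case: nu; have [c cE] := PU'; exists (c * eps u').
  by rewrite mulrA -cE -rmorphM -uE rmorph1.
rewrite rmorph_prod => /(prime_dv_prod pP)[q qs Pq]; exists p, q; split => //; first exact: sp.
have [r rE] : dv q (\prod_(j <- s) j).
  elim: (s) qs => [//|t s' IH] /= [->|qs']; rewrite big_cons; first by exists (\prod_(j <- s') j).
  by have [r ->] := IH qs'; exists (t * r); rewrite mulrCA.
have : dv (lead_coef q) (lead_coef g).
  by rewrite gE rE !lead_coefM; exists (lead_coef u * lead_coef r); rewrite mulrCA.
move=> /dv_trans; apply; exists ((T.@[mins ord0 p 1])^-1)%:MP.
by rewrite lg -mpolyCM mulfV.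
Qed.

End MonicRelation.

(** Cayley-Hamilton for multiplication by [y] on the generators [b k]. *)
Lemma integral_of_span (A S : idomainType) (eps : {rmorphism A -> S}) (B : finType) (b : B -> S) :
  (forall s, exists q : B -> A, s = \sum_k b k * eps (q k)) ->
  forall y : S, exists (M : nat) (c : nat -> A),
    y ^+ M + \sum_(i < M) eps (c i) * y ^+ i = 0.
Proof.
move=> sp y; pose q := #|B|; pose bv : 'cV[S]_q := \col_i b (enum_val i).
have /fun_choice[m hm] : forall i : 'I_q, exists r : B -> A, y * b (enum_val i) = \sum_k b k * eps (r k).
  by move=> i; apply: sp.
pose Mx : 'M[A]_q := \matrix_(i, j) m i (enum_val j).
have E : (y%:M - map_mx eps Mx) *m bv = 0.
  apply/matrixP => i j; rewrite mulmxBl mxE mul_scalar_mx !mxE hm.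
  rewrite (reindex_onto enum_rank enum_val) /= => [|k _]; last by rewrite enum_valK.
  apply/eqP; rewrite subr_eq0; apply/eqP; apply: eq_big => [k|k _]; first by rewrite enum_rankK eqxx.
  by rewrite !mxE enum_rankK mulrC.
have D0 : \det (y%:M - map_mx eps Mx) = 0.
  have h (i : 'I_q) : \det (y%:M - map_mx eps Mx) * b (enum_val i) = 0.
    have := congr1 (mulmx (\adj (y%:M - map_mx eps Mx))) E.
    by rewrite mulmxA mul_adj_mx mul_scalar_mx mulmx0 => /matrixP /(_ i 0); rewrite !mxE.
  have [r r1] := sp 1; rewrite -[LHS]mulr1 r1 mulr_sumr big1 // => k _.
  by rewrite mulrA -[k]enum_rankK h mul0r.
pose ch := char_poly Mx; exists q, (fun i => ch`_i); rewrite -[RHS]D0.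
pose ev : {rmorphism {poly A} -> S} := horner_eval y \o map_poly eps.
have <- : ev ch = \det (y%:M - map_mx eps Mx).
  rewrite /ch /char_poly -det_map_mx; congr (\det _); apply/matrixP => i j.
  by rewrite !mxE rmorphB rmorphMn /= ?horner_evalE map_polyX map_polyC hornerX hornerC.
have sz : size ch = q.+1 by apply: size_char_poly.
have mon : ch`_q = 1 by have := char_poly_monic Mx; rewrite monicE lead_coefE -/ch sz /= => /eqP.
have -> : ev ch = \sum_(i < q.+1) eps ch`_i * y ^+ i.
  rewrite /= horner_evalE (@horner_coef_wide _ q.+1).
    by apply: eq_bigr => i _; rewrite coef_map.
  by apply: leq_trans (size_poly _ _) _; rewrite sz.
by rewrite big_ord_recr /= mon rmorph1 mul1r addrC.
Qed.

Lemma rad_add (R : comNzRingType) (W : R -> Prop) x y a c : idealP W ->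
  W (x ^+ a) -> W (y ^+ c) -> W ((x + y) ^+ (a + c)).
Proof.
move=> iW wx wy; have [W0 WD WM] := iW; rewrite exprDn; apply: ideal_sum => // i _.
rewrite -mulr_natl; apply: (WM); case: (leqP c i) => h.
  by rewrite -(subnK h) exprD mulrA; apply: (WM).
have h' : (a <= a + c - i)%N by move: h; lia.
by rewrite -(subnK h') exprD mulrAC; apply: (WM).
Qed.

Lemma rad_sum (R : comNzRingType) (W : R -> Prop) r (g c : 'I_r -> R) M : idealP W ->
  (forall j, W (g j ^+ M)) -> exists K, W ((\sum_j c j * g j) ^+ K).
Proof.
move=> iW wg; have [W0 WD WM] := iW; elim/big_ind: _ => [|x y [a ha] [a' ha']|j _].
- by exists 1%N; rewrite expr1.
- by exists (a + a')%N; apply: rad_add.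
- by exists M; rewrite exprMn; apply: WM.
Qed.

Lemma mtop_deriv (F : fieldType) n (l : 'I_n.+1) (p : {mpoly F[n.+1]}) :
  mtop l (p^`M(l)) = (mtop l p)^`().
Proof.
elim/mpoly_ring_ind: p => [c|i|p q hp hq|p q hp hq].
- by rewrite mderivC (rmorph0 (@mtop F n l)) mtopC derivC.
- rewrite mderivXU mtopX; case: unliftP => [j ->|->].
    by rewrite derivC eq_sym (negPf (neq_lift l j)) (rmorph0 (@mtop F n l)).
  by rewrite eqxx derivX (rmorph1 (@mtop F n l)).
- by rewrite mderivD !mtopD derivD hp hq.
- by rewrite mderivM mtopD !mtopM derivM hp hq.
Qed.

(** * Lifting through [f^2] *)

Section Lifting.
Variable F : closedFieldType.
Hypothesis hchar : [pchar F] =i pred0.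
Variables (n d e k : nat) (f : polymap F n.+1) (B : finType) (b : B -> {mpoly F[n.+2]}).
Variables (P : {mpoly F[n.+2]}) (p : 'I_n.+1 -> F) (Nq : {poly {mpoly F[n.+1]}}).
Variable aq : 'I_n.+1 -> {mpoly F[n]}.
Notation N := n.+2.
Notation S := {mpoly F[N]}.
Let Finf := closed_infinite hchar.

Hypothesis d0 : (0 < d)%N.
Hypothesis hf : forall i, f i \is d.-homog.
Hypothesis fb : free_basis b f.
Hypothesis hP : P \is e.-homog.
Hypothesis pP : prime_elt P.
Hypothesis Ppt : forall l : 'I_N, P.@[pt F l] != 0.
Hypothesis pN : prime_elt Nq.
Hypothesis lN : dv (lead_coef Nq) 1.
Hypothesis PN2 : dv P (msub (shear p (fiter f 2)) (ptom ord0 Nq)).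
Hypothesis k2 : (2 <= k)%N.
Hypothesis bad : forall x, P.@[x] = 0 ->
  exists2 y, P.@[y] = 0 & forall i, (fiter f 2 i).@[y] = (fiter f k i).@[x].
Hypothesis aq0 : forall q, aq q != 0.
Hypothesis aqP : forall q, inI (fun j => P^`M(j))
  (msub (fun j => shear p (fiter f 2) (lift ord0 (lift q j))) (aq q)).

(** A relation between the coordinates of [f^2] that holds on [C] holds for those of [f^k], whose
    values on [C] are among the values of [f^2]. *)
Lemma transfer (T : S) : dv P (msub (fiter f 2) T) -> dv P (msub (fiter f k) T).
Proof.
move=> [c cE]; apply: (prime_vanish Finf pP) => x /bad[y Py fy].
rewrite meval_msub -(meval_eq _ fy) -meval_msub cE mevalM Py mul0r.
by [].
Qed.

Definition epsk j : {mpoly F[n.+1]} -> S := fun a => msub (shear p (fiter f j)) (ptom ord0 a%:P).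

Definition akq j q : S := msub (fun i => shear p (fiter f j) (lift ord0 (lift q i))) (aq q).

Lemma akqE j q : akq j q = epsk j (mlft q (aq q)).
Proof.
rewrite /epsk ptomC /mlft msub_msub; rewrite /akq -/(mlft _ _) /mlft msub_msub.
by apply: eq_msub => i; rewrite !msubXU.
Qed.

(** The [q]-th polynomial does not involve the variable [q], so neither does a prime that divides
    it. A prime dividing all of them would be constant. *)
Lemma aq_coprime (pi : {mpoly F[n.+1]}) : prime_elt pi -> exists q, ~ dv pi (mlft q (aq q)).
Proof.
move=> [pi0 nu pr]; apply: NNPP => no.
have hq q : pi^`M(q) = 0.
  have [c cE] : dv pi (mlft q (aq q)) by apply: NNPP => h; apply: no; exists q.
  have := congr1 (@mtop F n q) cE; rewrite mtop_lift mtopM => cE'.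
  have sz : (size (mtop q pi) <= 1)%N.
    have m0 : mtop q pi * mtop q c != 0 by rewrite -cE' polyC_eq0.
    have [u0 v0] : mtop q pi != 0 /\ mtop q c != 0.
      by move: m0; rewrite mulf_eq0 negb_or => /andP.
    have := size_polyC_leq1 (aq q); rewrite cE' size_mul //.
    by move: v0; rewrite -size_poly_gt0; move: (size _) (size _); clear; lia.
  apply: (can_inj (@mtopK F n q)); rewrite mtop_deriv (size1_polyC sz) derivC.
  by rewrite (rmorph0 (@mtop F n q)).
apply: nu; have piE : pi = (pi@_0)%:MP.
  apply/mpolyP => m; rewrite mcoeffC; case: (eqVneq 0%MM m) => [<-|ne]; first by rewrite mulr1.
  rewrite mulr0; case: (pickP (fun i => 0 < m i)%N) => [i mi|no'].
    have le : (U_(i) <= m)%MM by apply/mnm_lepP => j; rewrite mnm1E; case: eqP => [<-|].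
    have := congr1 (mcoeff (m - U_(i))%MM) (hq i); rewrite mcoeff0 mcoeff_deriv submK //.
    move=> /eqP; rewrite -mulr_natr mulf_eq0 => /orP[/eqP //|].
    by rewrite (negPf (natr_neq0 hchar _)).
  case/negP: ne; apply/eqP/mnmP => i; rewrite mnm0E.
  by have := no' i; rewrite lt0n => /negbFE/eqP.
exists ((pi@_0)^-1)%:MP; rewrite {1}piE -mpolyCM mulfV //.
by apply: contraNneq pi0 => c0; rewrite piE c0.
Qed.

Lemma free_k j : exists (B' : finType) (b' : B' -> S), free_basis b' (shear p (fiter f j)).
Proof.
by have [B' [b' h]] := free_iter j fb; exists B', b'; apply: free_shear.
Qed.

Lemma PNj j : j = 2%N \/ j = k -> dv P (msub (shear p (fiter f j)) (ptom ord0 Nq)).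
Proof.
case=> -> //; have E i : msub (shear p (fiter f i)) (ptom ord0 Nq) =
    msub (fiter f i) (msub (shear p (fun i => 'X_i)) (ptom ord0 Nq)).
  by rewrite msub_msub; apply: eq_msub => l; rewrite shear_msub.
by rewrite E; apply: transfer; rewrite -E.
Qed.

Section FreeModule.
Variables (j : nat) (B' : finType) (b' : B' -> S).
Hypothesis hj : j = 2%N \/ j = k.
Hypothesis fb' : free_basis b' (shear p (fiter f j)).
Let ep : {rmorphism {poly {mpoly F[n.+1]}} -> S} := msub (shear p (fiter f j)) \o ptom ord0.

Lemma span_ep s : exists q : B' -> {poly {mpoly F[n.+1]}}, s = \sum_k b' k * ep (q k).
Proof.
have [q ->] := proj1 fb' s; exists (fun k => mtop ord0 (q k)).
by apply: eq_bigr => i _; rewrite /ep /= mtopK.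
Qed.

Lemma indep_ep (q : B' -> {poly {mpoly F[n.+1]}}) : \sum_k b' k * ep (q k) = 0 ->
  forall k, q k = 0.
Proof.
move=> h i; apply: (can_inj (@ptomK F n.+1 ord0)); rewrite (rmorph0 (@ptom F n.+1 ord0)).
exact: (proj2 fb' (fun k => ptom ord0 (q k)) h).
Qed.

Lemma ext_aux (Z Om : S) M : ~ dv P Z ->
  (forall q, in2 Z P (Om * akq j q ^+ M)) -> in2 Z P Om.
Proof.
move=> nZ h; apply: (ext_regular span_ep indep_ep (@factorial_mpoly F n.+1) pP pN lN
  (PNj hj) (a := fun q => mlft q (aq q)) (i0 := ord0) (M := M)) => //.
- apply: contraNneq (aq0 ord0) => e0; have := mtop_lift ord0 (aq ord0).
  by rewrite e0 (rmorph0 (@mtop F n ord0)) => /esym/eqP; rewrite polyC_eq0.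
- exact: aq_coprime.
by move=> q; have := h q; rewrite akqE.
Qed.

Lemma akq_nz_aux q : ~ dv P (akq j q).
Proof.
rewrite akqE; apply: (const_image span_ep indep_ep pP pN lN (PNj hj)).
apply: contraNneq (aq0 q) => e0; have := mtop_lift q (aq q).
by rewrite e0 (rmorph0 (@mtop F n q)) => /esym/eqP; rewrite polyC_eq0.
Qed.

(** The prime [Nq] is a relation for both iterates on [C]. If [s] does not vanish on the image of
    [f^2], then [Nq] does not divide it, and [coprime_image] applies to [f^k]. *)
Lemma nondiv_aux (s : S) : j = k -> ~ dv P (msub (fiter f 2) s) -> ~ dv P (msub (fiter f j) s).
Proof.
move=> jk n2 nk; pose s' := mtop ord0 (msub (unshear p) s).
have sE i : msub (fiter f i) s = msub (shear p (fiter f i)) (ptom ord0 s').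
  by rewrite /s' mtopK msub_shear.
have dN : ~ dv Nq s'.
  move=> [c cE]; apply: n2; rewrite sE cE ptomM msubM; apply: dv_mulr; exact: PN2.
by apply: (coprime_image span_ep indep_ep pP pN dN (PNj hj)); rewrite /= -sE.
Qed.

End FreeModule.

Lemma lifting_ext j (Z Om : S) M : j = 2%N \/ j = k -> ~ dv P Z ->
  (forall q, in2 Z P (Om * akq j q ^+ M)) -> in2 Z P Om.
Proof. by move=> hj; have [B' [b' h]] := free_k j; apply: (ext_aux hj h). Qed.

Lemma akq_nz j q : j = 2%N \/ j = k -> ~ dv P (akq j q).
Proof. by move=> hj; have [B' [b' h]] := free_k j; apply: (akq_nz_aux hj h). Qed.

Lemma nondiv_k (s : S) : ~ dv P (msub (fiter f 2) s) -> ~ dv P (msub (fiter f k) s).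
Proof. by have [B' [b' h]] := free_k k; apply: (nondiv_aux (or_intror erefl) h). Qed.

Lemma integral_over_f j (y : S) : exists M (c : nat -> S),
  y ^+ M + \sum_(i < M) msub (fiter f j) (c i) * y ^+ i = 0.
Proof.
have [B' [b' [sp _]]] := free_iter j fb.
exact: (integral_of_span (eps := msub (fiter f j)) sp).
Qed.

Lemma conductor_l (l : 'I_N) (s u : S) M (c : nat -> S) : ~ dv P s ->
  dv P (u ^+ M + \sum_(i < M) c i * s ^+ (M - i) * u ^+ i) ->
  exists M', in2 s P (P^`M(l) ^+ M' * u).
Proof.
move=> nPs [v vE].
have lP : dv (lead_coef (mtop l P)) 1.
  rewrite (lead_mtop hP (Ppt l)); exists ((P.@[pt F l])^-1)%:MP.
  by rewrite -mpolyCM mulfV.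
have nPs' : ~ dv (mtop l P) (mtop l s).
  move=> [c' cE]; apply: nPs; exists (ptom l c').
  by rewrite -[s](mtopK l) cE ptomM mtopK.
have [|M' [w [x xE]]] := @conductor F Finf n.+1 (mtop l P) (prime_mtop l pP) lP (mtop l s) (mtop l u) M
  (fun i => mtop l (c i)) nPs'.
  exists (mtop l v); rewrite -mtopM -vE mtopD (rmorph_sum (@mtop F n.+1 l)) (rmorphXn (@mtop F n.+1 l)).
  congr (_ + _); apply: eq_bigr => i _ /=; rewrite !mtopM.
  by rewrite !(rmorphXn (@mtop F n.+1 l)).
exists M', (ptom l w), (ptom l x).
have := congr1 (@ptom F n.+1 l) (canRL (subrK _) xE).
rewrite ptomD !ptomM -mtop_deriv !mtopK => E.
have -> : P^`M(l) ^+ M' * u = ptom l (mtop l P^`M(l) ^+ M') * u.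
  by rewrite -[mtop l P^`M(l) ^+ M'](rmorphXn (@mtop F n.+1 l)) mtopK.
by rewrite E addrC [s * _]mulrC [P * _]mulrC.
Qed.

Variables (t sd : nat) (s : S) (u : 'X_{1..N} -> S).
Hypothesis sd_homog : s \is sd.-homog.
Hypothesis nPs : ~ dv P (msub (fiter f 2) s).
Hypothesis vt : (d ^ 2 %| t)%N.
Hypothesis ud_homog : forall m, mdeg m = t -> u m \is (sd + t %/ d ^ 2).-homog.
Hypothesis bir : forall y, P.@[y] = 0 -> forall m, mdeg m = t ->
  (msub (fiter f 2) s).@[y] * 'X_[m].@[y] = (msub (fiter f 2) (u m)).@[y].

Definition SK := msub (fiter f k) s.

Lemma SK_nz : ~ dv P SK.
Proof. exact: nondiv_k. Qed.

Lemma bir_k x y m : mdeg m = t -> P.@[y] = 0 ->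
  (forall i, (fiter f 2 i).@[y] = (fiter f k i).@[x]) ->
  SK.@[x] * 'X_[m].@[y] = (msub (fiter f k) (u m)).@[x].
Proof.
move=> mt Py fy; have := bir Py mt.
by rewrite /SK !meval_msub !(meval_eq _ fy).
Qed.

(** On [C] the fraction [U / SK] is the monomial [m] at the lifted point [y]; it is integral because
    ['X_[m]] is integral over the coordinates of [f^2], which at [y] are those of [f^k] at [x]. By
    the conductor, powers of the partial derivatives of [P] clear the denominator, hence so do
    powers of the elements [akq 2 q] of the gradient ideal. *)
Lemma quotient_regular (m : 'X_{1..N}) : mdeg m = t -> in2 SK P (msub (fiter f k) (u m)).
Proof.
move=> mt; set U := msub _ (u m).
have [M [c hc]] := integral_over_f 2 'X_[m].
have eqn : dv P (U ^+ M + \sum_(i < M) msub (fiter f k) (c i) * SK ^+ (M - i) * U ^+ i).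
  apply: (prime_vanish Finf pP) => x Px; have [y Py fy] := bad Px.
  have Ux : U.@[x] = SK.@[x] * 'X_[m].@[y] by rewrite (bir_k mt Py fy).
  have E := congr1 (meval y) hc; rewrite mevalD (raddf_sum (meval y)) rmorphXn meval0 /= in E.
  transitivity (SK.@[x] ^+ M * ('X_[m].@[y] ^+ M +
    \sum_(i < M) (msub (fiter f 2) (c i) * 'X_[m] ^+ i).@[y])); last by rewrite E mulr0.
  rewrite mevalD (raddf_sum (meval x)) rmorphXn /= Ux mulrDr exprMn mulr_sumr.
  congr (_ + _); apply: eq_bigr => i _; rewrite !mevalM !rmorphXn /= Ux exprMn.
  have -> : (msub (fiter f k) (c i)).@[x] = (msub (fiter f 2) (c i)).@[y].
    by rewrite !meval_msub (meval_eq _ fy).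
  have -> : SK.@[x] ^+ M = SK.@[x] ^+ (M - i) * SK.@[x] ^+ i.
    by rewrite -exprD subnK // ltnW.
  move: (_ ^+ _) (_ ^+ _) (_ ^+ _) => ? ? ?; ring.
have /fun_choice[Ml hMl] l := @conductor_l l SK U M (fun i => msub (fiter f k) (c i)) SK_nz eqn.
pose M' := \max_l Ml l.
have iW : idealP (fun A => in2 SK P (A * U)).
  split; first by exists 0, 0; rewrite !mul0r addr0.
    by move=> A A' h h'; rewrite mulrDl; apply: in2D.
  by move=> A A' h; rewrite -mulrA; apply: in2M.
have hW l : in2 SK P (P^`M(l) ^+ M' * U).
  have le : (Ml l <= M')%N by apply: leq_bigmax.
  by rewrite -(subnK le) exprD -mulrA; apply: in2M.
have /fun_choice[Kq hKq] q : exists K, in2 SK P (akq 2 q ^+ K * U).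
  have [cc ccE] := aqP q; rewrite /akq ccE; exact: (rad_sum _ iW hW).
(* Freeness over the coordinates of [f^2] is used here, as the [akq 2 q] are polynomials in them
   without common prime factor. *)
apply: (@lifting_ext 2 SK U (\max_q Kq q)); first by left.
  exact: SK_nz.
move=> q; have le : (Kq q <= \max_q Kq q)%N by apply: leq_bigmax.
by rewrite mulrC -(subnK le) exprD -mulrA; apply: in2M.
Qed.

(** Since [SK] and the numerator are homogeneous, only the component of degree [deg U - deg SK] of
    the quotient matters. *)
Lemma lift_monomial (m : 'X_{1..N}) : mdeg m = t ->
  exists2 H : S, H \is (t * d ^ (k - 2)).-homog & dv P (msub (fiter f k) (u m) - SK * H).
Proof.
move=> mt; have [H [w E]] := quotient_regular mt.
exists (hcomp (t * d ^ (k - 2)) H); first exact: pihomogP.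
have hS : SK \is (sd * d ^ k).-homog by apply: dhomog_msub => //; apply: fiter_homog.
have hU : msub (fiter f k) (u m) \is ((sd + t %/ d ^ 2) * d ^ k).-homog.
  by apply: dhomog_msub; [apply: ud_homog|apply: fiter_homog].
have degE : ((sd + t %/ d ^ 2) * d ^ k = t * d ^ (k - 2) + sd * d ^ k)%N.
  rewrite mulnDl addnC; congr (_ + _)%N.
  by rewrite -{1}(subnK k2) addnC expnD mulnA divnK.
rewrite degE in hU; rewrite -(pihomog_dE hU) E linearD /= (hcompM _ _ hS) leq_addl addnK.
rewrite [SK * _]mulrC addrAC subrr add0r (hcompM _ _ hP).
by case: ifP => _; [exists (hcomp (t * d ^ (k - 2) + sd * d ^ k - e) w); rewrite mulrC|apply: dv0].
Qed.

(** A monomial of degree [t * j] is a product of [j] monomials of degree [t], each of which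
    lifts. *)
Lemma lift_form j (A : S) : A \is (t * j).-homog ->
  exists2 H : S, H \is (t * j * d ^ (k - 2)).-homog &
  forall x y, P.@[y] = 0 -> (forall i, (fiter f 2 i).@[y] = (fiter f k i).@[x]) ->
    P.@[x] = 0 -> SK.@[x] != 0 -> H.@[x] = A.@[y].
Proof.
move=> /dhomogP hA.
have mon m : mdeg m = (t * j)%N -> exists2 H : S, H \is (t * j * d ^ (k - 2)).-homog &
  forall x y, P.@[y] = 0 -> (forall i, (fiter f 2 i).@[y] = (fiter f k i).@[x]) ->
    P.@[x] = 0 -> SK.@[x] != 0 -> H.@[x] = 'X_[m].@[y].
  elim: j m {hA} => [|j IH] m mE.
    exists 1 => [|x y _ _ _ _]; first by rewrite muln0 mul0n dhomog1.
    have -> : m = 0%MM by apply/eqP; rewrite -mdeg_eq0 mE muln0.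
    by rewrite mpolyX0 !rmorph1.
  have [|m1 [m2 [mm m1E m2E]]] := @mdeg_split _ m t; first by rewrite mE mulnS leq_addr.
  have [H1 h1 E1] := lift_monomial m1E.
  have [|H2 h2 E2] := IH m2; first by rewrite m2E mE mulnS addKn.
  exists (H1 * H2) => [|x y Py fy Px Sx]; first by rewrite mulnS mulnDl; apply: dhomogM.
  rewrite mm mpolyXD !mevalM (E2 x y) //; congr (_ * _).
  have [w wE] := E1; have := congr1 (meval x) wE.
  rewrite mevalB !mevalM Px mul0r => /eqP; rewrite subr_eq0 => /eqP.
  by rewrite -(bir_k m1E Py fy) => /(mulfI Sx).
rewrite [A]mpolyE big_seq; elim/big_ind: _ => [|A1 A2 [H1 h1 E1] [H2 h2 E2]|m mA].
- by exists 0 => [|x y _ _ _ _]; rewrite ?rpred0 ?meval0.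
- exists (H1 + H2) => [|x y Py fy Px Sx]; first by rewrite rpredD.
  by rewrite !mevalD (E1 x y) // (E2 x y).
have [H hH E] := mon m (hA m mA); exists (A@_m *: H) => [|x y Py fy Px Sx]; first by rewrite rpredZ.
by rewrite !mevalZ (E x y).
Qed.

End Lifting.

(** * Determinants with a replaced row *)

Section LinearAlgebra.
Variable F : fieldType.

Lemma det_1D_colrow n (x : 'cV[F]_n) (v : 'rV[F]_n) : \det (1%:M + x *m v) = 1 + (v *m x) 0 0.
Proof.
have E1 : block_mx 1%:M x (- v) 1%:M = block_mx 1%:M 0 (- v) 1%:M *m block_mx 1%:M x 0 (1%:M + v *m x).
  by rewrite mulmx_block !mul1mx !mul0mx !mulmx1 ?mulmx0 !addr0 mulNmx addrCA addNr addr0.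
have E2 : block_mx 1%:M x (- v) 1%:M = block_mx 1%:M x 0 1%:M *m block_mx (1%:M + x *m v) 0 (- v) 1%:M.
  by rewrite mulmx_block !mul1mx !mul0mx !mulmx1 ?mulmx0 !add0r mulmxN addrK.
have := congr1 determinant E1; rewrite E2 !det_mulmx !det_ublock !det_lblock !det1 !mul1r mulr1 => ->.
by rewrite det_mx11 !mxE eqxx.
Qed.

Definition repl_row n (A : 'M[F]_n) (l : 'I_n) (g : 'rV[F]_n) : 'M[F]_n :=
  \matrix_(a, b) if a == l then g 0 b else A a b.

(** Multiplying by a matrix that differs from the identity in row [j] only, with determinant
    [p 0 j], turns that row into a multiple of row [l] of [A], up to the replaced row. *)
Lemma det_repl_row_exchange n (A : 'M[F]_n) (g : 'rV[F]_n) (p : 'rV[F]_n) q j l :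
  p *m A = q *: g -> p 0 j * \det (repl_row A l g) = p 0 l * \det (repl_row A j g).
Proof.
move=> pA; case: (eqVneq j l) => [->//|jl].
pose w : 'rV[F]_n := \row_i (if i == j then p 0 j - 1 else if i == l then - q else p 0 i).
have d1 : \det (1%:M + delta_mx j 0 *m w) = p 0 j.
  rewrite det_1D_colrow mxE (bigD1 j) //= !mxE !eqxx mulr1 big1 => [|i /negPf ij].
    by rewrite addr0 addrC subrK.
  by rewrite !mxE ij mulr0.
rewrite -d1 -det_mulmx.
have -> : (1%:M + delta_mx j 0 *m w) *m repl_row A l g =
    diag_mx (\row_i if i == j then - p 0 l else 1) *m xrow j l (repl_row A j g).
  apply/matrixP => a b; rewrite mulmxDl mul1mx -mulmxA mul_diag_mx !mxE big_ord1 !mxE.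
  have [->|aj] := eqVneq a j; last first.
    rewrite mul0r addr0 mul1r; have [->|al] := eqVneq a l.
      by rewrite tpermR eqxx.
    by rewrite tpermD ?(eq_sym j) ?(eq_sym l) // (negPf aj).
  rewrite mul1r tpermL (negPf jl) eq_sym (negPf jl).
  have /matrixP /(_ 0 b) := pA; rewrite !mxE => pb.
  rewrite (bigD1 j) //= (bigD1 l) 1?eq_sym //= !mxE eqxx (negPf jl) eqxx eq_sym (negPf jl).
  move: pb; rewrite (bigD1 j) //= (bigD1 l) 1?eq_sym //= => pb.
  have -> : \sum_(i < n | (i != j) && (i != l)) w 0 i * repl_row A l g i b =
      \sum_(i < n | (i != j) && (i != l)) p 0 i * A i b.
    by apply: eq_bigr => i /andP[/negPf ij /negPf il]; rewrite !mxE ij il.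
  move: pb; set s := \sum_(i < n | _) _ => pb.
  have -> : s = q * g 0 b - p 0 j * A j b - p 0 l * A l b.
    by rewrite -pb; ring.
  by ring.
rewrite det_mulmx det_diag (bigD1 j) //= mxE eqxx big1 ?mulr1 => [|i /negPf ij]; last first.
  by rewrite mxE ij.
by rewrite xrowE det_mulmx det_perm odd_tperm jl expr1 mulN1r mulrNN.
Qed.

(** The algebra behind [Psi_scale]. The vector [x] satisfies Euler's relations, so the variation
    [nu] of the scaling factor kills [x]. The two matrices with row [l] replaced then differ by the
    unipotent factors [1 + rho *m delta_mx 0 l] and [1 + x' *m nu], of determinant [1]. *)
Lemma det_repl_row_scale n (A A' : 'M[F]_n.+1) (G m1 m2 : 'rV[F]_n.+1) (x h h' r : 'cV[F]_n.+1)
  (mu1 mu2 dl dl' : F) l : mu1 != 0 -> mu2 != 0 -> dl != 0 ->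
  A *m x = dl *: h -> G *m x = 0 -> mu1 *: h' = mu2 *: h ->
  mu1 *: A' + h' *m m1 = mu2 *: A + h *m m2 + r *m G ->
  m1 *m x = (dl' * mu1)%:M -> m2 *m x = (dl' * mu2)%:M ->
  mu1 ^+ n * \det (repl_row A' l G) = mu2 ^+ n * \det (repl_row A l G).
Proof.
move=> u1 u2 dl0 Ax Gx hh E m1x m2x.
pose nu := m2 - (mu2 / mu1) *: m1.
have nux : nu *m x = 0.
  rewrite mulmxBl -scalemxAl m1x m2x scale_scalar_mx -raddfB /=.
  by rewrite (_ : _ - _ = 0) ?raddf0 //; field.
have E' : mu1 *: A' = mu2 *: A + h *m nu + r *m G.
  rewrite /nu mulmxBr -scalemxAr scalemxAl; have -> : (mu2 / mu1) *: h = h'.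
    by rewrite mulrC -scalerA -hh scalerA mulVf // scale1r.
  apply: (addIr (h' *m m1)); rewrite E.
  move: (mu2 *: A) (h *m m2) (h' *m m1) (r *m G) => a b c dd; rewrite -!addrA; congr (_ + (_ + _)).
  by rewrite addrCA addNr addr0.
pose M (mu : F) (A : 'M[F]_n.+1) := \matrix_(a, b) if a == l then G 0 b else mu * A a b.
have dM mu A0 : \det (M mu A0) = mu ^+ n * \det (repl_row A0 l G).
  have -> : M mu A0 = diag_mx (\row_i if i == l then 1 else mu) *m repl_row A0 l G.
    apply/matrixP => a b; rewrite mul_diag_mx !mxE; case: eqP => _ //; by rewrite mul1r.
  rewrite det_mulmx det_diag; congr (_ * _); rewrite (bigD1 l) //= mxE eqxx mul1r.
  rewrite (eq_bigr (fun=> mu)) => [|i /negPf il]; last by rewrite mxE il.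
  by rewrite prodr_const (eq_card (B := predC1 l)) // cardC1 card_ord.
rewrite -!dM; pose rho : 'cV[F]_n.+1 := \col_a if a == l then 0 else r a 0.
pose x' := (mu2 * dl)^-1 *: x.
have -> : M mu1 A' = (1%:M + rho *m delta_mx 0 l) *m M mu2 A *m (1%:M + x' *m nu).
  have Mx a : (M mu2 A *m x') a 0 = if a == l then 0 else h a 0.
    rewrite mxE; under eq_bigr do rewrite !mxE.
    have [_|al] := eqVneq a l.
      have /matrixP /(_ 0 0) := Gx; rewrite !mxE => Gx0.
      rewrite -[RHS](mulr0 (mu2 * dl)^-1) -[in RHS]Gx0 mulr_sumr.
      by apply: eq_bigr => i _; ring.
    have /matrixP /(_ a 0) := Ax; rewrite !mxE => Axa.
    transitivity ((mu2 * dl)^-1 * mu2 * (dl * h a 0)); last by field; rewrite u2 dl0.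
    by rewrite -Axa mulr_sumr; apply: eq_bigr => i _; ring.
  have lM : delta_mx 0 l *m M mu2 A = G.
    by rewrite -rowE; apply/rowP => b; rewrite !mxE eqxx.
  have Gx' : G *m x' = 0 by rewrite /x' -scalemxAr Gx scaler0.
  rewrite mulmxDl mul1mx -mulmxA lM mulmxDr mulmx1 mulmxA mulmxDl -[rho *m G *m x']mulmxA Gx'.
  rewrite mulmx0 addr0; apply/matrixP => a b; rewrite !mxE big_ord1 big_ord1 Mx !mxE.
  have [_|al] := eqVneq a l; first by rewrite !mul0r !addr0.
  have /matrixP /(_ a b) := E'; rewrite !mxE !big_ord1 => ->.
  by rewrite !mxE; ring.
rewrite !det_mulmx !det_1D_colrow.
have -> : ((delta_mx 0 l : 'rV[F]_n.+1) *m rho) 0 0 = 0 by rewrite -rowE !mxE eqxx.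
by rewrite /x' -scalemxAr nux scaler0 mxE !addr0 mul1r mulr1.
Qed.

End LinearAlgebra.

Lemma euler (F : fieldType) n d (p : {mpoly F[n]}) : p \is d.-homog ->
  \sum_i 'X_i * p^`M(i) = p *+ d.
Proof.
move=> /dhomogP hp; rewrite [p]mpolyE; under eq_bigr do rewrite linear_sum mulr_sumr.
rewrite exchange_big /= -sumrMnl !big_seq; apply: eq_bigr => m mp.
have /= <- := hp _ mp; rewrite mdegE -sumrMnr; apply: eq_bigr => i _.
rewrite linearZ /= mderivX -scalerAr -scalerAr scalerA -mpolyXD.
case: (posnP (m i)) => [->|mi]; first by rewrite mulr0 scale0r mulr0n.
have le : (U_(i) <= m)%MM by apply/mnm_lepP => j; rewrite mnm1E; case: eqP => [<-|].
by rewrite addmC submK // -scaler_nat scalerA mulrC.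
Qed.

Lemma mevalMBM (F : fieldType) n (x : 'I_n -> F) (a b c d : {mpoly F[n]}) :
  (a * b - c * d).@[x] = a.@[x] * b.@[x] - c.@[x] * d.@[x].
Proof. by rewrite mevalB !mevalM. Qed.

Lemma mevalXn (F : fieldType) n (x : 'I_n -> F) (a : {mpoly F[n]}) k : (a ^+ k).@[x] = a.@[x] ^+ k.
Proof. exact: (rmorphXn (meval x)). Qed.

Lemma mevalXMBXM (F : fieldType) n (x : 'I_n -> F) (a b c d : {mpoly F[n]}) k :
  (a ^+ k * b - c ^+ k * d).@[x] = a.@[x] ^+ k * b.@[x] - c.@[x] ^+ k * d.@[x].
Proof. by rewrite mevalMBM !mevalXn. Qed.

(** * The Jacobian of the lifted map *)

Section Ramification.
Variable F : closedFieldType.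
Hypothesis hchar : [pchar F] =i pred0.
Variables (n e t D Q : nat) (P SK : {mpoly F[n.+1]}).
Notation N := n.+1.
Notation S := {mpoly F[N]}.
Variables (cor : ('I_N -> F) -> ('I_N -> F) -> Prop) (ak a2 : 'I_Q -> S) (w : 'I_Q -> nat).
Let Finf := closed_infinite hchar.

Hypothesis hP : P \is e.-homog.
Hypothesis pP : prime_elt P.
Hypothesis en : (n.+1 < e)%N.
Hypothesis t2 : (1 < t)%N.
Hypothesis D2 : (1 < D)%N.
Hypothesis nSK : ~ dv P SK.
Hypothesis corP : forall x y, cor x y -> P.@[x] = 0 /\ P.@[y] = 0.
Hypothesis cor_total : forall x, P.@[x] = 0 -> exists y, cor x y.
Hypothesis lift : forall j (A : S), A \is (t * j).-homog ->
  exists2 H : S, H \is (t * j * D).-homog &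
    forall x y, cor x y -> SK.@[x] != 0 -> H.@[x] = A.@[y].
Hypothesis extend : forall (Z Om : S) M, ~ dv P Z ->
  (forall q, in2 Z P (Om * ak q ^+ M)) -> in2 Z P Om.
Variable q0 : 'I_Q.
Hypothesis ak_nz : forall q, ~ dv P (ak q).
Hypothesis a2_homog : forall q, a2 q \is (w q).-homog.
Hypothesis a2_grad : forall q, inI (fun j => P^`M(j)) (a2 q).
Hypothesis aE : forall q x y, cor x y -> (ak q).@[x] = (a2 q).@[y].

(** [SK] does not vanish identically on the irreducible [C], so points with [SK] nonzero suffice. *)
Lemma onC (A : S) : (forall x y, cor x y -> SK.@[x] != 0 -> A.@[x] = 0) -> dv P A.
Proof.
move=> h; have : dv P (SK * A).
  apply: (prime_vanish Finf pP) => x Px; rewrite mevalM; have [y xy] := cor_total Px.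
  by case: (eqVneq SK.@[x] 0) => [->|nz]; rewrite ?mul0r // (h x y) ?mulr0.
by case: pP => _ _ H /H[].
Qed.

Lemma on_zero (A : S) x : dv P A -> P.@[x] = 0 -> A.@[x] = 0.
Proof. by move=> [c ->] Px; rewrite mevalM Px mul0r. Qed.

(* On [P = 0], [Psi h l / P_l(h)] is independent of [l]: it is the Jacobian of [h] with respect
   to the residue form of [P]. *)
Definition Psi (h : 'I_N -> S) (l : 'I_N) : S :=
  locked (\det (\matrix_(a, b) if a == l then P^`M(b) else (h a)^`M(b))).

Lemma Psi_eval h l x : (Psi h l).@[x] =
  \det (repl_row (\matrix_(a, b) ((h a)^`M(b)).@[x]) l (\row_b (P^`M(b)).@[x])).
Proof.
rewrite /Psi -lock -det_map_mx; congr (\det _); apply/matrixP => a b; rewrite !mxE.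
by case: ifP; rewrite ?mxE.
Qed.

Lemma Psi_homog h l dl : (forall j, h j \is dl.-homog) -> Psi h l \is (e.-1 + n * dl.-1).-homog.
Proof.
move=> hh; rewrite /Psi -lock; apply: rpred_sum => s _; rewrite -signr_odd -(rmorph_sign (@mpolyC N F)).
rewrite mul_mpolyC rpredZ //; rewrite (bigD1 l) //=; apply: dhomogM.
  by rewrite mxE eqxx; apply: dhomog_mderiv.
have -> : (n * dl.-1 = \sum_(i < N | i != l) dl.-1)%N.
  by rewrite sum_nat_const (eq_card (B := predC1 l)) // cardC1 card_ord.
elim/big_rec2: _ => [|i q1 d1 il IH]; first exact: dhomog1.
by apply: dhomogM => //; rewrite mxE (negPf il); apply: dhomog_mderiv.
Qed.

(** Differentiating [P(h) = P c] on [C] shows that the gradient of [P] at [h], times the Jacobian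
    matrix of [h], is a multiple of the gradient of [P]. *)
Lemma Psi_exchange (h : 'I_N -> S) j l : dv P (msub h P) ->
  dv P (msub h P^`M(j) * Psi h l - msub h P^`M(l) * Psi h j).
Proof.
move=> [c cE]; apply: (prime_vanish Finf pP) => x Px; rewrite mevalMBM 2!Psi_eval.
set A := \matrix_(a, b) _; set G := \row_b _.
pose p : 'rV[F]_N := \row_j (msub h P^`M(j)).@[x].
have pA : p *m A = c.@[x] *: G.
  apply/rowP => b; have := congr1 (fun q => (q^`M(b)).@[x]) cE.
  rewrite /= mderiv_msub mderivM (raddf_sum (meval x)) /= mevalD !mevalM Px mul0r addr0.
  rewrite !mxE => E; rewrite mulrC -E; apply: eq_bigr => i _.
  by rewrite !mxE mevalM.
have := det_repl_row_exchange j l pA; rewrite !mxE => ->.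
by rewrite subrr.
Qed.

(** If [h' = (m2 / m1) h] on [C], the Jacobian is multiplied by [(m2 / m1)^n]: derivatives of the
    factor add only multiples of [h], which by Euler's formula is the image of a tangent
    direction. *)
Lemma Psi_scale (h h' : 'I_N -> S) (m1 m2 : S) dl dm l : (0 < dl)%N ->
  (forall j, h j \is dl.-homog) -> m1 \is dm.-homog -> m2 \is dm.-homog ->
  (forall j, dv P (m1 * h' j - m2 * h j)) -> ~ dv P m1 -> ~ dv P m2 ->
  dv P (m1 ^+ n * Psi h' l - m2 ^+ n * Psi h l).
Proof.
move=> dl0 hh hm1 hm2 /fun_choice[r rE] nm1 nm2.
suff H : dv P (m1 * m2 * (m1 ^+ n * Psi h' l - m2 ^+ n * Psi h l)).
  case: pP => _ _ pr; case: (pr _ _ H) => //.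
  by move/pr; case.
apply: (prime_vanish Finf pP) => x Px; rewrite !mevalM.
case: (eqVneq m1.@[x] 0) => [->|u1]; first by rewrite !mul0r.
case: (eqVneq m2.@[x] 0) => [->|u2]; first by rewrite mulr0 !mul0r.
rewrite mevalXMBXM 2!Psi_eval.
have eu (p : S) d : p \is d.-homog -> (\row_b (p^`M(b)).@[x]) *m (\col_b x b) = (d%:R * p.@[x])%:M.
  move=> hp; have := congr1 (meval x) (euler hp); rewrite (raddf_sum (meval x)) mevalMn /= => E.
  apply/matrixP => a b; rewrite !ord1 !mxE eqxx mulr1n mulr_natl -E; apply: eq_bigr => i _.
  by rewrite !mxE mevalM mevalXU mulrC.
suff -> : m1.@[x] ^+ n * \det (repl_row (\matrix_(a, b) ((h' a)^`M(b)).@[x]) l (\row_b (P^`M(b)).@[x])) =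
  m2.@[x] ^+ n * \det (repl_row (\matrix_(a, b) ((h a)^`M(b)).@[x]) l (\row_b (P^`M(b)).@[x])).
  by rewrite subrr mulr0.
apply: (@det_repl_row_scale F n _ _ _ (\row_b (m1^`M(b)).@[x]) (\row_b (m2^`M(b)).@[x]) (\col_b x b)
  (\col_j (h j).@[x]) (\col_j (h' j).@[x]) (\col_j (r j).@[x]) m1.@[x] m2.@[x] dl%:R dm%:R l u1 u2).
- by apply: natr_neq0 => //; rewrite -lt0n.
- apply/matrixP => a b; have /matrixP /(_ 0 0) := eu _ _ (hh a); rewrite !ord1 !mxE eqxx mulr1n => <-.
  by apply: eq_bigr => i _; rewrite !mxE.
- by rewrite (eu _ _ hP) Px mulr0 raddf0.
- apply/matrixP => a b; rewrite !mxE; have := congr1 (meval x) (rE a).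
  by rewrite mevalB !mevalM Px mul0r => /eqP; rewrite subr_eq0 => /eqP.
- apply/matrixP => a b; rewrite !mxE !big_ord1 !mxE; have := congr1 (fun q => (q^`M(b)).@[x]) (rE a).
  rewrite /= mderivB !mderivM mevalB !mevalD !mevalM Px mul0r addr0 => E.
  have -> : (r a).@[x] * (P^`M(b)).@[x] = (P^`M(b)).@[x] * (r a).@[x] by rewrite mulrC.
  by rewrite -E; ring.
- exact: eu.
- exact: eu.
Qed.

End Ramification.

(** With [m = e - n - 1], [A = t D] and [r = t] this compares the degrees of [Om] and [Zl]; the
    difference is [m * (A - r)]. *)
Lemma degree_drop (m A r n : nat) : (0 < m)%N -> (0 < r)%N -> (r < A)%N ->
  ((n + m + n * A.-1) * r + A * (r.-1 * m) < (n + m) * A * r)%N.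
Proof.
case: A => // A; case: r => // r m0 _ rA /=.
have h : (m * r.+1 <= m * A)%N by rewrite leq_mul2l; apply/orP; right.
by move: m0 h; clear; nia.
Qed.

(** The letters stand for values at a point: [a], [b] for [y i0], [y i]; [p0], [pl] for [Psi] in the
    chart [i0] with index [l0], [l]; [p'] for [Psi] in the chart [i] with index [l]; [d0], [dl] for
    the two partial derivatives of [P] at [y]. *)
Lemma cross_identity (F : fieldType) (t n e : nat) (a b p0 pl p' d0 dl : F) :
  (1 < t)%N -> (n.+1 < e)%N -> a != 0 ->
  ((a ^+ t) ^+ t.-1) ^+ n * p' - ((a ^+ t.-1 * b) ^+ t.-1) ^+ n * pl = 0 ->
  (a ^+ t.-1) ^+ e.-1 * d0 * pl - (a ^+ t.-1) ^+ e.-1 * dl * p0 = 0 ->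
  p0 ^+ t * (a ^+ t) ^+ (t.-1 * (e - n.+1)) * ((b ^+ t.-1) ^+ e.-1 * dl) ^+ t -
  ((a ^+ t.-1) ^+ e.-1 * d0) ^+ t * (p' ^+ t * (b ^+ t) ^+ (t.-1 * (e - n.+1))) = 0.
Proof.
move=> t2 en a0; have tE : t = t.-1.+1 by rewrite prednK // ltnW.
have [c ->] : exists c, b = c * a by exists (b / a); rewrite divfK.
have eA : a ^+ t.-1 * (c * a) = c * a ^+ t by rewrite [in RHS]tE exprSr; ring.
rewrite eA => R3 R2; have {R2} R2 : d0 * pl = dl * p0.
  apply/eqP; rewrite -subr_eq0; move/eqP: R2; rewrite -!mulrA -mulrBr mulf_eq0 !expf_eq0 (negPf a0) !andbF /=.
  by [].
have {R3} -> : p' = c ^+ (t.-1 * n) * pl.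
  move/eqP: R3; rewrite -!exprM exprMn -!exprM subr_eq0 => /eqP R3.
  by apply: (mulfI (expf_neq0 (t * (t.-1 * n)) a0)); rewrite R3 mulrCA mulrA.
have eE : e.-1 = (n + (e - n.+1))%N by move: en; clear; lia.
set E := (t.-1 * (e - n.+1))%N.
have Hc : c ^+ (t.-1 * (e.-1 * t)) = c ^+ (t.-1 * (n * t)) * c ^+ (t * E).
  by rewrite -exprD /E {1}eE mulnDl mulnDr; congr (_ ^+ (_ + _)); rewrite mulnA mulnC.
have Hd : p0 ^+ t * dl ^+ t = d0 ^+ t * pl ^+ t by rewrite -!exprMn R2 mulrC.
rewrite !exprMn -!exprM -?mulnA Hc.
move: Hd (c ^+ _) (c ^+ _) (a ^+ _) (a ^+ _) => Hd c2 c3 a1 a2'.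
transitivity ((p0 ^+ t * dl ^+ t - d0 ^+ t * pl ^+ t) * a1 * a2' * c2 * c3); last by rewrite Hd subrr !mul0r.
by move: (p0 ^+ t) (dl ^+ t) (d0 ^+ t) (pl ^+ t) => ? ? ? ?; ring.
Qed.

(** * Charts of the lifted map and the degree argument *)

Section Charts.
Variable F : closedFieldType.
Hypothesis hchar : [pchar F] =i pred0.
Variables (n e t D Q : nat) (P SK : {mpoly F[n.+1]}).
Notation N := n.+1.
Notation S := {mpoly F[N]}.
Variables (cor : ('I_N -> F) -> ('I_N -> F) -> Prop) (ak a2 : 'I_Q -> S) (w : 'I_Q -> nat).
Let Finf := closed_infinite hchar.

Hypothesis hP : P \is e.-homog.
Hypothesis pP : prime_elt P.
Hypothesis en : (n.+1 < e)%N.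
Hypothesis t2 : (1 < t)%N.
Hypothesis D2 : (1 < D)%N.
Hypothesis nSK : ~ dv P SK.
Hypothesis corP : forall x y, cor x y -> P.@[x] = 0 /\ P.@[y] = 0.
Hypothesis cor_total : forall x, P.@[x] = 0 -> exists y, cor x y.
Hypothesis lift : forall j (A : S), A \is (t * j).-homog ->
  exists2 H : S, H \is (t * j * D).-homog &
    forall x y, cor x y -> SK.@[x] != 0 -> H.@[x] = A.@[y].
Hypothesis extend : forall (Z Om : S) M, ~ dv P Z ->
  (forall q, in2 Z P (Om * ak q ^+ M)) -> in2 Z P Om.
Variable q0 : 'I_Q.
Hypothesis ak_nz : forall q, ~ dv P (ak q).
Hypothesis a2_homog : forall q, a2 q \is (w q).-homog.
Hypothesis a2_grad : forall q, inI (fun j => P^`M(j)) (a2 q).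
Hypothesis aE : forall q x y, cor x y -> (ak q).@[x] = (a2 q).@[y].

Let onC A := @onC F hchar n P SK cor pP nSK cor_total A.

Lemma dvP_or (A B : S) : dv P (A * B) -> ~ dv P A -> dv P B.
Proof. by case: pP => _ _ H /H[]. Qed.

Lemma on_point (A : S) x y : dv P A -> cor x y -> A.@[x] = 0.
Proof. by move=> [c ->] /corP[Px _]; rewrite mevalM Px mul0r. Qed.

Variable g : 'I_N -> 'I_N -> S.
Hypothesis hg : forall i j, g i j \is (t * D).-homog.
Hypothesis gE : forall i j x y, cor x y -> SK.@[x] != 0 -> (g i j).@[x] = y i ^+ t.-1 * y j.

Let z i := g i i.
(** Multiplying [h] by [mu] multiplies [Psi h l / P_l(h)] by [mu ^ (n + 1 - e)]. In the chart [i]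
    the factor is [y_i^(t-1)], so after raising to the power [t] the correction is exactly
    [z i ^+ E]. *)
Let E := (t.-1 * (e - n.+1))%N.
Let Pg i l := msub (g i) P^`M(l).
Let Om i l := Psi P (g i) l ^+ t * z i ^+ E.
Let Zl i l := Pg i l ^+ t.

Lemma zE i x y : cor x y -> SK.@[x] != 0 -> (z i).@[x] = y i ^+ t.
Proof. by move=> xy Sx; rewrite (gE i i xy Sx) -exprSr prednK // ltnW. Qed.

Lemma hPl l : P^`M(l) \is (e.-1).-homog.
Proof. exact: dhomog_mderiv. Qed.

Lemma msub_gE (A : S) a i x y : A \is (a).-homog -> cor x y -> SK.@[x] != 0 ->
  (msub (g i) A).@[x] = (y i ^+ t.-1) ^+ a * A.@[y].
Proof.
move=> hA xy Sx; rewrite meval_msub -(dhomog_scale _ _ hA); apply: meval_eq => j.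
exact: gE.
Qed.

Lemma PgE i l x y : cor x y -> SK.@[x] != 0 ->
  (Pg i l).@[x] = (y i ^+ t.-1) ^+ e.-1 * (P^`M(l)).@[y].
Proof. exact: msub_gE (hPl l). Qed.

Lemma OmE i l x : (Om i l).@[x] = (Psi P (g i) l).@[x] ^+ t * (z i).@[x] ^+ E.
Proof. by rewrite /Om mevalM !mevalXn. Qed.

Lemma ZlE i l x : (Zl i l).@[x] = (Pg i l).@[x] ^+ t.
Proof. exact: mevalXn. Qed.

Lemma dvP_g i : dv P (msub (g i) P).
Proof.
apply: onC => x y xy Sx; rewrite (msub_gE i hP xy Sx).
by have [_ ->] := corP xy; rewrite mulr0.
Qed.

(** The fractions [Om i l / Zl i l] agree, for all charts [i] and indices [l]. If [y i] vanishes on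
    [C], both products are zero; otherwise [Psi_scale] compares the charts and [Psi_exchange] the
    indices. *)
Lemma cross i0 i l0 l : ~ dv P (z i0) -> dv P (Om i0 l0 * Zl i l - Zl i0 l0 * Om i l).
Proof.
move=> nz0; case: (classic (dv P (g i0 i))) => [gi|ngi].
  have yi x y : cor x y -> SK.@[x] != 0 -> (z i0).@[x] != 0 -> y i = 0.
    move=> xy Sx; rewrite (zE i0 xy Sx) expf_eq0 negb_and (ltnW t2) /= => y0.
    have := on_point gi xy; rewrite (gE i0 i xy Sx) => /eqP.
    by rewrite mulf_eq0 expf_eq0 (negPf y0) andbF => /eqP.
  apply: (dvP_or (A := z i0)) => //; apply: onC => x y xy Sx; rewrite mevalM.
  case: (eqVneq (z i0).@[x] 0) => [->|z0]; first by rewrite mul0r.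
  have t1 : (0 < t.-1)%N by move: t2; lia.
  have e1 : (0 < e.-1)%N by move: en; lia.
  have E0 : (0 < E)%N by rewrite /E muln_gt0 t1 subn_gt0.
  have p0 k : (0 < k)%N -> (0 : F) ^+ k = 0 by move=> k0; rewrite expr0n eqn0Ngt k0.
  have Zx : (Zl i l).@[x] = 0.
    rewrite ZlE (PgE i l xy Sx) (yi x y xy Sx z0) (p0 t.-1) // (p0 e.-1) // mul0r p0 //.
    exact: ltnW.
  have Ox : (Om i l).@[x] = 0.
    by rewrite OmE (zE i xy Sx) (yi x y xy Sx z0) (p0 t) ?(ltnW t2) // (p0 E) // mulr0.
  by rewrite mevalMBM Zx Ox !mulr0 subrr mulr0.
(* The quotient [m2 / m1] is [(y i / y i0) ^ (t-1)], the scaling between the vectors of the charts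
   [i0] and [i]. *)
pose m1 := z i0 ^+ t.-1; pose m2 := g i0 i ^+ t.-1.
have nm1 : ~ dv P m1 by move=> h; apply: nz0; apply: prime_dv_exp h.
have nm2 : ~ dv P m2 by move=> h; apply: ngi; apply: prime_dv_exp h.
have tE : t = t.-1.+1 by rewrite prednK // ltnW.
have rel j : dv P (m1 * g i j - m2 * g i0 j).
  apply: onC => x y xy Sx; rewrite mevalXMBXM (zE i0 xy Sx) !(gE _ _ xy Sx).
  rewrite exprMn -!exprM [in X in y i0 ^+ (X * _)]tE mulSn exprD; move: (_ ^+ _) (_ ^+ _) (_ ^+ _) => ? ? ?; ring.
have PS : dv P (m1 ^+ n * Psi P (g i) l - m2 ^+ n * Psi P (g i0) l).
  apply: (Psi_scale hchar hP pP (dl := (t * D)%N) (dm := (t * D * t.-1)%N)) => //.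
  - by rewrite muln_gt0 (ltnW t2) (ltnW D2).
  - by apply: dhomog_exp; apply: hg.
  - by apply: dhomog_exp; apply: hg.
apply: (dvP_or (A := z i0)) => //; apply: onC => x y xy Sx; rewrite mevalM.
case: (eqVneq (z i0).@[x] 0) => [->|z0]; first by rewrite mul0r.
suff -> : (Om i0 l0 * Zl i l - Zl i0 l0 * Om i l).@[x] = 0 by rewrite mulr0.
have a0 : y i0 != 0 by move: z0; rewrite (zE i0 xy Sx) expf_eq0 negb_and (ltnW t2).
have := on_point (Psi_exchange hchar pP l0 l (dvP_g i0)) xy.
rewrite mevalMBM -/(Pg i0 l0) -/(Pg i0 l) (PgE i0 l0 xy Sx) (PgE i0 l xy Sx).
have := on_point PS xy; rewrite mevalXMBXM /m1 /m2 2!mevalXn (zE i0 xy Sx) (gE i0 i xy Sx).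
rewrite mevalMBM 2!OmE 2!ZlE (PgE i0 l0 xy Sx) (PgE i l xy Sx) (zE i0 xy Sx) (zE i xy Sx).
by move=> R3 R2; apply: cross_identity R3 R2.
Qed.

(** The generators on the right are the values [Zl i l] written in [y]. By Euler's formula each
    partial derivative lies in the ideal of the variables, so a power of it absorbs the factors
    ['X_i ^+ (t * (t.-1 * e.-1))]. *)
Lemma gradient_power q : exists M0, forall M, (M0 <= M)%N -> exists C : 'I_N -> 'I_N -> S,
  a2 q ^+ M = \sum_i \sum_l C i l * ('X_i ^+ (t * (t.-1 * e.-1)) * P^`M(l) ^+ t).
Proof.
pose K := (t * (t.-1 * e.-1))%N.
pose W (A : S) := exists C : 'I_N -> 'I_N -> S, A = \sum_i \sum_l C i l * ('X_i ^+ K * P^`M(l) ^+ t).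
have iW : idealP W.
  split.
  - exists (fun _ _ => 0); rewrite big1 // => i _; rewrite big1 // => l _; by rewrite mul0r.
  - move=> A A' [C ->] [C' ->]; exists (fun i l => C i l + C' i l).
    rewrite -big_split; apply: eq_bigr => i _; rewrite -big_split; apply: eq_bigr => l _.
    by rewrite mulrDl.
  - move=> A B [C ->]; exists (fun i l => B * C i l); rewrite mulr_sumr; apply: eq_bigr => i _.
    by rewrite mulr_sumr; apply: eq_bigr => l _; rewrite !mulrA.
have [W0 WD WM] := iW.
have gen i l : W ('X_i ^+ K * P^`M(l) ^+ t).
  exists (fun i' l' => ((i' == i) && (l' == l))%:R); rewrite (bigD1 i) //= (bigD1 l) //= !eqxx mul1r.
  rewrite [X in _ + X + _]big1 ?addr0 => [|l' /negPf ->]; last by rewrite andbF mul0r.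
  rewrite big1 ?addr0 // => i' /negPf ->; rewrite big1 // => l' _; by rewrite mul0r.
have /fun_choice[Kl hKl] l : exists K', W (P^`M(l) ^+ K').
  have iWl : idealP (fun A => W (A * P^`M(l) ^+ t)).
    split; first by rewrite mul0r.
      by move=> A A' h h'; rewrite mulrDl; apply: WD.
    by move=> A A' h; rewrite -mulrA; apply: WM.
  have [K' hK'] := rad_sum (fun i => (e.-1%:R)^-1%:MP * (P^`M(l))^`M(i)) iWl (fun i => gen i l).
  exists (K' + t)%N; rewrite exprD; move: hK'.
  suff -> : \sum_j (e.-1%:R)^-1%:MP * (P^`M(l))^`M(j) * 'X_j = P^`M(l) by [].
  under eq_bigr do rewrite -mulrA [_^`M(_) * _]mulrC.
  rewrite -mulr_sumr (euler (hPl l)) -[P^`M(l) *+ _]mulr_natl mulrA -mpolyC_nat -mpolyCM mulVf ?mul1r //.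
  by apply: natr_neq0 => //; move: en; lia.
pose K' := \max_l Kl l.
have hW l : W (P^`M(l) ^+ K').
  have le : (Kl l <= K')%N by apply: leq_bigmax.
  by rewrite -(subnK le) exprD; apply: WM.
have [c cE] := a2_grad q; have [M0 hM0] := rad_sum c iW hW.
exists M0 => M le; rewrite -(subnK le) exprD cE; exact: WM.
Qed.

Lemma ak_in_Z : exists M, forall q, exists C : 'I_N -> 'I_N -> S,
  dv P (ak q ^+ M - \sum_i \sum_l C i l * Zl i l).
Proof.
have /fun_choice[Mq hMq] := gradient_power.
(* A multiple of [t], so that the homogeneous coefficients in [y] have degree divisible by [t] and
   can be lifted. *)
pose M := (t * \max_q Mq q)%N; exists M => q.
have [|C CE] := hMq q M.
  by apply: leq_trans (leq_bigmax q) _; rewrite leq_pmull // ltnW.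
pose K := (t * (t * e.-1))%N.
have hgen i l : 'X_i ^+ (t * (t.-1 * e.-1)) * P^`M(l) ^+ t \is K.-homog.
  have -> : K = (1 * (t * (t.-1 * e.-1)) + e.-1 * t)%N.
    by rewrite /K; case: (t) t2 => // t' _ /=; rewrite mul1n !mulSn !mulnDr; lia.
  by apply: dhomogM; apply: dhomog_exp; [rewrite dhomogX /= mdeg1|apply: hPl].
have hA : a2 q ^+ M \is (w q * M).-homog by apply: dhomog_exp.
have lif i l : exists H : S, forall x y, cor x y -> SK.@[x] != 0 ->
    H.@[x] = (if (K <= w q * M)%N then hcomp (w q * M - K) (C i l) else 0).@[y].
  case: ifP => le; last by exists 0 => x y _ _; rewrite !meval0.
  have deg : (w q * M - K = t * (w q * (\max_q Mq q) - t * e.-1))%N.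
    by rewrite mulnBr /M /K mulnCA.
  have hC : hcomp (w q * M - K) (C i l) \is (t * (w q * (\max_q Mq q) - t * e.-1)).-homog.
    by rewrite -deg; apply: pihomogP.
  by have [H0 _ H0E] := lift hC; exists H0 => x y xy Sx; rewrite (H0E x y).
have /fun_choice[L hL] := fun i => fun_choice (lif i).
exists L; apply: onC => x y xy Sx.
rewrite mevalB mevalXn (aE q xy) -mevalXn -(pihomog_dE hA) CE (raddf_sum (hcomp (w q * M))) /=.
rewrite (raddf_sum (meval y)) (raddf_sum (meval x)) /= -sumrB big1 // => i _.
rewrite (raddf_sum (hcomp (w q * M))) /= (raddf_sum (meval y)) (raddf_sum (meval x)) /= -sumrB big1 // => l _.
rewrite (hcompM _ _ (hgen i l)) !mevalM (hL i l x y xy Sx) rmorphXn /= (PgE i l xy Sx).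
case: ifP => _; last by rewrite !meval0 mul0r subrr.
rewrite !mevalM 2!mevalXn mevalXU exprMn -!exprM [(t * (t.-1 * e.-1))%N]mulnC -mulnA.
by rewrite subrr.
Qed.

Lemma in2_mod (Z O1 A B : S) : dv P (A - B) -> in2 Z P (O1 * B) -> in2 Z P (O1 * A).
Proof.
move=> [c cE] [u [v uE]]; exists u, (v + O1 * c).
have -> : A = B + P * c by rewrite -cE addrC subrK.
by rewrite mulrDr uE; ring.
Qed.

(** By [cross] and [ak_in_Z] the fraction [Om i0 l0 / Zl i0 l0] is regular off the zeros of the
    [ak q], hence regular. As [Om] has smaller degree than [Zl], its multiple of [Zl] contributes
    nothing in that degree and [P] divides [Om]. *)
Lemma Psi_divisible : exists i0 l0, [/\ ~ dv P (g i0 i0), ~ dv P (msub (g i0) P^`M(l0)) &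
  dv P (Psi P (g i0) l0)].
Proof.
have [M hM] := ak_in_Z.
have [i0 [l0 nZ]] : exists i0 l0, ~ dv P (Zl i0 l0).
  apply: NNPP => no; have [C hC] := hM q0; apply: (ak_nz (q := q0)).
  apply: (@prime_dv_exp _ _ _ M) => //.
  have h : dv P (\sum_i \sum_l C i l * Zl i l).
    apply: dv_sum => i _; apply: dv_sum => l _; apply: dv_mull.
    by apply: NNPP => h; apply: no; exists i, l.
  by rewrite -(subrK (\sum_i \sum_l C i l * Zl i l) (ak q0 ^+ M)); apply: dvD.
have nPg : ~ dv P (Pg i0 l0).
  by move=> h; apply: nZ; rewrite /Zl -(prednK (ltnW t2)) exprS; apply: dv_mulr.
have nz : ~ dv P (z i0).
  move=> h; apply: nPg; apply: onC => x y xy Sx; have := on_point h xy.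
  rewrite (zE i0 xy Sx) (PgE i0 l0 xy Sx) => /eqP; rewrite expf_eq0 => /andP[_ /eqP->].
  have t1 : (0 < t.-1)%N by move: t2; lia.
  have e1 : (0 < e.-1)%N by move: en; lia.
  by rewrite !expr0n (negPf (lt0n_neq0 t1)) expr0n (negPf (lt0n_neq0 e1)) mul0r.
exists i0, l0; split=> //.
have [u [v uE]] : in2 (Zl i0 l0) P (Om i0 l0).
  apply: (extend (M := M)) => // q; have [C hC] := hM q; apply: in2_mod hC _.
  rewrite mulr_sumr; elim/big_rec: _ => [|i A _ IH]; first by exists 0, 0; rewrite !mul0r addr0.
  apply: in2D => //; rewrite mulr_sumr; elim/big_rec: _ => [|l A' _ IH']; first by exists 0, 0; rewrite !mul0r addr0.
  apply: in2D => //; rewrite mulrCA; apply: in2M.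
  have [c cE] := cross i l0 l nz; exists (Om i l), c.
  by rewrite mulrC [X in _ + X]mulrC -cE; ring.
have hOm : Om i0 l0 \is ((e.-1 + n * (t * D).-1) * t + t * D * E).-homog.
  apply: dhomogM; apply: dhomog_exp; last exact: hg.
  exact: (Psi_homog hP l0 (hg i0)).
have hZ : Zl i0 l0 \is (e.-1 * (t * D) * t).-homog.
  by apply: dhomog_exp; apply: dhomog_msub => //; apply: hPl.
have lt : ((e.-1 + n * (t * D).-1) * t + t * D * E < e.-1 * (t * D) * t)%N.
  rewrite /E; have eE : e.-1 = (n + (e - n.+1))%N by move: en; lia.
  have m0 : (0 < e - n.+1)%N by rewrite subn_gt0.
  have tA : (t < t * D)%N by rewrite -[X in (X < _)%N]muln1 ltn_pmul2l // ltnW.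
  by rewrite eE; apply: degree_drop => //; apply: ltnW.
have : dv P (Om i0 l0).
  rewrite -(pihomog_dE hOm) uE linearD /= (hcompM _ _ hZ) leqNgt lt /= add0r (hcompM _ _ hP).
  by case: ifP => _; [apply: dv_mull; apply: dvxx|apply: dv0].
case: (pP) => _ _ pr /pr[] h; first exact: prime_dv_exp h.
by case: nz; apply: prime_dv_exp h.
Qed.

End Charts.

(** * Derivations at a point and ramification *)

Section PointDerivation.
Variables (F : fieldType) (n : nat) (x v : 'I_n -> F).

Definition pder (p : {mpoly F[n]}) := \sum_b (p^`M(b)).@[x] * v b.

Lemma pderD p q : pder (p + q) = pder p + pder q.
Proof. by rewrite -big_split; apply: eq_bigr => b _; rewrite mderivD mevalD mulrDl. Qed.

Lemma pderN p : pder (- p) = - pder p.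
Proof. by rewrite -sumrN; apply: eq_bigr => b _; rewrite mderivN mevalN mulNr. Qed.

Lemma pderM p q : pder (p * q) = p.@[x] * pder q + q.@[x] * pder p.
Proof.
rewrite /pder !mulr_sumr -big_split; apply: eq_bigr => b _ /=.
by rewrite mderivM mevalD !mevalM; ring.
Qed.

Lemma pderX j : pder 'X_j = v j.
Proof.
rewrite /pder (bigD1 j) //= mderivXU eqxx rmorph1 mul1r big1 ?addr0 // => b bj.
by rewrite mderivXU eq_sym (negPf bj) meval0 mul0r.
Qed.

Lemma pder_msub m (h : 'I_m -> {mpoly F[n]}) p :
  pder (msub h p) = \sum_i (msub h p^`M(i)).@[x] * pder (h i).
Proof.
rewrite /pder; under eq_bigr do rewrite mderiv_msub (raddf_sum (meval x)) mulr_suml.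
rewrite exchange_big; apply: eq_bigr => i _; rewrite mulr_sumr; apply: eq_bigr => b _ /=.
by rewrite mevalM mulrA.
Qed.

Lemma pder_dv P A : P.@[x] = 0 -> pder P = 0 -> dv P A -> pder A = 0.
Proof. by move=> Px DP [c ->]; rewrite pderM Px DP mul0r mulr0 addr0. Qed.

End PointDerivation.

Lemma pder_euler (F : fieldType) n d (p : {mpoly F[n]}) x : p \is d.-homog ->
  pder x x p = d%:R * p.@[x].
Proof.
move=> hp; have := congr1 (meval x) (euler hp); rewrite (raddf_sum (meval x)) mevalMn /= mulr_natl => <-.
by apply: eq_bigr => i _; rewrite mevalM mevalXU mulrC.
Qed.

Lemma pder_lin (F : fieldType) n (x u v : 'I_n -> F) c p :
  pder x (fun i => u i - c * v i) p = pder x u p - c * pder x v p.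
Proof. by rewrite /pder mulr_sumr -sumrB; apply: eq_bigr => i _; ring. Qed.

Section Separable.
Variable F : closedFieldType.
Hypothesis hchar : [pchar F] =i pred0.
Variables (n : nat) (P : {mpoly F[n]}) (h : 'I_n -> {mpoly F[n]}) (B : finType) (b : B -> {mpoly F[n]}).
Notation S := {mpoly F[n]}.
Hypothesis pP : prime_elt P.
Hypothesis sp : forall A : S, exists q : B -> S, A = \sum_k b k * msub h (q k).

Definition evj (j : 'I_n) : {poly S} -> S := horner_eval 'X_j \o map_poly (msub h).
HB.instance Definition _ j := GRing.RMorphism.on (evj j).

Lemma evjC j c : evj j c%:P = msub h c.
Proof. by rewrite /evj /= map_polyC horner_evalE hornerC. Qed.

Lemma evjX j : evj j 'X = 'X_j.
Proof. by rewrite /evj /= map_polyX horner_evalE hornerX. Qed.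

(** While the derivative still gives a relation on [C], it replaces [R]. In characteristic [0] its
    leading coefficient is that of [R] times a nonzero integer, so the process stops before the
    polynomial becomes constant. *)
Lemma separable_step j m (R : {poly S}) : (size R <= m)%N -> dv P (evj j R) ->
  ~ dv P (msub h (lead_coef R)) ->
  exists2 R' : {poly S}, dv P (evj j R') & ~ dv P (evj j R'^`()).
Proof.
elim: m R => [|m IH] R sR PR nl.
  move: sR; rewrite leqn0 size_poly_eq0 => /eqP R0; case: nl.
  by rewrite R0 lead_coef0 (rmorph0 (msub h)); apply: dv0.
case: (classic (dv P (evj j R^`()))) => [PR'|]; last by exists R.
have s1 : (1 < size R)%N.
  rewrite ltnNge; apply/negP => s1; apply: nl; move: PR.
  by rewrite (size1_polyC s1) lead_coefC evjC.
have l0 : lead_coef R != 0 by rewrite lead_coef_eq0 -size_poly_gt0 ltnW.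
have c0 : ((size R).-1%:R : F) != 0 by apply: natr_neq0 => //; rewrite -lt0n -subn1 subn_gt0.
have cE : R^`()`_(size R).-2 = (size R).-1%:R%:MP * lead_coef R.
  rewrite coef_deriv prednK; last by rewrite -subn1 subn_gt0.
  by rewrite mpolyC_nat mulr_natl.
have cn0 : R^`()`_(size R).-2 != 0 by rewrite cE mulf_neq0 // mpolyC_eq0.
have lE : lead_coef R^`() = (size R).-1%:R%:MP * lead_coef R.
  rewrite -cE lead_coefE; congr (_`_ _).
  have h1 : (size R^`() < size R)%N by apply: lt_size_deriv; rewrite -size_poly_gt0 ltnW.
  have h2 : ((size R).-2 < size R^`())%N.
    by rewrite ltnNge; apply/negP => /(nth_default 0) e0; rewrite e0 eqxx in cn0.
  have H (a c : nat) : (1 < c)%N -> (a < c)%N -> (c.-2 < a)%N -> a.-1 = c.-2 by clear; lia.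
  exact: H.
apply: (IH R^`()) => //.
  by rewrite -ltnS; apply: leq_trans sR; apply: lt_size_deriv; rewrite -size_poly_gt0 ltnW.
rewrite lE msubM msubC => /[dup] [[c cE']] _; apply: nl; exists (((size R).-1%:R)^-1%:MP * c).
by rewrite mulrCA -cE' mulrA -mpolyCM mulVf // mul1r.
Qed.

Lemma separable j : exists2 R : {poly S}, dv P (evj j R) & ~ dv P (evj j R^`()).
Proof.
have [M [c cE]] := integral_of_span sp ('X_j : S).
pose R := 'X^M + \poly_(i < M) c i.
have sR : (size (\poly_(i < M) c i) < size ('X^M : {poly S}))%N.
  by rewrite size_polyXn ltnS size_poly.
apply: (@separable_step j (size R) R) => //.
  suff -> : evj j R = 0 by apply: dv0.
  rewrite /R poly_def rmorphD rmorphXn /= evjX (rmorph_sum (evj j)) /= -[RHS]cE; congr (_ + _).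
  by apply: eq_bigr => i _; rewrite -mul_polyC rmorphM /= evjC rmorphXn /= evjX.
rewrite lead_coefDl // lead_coefXn (rmorph1 (msub h)); by case: pP.
Qed.

Lemma pder_evj x v j R : (forall r, pder x v (msub h r) = 0) ->
  pder x v (evj j R) = (evj j R^`()).@[x] * v j.
Proof.
move=> h0; elim/poly_ind: R => [|q c IH].
  by rewrite deriv0 !(rmorph0 (evj j)) meval0 mul0r -[0 in LHS](rmorph0 (msub h)) h0.
rewrite rmorphD rmorphM /= evjX evjC pderD pderM pderX h0 addr0 IH.
rewrite derivD derivM derivX derivC addr0 mulr1 rmorphD rmorphM /= evjX mevalD mevalM mevalXU.
ring.
Qed.

End Separable.

Section NonRamified.
Variable F : closedFieldType.
Hypothesis hchar : [pchar F] =i pred0.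
Variables (n d e k dl : nat) (f : polymap F n) (P : {mpoly F[n.+1]}).
Notation N := n.+1.
Notation S := {mpoly F[N]}.
Variables (g : 'I_N -> S) (i0 l0 : 'I_N) (B : finType) (b : B -> S).
Let Finf := closed_infinite hchar.
Notation f2 := (fiter f 2).
Notation fk := (fiter f k).
Hypothesis d0 : (0 < d)%N.
Hypothesis hf : forall i, f i \is d.-homog.
Hypothesis endo : forall x, (forall i, (f i).@[x] = 0) -> forall j, x j = 0.
Hypothesis sp : forall A : S, exists q : B -> S, A = \sum_k b k * msub fk (q k).
Hypothesis hP : P \is e.-homog.
Hypothesis pP : prime_elt P.
Hypothesis dl0 : (0 < dl)%N.
Hypothesis hg : forall i, g i \is dl.-homog.
Hypothesis Pg : dv P (msub g P).
Hypothesis fg : forall i j, dv P (msub g (f2 j) * fk i - msub g (f2 i) * fk j).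
Hypothesis nz : ~ dv P (g i0).
Hypothesis nPl : ~ dv P (msub g P^`M(l0)).

Lemma fiter_endo j x : (forall i, (fiter f j i).@[x] = 0) -> forall i, x i = 0.
Proof.
elim: j => [|j IH] h i; first by have := h i; rewrite /= mevalXU.
by apply: IH => l; apply: (endo (x := fun i => (fiter f j i).@[x])) => m; have := h m; rewrite /= meval_msub.
Qed.

(** At a general point a degenerate [Psi] yields a nonzero [u] tangent to [C] and killed by the
    differential of [g]. Since [f^2(g)] is proportional to [f^k], the differential of [f^k] sends
    [u] to a multiple of [f^k]; minus a multiple of the Euler vector, [u] is killed by it, which
    separability forbids. *)
Lemma Psi_nonzero : ~ dv P (Psi P g l0).
Proof.
move=> PPsi.
have /fun_choice[R hR] : forall j, exists R : {poly S}, dv P (evj fk j R) /\ ~ dv P (evj fk j R^`()).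
  by move=> j; have [R] := separable hchar pP sp j; exists R.
have [x [Px gx lx Rx]] : exists x, [/\ P.@[x] = 0, (g i0).@[x] != 0, (msub g P^`M(l0)).@[x] != 0 &
    forall j, (evj fk j (R j)^`()).@[x] != 0].
  apply: NNPP => no; pose A := g i0 * (msub g P^`M(l0) * \prod_j evj fk j (R j)^`()).
  have : dv P A.
    apply: (prime_vanish Finf pP) => x Px; apply/eqP/negP => /negP nA; apply: no; exists x.
    move: nA; rewrite /A mevalM mulf_eq0 negb_or => /andP[h1].
    rewrite mevalM mulf_eq0 negb_or => /andP[h2]; rewrite rmorph_prod => /prodf_neq0 h3.
    by split=> // j; apply: h3.
  have [_ _ pr] := pP; case/pr => // /pr[] // /(prime_dv_prod pP)[j _].
  by case: (hR j).
have := on_zero PPsi Px; rewrite Psi_eval => /eqP; rewrite -det_tr => /det0P[u u0 uM].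
pose v i := u 0 i.
have uE (a : 'I_N) : \sum_b (if a == l0 then (P^`M(b)).@[x] else ((g a)^`M(b)).@[x]) * v b = 0.
  have := congr1 (fun r : 'rV_N => r 0 a) uM; rewrite /= [in RHS]mxE mxE => E.
  rewrite -[RHS]E; apply: eq_bigr => i _.
  by rewrite !mxE mulrC; case: ifP; rewrite ?mxE.
have DP : pder x v P = 0 by have := uE l0; rewrite eqxx.
have Dg a : pder x v (g a) = 0.
  have [->|al] := eqVneq a l0; last by have := uE a; rewrite (negPf al).
  (* The row [l0] of the matrix holds the gradient of [P], so the missing differential of [g l0] is
     recovered from [P(g)] being divisible by [P]. *)
  have := pder_dv Px DP Pg; rewrite pder_msub (bigD1 l0) //= big1 ?addr0 => [/eqP|i il].
    by rewrite mulf_eq0 (negPf lx) => /eqP.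
  by have := uE i; rewrite (negPf il) => Dgi; rewrite /pder Dgi mulr0.
have Dgs p : pder x v (msub g p) = 0.
  by rewrite pder_msub big1 // => i _; rewrite Dg mulr0.
pose w j := (msub g (f2 j)).@[x].
have w1 i j : w j * (fk i).@[x] = w i * (fk j).@[x].
  by have := on_zero (fg i j) Px; rewrite mevalMBM => /eqP; rewrite subr_eq0 => /eqP.
have w2 i j : w j * pder x v (fk i) = w i * pder x v (fk j).
  have := pder_dv Px DP (fg i j); rewrite pderD pderN !pderM !Dgs !mulr0 !addr0 => /eqP.
  by rewrite subr_eq0 => /eqP.
have [j wj] : exists j, w j != 0.
  apply: NNPP => no; have w0 i : (f2 i).@[fun j => (g j).@[x]] = 0.
    by rewrite -meval_msub; apply/eqP/negP => /negP h; apply: no; exists i.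
  by move/negP: gx; apply; apply/eqP; apply: (fiter_endo w0 i0).
have xnz : exists i, (fk i).@[x] != 0.
  apply: NNPP => no; have x0 : forall i, x i = 0.
    by apply: (@fiter_endo k) => i; apply/eqP/negP => /negP h; apply: no; exists i.
  move/negP: gx; apply; apply/eqP; rewrite -(homog_origin dl0 (hg i0)).
  by apply: meval_eq.
have fj : (fk j).@[x] != 0.
  have [i fi] := xnz; apply/eqP => f0; have := w1 i j; rewrite f0 mulr0 => /eqP.
  by rewrite mulf_eq0 (negPf wj) (negPf fi).
pose c := pder x v (fk j) / (fk j).@[x].
have Df i : pder x v (fk i) = c * (fk i).@[x].
  apply: (mulfI wj); rewrite w2 mulrCA w1 /c mulrCA; congr (_ * _).
  by rewrite divfK.
have dk0 : ((d ^ k)%:R : F) != 0 by apply: natr_neq0 => //; rewrite -lt0n expn_gt0 d0.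
(* By Euler's formula the vector [x] is an eigenvector for the degree [d ^ k], so this multiple
   cancels the value on each [fk i]. *)
pose c' := c / (d ^ k)%:R; pose m i := v i - c' * x i.
have Dmf i : pder x m (fk i) = 0.
  by rewrite /m pder_lin Df (pder_euler x (fiter_homog k hf i)) /c' mulrA divfK // subrr.
have DmP : pder x m P = 0 by rewrite /m pder_lin DP (pder_euler x hP) Px !mulr0 subrr.
have m0 i : m i = 0.
  have := pder_evj i (R i) (x := x) (v := m) (h := fk).
  move=> E; have := pder_dv Px DmP (proj1 (hR i)); rewrite E => [/eqP|r].
    by rewrite mulf_eq0 (negPf (Rx i)) => /eqP.
  by rewrite pder_msub big1 // => l _; rewrite Dmf mulr0.
have vE i : v i = c' * x i by have /eqP := m0 i; rewrite subr_eq0 => /eqP.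
(* The vector is now a multiple of [x], and [g i0] has nonzero derivative along [x] because it is a
   form of positive degree not vanishing there. *)
have c0 : c' = 0.
  have := Dg i0; have -> : pder x v (g i0) = c' * pder x x (g i0).
    by rewrite /pder mulr_sumr; apply: eq_bigr => i _; rewrite vE mulrCA.
  rewrite (pder_euler x (hg i0)) => /eqP; rewrite [_ == 0]mulf_eq0 => /orP[/eqP //|].
  by rewrite mulf_eq0 (negPf gx) orbF (negPf (natr_neq0 hchar _)) // -lt0n.
case/negP: u0; apply/eqP/rowP => i; rewrite mxE.
by have := vE i; rewrite c0 mul0r.
Qed.

End NonRamified.

(** * Dimension counts *)

Lemma image_thin (F : fieldType) M K (h : 'I_K -> {mpoly F[M]}) : (M < K)%N ->
  exists2 G : {mpoly F[K]}, G != 0 & msub h G = 0.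
Proof.
have iW : idealP (fun A : {mpoly F[M]} => A = 0).
  by split=> [//|? ? -> ->|? ? ->]; rewrite ?addr0 ?mulr0.
apply: (@alg_dependence F M (fun A => A = 0) M (fun i => 'X_i) 1 iW) => m /eqP.
rewrite mdeg_eq1 => /existsP[i /eqP ->].
exists (fun j => (j == i)%:R) => [j|]; first by case: eqP => _; rewrite ?msize0 ?msize1.
rewrite (bigD1 i) //= eqxx mulr1 big1 ?addr0 ?subrr // => j /negPf ->; by rewrite mulr0.
Qed.

Section LinDim.
Variables (F : fieldType) (K a r : nat) (Phi : 'I_r -> 'I_K -> {mpoly F[a]}).
Hypothesis ra : (a.+1 < r)%N.

(** Cramer's rule recovers the [r] coordinates of [c] selected by [J] from the others, the [a]
    parameters and the inverse of the minor. So such [c] are images of [a + 1 + (K - r) < K]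
    parameters, and [image_thin] applies. *)
Lemma lin_dim_minor (J : 'I_r -> 'I_K) : exists2 G : {mpoly F[K]}, G != 0 &
  forall c p, (forall i, \sum_j (Phi i j).@[p] * c j = 0) ->
  \det (\matrix_(i, i') (Phi i (J i')).@[p]) != 0 -> G.@[c] = 0.
Proof.
case: (classic (injective J)) => [Ji|nJ]; last first.
  exists 1; first exact: oner_neq0.
  move=> c p _; have [i [i' [e ne]]] : exists i i', J i = J i' /\ i != i'.
    apply: NNPP => no; apply: nJ => i i' e; apply/eqP/negP => /negP ne; apply: no.
    by exists i, i'.
  rewrite -det_tr (determinant_alternate ne) ?eqxx // => l.
  by rewrite !mxE e.
pose X := ('I_a + unit + {j : 'I_K | j \notin codom J})%type.
pose X_ (x : X) : {mpoly F[#|{: X}|]} := 'X_(enum_rank x).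
pose up (q : {mpoly F[a]}) := msub (fun i => X_ (inl (inl i))) q.
pose c_ (j : 'I_K) : {mpoly F[#|{: X}|]} := if insub j is Some j' then X_ (inr j') else 0.
pose PJ := \matrix_(i, i') up (Phi i (J i')).
pose s_ := X_ (inl (inr tt)).
pose h (j : 'I_K) := if [pick i | J i == j] is Some i then
   - s_ * \sum_i' (\adj PJ) i i' * \sum_j' up (Phi i' j') * c_ j' else c_ j.
have lt : (#|{: X}| < K)%N.
  rewrite !card_sum card_unit card_ord card_sig.
  have : (#|codom J| + #|[predC codom J]| = K)%N by rewrite cardC card_ord.
  rewrite card_codom // card_ord; rewrite (eq_card (B := [predC codom J])) //.
  by move: ra; clear; lia.
have [G G0 hG] := image_thin h lt; exists G => // c p Pc dn0.
set PJp := \matrix_(i, i') _ in dn0.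
pose y (k : 'I_#|{: X}|) : F := match enum_val k with
  | inl (inl i) => p i | inl (inr _) => (\det PJp)^-1 | inr j => c (val j) end.
have XE x : (X_ x).@[y] = match x with
  | inl (inl i) => p i | inl (inr _) => (\det PJp)^-1 | inr j => c (val j) end.
  by rewrite mevalXU /y enum_rankK.
have upE q : (up q).@[y] = q.@[p] by rewrite meval_msub; apply: meval_eq => i; rewrite XE.
have cE j : (c_ j).@[y] = if j \in codom J then 0 else c j.
  rewrite /c_; case: insubP => [j' nj vj|]; last by rewrite negbK => ->; rewrite meval0.
  by rewrite XE (negPf nj) vj.
have PJE : map_mx (meval y) PJ = PJp by apply/matrixP => i i'; rewrite !mxE upE.
have hE j : (h j).@[y] = c j.
  rewrite /h; case: pickP => [i /eqP <-|no]; last first.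
    rewrite cE; case: ifP => // /codomP[i e]; by have := no i; rewrite e eqxx.
  pose cJ : 'cV[F]_r := \col_i c (J i).
  pose rest : 'cV[F]_r := \col_i' \sum_j' (Phi i' j').@[p] * (c_ j').@[y].
  have lin : PJp *m cJ = - rest.
    apply/colP => i'; rewrite !mxE; apply/eqP; rewrite -addr_eq0; apply/eqP.
    rewrite -[RHS](Pc i') [RHS](bigID (mem (codom J))) /=; congr (_ + _).
      have -> : \sum_(j in codom J) (Phi i' j).@[p] * c j =
          \sum_(j in J @: [set: 'I_r]) (Phi i' j).@[p] * c j.
        apply: eq_bigl => j0; apply/codomP/imsetP => [[l ->]|[l _ ->]]; by exists l.
      rewrite big_imset /= => [|? ? _ _]; last exact: Ji.
      by apply: eq_big => [l|l _]; rewrite ?inE ?mxE.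
    rewrite [RHS]big_mkcond /=; apply: eq_bigr => j1 _; rewrite cE.
    by case: ifP => _; rewrite ?mulr0.
  have cJE : cJ = - (\det PJp)^-1 *: (\adj PJp *m rest).
    have : \adj PJp *m (PJp *m cJ) = \adj PJp *m - rest by rewrite lin.
    rewrite mulmxA mul_adj_mx mul_scalar_mx mulmxN => E.
    by rewrite scaleNr -scalerN -E scalerA mulVf // scale1r.
  have := congr1 (fun M : 'cV[F]_r => M i 0) cJE; rewrite !mxE => ->.
  rewrite mevalM mevalN XE (raddf_sum (meval y)) /=; congr (_ * _).
  apply: eq_bigr => i' _; rewrite mevalM -PJE -map_mx_adj [in RHS]mxE; congr (_ * _).
  rewrite (raddf_sum (meval y)) !mxE /=; apply: eq_bigr => j' _.
  by rewrite mevalM upE.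
have := congr1 (meval y) hG; rewrite meval0 meval_msub => <-.
by apply: meval_eq => j; rewrite hE.
Qed.

(** Independent conditions have some nonzero maximal minor, so the product over all choices of
    columns works. *)
Lemma lin_dim : exists2 G : {mpoly F[K]}, G != 0 &
  forall c p, (forall i, \sum_j (Phi i j).@[p] * c j = 0) ->
  (forall al : 'I_r -> F, (forall j, \sum_i al i * (Phi i j).@[p] = 0) -> forall i, al i = 0) ->
  G.@[c] = 0.
Proof.
have /fun_choice[G hG] : forall J : {ffun 'I_r -> 'I_K}, exists G : {mpoly F[K]}, G != 0 /\
    forall c p, (forall i, \sum_j (Phi i j).@[p] * c j = 0) ->
    \det (\matrix_(i, i') (Phi i (J i')).@[p]) != 0 -> G.@[c] = 0.
  by move=> J; have [G G0 h] := lin_dim_minor J; exists G.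
exists (\prod_J G J); first by apply/prodf_neq0 => J _; case: (hG J).
move=> c p Pc ind; pose A := \matrix_(i < r, j < K) (Phi i j).@[p].
have rfA : row_full A^T.
  rewrite /row_full mxrank_tr; apply: inj_row_free => al alA.
  apply/rowP => i; rewrite mxE; apply: (ind (fun i => al 0 i)) => j.
  have := congr1 (fun M : 'rV_K => M 0 j) alA; rewrite /= [in RHS]mxE mxE => E; rewrite -[RHS]E.
  by apply: eq_bigr => l _; rewrite !mxE.
pose J : {ffun 'I_r -> 'I_K} := [ffun i => fullrankfun rfA i].
rewrite rmorph_prod (bigD1 J) //=; have [_ h] := hG J; rewrite (h c p) ?mul0r //.
have -> : \matrix_(i, i') (Phi i (J i')).@[p] = (rowsub (fullrankfun rfA) A^T)^T.
  by apply/matrixP => i i'; rewrite !mxE ffunE.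
rewrite det_tr -unitfE -unitmxE -row_full_unit; exact: fullrowsub_full.
Qed.

End LinDim.

(* Dimension count: the solutions [c] of more linear conditions than there are parameters [p]
   do not fill the space. *)
Lemma lin_dim_functionals (F : fieldType) K (A Rr : finType)
  (L : Rr -> ('I_#|A| -> F) -> ('I_K -> F) -> F) : (#|A| + 1 < #|Rr|)%N ->
  (forall r p c, L r p c = \sum_j c j * L r p (fun j' => (j' == j)%:R)) ->
  (forall r j, polyfun (fun p => L r p (fun j' => (j' == j)%:R))) ->
  exists2 G : {mpoly F[K]}, G != 0 & forall c p, (forall r, L r p c = 0) ->
    (forall al : Rr -> F, (forall c', \sum_r al r * L r p c' = 0) -> forall r, al r = 0) ->
    G.@[c] = 0.
Proof.
move=> cA lin pf.
have /fun_choice[Phi0 hPhi0] : forall r, exists Phi : 'I_K -> {mpoly F[#|A|]}, forall j p,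
    L r p (fun j' => (j' == j)%:R) = (Phi j).@[p].
  by move=> r; apply: (fun_choice (Q := fun j q => forall p, L r p (fun j' => (j' == j)%:R) = q.@[p])); apply: pf.
pose Phi (i : 'I_#|Rr|) j := Phi0 (enum_val i) j.
have [|G G0 hG] := lin_dim Phi; first by rewrite -addn1.
exists G => // c p Lc ind; apply: (hG c p) => [i|al hal i].
  rewrite -[RHS](Lc (enum_val i)) lin; apply: eq_bigr => j _.
  by rewrite /Phi -hPhi0 mulrC.
have := ind (fun r => al (enum_rank r)) _ (enum_val i); rewrite enum_valK; apply => c'.
under eq_bigr => r _ do rewrite lin mulr_sumr.
rewrite exchange_big big1 //= => j _; rewrite -[RHS](mulr0 (c' j)) -[in RHS](hal j) mulr_sumr.
rewrite [RHS](reindex_onto enum_rank enum_val) /= => [|k _]; last by rewrite enum_valK.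
apply: eq_big => [r|r _]; first by rewrite enum_rankK eqxx.
by rewrite /Phi enum_rankK -hPhi0 mulrCA.
Qed.

Definition smooth_on_plane (F : closedFieldType) n (P : {mpoly F[n.+1]}) :=
  forall x : 'I_n.+1 -> F, (forall i : 'I_n.+1, (3 <= i)%N -> x i = 0) ->
  (forall j, (P^`M(j)).@[x] = 0) -> forall i, x i = 0.

(* [f^2] is birational on [P = 0]: the monomials of degree [t] are the fractions [u m / s] in [f^2]. *)
Definition birational (F : closedFieldType) n d (f : polymap F n) (P : {mpoly F[n.+1]}) :=
  exists t sd (s : {mpoly F[n.+1]}) (u : 'X_{1..n.+1} -> {mpoly F[n.+1]}),
  [/\ (0 < t)%N /\ (d ^ 2 %| t)%N, s \is sd.-homog, ~ dv P (msub (fiter f 2) s),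
    forall m, mdeg m = t -> u m \is (sd + t %/ d ^ 2).-homog &
    forall y, P.@[y] = 0 -> forall m, mdeg m = t ->
      (msub (fiter f 2) s).@[y] * 'X_[m].@[y] = (msub (fiter f 2) (u m)).@[y]].

Lemma dhomog_jac (F : closedFieldType) n d (f : polymap F n) : (forall i, f i \is d.-homog) ->
  jac f \is (n.+1 * d.-1).-homog.
Proof.
move=> hf; apply: rpred_sum => s _; rewrite -signr_odd -(rmorph_sign (@mpolyC n.+1 F)).
rewrite mul_mpolyC rpredZ //.
rewrite -[X in (X * _)%N]card_ord -sum_nat_const.
elim/big_rec2: _ => [|i q1 d1 _ IH]; first exact: dhomog1.
by apply: dhomogM => //; rewrite mxE; apply: dhomog_mderiv.
Qed.

Lemma root_exists (F : closedFieldType) (v : nat) (c : F) : (0 < v)%N -> exists x, x ^+ v = c.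
Proof.
move=> v0; have [x xE] := @solve_monicpoly F v (fun i => if i == 0%N then c else 0) v0.
exists x; rewrite xE (bigD1 (Ordinal v0)) //= mulr1 big1 ?addr0 // => i ne.
by rewrite (negPf (_ : (i : nat) != 0%N)) ?mul0r //; apply: contraNneq ne => i0; apply/eqP/val_inj.
Qed.

(** * The contradiction for generic maps *)

Section MainContradiction.
Variable F : closedFieldType.
Hypothesis hchar : [pchar F] =i pred0.
Variables (n d k : nat) (f : polymap F n.+1).
Hypothesis n2 : (1 < n)%N.
Hypothesis d3 : (2 < d)%N.
Hypothesis k3 : (2 < k)%N.
Hypothesis hf : forall i, f i \is d.-homog.
Hypothesis fdet : freedet d f != 0.
Hypothesis Ppt : forall l, (jac f).@[pt F l] != 0.
Hypothesis smooth : smooth_on_plane (jac f).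
Hypothesis bir : birational d f (jac f).
Hypothesis bad : crit_image_incl f k 2.
Let Finf := closed_infinite hchar.
Let P := jac f.
Notation N := n.+2.
Let e := (N * d.-1)%N.

Let d0 : (0 < d)%N. Proof. by apply: leq_trans d3. Qed.

Lemma P_homog : P \is e.-homog. Proof. exact: dhomog_jac. Qed.

Lemma e_gt : (N < e)%N.
Proof. by rewrite /e -[X in (X < _)%N]muln1 ltn_pmul2l //; move: d3; case: (d) => // -[|[|]]. Qed.

Lemma e_pos : (0 < e)%N. Proof. exact: leq_ltn_trans e_gt. Qed.

Lemma P_neq0 : P != 0.
Proof. by apply: contraNneq (Ppt ord0) => P0; rewrite -/P P0 meval0. Qed.

Lemma P_prime : prime_elt P.
Proof.
exact: (smooth_plane_prime Finf (leqW n2) e_pos P_homog P_neq0 smooth).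
Qed.

Lemma f_endo x : (forall i, (f i).@[x] = 0) -> forall j, x j = 0.
Proof. by have [_] := freedet_endo d0 hf fdet; apply. Qed.

Lemma bad_affine x : P.@[x] = 0 ->
  exists2 y, P.@[y] = 0 & forall i, (fiter f 2 i).@[y] = (fiter f k i).@[x].
Proof.
move=> Px; case: (classic (exists i, x i != 0)) => [xn0|x0].
  have [y [[_ Py] [c [c0 E]]]] : exists y, in_crit f y /\ exists c : F, c != 0 /\
      iter k (peval f) x = (fun i => c * iter 2 (peval f) y i).
    by apply: bad; split=> //; rewrite -meval_jac.
  have v0 : (0 < d ^ 2)%N by rewrite expn_gt0 d0.
  (* Scaling [y] by a root of order [d ^ 2] of [c] turns the projective equality into an equality of
     vectors. *)
  have [a aE] := root_exists c v0; exists (fun i => a * y i).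
    by rewrite (dhomog_scale _ _ P_homog) /P meval_jac Py mulr0.
  by move=> i; rewrite (dhomog_scale _ _ (fiter_homog 2 hf i)) aE !fiter_eval E.
have {}x0 i : x i = 0 by apply/eqP/negP => /negP h; apply: x0; exists i.
exists x => // i; have z j : (0 < d ^ j)%N by rewrite expn_gt0 d0.
have E j : (fiter f j i).@[x] = 0.
  by rewrite -(homog_origin (z j) (fiter_homog j hf i)); apply: meval_eq.
by rewrite !E.
Qed.

Lemma main_contradiction : False.
Proof.
have [t [sd [s [u [[t0 vt] hs nPs hu buE]]]]] := bir.
have hP := P_homog; have pP := P_prime; have P0 := P_neq0.
have fb := free_of_freedet d0 hf fdet.
have [p [Nq [pN lN PN]]] := monic_relation Finf hP (Ppt ord0) pP (fiter f 2).
have hsh j i : shear p (fiter f j) i \is (d ^ j).-homog.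
  rewrite /shear; case: unlift => [l|]; last exact: fiter_homog.
  by rewrite rpredB ?rpredZ //; apply: fiter_homog.
have v0 j : (0 < d ^ j)%N by rewrite expn_gt0 d0.
have /fun_choice[aq /fun_choice[wq haq]] : forall q : 'I_n.+1, exists (a : {mpoly F[n]}) w,
    [/\ a != 0, a \is w.-homog & inI (fun j => P^`M(j))
      (msub (fun j => shear p (fiter f 2) (lift ord0 (lift q j))) a)].
  move=> q; apply: (gradient_relation Finf (leqW n2) e_pos hP P0 smooth _ (v0 2%N)) => [|i].
    (* The relation involves [n] of the [n.+2] sheared coordinates of [f^2], one more than the
       dimension allowed to the cone over the singular locus. *)
    by move: n2; clear; lia.
  exact: hsh.
have aq0 q : aq q != 0 by case: (haq q).
have aqP q : inI (fun j => P^`M(j)) (msub (fun j => shear p (fiter f 2) (lift ord0 (lift q j))) (aq q)).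
  by case: (haq q).
have k2 : (2 <= k)%N by apply: ltnW.
pose SK0 := SK k f s.
have nSK : ~ dv P SK0 by apply: (SK_nz hchar fb pP pN PN bad_affine nPs).
pose cor x y := [/\ P.@[x] = 0, P.@[y] = 0 & forall i, (fiter f 2 i).@[y] = (fiter f k i).@[x]].
have corP x y : cor x y -> P.@[x] = 0 /\ P.@[y] = 0 by case.
have cor_total x : P.@[x] = 0 -> exists y, cor x y.
  by move=> Px; have [y Py fy] := bad_affine Px; exists y.
have lft j (A : {mpoly F[N]}) : A \is (t * j).-homog ->
  exists2 H : {mpoly F[N]}, H \is (t * j * d ^ (k - 2)).-homog &
    forall x y, cor x y -> SK0.@[x] != 0 -> H.@[x] = A.@[y].
  move=> hA; have [H hH HE] := lift_form hchar hf fb hP pP Ppt pN lN PN k2 bad_affine aq0 aqP hs nPs vt hu buE hA.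
  by exists H => // x y [Px Py fy] Sx; apply: HE.
pose ak := akq f p aq k; pose a2 := akq f p aq 2.
have extend (Z Om : {mpoly F[N]}) M : ~ dv P Z -> (forall q, in2 Z P (Om * ak q ^+ M)) -> in2 Z P Om.
  move=> nZ h; have H := lifting_ext hchar fb pP pN lN PN bad_affine aq0 (or_intror (erefl k)) nZ h.
  exact H.
have ak_nz q : ~ dv P (ak q).
  have H := akq_nz hchar fb pP pN lN PN bad_affine aq0 (or_intror (erefl k)); exact: H.
have a2_homog q : a2 q \is (wq q * d ^ 2).-homog.
  by apply: dhomog_msub; [case: (haq q)|move=> i; apply: hsh].
have aE q x y : cor x y -> (ak q).@[x] = (a2 q).@[y].
  move=> [_ _ fy]; rewrite /ak /a2 /akq !meval_msub; apply: meval_eq => i.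
  by rewrite !(shear_msub p (fiter f _)) !meval_msub (meval_eq _ fy).
have t2 : (1 < t)%N.
  have := dvdn_leq t0 vt; apply: leq_trans.
  by rewrite -[X in (X < _)%N](exp1n 2) ltn_exp2r // ltnW.
have D2 : (1 < d ^ (k - 2))%N by rewrite -[X in (X < _)%N](expn0 d) ltn_exp2l ?subn_gt0 // ltnW.
have /fun_choice[g hg] : forall i : 'I_N, exists g : 'I_N -> {mpoly F[N]}, forall j,
    g j \is (t * d ^ (k - 2)).-homog /\ forall x y, cor x y -> SK0.@[x] != 0 ->
      (g j).@[x] = y i ^+ t.-1 * y j.
  move=> i; apply: (fun_choice (Q := fun j H => H \is (t * d ^ (k - 2)).-homog /\ forall x y,
    cor x y -> SK0.@[x] != 0 -> H.@[x] = y i ^+ t.-1 * y j)) => j.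
  have hA : ('X_i ^+ t.-1 * 'X_j : {mpoly F[N]}) \is (t * 1).-homog.
    have -> : (t * 1 = 1 * t.-1 + 1)%N by rewrite mul1n muln1 addn1 prednK.
    by apply: dhomogM; first apply: dhomog_exp; rewrite dhomogX /= mdeg1.
  have [H hH HE] := lft _ _ hA; exists H; split; first by rewrite muln1 in hH.
  by move=> x y xy Sx; rewrite (HE x y xy Sx) mevalM mevalXn !mevalXU.
have hgh i j := proj1 (hg i j); have hgE i j := proj2 (hg i j).
have [i0 [l0 [nz nPl dPsi]]] := @Psi_divisible F hchar n.+1 e t (d ^ (k - 2)) n.+1 P SK0 cor ak a2
  (fun q => wq q * d ^ 2)%N hP pP e_gt t2 D2 nSK corP cor_total lft extend ord0 ak_nz a2_homog aqP aE
  g hgh hgE.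
have [B' [b' [sp _]]] := free_iter k fb.
apply: (@Psi_nonzero F hchar n.+1 d e k (t * d ^ (k - 2)) f P (g i0) i0 l0 B' b') => //.
- exact: f_endo.
- by rewrite muln_gt0 t0 v0.
- exact: (dvP_g hchar hP pP nSK corP cor_total hgE).
- move=> i j; apply: (onC hchar pP nSK cor_total) => x y xy Sx.
  have [_ _ fy] := xy; rewrite mevalMBM.
  rewrite !(msub_gE hgE i0 (fiter_homog 2 hf _) xy Sx) !fy.
  ring.
Qed.

End MainContradiction.

Lemma mderiv_prod (F : comNzRingType) n (I : eqType) (r : seq I) (a : I -> {mpoly F[n]}) k : uniq r ->
  (\prod_(i <- r) a i)^`M(k) = \sum_(i <- r) (a i)^`M(k) * \prod_(j <- r | j != i) a j.
Proof.
elim: r => [|x s IH] /=; first by rewrite !big_nil -mpolyC1 mderivC.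
move=> /andP[xs us]; rewrite big_cons mderivM IH // [RHS]big_cons big_cons eqxx /=; congr (_ * _ + _).
  rewrite big_seq [RHS]big_seq_cond; apply: eq_bigl => j; case: (boolP (j \in s)) => //= js.
  by rewrite (memPn xs).
rewrite mulr_sumr [LHS]big_seq [RHS]big_seq; apply: eq_bigr => i si.
by rewrite big_cons eq_sym (memPn xs) // mulrCA.
Qed.








Lemma mderiv_det (F : comNzRingType) n m (M : 'M[{mpoly F[n]}]_m) k :
  (\det M)^`M(k) = \sum_i \sum_j (M i j)^`M(k) * cofactor M i j.
Proof.
pose M' i := \matrix_(a, b) if a == i then (M a b)^`M(k) else M a b.
transitivity (\sum_i \det (M' i)).
  rewrite /determinant linear_sum exchange_big /=; apply: eq_bigr => s _.
  rewrite -signr_odd -(rmorph_sign (@mpolyC n F)) mul_mpolyC linearZ /= mderiv_prod ?index_enum_uniq //.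
  rewrite -mul_mpolyC mulr_sumr; apply: eq_bigr => i _; congr (_ * _).
  rewrite [RHS](bigD1 i) //= mxE eqxx; congr (_ * _); apply: eq_bigr => j /negPf ji.
  by rewrite mxE ji.
apply: eq_bigr => i _; rewrite (expand_det_row _ i); apply: eq_bigr => j _.
have -> : cofactor (M' i) i j = cofactor M i j.
  rewrite /cofactor; apply: (congr1 (fun X => _ * \det X)).
  by apply/matrixP => a b; rewrite !mxE eq_sym (negPf (neq_lift i a)).
by rewrite mxE eqxx.
Qed.

(** * Generic smoothness on a plane *)

Section Kernel.
Variables (F : fieldType) (n : nat) (A : 'M[F]_n.+2).

Definition kerv (v : 'I_n.+2 -> F) := forall i, \sum_b A i b * v b = 0.

Lemma kerv_comb c c' u v : kerv u -> kerv v -> kerv (fun b => c * u b + c' * v b).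
Proof.
move=> hu hv i; transitivity (c * \sum_b A i b * u b + c' * \sum_b A i b * v b).
  by rewrite !mulr_sumr -big_split; apply: eq_bigr => b _ /=; ring.
by rewrite hu hv !mulr0 addr0.
Qed.

(** Corank at least two, with two kernel vectors normalised at two coordinates; the remaining
    entries serve as parameters in the dimension count. *)
Definition two_kernel := exists j k v v', [/\ kerv v, kerv v',
  v j = 1 /\ v (lift j k) = 0 & v' j = 0 /\ v' (lift j k) = 1].

Lemma two_kernelP p q j : kerv p -> kerv q -> p j != 0 -> q j = 0 -> (exists i, q i != 0) ->
  two_kernel.
Proof.
move=> kp kq pj qj [i qi]; have [k ke] : exists k, i = lift j k.
  by case: (unliftP j i) => [k ->|e]; [exists k|rewrite e qj eqxx in qi].
rewrite ke in qi.
pose v' b := (q (lift j k))^-1 * q b + 0 * q b.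
pose v b := (p j)^-1 * p b + (- (p (lift j k) / p j)) * v' b.
have v'k : v' (lift j k) = 1 by rewrite /v' mul0r addr0 mulVf.
have v'j : v' j = 0 by rewrite /v' qj !mulr0 addr0.
exists j, k, v, v'; have kv' : kerv v' by apply: kerv_comb.
split=> //; first exact: kerv_comb.
rewrite /v v'k v'j mulr0 addr0 mulVf // mulr1 [p (lift j k) / p j]mulrC.
by rewrite addrN.
Qed.












Lemma det0_kerv : \det A = 0 -> exists2 p, kerv p & exists j, p j != 0.
Proof.
move=> /eqP; rewrite -det_tr => /det0P[u u0 uA]; exists (fun b => u 0 b).
  move=> i; have := congr1 (fun M : 'rV_n.+2 => M 0 i) uA; rewrite /= [in RHS]mxE mxE => E.
  by rewrite -[RHS]E; apply: eq_bigr => b _; rewrite mxE mulrC.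
apply: NNPP => no; case/negP: u0; apply/eqP/rowP => j; rewrite mxE.
by apply/eqP/negP => /negP h; apply: no; exists j.
Qed.

(** Let [p] be a kernel vector with [p j] nonzero. If the matrix without column [j] has a kernel,
    that gives a second vector; otherwise it has full column rank, and deleting a row leaves a
    nonzero cofactor. *)
Lemma adj0_two_kernel : \det A = 0 -> \adj A = 0 -> two_kernel.
Proof.
move=> dA aA; have [p kp [j pj]] := det0_kerv dA.
case: (classic (exists2 u : 'rV[F]_n.+1, u != 0 & u *m (col' j A)^T = 0)) => [[u u0 uA]|no].
  have ku : kerv (mins j (fun k => u 0 k) 0).
    move=> i; rewrite (bigD1 j) //= mins_id mulr0 add0r.
    have := congr1 (fun M : 'rV_n.+2 => M 0 i) uA; rewrite /= [in RHS]mxE mxE => E.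
    rewrite -[RHS]E (reindex_onto (lift j) (fun b => odflt ord0 (unlift j b))) /=; last first.
      by move=> b bj; case: unliftP => [k ->|e] //=; rewrite e eqxx in bj.
    apply: eq_big => [k|k _]; first by rewrite liftK eqxx andbT eq_sym neq_lift.
    by rewrite mins_lift !mxE mulrC.
  apply: (@two_kernelP p (mins j (fun k => u 0 k) 0) j) => //; first by rewrite mins_id.
  have [k uk] : exists k, u 0 k != 0.
    apply: NNPP => no; case/negP: u0; apply/eqP/rowP => k; rewrite mxE.
    by apply/eqP/negP => /negP h; apply: no; exists k.
  by exists (lift j k); rewrite mins_lift.
have rf : row_full (col' j A).
  rewrite /row_full -mxrank_tr; apply: inj_row_free => u uA; apply/eqP/negP => /negP u0.
  by apply: no; exists u.
have [i hi] : exists i, i \notin codom (fullrankfun rf).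
  apply: NNPP => h; have : (#|'I_n.+2| <= #|codom (fullrankfun rf)|)%N.
    apply: subset_leq_card; apply/subsetP => i _; apply/negPn/negP => hi; apply: h; by exists i.
  by rewrite card_codom ?card_ord ?ltnn //; apply: fullrankfun_inj.
have /fun_choice[s hs] : forall k, exists s, fullrankfun rf k = lift i s.
  move=> k; case: (unliftP i (fullrankfun rf k)) => [s ->|e]; first by exists s.
  by move: hi; rewrite -e codom_f.
have full : row_full (rowsub s (row' i (col' j A))).
  have -> : rowsub s (row' i (col' j A)) = rowsub (fullrankfun rf) (col' j A).
    by apply/matrixP => a b; rewrite !mxE hs.
  exact: fullrowsub_full.
have : row_full (row' i (col' j A)).
  rewrite -col_leq_rank; apply: leq_trans (mxrankS (rowsub_sub s (row' i (col' j A)))).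
  by rewrite col_leq_rank.
rewrite row_full_unit unitmxE unitfE => /eqP; case.
have := congr1 (fun M : 'M_n.+2 => M j i) aA; rewrite /= !mxE /cofactor => /eqP.
by rewrite mulf_eq0 signr_eq0 => /eqP.
Qed.





































(** The columns of the adjugate lie in the kernel, which is a line, and its rows lie in the left
    kernel. *)
Lemma adj_rank_one : \det A = 0 -> ~ two_kernel ->
  exists i0 j0 ka v w, [/\ ka != 0, v j0 = 1, w i0 = 1, kerv v &
    (forall b, \sum_i w i * A i b = 0) /\ forall i j, (\adj A) j i = ka * v j * w i].
Proof.
move=> dA nt.
have [j0 [i0 ka0]] : exists j0 i0, (\adj A) j0 i0 != 0.
  apply: NNPP => no; apply: nt; apply: adj0_two_kernel => //; apply/matrixP => j i; rewrite [RHS]mxE.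
  by apply/eqP/negP => /negP h; apply: no; exists j, i.
have kcol i : kerv (fun j => (\adj A) j i).
  move=> l; have := congr1 (fun M : 'M_n.+2 => M l i) (mul_mx_adj A).
  by rewrite /= dA [in RHS]mxE mul0rn mxE.
move: (\adj A) ka0 kcol (mul_adj_mx A) => B ka0 kcol BA.
pose ka := B j0 i0.
pose v j := ka^-1 * B j i0 + 0 * B j i0; pose w i := ka^-1 * B j0 i.
have v1 : v j0 = 1 by rewrite /v mul0r addr0 mulVf.
have kv : kerv v by apply: kerv_comb.
exists i0, j0, ka, v, w; split=> //; first by rewrite /w mulVf.
split=> [b|i j].
  have := congr1 (fun M : 'M_n.+2 => M j0 b) BA; rewrite /= dA [in RHS]mxE mul0rn mxE => E.
  transitivity (ka^-1 * \sum_i B j0 i * A i b); last by rewrite E mulr0.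
  by rewrite mulr_sumr; apply: eq_bigr => i _; rewrite mulrA.
apply: NNPP => ne; apply: nt.
apply: (@two_kernelP v (fun j => 1 * B j i + (- B j0 i) * v j) j0) => //.
- by apply: kerv_comb.
- by rewrite v1 oner_neq0.
- by rewrite v1 mulr1 mul1r addrN.
exists j; apply/eqP => e0; apply: ne; move: e0; rewrite mul1r => /eqP.
rewrite addr_eq0 => /eqP ->; rewrite /w mulNr opprK mulrAC mulrA mulfV // mul1r.
by [].
Qed.
























End Kernel.

(** * Test forms with prescribed first and second order terms at a point *)

Section TestForms.
Variables (F : closedFieldType) (n d : nat) (x : 'I_n -> F) (q : 'I_n).
Hypothesis hchar : [pchar F] =i pred0.
Hypothesis d2 : (1 < d)%N.
Hypothesis xq : x q = 1.

Definition ulin (a : 'I_n) : {mpoly F[n]} := 'X_a - x a *: 'X_q.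

Lemma ulin_homog a : ulin a \is 1.-homog.
Proof. by rewrite rpredB ?rpredZ // dhomogX /= mdeg1. Qed.

Lemma ulin_eval a : (ulin a).@[x] = 0.
Proof. by rewrite mevalB mevalZ !mevalXU xq mulr1 subrr. Qed.

Lemma pderZ v c p : pder x v (c *: p) = c * pder x v p.
Proof. by rewrite /pder mulr_sumr; apply: eq_bigr => b _; rewrite linearZ mevalZ mulrA. Qed.

Lemma pder_ulin v a : pder x v (ulin a) = v a - x a * v q.
Proof. by rewrite /ulin pderD pderN pderZ !pderX. Qed.

Lemma pder_Xq v k : pder x v ('X_q ^+ k) = k%:R * v q.
Proof.
elim: k => [|k IH].
  by rewrite expr0 mul0r /pder big1 // => b _; rewrite -mpolyC1 mderivC meval0 mul0r.
by rewrite exprS pderM IH pderX mevalXn !mevalXU xq expr1n !mul1r -[k.+1%:R]natr1 mulrDl mul1r.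
Qed.

Lemma gradient_test v : (forall h, h \is d.-homog -> pder x v h = 0) -> forall a, v a = 0.
Proof.
move=> hv; have hX k : ('X_q : {mpoly F[n]}) ^+ k \is k.-homog.
  by rewrite -[X in X.-homog]mul1n; apply: dhomog_exp; rewrite dhomogX /= mdeg1.
have vq : v q = 0.
  have := hv _ (hX d); rewrite pder_Xq => /eqP; rewrite mulf_eq0 (negPf (natr_neq0 hchar _)) => [/eqP //|].
  by rewrite -lt0n ltnW.
move=> a; have /hv : 'X_q ^+ d.-1 * ulin a \is d.-homog.
  have -> : d = (d.-1 + 1)%N by rewrite addn1 prednK // ltnW.
  by rewrite addn1 /= -addn1; apply: dhomogM; [apply: hX|apply: ulin_homog].
by rewrite pderM ulin_eval mul0r addr0 mevalXn mevalXU xq expr1n mul1r pder_ulin vq mulr0 subr0.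
Qed.

(** It vanishes to second order at [x], so it separates conditions on second derivatives from those
    on first derivatives. *)
Definition quad a b : {mpoly F[n]} := 'X_q ^+ d.-2 * (ulin a * ulin b).

Lemma quad_homog a b : quad a b \is d.-homog.
Proof.
have hX : ('X_q : {mpoly F[n]}) ^+ d.-2 \is (1 * d.-2).-homog.
  by apply: dhomog_exp; rewrite dhomogX /= mdeg1.
have := dhomogM hX (dhomogM (ulin_homog a) (ulin_homog b)).
rewrite mul1n; have -> : (d.-2 + (1 + 1) = d)%N by move: d2; clear; lia.
by [].
Qed.







Lemma quad_pder v a b : pder x v (quad a b) = 0.
Proof.
rewrite /quad pderM [pder x v (ulin a * ulin b)]pderM mevalM !ulin_eval.
by rewrite !(mul0r, mulr0, addr0).
Qed.

Lemma quad_hess v a b k : k != q ->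
  pder x v ((quad a b)^`M(k)) = (a == k)%:R * (v b - x b * v q) + (b == k)%:R * (v a - x a * v q).
Proof.
move=> kq; have uk c : (ulin c)^`M(k) = ((c == k)%:R)%:MP.
  by rewrite mderivB linearZ /= !mderivXU [q == k]eq_sym (negPf kq) scaler0 subr0 mpolyC_nat.
have Xe : ('X_q ^+ d.-2).@[x] = 1 :> F by rewrite mevalXn mevalXU xq expr1n.
have -> : (quad a b)^`M(k) = ('X_q ^+ d.-2)^`M(k) * (ulin a * ulin b) +
    'X_q ^+ d.-2 * ((a == k)%:R *: ulin b + (b == k)%:R *: ulin a).
  by rewrite /quad !mderivM !uk -!mul_mpolyC; congr (_ + _ * (_ + _)); exact: mulrC.
set s := _ *: ulin b + _; have sx : s.@[x] = 0 by rewrite mevalD !mevalZ !ulin_eval !mulr0 addr0.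
have ps : pder x v s = (a == k)%:R * (v b - x b * v q) + (b == k)%:R * (v a - x a * v q).
  by rewrite pderD !pderZ !pder_ulin.
have pu : pder x v (ulin a * ulin b) = 0 by rewrite pderM !ulin_eval !mul0r addr0.
have ux : (ulin a * ulin b).@[x] = 0 by rewrite mevalM ulin_eval mul0r.
by rewrite pderD (pderM x v _ (ulin a * ulin b)) pu ux (pderM x v _ s) Xe sx ps; ring.
Qed.

Lemma quad_grad a b k : ((quad a b)^`M(k)).@[x] = 0.
Proof.
have := quad_pder (fun l => (l == k)%:R) a b.
by rewrite /pder (bigD1 k) //= eqxx mulr1 big1 ?addr0 // => l /negPf ->; rewrite mulr0.
Qed.

End TestForms.

Section LinearFunctional.
Variables (F : closedFieldType) (n d : nat).
Let K := #|{: coef_index n d}|.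

Definition linfun_on (l : {mpoly F[n.+1]} -> F) :=
  (forall p q, l (p + q) = l p + l q) /\ (forall c p, l (c *: p) = c * l p).

Lemma linfun_sum l I (r : seq I) (Q : pred I) (E : I -> {mpoly F[n.+1]}) : linfun_on l ->
  l (\sum_(i <- r | Q i) E i) = \sum_(i <- r | Q i) l (E i).
Proof.
move=> [lD lZ]; have l0 : l 0 = 0 by rewrite -(scale0r 0) lZ mul0r.
exact: (big_morph l lD l0).
Qed.

Lemma linfun_fc l i (c : 'I_K -> F) : linfun_on l ->
  l (fc c i) = \sum_j c j * l (fc (fun j' => (j' == j)%:R) i).
Proof.
move=> hl; have [lD lZ] := hl; rewrite /fc linfun_sum //.
transitivity (\sum_j \sum_(m : 'X_{1..n.+1 < d.+1} | mdeg m == d)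
    (c j * (enum_rank (i, m) == j)%:R) * l 'X_[m]).
  rewrite exchange_big /=; apply: eq_bigr => m _; rewrite lZ (bigD1 (enum_rank (i, m))) //=.
  rewrite eqxx mulr1 big1 ?addr0 // => j jm; by rewrite eq_sym (negPf jm) mulr0 mul0r.
apply: eq_bigr => j _; rewrite linfun_sum // mulr_sumr; apply: eq_bigr => m _.
by rewrite lZ mulrA.
Qed.

Lemma linfun_pder x v : linfun_on (pder x v).
Proof. by split=> [p q|c p]; rewrite ?pderD ?pderZ. Qed.

Lemma linfun_mderiv l j : linfun_on l -> linfun_on (fun p => l p^`M(j)).
Proof. by move=> [lD lZ]; split=> [p q|c p]; rewrite ?mderivD ?linearZ /= ?lD ?lZ. Qed.

Lemma linfun_eval x : linfun_on (meval x).
Proof. by split=> [p q|c p]; rewrite ?mevalD ?mevalZ. Qed.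

End LinearFunctional.

Lemma pf_meval_gen (F : fieldType) K n (p : {mpoly F[n]}) (x : 'I_n -> ('I_K -> F) -> F) :
  (forall i, polyfun (x i)) -> polyfun (fun c => p.@[fun i => x i c]).
Proof.
move=> hx; apply: (@pf_ext _ _ (fun c => \sum_(k <- msupp p) p@_k * \prod_j x j c ^+ k j)).
  by move=> c; rewrite mevalE.
by apply: pf_sum => k; apply: pf_mul; [apply: pf_const|apply: pf_prod => j; apply: pf_exp].
Qed.

Lemma pf_pder (F : fieldType) K n (p : {mpoly F[n]}) (x v : 'I_n -> ('I_K -> F) -> F) :
  (forall i, polyfun (x i)) -> (forall i, polyfun (v i)) ->
  polyfun (fun c => pder (fun i => x i c) (fun i => v i c) p).
Proof.
move=> hx hv; apply: pf_sum => b; apply: pf_mul => //; exact: pf_meval_gen.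
Qed.

Section GenericSmooth.
Variables (F : closedFieldType) (n d : nat).
Hypothesis hchar : [pchar F] =i pred0.
Hypothesis n2 : (1 < n)%N.
Hypothesis d2 : (1 < d)%N.
Notation N := n.+2.
Let K := #|{: coef_index n.+1 d}|.

(** The chart of the plane of the first three coordinates where the coordinate [c] equals [1]. *)
Definition xpt (c : 'I_3) (a : 'I_2 -> F) : 'I_N -> F :=
  fun i => if (i < 3)%N then mins c a 1 (inord i) else 0.

Definition cidx (c : 'I_3) : 'I_N := inord c.

Lemma cidx_val c : (cidx c : nat) = c.
Proof. by rewrite inordK //; apply: leq_trans (ltn_ord c) _; rewrite !ltnS ltnW. Qed.

Lemma xpt_c c a : xpt c a (cidx c) = 1.
Proof. by rewrite /xpt cidx_val ltn_ord inord_val mins_id. Qed.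

Lemma single_homog (i0 : 'I_N) (h : {mpoly F[N]}) : h \is d.-homog ->
  fc (coef_vec (d := d) (fun i => if i == i0 then h else 0)) = (fun i => if i == i0 then h else 0) :> polymap F n.+1.
Proof. by move=> hh; apply: fcK => i; case: ifP => _; rewrite ?rpred0. Qed.

Lemma pf_mins m A (l : 'I_m.+1) (a : 'I_m -> ('I_A -> F) -> F) (b : F) i :
  (forall k, polyfun (a k)) -> polyfun (fun p => mins l (fun k => a k p) b i).
Proof. by move=> ha; rewrite /mins; case: unlift => [k|] //; apply: pf_const. Qed.

Lemma pf_mins' m A (l : 'I_m.+1) (a : 'I_m -> ('I_A -> F) -> F) (b : ('I_A -> F) -> F) i :
  (forall k, polyfun (a k)) -> polyfun b -> polyfun (fun p => mins l (fun k => a k p) (b p) i).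
Proof. by move=> ha hb; rewrite /mins; case: unlift. Qed.

Lemma pf_xpt A c (a : 'I_2 -> ('I_A -> F) -> F) i :
  (forall k, polyfun (a k)) -> polyfun (fun p => xpt c (fun k => a k p) i).
Proof. by move=> ha; rewrite /xpt; case: (i < 3)%N; [apply: pf_mins|apply: pf_const]. Qed.

Definition vec1 (j : 'I_N) (k : 'I_n.+1) (b : 'I_n -> F) := mins j (mins k b 0) 1.
Definition vec1' (j : 'I_N) (k : 'I_n.+1) (b : 'I_n -> F) := mins j (mins k b 1) 0.

(** There are [2 + 2 n] parameters, for the point and two kernel vectors, against [2 (n + 2)]
    conditions. These are independent because the two vectors are. *)
Lemma thin_corank2 c j k : exists2 G : {mpoly F[K]}, G != 0 & forall cc a b b',
  (forall i, pder (xpt c a) (vec1 j k b) (fc cc i) = 0) ->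
  (forall i, pder (xpt c a) (vec1' j k b') (fc cc i) = 0) -> G.@[cc] = 0.
Proof.
pose A := ('I_2 + 'I_n + 'I_n)%type; pose Rr := ('I_N + 'I_N)%type.
pose pa (p : 'I_#|{: A}| -> F) := fun k => p (enum_rank (inl (inl k) : A)).
pose pb (p : 'I_#|{: A}| -> F) := fun k => p (enum_rank (inl (inr k) : A)).
pose pb' (p : 'I_#|{: A}| -> F) := fun k => p (enum_rank (inr k : A)).
pose L (r : Rr) (p : 'I_#|{: A}| -> F) (cc : 'I_K -> F) := match r with
  | inl i => pder (xpt c (pa p)) (vec1 j k (pb p)) (fc cc i)
  | inr i => pder (xpt c (pa p)) (vec1' j k (pb' p)) (fc cc i) end.
have [|||G G0 hG] := @lin_dim_functionals F K A Rr L.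
- by rewrite !card_sum !card_ord; clear; lia.
- by move=> [i|i] p cc; apply: linfun_fc; apply: linfun_pder.
- have pfx l : polyfun (fun p => xpt c (pa p) l) by apply: pf_xpt => m; apply: pf_coord.
  have pfv l : polyfun (fun p => vec1 j k (pb p) l).
    by apply: pf_mins' => [m|]; [apply: pf_mins => m'; apply: pf_coord|apply: pf_const].
  have pfv' l : polyfun (fun p => vec1' j k (pb' p) l).
    by apply: pf_mins' => [m|]; [apply: pf_mins => m'; apply: pf_coord|apply: pf_const].
  move=> [i|i] j0 /=.
    exact: (@pf_pder F _ N _ (fun i p => xpt c (pa p) i) (fun i p => vec1 j k (pb p) i)).
  exact: (@pf_pder F _ N _ (fun i p => xpt c (pa p) i) (fun i p => vec1' j k (pb' p) i)).
exists G => // cc a b b' h1 h2.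
pose p (m : 'I_#|{: A}|) := match enum_val m with
  | inl (inl k) => a k | inl (inr k) => b k | inr k => b' k end.
have paE : pa p = a by apply: functional_extensionality => m; rewrite /pa /p enum_rankK.
have pbE : pb p = b by apply: functional_extensionality => m; rewrite /pb /p enum_rankK.
have pbE' : pb' p = b' by apply: functional_extensionality => m; rewrite /pb' /p enum_rankK.
apply: (hG cc p) => [[i|i]|al hal]; rewrite /L ?paE ?pbE ?pbE' //.
have key i : (al (inl i) = 0) /\ (al (inr i) = 0).
  have h0 := gradient_test hchar d2 (xpt_c c a) (v := fun l => al (inl i) * vec1 j k b l + al (inr i) * vec1' j k b' l).
  have {}h0 : forall l, al (inl i) * vec1 j k b l + al (inr i) * vec1' j k b' l = 0.
    apply: h0 => h hh; have := hal (coef_vec (d := d) (fun i' => if i' == i then h else 0)).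
    rewrite big_sumType /= /L single_homog // paE pbE pbE'.
    have z v : pder (xpt c a) v 0 = 0 by rewrite /pder big1 // => l _; rewrite linear0 meval0 mul0r.
    rewrite (bigD1 i) //= eqxx big1 ?addr0 => [|i' /negPf ->]; last by rewrite z mulr0.
    rewrite (bigD1 i) //= eqxx big1 ?addr0 => [|i' /negPf ->]; last by rewrite z mulr0.
    move=> <-; rewrite /pder !mulr_sumr -big_split; apply: eq_bigr => l _ /=; ring.
  split; first by have := h0 j; rewrite /vec1 /vec1' !mins_id mulr1 mulr0 addr0.
  by have := h0 (lift j k); rewrite /vec1 /vec1' !mins_lift !mins_id mulr0 mulr1 add0r.
by move=> [i|i]; case: (key i).
Qed.

(** The derivative of the determinant in direction [k] is proportional to [w (dA/dx_k) v], with [v]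
    and [w] spanning the kernels. There are [2 + 2 (n + 1)] parameters against
    [(n + 2) + (n + 1) + 3] conditions; for [w] the column [j0] is left out, since [w A v = 0] makes
    it follow from the others. *)
Lemma thin_corank1 c i0 j0 : exists2 G : {mpoly F[K]}, G != 0 & forall cc a b b',
  (forall i, pder (xpt c a) (mins j0 b 1) (fc cc i) = 0) ->
  (forall j, \sum_i mins i0 b' 1 i * ((fc cc i)^`M(j)).@[xpt c a] = 0) ->
  (forall k, \sum_i mins i0 b' 1 i * pder (xpt c a) (mins j0 b 1) (fc cc i)^`M(k) = 0) ->
  (exists l, mins j0 b 1 l - xpt c a l * mins j0 b 1 (cidx c) != 0) -> G.@[cc] = 0.
Proof.
pose A := ('I_2 + 'I_n.+1 + 'I_n.+1)%type; pose Rr := ('I_N + 'I_n.+1 + 'I_3)%type.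
pose pa (p : 'I_#|{: A}| -> F) := fun k => p (enum_rank (inl (inl k) : A)).
pose pb (p : 'I_#|{: A}| -> F) := fun k => p (enum_rank (inl (inr k) : A)).
pose pb' (p : 'I_#|{: A}| -> F) := fun k => p (enum_rank (inr k : A)).
(* Three variables other than the one normalised to [1], available because [N] is at least [4]. *)
pose kq (q : 'I_3) : 'I_N := lift (cidx c) (inord q).
pose L (r : Rr) (p : 'I_#|{: A}| -> F) (cc : 'I_K -> F) := match r with
  | inl (inl i) => pder (xpt c (pa p)) (mins j0 (pb p) 1) (fc cc i)
  | inl (inr j) => \sum_i mins i0 (pb' p) 1 i * ((fc cc i)^`M(lift j0 j)).@[xpt c (pa p)]
  | inr q => \sum_i mins i0 (pb' p) 1 i * pder (xpt c (pa p)) (mins j0 (pb p) 1) (fc cc i)^`M(kq q) end.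
have pfx l : polyfun (fun p => xpt c (pa p) l) by apply: pf_xpt => m; apply: pf_coord.
have pfv l : polyfun (fun p => mins j0 (pb p) 1 l) by apply: pf_mins => m; apply: pf_coord.
have pfw l : polyfun (fun p => mins i0 (pb' p) 1 l) by apply: pf_mins => m; apply: pf_coord.
have lsum (w : 'I_N -> F) (l : 'I_N -> {mpoly F[N]} -> F) (cc : 'I_K -> F) : (forall i, linfun_on (l i)) ->
    \sum_i w i * l i (fc cc i) = \sum_j cc j * \sum_i w i * l i (fc (fun j' => (j' == j)%:R) i).
  move=> hl; under eq_bigr => i _ do rewrite (linfun_fc _ _ (hl i)) mulr_sumr.
  rewrite exchange_big; apply: eq_bigr => j _; rewrite mulr_sumr; apply: eq_bigr => i _ /=.
  by rewrite mulrCA.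
have [|||G G0 hG] := @lin_dim_functionals F K A Rr L.
- by rewrite !card_sum !card_ord; clear; lia.
- move=> [[i|j]|q] p cc; first by apply: linfun_fc; apply: linfun_pder.
    apply: (lsum _ (fun _ p0 => (p0^`M(lift j0 j)).@[xpt c (pa p)])) => i.
    exact: linfun_mderiv (linfun_eval _).
  apply: (lsum _ (fun _ p0 => pder (xpt c (pa p)) (mins j0 (pb p) 1) p0^`M(kq q))) => i.
  exact: linfun_mderiv (linfun_pder _ _).
- move=> [[i|j]|q] j1 /=.
  + exact: (@pf_pder F _ N _ (fun i p => xpt c (pa p) i) (fun i p => mins j0 (pb p) 1 i)).
  + apply: pf_sum => i; apply: pf_mul => //.
    exact: (@pf_meval_gen F _ N _ (fun i p => xpt c (pa p) i)).
  + apply: pf_sum => i; apply: pf_mul => //.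
    exact: (@pf_pder F _ N _ (fun i p => xpt c (pa p) i) (fun i p => mins j0 (pb p) 1 i)).
exists G => // cc a b b' h1 h2 h3 [l0 vl0].
pose p (m : 'I_#|{: A}|) := match enum_val m with
  | inl (inl k) => a k | inl (inr k) => b k | inr k => b' k end.
have paE : pa p = a by apply: functional_extensionality => m; rewrite /pa /p enum_rankK.
have pbE : pb p = b by apply: functional_extensionality => m; rewrite /pb /p enum_rankK.
have pbE' : pb' p = b' by apply: functional_extensionality => m; rewrite /pb' /p enum_rankK.
apply: (hG cc p) => [[[i|j]|q]|al hal]; rewrite /L ?paE ?pbE ?pbE' //.
set x := xpt c a in h1 h2 h3 vl0 *; set v := mins j0 b 1 in h1 h2 h3 vl0 *; set w := mins i0 b' 1 in h2 h3.
have xq : x (cidx c) = 1 by apply: xpt_c.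
have z u : pder x u 0 = 0 by rewrite /pder big1 // => l _; rewrite linear0 meval0 mul0r.
have rel i h : h \is d.-homog ->
    al (inl (inl i)) * pder x v h + w i * (\sum_j al (inl (inr j)) * (h^`M(lift j0 j)).@[x]
      + \sum_q al (inr q) * pder x v h^`M(kq q)) = 0.
  move=> hh; have := hal (coef_vec (d := d) (fun i' => if i' == i then h else 0)).
  rewrite !big_sumType /= /L single_homog // paE pbE pbE' -/x -/v -/w.
  rewrite (bigD1 i) //= eqxx big1 ?addr0 => [|i' /negPf ->]; last by rewrite z mulr0.
  have s1 j : \sum_i0 w i0 * ((if i0 == i then h else 0)^`M(lift j0 j)).@[x] = w i * (h^`M(lift j0 j)).@[x].
    rewrite (bigD1 i) //= eqxx big1 ?addr0 // => i' /negPf ->; by rewrite linear0 meval0 mulr0.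
  have s2 q : \sum_i0 w i0 * pder x v (if i0 == i then h else 0)^`M(kq q) = w i * pder x v h^`M(kq q).
    rewrite (bigD1 i) //= eqxx big1 ?addr0 // => i' /negPf ->; by rewrite linear0 z mulr0.
  under [X in _ + X + _ = _ -> _]eq_bigr do rewrite s1.
  under [X in _ + X = _ -> _]eq_bigr do rewrite s2.
  move=> E; rewrite -[RHS]E -addrA mulrDr !mulr_sumr; congr (_ + (_ + _)); apply: eq_bigr => ? _; exact: mulrCA.
have wi0 : w i0 = 1 by rewrite /w mins_id.
pose vb l := v l - x l * v (cidx c).
have kq_neq q : kq q != cidx c by rewrite eq_sym neq_lift.
have kq_inj : injective kq.
  move=> q q' /lift_inj /(congr1 val) /=; rewrite !inordK; first by move=> /val_inj.
    by apply: leq_trans (ltn_ord _) _; rewrite !ltnS.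
  by apply: leq_trans (ltn_ord _) _; rewrite !ltnS.
pose gam l := \sum_q al (inr q) * (l == kq q)%:R.
(* On the quadratic test forms the first order conditions vanish, which isolates the coefficients of
   the second order ones. *)
have quadrel l l' : gam l * vb l' + gam l' * vb l = 0.
  have := rel i0 _ (quad_homog x (cidx c) d2 l l'); rewrite (quad_pder d xq) mulr0 add0r wi0 mul1r.
  rewrite big1 ?add0r => [|j _]; last first.
    by rewrite (quad_grad d xq) mulr0.
  move=> E; rewrite -[RHS]E /gam !mulr_suml -big_split; apply: eq_bigr => q _ /=.
  rewrite (quad_hess d xq) // /vb; ring.
have gl0 : gam l0 = 0.
  have /eqP := quadrel l0 l0; rewrite -mulr2n -mulr_natl mulf_eq0 (negPf (natr_neq0 hchar _)) //=.
  by rewrite mulf_eq0 (negPf vl0) orbF => /eqP.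
have gam0 l : gam l = 0.
  have /eqP := quadrel l l0; rewrite gl0 mul0r addr0 mulf_eq0 (negPf vl0) orbF => /eqP //.
have al3 q : al (inr q) = 0.
  have := gam0 (kq q); rewrite /gam (bigD1 q) //= eqxx mulr1 big1 ?addr0 // => q' ne.
  by rewrite (inj_eq kq_inj) eq_sym (negPf ne) mulr0.
(* With those coefficients gone, what remains is a first derivative along a vector that vanishes on
   all forms, so the vector is zero. *)
have lin i l : al (inl (inl i)) * v l + w i * mins j0 (fun j => al (inl (inr j))) 0 l = 0.
  move: l; apply: (gradient_test hchar d2 xq) => h hh; rewrite -[RHS](rel i h hh).
  rewrite [X in _ * (_ + X)]big1 ?addr0 => [|q _]; last by rewrite al3 mul0r.
  rewrite {1}/pder; under eq_bigr do rewrite mulrDr.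
  rewrite big_split /=; congr (_ + _).
    by rewrite /pder mulr_sumr; apply: eq_bigr => l _; rewrite mulrCA.
  rewrite (bigD1 j0) //= mins_id !mulr0 add0r mulr_sumr.
  rewrite (reindex_onto (lift j0) (fun b => odflt ord0 (unlift j0 b))) /=; last first.
    by move=> l lj; case: unliftP => [k ->|e] //=; rewrite e eqxx in lj.
  apply: eq_big => [k|k _]; first by rewrite liftK eqxx andbT eq_sym neq_lift.
  by rewrite mins_lift; ring.
have al1 i : al (inl (inl i)) = 0.
  by have := lin i j0; rewrite mins_id mulr0 addr0 /v mins_id mulr1.
move=> [[i|j]|q] //.
by have := lin i0 (lift j0 j); rewrite al1 mul0r add0r wi0 mul1r mins_lift.
Qed.

(** At a singular point of the Jacobian hypersurface the matrix has corank at least two or exactly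
    one; both cases are excluded by the counts. *)
Lemma gen_smooth : gen d (fun f : polymap F n.+1 => is_endo d f -> smooth_on_plane (jac f)).
Proof.
have /fun_choice[G1 hG1] : forall cjk : 'I_3 * 'I_N * 'I_n.+1, exists G : {mpoly F[K]}, G != 0 /\ forall cc a b b',
  (forall i, pder (xpt cjk.1.1 a) (vec1 cjk.1.2 cjk.2 b) (fc cc i) = 0) ->
  (forall i, pder (xpt cjk.1.1 a) (vec1' cjk.1.2 cjk.2 b') (fc cc i) = 0) -> G.@[cc] = 0.
  by move=> [[c j] k]; have [G] := thin_corank2 c j k; exists G.
have /fun_choice[G2 hG2] : forall cij : 'I_3 * 'I_N * 'I_N, exists G : {mpoly F[K]}, G != 0 /\ forall cc a b b',
  (forall i, pder (xpt cij.1.1 a) (mins cij.2 b 1) (fc cc i) = 0) ->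
  (forall j, \sum_i mins cij.1.2 b' 1 i * ((fc cc i)^`M(j)).@[xpt cij.1.1 a] = 0) ->
  (forall k, \sum_i mins cij.1.2 b' 1 i * pder (xpt cij.1.1 a) (mins cij.2 b 1) (fc cc i)^`M(k) = 0) ->
  (exists l, mins cij.2 b 1 l - xpt cij.1.1 a l * mins cij.2 b 1 (cidx cij.1.1) != 0) -> G.@[cc] = 0.
  by move=> [[c i0] j0]; have [G] := thin_corank1 c i0 j0; exists G.
exists (\prod_i G1 i * \prod_i G2 i).
  by rewrite mulf_neq0 //; apply/prodf_neq0 => i _; [case: (hG1 i)|case: (hG2 i)].
move=> cc; rewrite mevalM mulf_eq0 negb_or !rmorph_prod => /andP[/prodf_neq0 nG1 /prodf_neq0 nG2].
move=> [_ endo] x0 x0P gx0 i1; apply/eqP/negP => /negP x0i1.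
have i13 : (i1 < 3)%N.
  by rewrite ltnNge; apply/negP => /x0P e0; rewrite e0 eqxx in x0i1.
pose f := fc cc; have hf i : f i \is d.-homog by apply: fc_homog.
pose c : 'I_3 := Ordinal i13.
have cE : cidx c = i1 by apply: val_inj; rewrite /= cidx_val.
pose a (k : 'I_2) := (x0 i1)^-1 * x0 (inord (lift c k)).
have xE : xpt c a = (fun i => (x0 i1)^-1 * x0 i).
  apply: functional_extensionality => i; rewrite /xpt; case: ifP => i3; last first.
    by rewrite (x0P i) ?mulr0 // leqNgt i3.
  have iv : ((inord i : 'I_3) : nat) = i by apply: inordK.
  rewrite /mins; case: (unliftP c (inord i)) => [k e|e].
    rewrite /a -e; have -> // : inord (inord i : 'I_3) = i.
    by apply: val_inj; rewrite /= iv inordK.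
  have -> : i = i1 by apply: val_inj; rewrite /= -iv e.
  by rewrite mulVf.
set x := xpt c a in xE.
have gx k : ((jac f)^`M(k)).@[x] = 0.
  by rewrite xE (dhomog_scale _ _ (dhomog_mderiv k (dhomog_jac hf))) gx0 mulr0.
have xq : x (cidx c) = 1 by apply: xpt_c.
have Px : (jac f).@[x] = 0.
  have := pder_euler x (dhomog_jac hf); rewrite /pder big1 => [/esym /eqP|k _]; last by rewrite gx mul0r.
  rewrite mulf_eq0 (negPf (natr_neq0 hchar _)) => [/eqP //|].
  by rewrite muln_eq0 /= -lt0n; move: d2; clear; lia.
pose A : 'M[F]_N := \matrix_(i, j) ((f i)^`M(j)).@[x].
have dA : \det A = 0 by rewrite -meval_jac.
have kE v i : kerv A v -> pder x v (f i) = 0.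
  by move=> /(_ i) h; rewrite -[RHS]h; apply: eq_bigr => b _; rewrite mxE.
case: (classic (two_kernel A)) => [[j [k [v [v' [kv kv' [vj vk] [vj' vk']]]]]]|nt].
  have nz := nG1 (c, j, k) isT; have [_ h] := hG1 (c, j, k).
  case/negP: nz; apply/eqP; apply: (h cc a (fun l => v (lift j (lift k l))) (fun l => v' (lift j (lift k l)))) => i /=.
    have -> : vec1 j k (fun l => v (lift j (lift k l))) = v.
      apply: functional_extensionality => l; rewrite /vec1 /mins; case: (unliftP j l) => [m ->|->] //.
      by case: (unliftP k m) => [m' ->|->].
    exact: kE.
  have -> : vec1' j k (fun l => v' (lift j (lift k l))) = v'.
    apply: functional_extensionality => l; rewrite /vec1' /mins; case: (unliftP j l) => [m ->|->] //.
    by case: (unliftP k m) => [m' ->|->].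
  exact: kE.
have [i0 [j0 [ka [v [w [ka0 vj wi kv [wA aA]]]]]]] := adj_rank_one dA nt.
have nz := nG2 (c, i0, j0) isT; have [_ h] := hG2 (c, i0, j0).
have vE : mins j0 (fun l => v (lift j0 l)) 1 = v.
  by apply: functional_extensionality => l; rewrite /mins; case: (unliftP j0 l) => [m ->|->].
have wE : mins i0 (fun l => w (lift i0 l)) 1 = w.
  by apply: functional_extensionality => l; rewrite /mins; case: (unliftP i0 l) => [m ->|->].
case/negP: nz; apply/eqP; apply: (h cc a (fun l => v (lift j0 l)) (fun l => w (lift i0 l))); rewrite /= ?vE ?wE.
- by move=> i; apply: kE.
- by move=> j; rewrite -[RHS](wA j); apply: eq_bigr => i _; rewrite mxE.
- move=> k; have := gx k; rewrite /jac mderiv_det (raddf_sum (meval x)) /= => E.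
  apply: (mulfI ka0); rewrite mulr0 -[RHS]E mulr_sumr; apply: eq_bigr => i _.
  rewrite (raddf_sum (meval x)) /= /pder !mulr_sumr; apply: eq_bigr => j _.
  rewrite mevalM !mxE.
  have -> : (cofactor (\matrix_(i2, j1) (fc cc i2)^`M(j1)) i j).@[x] = ka * v j * w i.
    rewrite -aA mxE /cofactor rmorphM /= rmorph_sign -det_map_mx; congr (_ * \det _).
    by apply/matrixP => i2 j2; rewrite !mxE.
  rewrite mderiv_comm; ring.
apply: NNPP => no.
(* A kernel vector proportional to [x] would, by Euler's formula, make [x] a common zero of the
   [f i]. *)
have vx : v = (fun l => v (cidx c) * x l).
  apply: functional_extensionality => l; apply/eqP; rewrite -subr_eq0; apply/negPn/negP => ne; apply: no.
  by exists l; rewrite mulrC.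
have fx i : (f i).@[x] = 0.
  have : pder x v (f i) = v (cidx c) * pder x x (f i).
    by rewrite {1}vx /pder mulr_sumr; apply: eq_bigr => b _; rewrite mulrCA.
  rewrite kE // (pder_euler x (hf i)) => /esym /eqP; rewrite mulf_eq0 mulf_eq0.
  have -> : (v (cidx c) == 0) = false.
    apply/negP => /eqP e0; move: vj; rewrite vx e0 mul0r => /eqP; by rewrite eq_sym oner_eq0.
  rewrite /= (negPf (natr_neq0 hchar _)) /= => [/eqP //|].
  by rewrite -lt0n ltnW.
by have := endo x fx (cidx c); rewrite xq => /eqP; rewrite oner_eq0.
Qed.

End GenericSmooth.

(** * Generic birationality on the critical locus *)

Section Unisolvent.
Variable F : fieldType.
Hypothesis Finf : forall s : seq F, exists x, x \notin s.

(** Points are added one at a time: a nonzero combination of the [g i] vanishing at the points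
    chosen so far is nonzero at some new point. *)
Lemma unisolvent n M (g : 'I_M -> {mpoly F[n]}) :
  (forall al : 'I_M -> F, \sum_i al i *: g i = 0 -> forall i, al i = 0) ->
  exists x : 'I_M -> 'I_n -> F, \det (\matrix_(i, l) (g i).@[x l]) != 0.
Proof.
move=> ind.
have step k : (k <= M)%N -> exists x : 'I_k -> 'I_n -> F, forall be : 'I_k -> F,
    (forall i, \sum_l be l * (g i).@[x l] = 0) -> forall l, be l = 0.
  elim: k => [|k IH] kM; first by exists (fun _ _ => 0) => be _ [].
  have [x hx] := IH (ltnW kM).
  have [al al0 alE] := @left_kernel F M k (\matrix_(i, l) (g i).@[x l]) kM.
  pose G := \sum_i al 0 i *: g i.
  have G0 : G != 0.
    apply: contraNneq al0 => G0; apply/eqP/rowP => i; rewrite mxE.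
    exact: (ind (fun i => al 0 i)).
  have [y Gy] := mpoly_nonroot Finf G0.
  exists (fun l => if unlift ord_max l is Some l' then x l' else y) => be hbe.
  have E i : \sum_(l < k) be (lift ord_max l) * (g i).@[x l] + be ord_max * (g i).@[y] = 0.
    rewrite -[RHS](hbe i) big_ord_recr /= unlift_none; congr (_ + _).
    apply: eq_bigr => l _; have -> : widen_ord (leqnSn k) l = lift ord_max l.
      by apply: val_inj; rewrite /= /bump leqNgt ltn_ord.
    by rewrite liftK.
  have bm : be ord_max = 0.
    have : \sum_i al 0 i * (\sum_(l < k) be (lift ord_max l) * (g i).@[x l] + be ord_max * (g i).@[y]) = 0.
      by rewrite big1 // => i _; rewrite E mulr0.
    under eq_bigr do rewrite mulrDr.
    rewrite big_split /= [X in X + _](_ : _ = 0) ?add0r => [|].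
      under eq_bigr do rewrite mulrCA.
      rewrite -mulr_sumr => /eqP; rewrite mulf_eq0 => /orP[/eqP //|].
      suff -> : \sum_i al 0 i * (g i).@[y] = G.@[y] by rewrite (negPf Gy).
      by rewrite (raddf_sum (meval y)) /=; apply: eq_bigr => i _; rewrite mevalZ.
    under eq_bigr do rewrite mulr_sumr.
    rewrite exchange_big big1 //= => l _.
    have := congr1 (fun A : 'rV_k => A 0 l) alE; rewrite /= [in RHS]mxE mxE => El.
    transitivity (be (lift ord_max l) * \sum_j al 0 j * (\matrix_(i, l) (g i).@[x l]) j l); last by rewrite El mulr0.
    by rewrite mulr_sumr; apply: eq_bigr => i _; rewrite mxE mulrCA.
  move=> l; case: (unliftP ord_max l) => [l' ->|->] //.
  apply: (hx (fun l => be (lift ord_max l))) => i; have := E i.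
  by rewrite bm mul0r addr0.
have [x hx] := step M (leqnn M); exists x.
apply/negP => /eqP d0; have /det0P[u u0 uA] : \det (\matrix_(i, l) (g i).@[x l])^T == 0.
  by rewrite det_tr d0.
case/negP: u0; apply/eqP/rowP => l; rewrite mxE; apply: (hx (fun l => u 0 l)) => i.
have := congr1 (fun A : 'rV_M => A 0 i) uA; rewrite /= [in RHS]mxE mxE => E.
by rewrite -[RHS]E; apply: eq_bigr => l' _; rewrite !mxE.
Qed.

End Unisolvent.

(** * Forms vanishing at a reduced point *)

Section SimplePoint.
Variable F : closedFieldType.
Hypothesis Finf : forall s : seq F, exists x, x \notin s.
Variables (n r : nat) (h : 'I_r -> {mpoly F[n.+1]}) (dg : 'I_r -> nat) (x : 'I_n.+1 -> F) (q : 'I_n.+1).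
Notation S := {mpoly F[n.+1]}.
Hypothesis hh : forall i, h i \is (dg i).-homog.
Hypothesis xq : x q = 1.
Hypothesis hx : forall i, (h i).@[x] = 0.
Hypothesis zeros : forall y, (forall i, (h i).@[y] = 0) -> forall a, y a = y q * x a.
Hypothesis tangent : forall v, (forall i, pder x v (h i) = 0) -> forall a, v a = v q * x a.

Let va (a : 'I_n.+1) : S := 'X_a - (x a)%:MP.
Let I := inI h.
Let J := idealAdd I ('X_q - 1%:MP).

Definition taylor1 (p : S) := exists c : 'I_n.+1 -> S, (forall a, (c a).@[x] = 0) /\
  p = (p.@[x])%:MP + \sum_a ((p^`M(a)).@[x])%:MP * va a + \sum_a c a * va a.

Lemma taylor p : taylor1 p.
Proof.
elim/mpoly_ring_ind: p => [c|i|p p' [c [c0 cE]] [c' [c0' cE']]|p p' [c [c0 cE]] [c' [c0' cE']]].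
- exists (fun=> 0); split=> [a|]; first exact: meval0.
  rewrite mevalC !big1 ?addr0 // => a _; rewrite ?mul0r // mderivC meval0 mpolyC0 mul0r //.
- exists (fun=> 0); split=> [a|]; first exact: meval0.
  rewrite mevalXU [X in _ + X]big1 ?addr0 => [|a _]; last by rewrite mul0r.
  rewrite (bigD1 i) //= mderivXU eqxx rmorph1 mpolyC1 mul1r big1 ?addr0 => [|a ai].
    by rewrite addrC subrK.
  by rewrite mderivXU eq_sym (negPf ai) meval0 mpolyC0 mul0r.
- exists (fun a => c a + c' a); split=> [a|]; first by rewrite mevalD c0 c0' addr0.
  rewrite {1}cE {1}cE' mevalD mpolyCD.
  have -> : \sum_a (((p + p')^`M(a)).@[x])%:MP * va a =
      \sum_a ((p^`M(a)).@[x])%:MP * va a + \sum_a ((p'^`M(a)).@[x])%:MP * va a.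
    by rewrite -big_split; apply: eq_bigr => a _ /=; rewrite mderivD mevalD mpolyCD mulrDl.
  have -> : \sum_a (c a + c' a) * va a = \sum_a c a * va a + \sum_a c' a * va a.
    by rewrite -big_split; apply: eq_bigr => a _ /=; rewrite mulrDl.
  by move: (\sum_a _) (\sum_a _) (\sum_a _) (\sum_a _) => ? ? ? ?; ring.
pose D := \sum_a ((p^`M(a)).@[x])%:MP * va a; pose C := \sum_a c a * va a.
pose D' := \sum_a ((p'^`M(a)).@[x])%:MP * va a; pose C' := \sum_a c' a * va a.
exists (fun a => (D + C) * (((p'^`M(a)).@[x])%:MP + c' a) + (p.@[x])%:MP * c' a + (p'.@[x])%:MP * c a).
have vx a : (va a).@[x] = 0 by rewrite mevalB mevalXU mevalC subrr.
have Dx : D.@[x] = 0 by rewrite (raddf_sum (meval x)) big1 //= => a _; rewrite mevalM vx mulr0.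
have Cx : C.@[x] = 0 by rewrite (raddf_sum (meval x)) big1 //= => a _; rewrite mevalM vx mulr0.
split=> [a|].
  by rewrite !mevalD !mevalM mevalD Dx Cx c0 c0' addr0 mul0r !mulr0 !addr0.
have -> : \sum_a (((p * p')^`M(a)).@[x])%:MP * va a = (p'.@[x])%:MP * D + (p.@[x])%:MP * D'.
  rewrite /D /D' !mulr_sumr -big_split; apply: eq_bigr => a _ /=.
  by rewrite mderivM mevalD !mevalM mpolyCD !mpolyCM; ring.
have -> : \sum_a ((D + C) * (((p'^`M(a)).@[x])%:MP + c' a) + (p.@[x])%:MP * c' a + (p'.@[x])%:MP * c a) * va a
    = (D + C) * (D' + C') + (p.@[x])%:MP * C' + (p'.@[x])%:MP * C.
  rewrite /D' /C' /C -[X in _ * X + _ + _]big_split !mulr_sumr -!big_split; apply: eq_bigr => a _ /=.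
  by rewrite -/C; ring.
rewrite {1}cE {1}cE' -/D -/C -/D' -/C' mevalM mpolyCM.
by clear Dx Cx; move: D C D' C' => ? ? ? ?; ring.
Qed.

Lemma iI : idealP I. Proof. exact: inI_ideal. Qed.
Lemma iJ : idealP J. Proof. exact: idealAdd_ideal iI. Qed.

Lemma J_at A : J A -> A.@[x] = 0.
Proof.
move=> [b hb]; have := inI_eval hb hx; rewrite mevalB mevalM mevalB mevalXU mevalC xq subrr mulr0 subr0.
by [].
Qed.

(** Linear duality: by [tangent] only multiples of [x] are killed by all gradients of the [h i], so
    the gradients span every covector that kills [x]. *)
Lemma gradient_span (w : 'I_n.+1 -> F) : \sum_a w a * x a = 0 ->
  exists la : 'I_r -> F, forall a, \sum_i la i * ((h i)^`M(a)).@[x] = w a.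
Proof.
move=> wx; pose H : 'M[F]_(r, n.+1) := \matrix_(i, a) ((h i)^`M(a)).@[x].
pose wr : 'rV[F]_n.+1 := \row_a w a.
have /submxP[la laE] : (wr <= H)%MS.
  rewrite submxE; apply/eqP/rowP => b; rewrite [RHS]mxE mxE.
  pose v a := cokermx H a b.
  have vE : forall a, v a = v q * x a.
    apply: tangent => i; have := congr1 (fun A : 'M[F]_(r, n.+1) => A i b) (mulmx_coker H).
    rewrite /= [in RHS]mxE mxE => E; rewrite -[RHS]E; apply: eq_bigr => a _; by rewrite mxE.
  rewrite -[RHS](mulr0 (v q)) -[in RHS]wx mulr_sumr; apply: eq_bigr => a _.
  by rewrite mxE -/(v a) vE mulrCA.
exists (fun i => la 0 i) => a; have := congr1 (fun A : 'rV[F]_n.+1 => A 0 a) laE; rewrite mxE => ->.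
by rewrite mxE; apply: eq_bigr => i _; rewrite mxE.
Qed.

Lemma va_step a : exists c : 'I_n.+1 -> S, (forall b, (c b).@[x] = 0) /\ J (va a - \sum_b c b * va b).
Proof.
have [J0 JD JM] := iJ.
have [|la laE] := @gradient_span (fun b => (b == a)%:R - x a * (b == q)%:R).
  under eq_bigr do rewrite mulrBl; rewrite sumrB.
  rewrite (bigD1 a) //= eqxx mul1r big1 ?addr0 => [|b /negPf->]; last by rewrite mul0r.
  rewrite (bigD1 q) //= eqxx xq !mulr1 big1 ?addr0 ?subrr // => b /negPf->; by rewrite mulr0 mul0r.
pose g := \sum_i (la i)%:MP * h i.
have Jg : J g by apply: idealAdd_sub; exists (fun i => (la i)%:MP).
have gx : g.@[x] = 0 by apply: J_at.
have gd b : (g^`M(b)).@[x] = (b == a)%:R - x a * (b == q)%:R.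
  rewrite -laE (raddf_sum (mderiv b)) (raddf_sum (meval x)) /=; apply: eq_bigr => i _.
  by rewrite mul_mpolyC linearZ mevalZ.
have [c [c0 cE]] := taylor g; exists (fun b => - c b); split=> [b|]; first by rewrite mevalN c0 oppr0.
have Jq : J (va q) by rewrite /va xq; apply: idealAdd_gen iI.
have -> : va a - \sum_b - c b * va b = g + (x a)%:MP * va q.
  rewrite {1}cE gx mpolyC0 add0r; under [X in _ = X + _ + _]eq_bigr do rewrite gd.
  have -> : \sum_b ((b == a)%:R - x a * (b == q)%:R)%:MP * va b = va a - (x a)%:MP * va q.
    under eq_bigr do rewrite mpolyCB mulrBl mpolyCM -mulrA; rewrite sumrB; congr (_ - _).
      rewrite (bigD1 a) //= eqxx mpolyC1 mul1r big1 ?addr0 // => b /negPf->; by rewrite mpolyC0 mul0r.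
    rewrite (bigD1 q) //= eqxx mpolyC1 mul1r big1 ?addr0 // => b /negPf->; by rewrite mpolyC0 mul0r mulr0.
  under [X in _ - X]eq_bigr do rewrite mulNr.
  by rewrite sumrN opprK; move: (\sum_b _) => ?; ring.
by apply: JD => //; apply: JM.
Qed.

Variable L0 : nat.
Hypothesis L0p : (0 < L0)%N.
Hypothesis red : forall p, p \is L0.-homog -> exists2 q0, q0 \is (L0.-1).-homog & inI h (p - 'X_q * q0).

(** Nakayama by determinants: [de * va a] lies in [J] with [de] equal to [1] at [x]. As [x] is the
    only zero of [J], the ideal [J + (de)] has none and contains [1]. *)
Lemma va_in_J a : J (va a).
Proof.
have [J0 JD JM] := iJ.
have /fun_choice[C hC] := va_step.
pose Mx : 'M[S]_n.+1 := \matrix_(a, b) ((a == b)%:R - C a b).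
pose de := \det Mx.
have dex : de.@[x] = 1.
  rewrite /de -det_map_mx; have -> : map_mx (meval x) Mx = 1%:M.
    by apply/matrixP => i j; rewrite !mxE mevalB (proj1 (hC i)) subr0 rmorph_nat.
  exact: det1.
have row_in i : J (\sum_b Mx i b * va b).
  have [_ hJ] := hC i; suff -> : \sum_b Mx i b * va b = va i - \sum_b C i b * va b by [].
  under eq_bigr do rewrite mxE mulrBl; rewrite sumrB; congr (_ - _).
  rewrite (bigD1 i) //= eqxx mul1r big1 ?addr0 // => b bi; by rewrite eq_sym (negPf bi) mul0r.
have dva : J (de * va a).
  have -> : de * va a = \sum_i (\adj Mx) a i * \sum_b Mx i b * va b.
    under eq_bigr do rewrite mulr_sumr; rewrite exchange_big /=.
    have E b : \sum_i (\adj Mx) a i * (Mx i b * va b) = (de *+ (a == b)) * va b.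
      have := congr1 (fun A : 'M[S]_n.+1 => A a b) (mul_adj_mx Mx).
      rewrite /= [in RHS]mxE mxE => <-; rewrite mulr_suml; by apply: eq_bigr => i _; rewrite mulrA.
    rewrite (eq_bigr _ (fun b _ => E b)) (bigD1 a) //= eqxx mulr1n big1 ?addr0 // => b ba.
    by rewrite eq_sym (negPf ba) mulr0n mul0r.
  by apply: ideal_sum => // i _; apply: JM.
case: (classic (idealAdd J de 1)) => [[c hc]|n1].
  have -> : va a = va a * (1 - c * de) + c * (de * va a) by ring.
  by apply: JD; apply: JM.
have [|y hy] := zerodim_point (idealAdd_ideal de iJ) n1.
  move=> j; have [rs hrs] := chart_split L0p red j; exists rs; exact: idealAdd_sub.
have hJy A : J A -> A.@[y] = 0 by move=> JA; apply: hy; apply: idealAdd_sub.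
have yq : y q = 1.
  have := hJy _ (idealAdd_gen ('X_q - 1%:MP) iI); rewrite mevalB mevalXU mevalC => /eqP.
  by rewrite subr_eq0 => /eqP.
have yx b : y b = x b.
  rewrite -[RHS]mul1r -yq; apply: zeros => i; apply: hJy; apply: idealAdd_sub; exact: inI_gen.
have := hy _ (idealAdd_gen de iJ); rewrite (meval_eq _ yx) dex => /eqP; by rewrite oner_eq0.
Qed.

(** Back to forms: some ['X_q ^+ B] times each linear form [ua a] lies in [I]. In large degree any
    form is, modulo [I], divisible by ['X_q ^+ B], and the quotient vanishes at [x], so it lies in
    the ideal of the [ua a]. *)
Lemma simple_point_aux : exists T, forall t p, (T <= t)%N -> p \is t.-homog -> p.@[x] = 0 -> inI h p.
Proof.
have [I0 ID IM] := iI; have [J0 JD JM] := iJ.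
pose ua a : S := 'X_a - x a *: 'X_q.
have hu a : ua a \is 1.-homog by rewrite rpredB ?rpredZ // dhomogX /= mdeg1.
have /fun_choice[Ba hBa] a : exists B, I ('X_q ^+ B * ua a).
  apply: (chart_homogenize Finf hh (hu a)).
  have -> : ua a = va a - (x a)%:MP * ('X_q - 1%:MP).
    by rewrite /ua /va -mul_mpolyC mpolyC1; ring.
  apply: idealB; [exact: iJ|exact: va_in_J|apply: JM; exact: idealAdd_gen iI].
pose B := \max_a Ba a.
have hB a : I ('X_q ^+ B * ua a).
  have le : (Ba a <= B)%N by apply: leq_bigmax.
  by rewrite -(subnK le) exprD -mulrA; apply: IM.
have red1 t p : (L0 <= t)%N -> p \is t.-homog -> exists2 p', p' \is (t.-1).-homog & I (p - 'X_q * p').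
  move=> Lt /dhomogP hp; rewrite [p]mpolyE big_seq.
  elim/big_ind: _ => [|p1 p2 [q1 h1 E1] [q2 h2 E2]|m mp].
  - by exists 0; rewrite ?rpred0 // mulr0 subr0.
  - by exists (q1 + q2); rewrite ?rpredD // mulrDr opprD addrACA; apply: ID.
  have mt := hp m mp; have [|m1 [m2 [mm m1E m2E]]] := @mdeg_split _ m L0; first by rewrite [mdeg m]mt.
  have [|q1 hq1 E1] := red (p := 'X_[m1]); first by rewrite dhomogX /= m1E.
  exists (p@_m *: (q1 * 'X_[m2])).
    have -> : t.-1 = (L0.-1 + mdeg m2)%N.
      by rewrite m2E; have /= -> := mt; move: Lt L0p; clear; lia.
    by rewrite rpredZ // dhomogM // dhomogX.
  rewrite mm mpolyXD -scalerAr -scalerBr; apply: (idealZ _ iI).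
  by rewrite mulrA -mulrBl mulrC; apply: IM.
have redB b t p : (L0 + b <= t)%N -> p \is t.-homog ->
    exists2 p', p' \is (t - b).-homog & I (p - 'X_q ^+ b * p').
  elim: b t p => [|b IH] t p Lt hp.
    by exists p; rewrite ?subn0 // mul1r subrr.
  have [|p1 hp1 E1] := red1 t p _ hp; first by move: Lt; clear; lia.
  have [|p2 hp2 E2] := IH t.-1 p1 _ hp1; first by move: Lt; clear; lia.
  exists p2; first by have -> : (t - b.+1 = t.-1 - b)%N by move: Lt; clear; lia.
  apply: (@ideal_trans _ _ _ _ ('X_q * p1)) => //.
  by rewrite exprS -mulrA -mulrBr; apply: IM.
have inu p t : p \is t.-homog -> p.@[x] = 0 -> inI ua p.
  move=> hp px; have [U0 UD UM] := inI_ideal ua.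
  have hs : inI ua (p - msub (fun a => x a *: 'X_q) p).
    elim/mpoly_ring_ind: p {hp px} => [c|i|p p' h1 h2|p p' h1 h2].
    - by rewrite msubC subrr.
    - by rewrite msubXU; apply: (inI_gen ua i).
    - by rewrite msubD opprD addrACA; apply: UD.
    - by rewrite msubM; apply: ideal_mul => //; apply: inI_ideal.
  suff e0 : msub (fun a => x a *: 'X_q) p = 0 by rewrite e0 subr0 in hs.
  apply: (mpoly_eval_inj Finf) => y; rewrite meval0 meval_msub.
  transitivity (p.@[fun a => y q * x a]).
    by apply: meval_eq => a; rewrite mevalZ mevalXU mulrC.
  by rewrite (dhomog_scale _ _ hp) px mulr0.
exists (L0 + B)%N => t p Lt hp px; have [p' hp' E] := redB B t p Lt hp.
have px' : p'.@[x] = 0.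
  have := inI_eval E hx; rewrite mevalB mevalM mevalXn mevalXU xq expr1n mul1r px sub0r => /eqP.
  by rewrite oppr_eq0 => /eqP.
rewrite -(subrK ('X_q ^+ B * p') p); apply: ID => //.
have [c ->] := inu p' _ hp' px'; rewrite mulr_sumr; apply: ideal_sum; first exact: iI.
by move=> a _; rewrite mulrCA; apply: IM.
Qed.

End SimplePoint.

(* The condition on tangent vectors makes [x] a reduced point of the scheme [h = 0], and ideals
   are determined in large degrees by their schemes. *)
Lemma simple_point (F : closedFieldType) (Finf : forall s : seq F, exists x, x \notin s)
  n r (h : 'I_r -> {mpoly F[n.+1]}) (dg : 'I_r -> nat) (x : 'I_n.+1 -> F) (q : 'I_n.+1) :
  (forall i, h i \is (dg i).-homog) -> x q = 1 -> (forall i, (h i).@[x] = 0) ->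
  (forall y, (forall i, (h i).@[y] = 0) -> forall a, y a = y q * x a) ->
  (forall v, (forall i, pder x v (h i) = 0) -> forall a, v a = v q * x a) ->
  exists T, forall t p, (T <= t)%N -> p \is t.-homog -> p.@[x] = 0 -> inI h p.
Proof.
move=> hh xq hx zeros tangent.
pose H (k : 'I_r.+1) : {mpoly F[n.+1]} := if unlift ord_max k is Some i then h i else 'X_q.
pose dH (k : 'I_r.+1) := if unlift ord_max k is Some i then dg i else 1%N.
have hH k : H k \is (dH k).-homog.
  by rewrite /H /dH; case: unlift => [i|] //; rewrite dhomogX /= mdeg1.
have [y hy|L0 L0p hL] := nullstellensatz_homog Finf hH.
  have yq : y q = 0 by have := hy ord_max; rewrite /H unlift_none mevalXU.
  move=> a; rewrite (zeros y) ?yq ?mul0r // => i.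
  by have := hy (lift ord_max i); rewrite /H liftK.
apply: (simple_point_aux Finf hh xq hx zeros tangent L0p) => p hp.
have [c cE] := hL p hp; rewrite big_ord_recr /= {2}/H unlift_none in cE.
exists (hcomp L0.-1 (c ord_max)); first exact: pihomogP.
have hX : ('X_q : {mpoly F[n.+1]}) \is 1.-homog by rewrite dhomogX /= mdeg1.
have E : inI h (\sum_(i < r) c (widen_ord (leqnSn r) i) * H (widen_ord (leqnSn r) i)).
  exists (fun i => c (widen_ord (leqnSn r) i)); apply: eq_bigr => i _; congr (_ * _).
  have -> : widen_ord (leqnSn r) i = lift ord_max i.
    by apply: val_inj; rewrite /= /bump leqNgt ltn_ord.
  by rewrite /H liftK.
have := inI_hcomp L0 hh E.
suff -> : hcomp L0 (\sum_(i < r) c (widen_ord (leqnSn r) i) * H (widen_ord (leqnSn r) i)) =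
   p - 'X_q * hcomp L0.-1 (c ord_max) by [].
rewrite -[p in RHS](pihomog_dE hp) [in RHS]cE linearD /= (hcompM _ _ hX) L0p subn1 mulrC addrK.
by [].
Qed.

Lemma pf_common (F : closedFieldType) (hchar : [pchar F] =i pred0) K (I : finType)
  (u : I -> ('I_K -> F) -> F) : (forall i, polyfun (u i)) -> (forall i, exists c, u i c != 0) ->
  exists c, forall i, u i c != 0.
Proof.
move=> hu hn; have /fun_choice[G hG] := hu.
have G0 : \prod_i G i != 0.
  apply/prodf_neq0 => i _; have [c hc] := hn i; apply: contraNneq hc => Gi.
  by rewrite hG Gi meval0.
have [c hc] := mpoly_nonroot (closed_infinite hchar) G0; exists c => i.
by move: hc; rewrite rmorph_prod => /prodf_neq0 /(_ i isT); rewrite hG.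
Qed.

Lemma pder_exp (F : fieldType) n (x v : 'I_n -> F) p k :
  pder x v (p ^+ k) = k%:R * p.@[x] ^+ k.-1 * pder x v p.
Proof.
rewrite /pder mulr_sumr; apply: eq_bigr => b _.
by rewrite mderiv_exp (rmorphMn (meval x)) /= mevalM mevalXn -mulr_natl !mulrA.
Qed.

(** Equations of the part in [jac f = 0] of the fibre of [f^2] over the projective point [z]. *)
Definition fibgen (F : fieldType) n (f : polymap F n) (z : 'I_n.+1 -> F)
  (o : option ('I_n.+1 * 'I_n.+1)) : {mpoly F[n.+1]} :=
  if o is Some ij then z ij.2 *: fiter f 2 ij.1 - z ij.1 *: fiter f 2 ij.2 else jac f.

Definition fibdeg n d (o : option ('I_n.+1 * 'I_n.+1)) : nat :=
  if o is Some _ then (d ^ 2)%N else (n.+1 * d.-1)%N.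

Lemma fibgen_homog (F : closedFieldType) n d (f : polymap F n) z o : (forall i, f i \is d.-homog) ->
  fibgen f z o \is (fibdeg d o).-homog.
Proof.
move=> hf; case: o => [ij|] /=; last exact: dhomog_jac.
by apply: rpredB; apply: rpredZ; apply: fiter_homog.
Qed.

(** * A map with a reduced one-point fibre *)

Section Example.
Variable F : closedFieldType.
Hypothesis hchar : [pchar F] =i pred0.
Variables (n d : nat).
Hypothesis d2 : (1 < d)%N.
Notation N := n.+2.

Let d0 : (0 < d)%N. Proof. exact: ltnW. Qed.
Let dp0 : (0 < d.-1)%N. Proof. by rewrite -subn1 subn_gt0. Qed.
Let dR : (d%:R : F) != 0. Proof. by apply: natr_neq0 => //; rewrite -lt0n. Qed.

Definition i1 : 'I_N := lift ord0 ord0.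
Definition oth (k : 'I_N) := (k != ord0) && (k != i1).

Lemma i1_neq0 : i1 != ord0. Proof. by []. Qed.

Section Params.
Variables (tau : F) (x : 'I_N -> F).

(* On [x_1 = 1] this is [T^d - d T] in [x_0], with critical points the roots of [T^(d-1) = 1],
   perturbed so that [f^2] is injective on the critical points of the fibre of [x]. *)
Definition ex0 : {mpoly F[N]} := 'X_ord0 ^+ d - d%:R *: ('X_ord0 * 'X_i1 ^+ d.-1)
  - (\sum_(k | oth k) 'X_k) * 'X_i1 ^+ d.-1 + tau *: 'X_i1 ^+ d.

Definition exf : polymap F n.+1 := fun i => if i == ord0 then ex0 else 'X_i ^+ d.

Lemma exf_homog i : exf i \is d.-homog.
Proof.
have hX (k : 'I_N) : ('X_k : {mpoly F[N]}) \is 1.-homog by rewrite dhomogX /= mdeg1.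
have hXn k m : ('X_k ^+ m : {mpoly F[N]}) \is m.-homog.
  by have := dhomog_exp m (hX k); rewrite mul1n.
rewrite /exf; case: ifP => // _; rewrite /ex0 rpredD ?rpredB ?rpredZ //.
  by have := dhomogM (hX ord0) (hXn i1 d.-1); rewrite add1n prednK.
have : (\sum_(k | oth k) 'X_k : {mpoly F[N]}) \is 1.-homog by apply: rpred_sum => k _.
by move=> h; have := dhomogM h (hXn i1 d.-1); rewrite add1n prednK.
Qed.

Lemma exf_eval0 y : (exf ord0).@[y] = y ord0 ^+ d - d%:R * (y ord0 * y i1 ^+ d.-1)
  - (\sum_(k | oth k) y k) * y i1 ^+ d.-1 + tau * y i1 ^+ d.
Proof.
rewrite /exf eqxx /ex0 mevalD !mevalB !mevalZ !mevalM !mevalXn !mevalXU.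
by rewrite (raddf_sum (meval y)) /=; congr (_ - _ * _ + _); apply: eq_bigr => k _; rewrite mevalXU.
Qed.

Lemma exf_evalS y i : i != ord0 -> (exf i).@[y] = y i ^+ d.
Proof. by move=> i0; rewrite /exf (negPf i0) mevalXn mevalXU. Qed.

Lemma exf2_eval0 y : y ord0 ^+ d.-1 = 1 -> y i1 = 1 ->
  (fiter exf 2 ord0).@[y] = let b := tau + ((1 - d%:R) * y ord0 - \sum_(k | oth k) y k) in
    b ^+ d - d%:R * b - \sum_(k | oth k) y k ^+ d + tau.
Proof.
move=> y0 y1; rewrite fiter_eval /= {1}/peval exf_eval0 {3 5 6}/peval exf_evalS // y1 !expr1n !mulr1.
have -> : peval exf y ord0 = tau + ((1 - d%:R) * y ord0 - \sum_(k | oth k) y k).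
  by rewrite /peval exf_eval0 y1 !expr1n !mulr1 -{1}(prednK d0) exprS y0 mulr1; ring.
by congr (_ - _ + _); apply: eq_bigr => k /andP[k0 _]; rewrite /peval exf_evalS.
Qed.

Lemma exf2_S i : i != ord0 -> fiter exf 2 i = 'X_i ^+ (d * d).
Proof.
by move=> i0; rewrite /= /exf (negPf i0) !rmorphXn /= !msubXU (negPf i0) rmorphXn /= msubXU exprM.
Qed.

Lemma ex0_deriv : ex0^`M(ord0) = d%:R *: ('X_ord0 ^+ d.-1 - 'X_i1 ^+ d.-1).
Proof.
have dX m : ('X_i1 ^+ m : {mpoly F[N]})^`M(ord0) = 0.
  by rewrite mderiv_exp mderivXU mulr0 mul0rn.
rewrite /ex0 mderivD !mderivB !mderivZ !mderivM !dX !mulr0 scaler0 !addr0 mderiv_exp !mderivXU eqxx.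
rewrite [X in _ - X * _](_ : _ = 0) ?mul0r ?subr0 => [|].
  by rewrite mulr1 mul1r scalerBr !scaler_nat.
rewrite (raddf_sum (mderiv ord0)) big1 //= => k /andP[k0 _]; by rewrite mderivXU (negPf k0).
Qed.

Lemma jac_exf : jac exf = ex0^`M(ord0) * \prod_(i | i != ord0) ('X_i ^+ d : {mpoly F[N]})^`M(i).
Proof.
rewrite /jac -det_tr det_trig.
  rewrite (bigD1 ord0) //= !mxE /exf eqxx; congr (_ * _); apply: eq_bigr => i i0.
  by rewrite !mxE (negPf i0).
apply/is_trig_mxP => i j ij; rewrite !mxE /exf; case: eqP => [j0|_].
  by rewrite j0 ltn0 in ij.
rewrite mderiv_exp mderivXU; have -> : (j == i) = false.
  by apply/eqP => ji; rewrite ji ltnn in ij.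
by rewrite mulr0 mul0rn.
Qed.

Lemma jac_exf_neq0 : jac exf != 0.
Proof.
pose y (i : 'I_N) : F := (i != ord0)%:R.
suff : (jac exf).@[y] != 0 by apply: contraNneq => ->; rewrite meval0.
rewrite jac_exf mevalM ex0_deriv mevalZ mevalB !mevalXn !mevalXU mulf_neq0 //.
  by rewrite /y /= mulf_neq0 // expr0n gtn_eqF // expr1n sub0r oppr_eq0 oner_eq0.
rewrite rmorph_prod; apply/prodf_neq0 => i i0.
rewrite /= mderiv_exp mderivXU eqxx mulr1 (rmorphMn (meval y)) /= mevalXn mevalXU /y i0 expr1n.
exact: dR.
Qed.

(* The difference of the values of [f^2_0] at the critical point [mu * x] and at [x]. *)
Definition Phi (mu : 'I_N -> F) :=
  let a := tau + ((1 - d%:R) - \sum_(k | oth k) x k) in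
  let b := tau + ((1 - d%:R) * mu ord0 - \sum_(k | oth k) mu k * x k) in
  (b ^+ d - d%:R * b) - (a ^+ d - d%:R * a) - \sum_(k | oth k) (mu k ^+ d - 1) * x k ^+ d.

Hypothesis x0 : x ord0 = 1.
Hypothesis x1 : x i1 = 1.
Hypothesis xn0 : forall i, x i != 0.
Hypothesis hPhi : forall mu, mu ord0 ^+ d.-1 = 1 -> mu i1 = 1 ->
  (forall k, k != ord0 -> mu k ^+ (d * d) = 1) -> (exists k, mu k != 1) -> Phi mu != 0.

Lemma jac_exf_x : (jac exf).@[x] = 0.
Proof.
by rewrite jac_exf mevalM ex0_deriv mevalZ mevalB !mevalXn !mevalXU x0 x1 subrr mulr0 mul0r.
Qed.

(** The power coordinates force [w k = mu k * x k] with roots of unity [mu k], and criticality gives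
    [mu ord0 ^+ d.-1 = 1]. Equality of the remaining coordinate of [f^2] reads [Phi mu = 0],
    excluded unless [mu] is trivial. *)
Lemma ex_fibre w : w i1 = 1 -> (forall i, (fiter exf 2 i).@[w] = (fiter exf 2 i).@[x]) ->
  (jac exf).@[w] = 0 -> forall a, w a = x a.
Proof.
move=> w1 hw wP.
have wv i : i != ord0 -> w i ^+ (d * d) = x i ^+ (d * d).
  by move=> i0; have := hw i; rewrite (exf2_S i0) !mevalXn !mevalXU.
have wn0 i : i != ord0 -> w i != 0.
  move=> i0; apply: contraTneq (xn0 i) => wi; have := wv i i0.
  by rewrite wi expr0n gtn_eqF ?muln_gt0 ?d0 //= => /esym/eqP; rewrite expf_eq0 => /andP[_ ->].
have w0 : w ord0 ^+ d.-1 = 1.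
  move: wP; rewrite jac_exf mevalM => /eqP; rewrite mulf_eq0 => /orP[|].
    rewrite ex0_deriv mevalZ mulf_eq0 (negPf dR) /= mevalB !mevalXn !mevalXU w1 expr1n subr_eq0.
    by move=> /eqP.
  rewrite rmorph_prod => /prodf_eq0[i i0].
  rewrite /= mderiv_exp mderivXU eqxx mulr1 (rmorphMn (meval w)) /= mevalXn mevalXU.
  rewrite -mulr_natl mulf_eq0 (negPf dR) /= expf_eq0 => /andP[_]; by rewrite (negPf (wn0 i i0)).
pose mu k := w k / x k.
have muE k : mu k * x k = w k by rewrite divfK.
case: (classic (exists k, mu k != 1)) => [hk|nk]; last first.
  move=> a; rewrite -muE; case: (eqVneq (mu a) 1) => [->|h]; first by rewrite mul1r.
  by case: nk; exists a.
have : Phi mu != 0.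
  apply: hPhi => //; rewrite /mu.
  - by rewrite x0 divr1.
  - by rewrite x1 w1 divr1.
  - by move=> k k0; rewrite expr_div_n wv // divff // expf_neq0.
case/negP; have := hw ord0; rewrite exf2_eval0 // exf2_eval0 ?x0 ?expr1n // mulr1 /Phi /=.
have -> : mu ord0 = w ord0 by rewrite /mu x0 divr1.
have -> : \sum_(k | oth k) (mu k ^+ d - 1) * x k ^+ d = \sum_(k | oth k) w k ^+ d - \sum_(k | oth k) x k ^+ d.
  by rewrite -sumrB; apply: eq_bigr => k _; rewrite mulrBl mul1r -exprMn muE.
have -> : \sum_(k | oth k) mu k * x k = \sum_(k | oth k) w k by apply: eq_bigr => k _.
move: (\sum_(k | oth k) w k) (\sum_(k | oth k) w k ^+ d) (\sum_(k | oth k) x k ^+ d) => A B C.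
move: (_ ^+ d) (_ ^+ d) => U V E; apply/eqP.
move: E; set LL := _ + tau; set RR := _ + tau => E.
by rewrite -[RHS](subrr LL) {2}E /LL /RR; ring.
Qed.

Definition exz i := (fiter exf 2 i).@[x].

Lemma exz1 : exz i1 = 1.
Proof. by rewrite /exz exf2_S // mevalXn mevalXU x1 expr1n. Qed.

Lemma ex_zeros y : (forall o, (fibgen exf exz o).@[y] = 0) -> forall a, y a = y i1 * x a.
Proof.
move=> hy; have hyP := hy None.
have hyf i : (fiter exf 2 i).@[y] = y i1 ^+ (d * d) * exz i.
  have := hy (Some (i, i1)); rewrite /fibgen exz1 scale1r mevalB mevalZ (exf2_S i1_neq0) mevalXn mevalXU.
  by move=> /eqP; rewrite subr_eq0 mulrC => /eqP.
(* For [y i1 = 0] all coordinates of [f^2] vanish at [y], hence [y] itself does; otherwise [y] is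
   scaled to [y i1 = 1]. *)
have [y1|y1] := eqVneq (y i1) 0.
  have ddp : (0 < d * d)%N by rewrite muln_gt0 d0.
  have hyf0 i : (fiter exf 2 i).@[y] = 0 by rewrite hyf y1 expr0n gtn_eqF // mul0r.
  have ys i : i != ord0 -> y i = 0.
    move=> i0; have := hyf0 i; rewrite (exf2_S i0) mevalXn mevalXU => /eqP.
    by rewrite expf_eq0 => /andP[_ /eqP].
  move=> a; rewrite y1 mul0r; have [->|] := eqVneq a ord0; last exact: ys.
  have e0 : peval exf y ord0 = y ord0 ^+ d.
    by rewrite /peval exf_eval0 y1 !expr0n !gtn_eqF // !mulr0 !subr0 addr0.
  have e1 : peval exf y i1 = 0 by rewrite /peval exf_evalS // y1 expr0n gtn_eqF.
  have := hyf0 ord0; rewrite fiter_eval /= {1}/peval exf_eval0 e1 !expr0n !gtn_eqF // !mulr0 !subr0 addr0.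
  by rewrite e0 => /eqP; rewrite -exprM expf_eq0 => /andP[_ /eqP].
have h a : (y i1)^-1 * y a = x a.
  apply: (@ex_fibre (fun a => (y i1)^-1 * y a)).
  - by rewrite mulVf.
  - move=> i; rewrite (dhomog_scale _ _ (fiter_homog 2 exf_homog i)) hyf mulrA -mulnn.
    by rewrite -exprMn mulVf // expr1n mul1r.
  - by rewrite (dhomog_scale _ _ (dhomog_jac exf_homog)) [(jac _).@[_]]hyP mulr0.
by move=> a; rewrite -h mulrA divff // mul1r.
Qed.

Lemma ex_tangent v : (forall o, pder x v (fibgen exf exz o) = 0) -> forall a, v a = v i1 * x a.
Proof.
move=> hv a; have ddR : ((d * d)%:R : F) != 0 by rewrite natrM mulf_neq0.
have [->|a0] := eqVneq a ord0.
  have := hv None; rewrite /fibgen jac_exf pderM ex0_deriv mevalZ mevalB !mevalXn !mevalXU x0 x1 subrr.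
  rewrite mulr0 mul0r add0r pderZ pderD pderN !pder_exp !pderX !mevalXU x0 x1 !expr1n !mulr1 => /eqP.
  rewrite mulf_eq0 => /orP[|].
    rewrite rmorph_prod => /prodf_eq0[i i0].
    rewrite /= mderiv_exp mderivXU eqxx mulr1 (rmorphMn (meval x)) /= mevalXn mevalXU.
    by rewrite -mulr_natl mulf_eq0 (negPf dR) /= expf_eq0 (negPf (xn0 i)) andbF.
  rewrite mulf_eq0 (negPf dR) /= -mulrBr mulf_eq0 => /orP[|].
    by rewrite (negPf (natr_neq0 hchar _)) // -lt0n.
  by rewrite subr_eq0 => /eqP.
have := hv (Some (a, i1)); rewrite /fibgen exz1 scale1r (exf2_S i1_neq0) /exz (exf2_S a0).
rewrite pderD pderN pderZ !pder_exp !pderX mevalXn !mevalXU x1 expr1n mulr1 => /eqP.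
rewrite subr_eq0 => /eqP E.
have dd1 : (0 < d * d)%N by rewrite muln_gt0 d0.
move: E; rewrite mulrCA -mulrA => /(mulfI ddR); rewrite -{2}(prednK dd1) exprS => E.
have xx : x a ^+ (d * d).-1 != 0 by rewrite expf_neq0.
apply: (mulfI xx); rewrite E; ring.
Qed.

End Params.

Lemma roots_of_unity_finite L : (0 < L)%N -> exists rs : seq F, forall y, y ^+ L = 1 -> y \in rs.
Proof.
move=> L0; have [rs rsE] := closed_field_poly_normal ('X^L - 1 : {poly F}).
exists rs => y yL; have : root ('X^L - 1 : {poly F}) y.
  by rewrite rootE !hornerE yL subrr.
rewrite rsE lead_coefDl ?lead_coefXn ?scale1r ?root_prod_XsubC //.
by rewrite size_polyN size_poly1 size_polyXn ltnS.
Qed.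

(** The values at [tau = - a] and [tau = b - 2 a] differ by [(2 ^ d - 2) (b - a) ^ d], so the
    expression is not identically zero in [tau]. *)
Lemma shifted_powers_differ (a b C : F) : a != b ->
  exists tau, ((tau + b) ^+ d - d%:R * (tau + b)) - ((tau + a) ^+ d - d%:R * (tau + a)) - C != 0.
Proof.
move=> ab; apply: NNPP => h.
have E tau : ((tau + b) ^+ d - d%:R * (tau + b)) - ((tau + a) ^+ d - d%:R * (tau + a)) - C = 0.
  by apply/eqP/negP => /negP ht; apply: h; exists tau.
have e1 := E (- a); have e2 := E (b - a - a).
have h1 : b - a - a + b = 2%:R * (b - a) by ring.
have h2 : b - a - a + a = b - a by ring.
have h3 : - a + b = b - a by ring.
have h4 : - a + a = 0 by ring.
rewrite h3 h4 expr0n gtn_eqF //= in e1; rewrite h1 h2 exprMn in e2.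
have ba : b - a != 0 by rewrite subr_eq0 eq_sym.
have : (2%:R ^+ d - 2%:R) * (b - a) ^+ d = 0.
  have := subrr (0 : F); rewrite -{1}e2 -e1; move: (_ ^+ d) (2%:R ^+ d) => U V <-; ring.
move/eqP; rewrite mulf_eq0 expf_eq0 (negPf ba) andbF orbF -natrX subr_eq0.
have -> : (2 ^ d = 2 + (2 ^ d - 2))%N by rewrite subnKC // -{1}(expn1 2) leq_exp2l.
rewrite natrD -[X in _ == X]addr0 (inj_eq (addrI _)).
by rewrite (negPf (natr_neq0 hchar _)) // subn_eq0 -ltnNge -{1}(expn1 2) ltn_exp2l.
Qed.

(** Only finitely many [mu] matter, vectors of roots of unity encoded by positions in [rs]. Each
    condition is polynomial in [c], whose coordinate [ord0] carries [tau], so it suffices to satisfy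
    them one at a time. *)
Lemma example_params : exists tau x, [/\ x ord0 = 1, x i1 = 1, forall i, x i != 0 &
  forall mu, mu ord0 ^+ d.-1 = 1 -> mu i1 = 1 -> (forall k, k != ord0 -> mu k ^+ (d * d) = 1) ->
    (exists k, mu k != 1) -> Phi tau x mu != 0].
Proof.
have L0 : (0 < d.-1 * (d * d))%N by rewrite !muln_gt0 dp0 d0.
have [rs hrs] := roots_of_unity_finite L0.
pose I : finType := ('I_N + {ffun 'I_N -> 'I_(size rs)})%type.
pose muf (g : {ffun 'I_N -> 'I_(size rs)}) k := nth 0 rs (g k).
pose triv (g : {ffun 'I_N -> 'I_(size rs)}) := (muf g i1 != 1) || [forall k, muf g k == 1].
pose u (i : I) (c : 'I_N -> F) := match i with inl k => c k
  | inr g => if triv g then 1 else Phi (c ord0) c (muf g) end.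
have [|i|c hc] := @pf_common F hchar N I u.
- move=> [k|g]; rewrite /u; first exact: pf_coord.
  case: (triv g); first exact: pf_const.
  have pq v : polyfun v -> polyfun (fun c : 'I_N -> F => v c ^+ d - d%:R * v c).
    move=> hv; apply: pf_add; first exact: pf_exp.
    by apply: pf_opp; apply: pf_mul => //; apply: pf_const.
  apply: pf_add; first apply: pf_add.
  + apply: pq; apply: pf_add; first exact: pf_coord.
    apply: pf_add; first exact: pf_const.
    by apply: pf_opp; apply: pf_sum => k; apply: pf_mul; [apply: pf_const|apply: pf_coord].
  + apply: pf_opp; apply: pq; apply: pf_add; first exact: pf_coord.
    apply: pf_add; first exact: pf_const.
    by apply: pf_opp; apply: pf_sum => k; apply: pf_coord.
  + apply: pf_opp; apply: pf_sum => k; apply: pf_mul; first exact: pf_const.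
    by apply: pf_exp; apply: pf_coord.
- case: i => [k|g]; first by exists (fun=> 1); rewrite oner_eq0.
  rewrite /u; have [_|] := boolP (triv g); first by exists (fun=> 0); rewrite oner_eq0.
  rewrite negb_or negbK => /andP[/eqP g1 /forallPn[k gk]].
  set mu := muf g.
  (* Once the linear terms inside the two [d]-th powers differ, a shift by [tau] makes [Phi]
     nonzero. *)
  suff [y hy] : exists y : 'I_N -> F, (1 - d%:R) - \sum_(k | oth k) y k !=
      (1 - d%:R) * mu ord0 - \sum_(k | oth k) mu k * y k.
    have [tau ht] := shifted_powers_differ (\sum_(k | oth k) (mu k ^+ d - 1) * y k ^+ d) hy.
    exists (fun k => if k == ord0 then tau else y k); rewrite /Phi eqxx.
    have E (G : 'I_N -> F -> F) : \sum_(k | oth k) G k (if k == ord0 then tau else y k) = \sum_(k | oth k) G k (y k).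
      by apply: eq_bigr => k' /andP[/negPf-> _].
    by rewrite (E (fun _ a => a)) (E (fun k a => mu k * a)) (E (fun k a => (mu k ^+ d - 1) * a ^+ d)).
  have d1R : 1 - d%:R != 0 :> F.
    rewrite -opprB oppr_eq0 -[d%:R](congr1 (fun k => k%:R) (prednK d0)) -addn1 natrD addrK.
    by apply: natr_neq0 => //; rewrite -lt0n.
  have [k0|k0] := eqVneq k ord0.
    exists (fun=> 0); under [X in _ != _ - X]eq_bigr do rewrite mulr0.
    rewrite !big1_eq !subr0.
    rewrite -{1}[1 - _]mulr1 (inj_eq (mulfI d1R)) eq_sym -k0; exact: gk.
  have ok : oth k by rewrite /oth k0; apply: contraNneq gk => ->; apply/eqP; exact: g1.
  pose de y : 'I_N -> F := fun j => if j == k then y else 0.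
  have dE y : \sum_(j | oth j) de y j = y.
    rewrite (bigD1 k) //= /de eqxx big1 ?addr0 // => j /andP[_ /negPf->] //.
  have dE' y : \sum_(j | oth j) mu j * de y j = mu k * y.
    rewrite (bigD1 k) //= /de eqxx big1 ?addr0 // => j /andP[_ /negPf->]; by rewrite mulr0.
  have [h|h] := eqVneq (mu ord0) 1.
    exists (de 1); rewrite dE dE' h !mulr1 (inj_eq (addrI _)) eqr_opp eq_sym; exact: gk.
  exists (de 0); rewrite dE dE' mulr0 !subr0 -{1}[1 - _]mulr1 (inj_eq (mulfI d1R)) eq_sym; exact: h.
pose x : 'I_N -> F := fun k => if oth k then c k else 1.
exists (c ord0), x; split.
- by rewrite /x /oth eqxx.
- by rewrite /x /oth eqxx andbF.
- move=> i; rewrite /x; case: ifP; rewrite ?oner_eq0 // => _; exact: (hc (inl i)).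
move=> mu m0 m1 mk [k hk].
have hmu j : mu j \in rs.
  apply: hrs; have [->|j0] := eqVneq j ord0; first by rewrite exprM m0 expr1n.
  by rewrite mulnC exprM mk // expr1n.
have hi j : (index (mu j) rs < size rs)%N by rewrite index_mem.
pose g : {ffun 'I_N -> 'I_(size rs)} := [ffun j => Ordinal (hi j)].
have gE j : muf g j = mu j by rewrite /muf ffunE /= nth_index.
have := hc (inr g); rewrite /u.
have -> : triv g = false.
  rewrite /triv gE m1 eqxx /=; apply/negbTE/forallPn; exists k; by rewrite gE.
rewrite /Phi gE.
have -> : \sum_(k | oth k) x k = \sum_(k | oth k) c k by apply: eq_bigr => j oj; rewrite /x oj.
have -> : \sum_(k | oth k) mu k * x k = \sum_(k | oth k) muf g k * c k.
  by apply: eq_bigr => j oj; rewrite /x oj gE.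
suff -> : \sum_(k | oth k) (mu k ^+ d - 1) * x k ^+ d = \sum_(k | oth k) (muf g k ^+ d - 1) * c k ^+ d.
  by [].
by apply: eq_bigr => j oj; rewrite /x oj gE.
Qed.

Lemma birational_example : exists (f : polymap F n.+1) (x : 'I_N -> F),
  let z i := (fiter f 2 i).@[x] in
  [/\ forall i, f i \is d.-homog, z i1 = 1, (jac f).@[x] = 0 /\ jac f != 0 &
    exists T, forall t p, (T <= t)%N -> p \is t.-homog -> p.@[x] = 0 ->
      exists c, [/\ forall o : option ('I_N * 'I_N), (fibdeg d o <= t)%N, forall o, c o \is (t - fibdeg d o).-homog &
        p = \sum_o c o * fibgen f z o]].
Proof.
have [tau [x [x0 x1 xn0 hPhi]]] := example_params.
exists (exf tau), x => z; split.
- exact: exf_homog.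
- exact: (exz1 tau x1).
- by split; [exact: (jac_exf_x tau x0 x1)|exact: jac_exf_neq0].
pose O := option ('I_N * 'I_N).
pose h (k : 'I_#|{: O}|) := fibgen (exf tau) z (enum_val k).
have hh k : h k \is (fibdeg d (enum_val k)).-homog by apply: fibgen_homog; apply: exf_homog.
have [T hT] : exists T, forall t p, (T <= t)%N -> p \is t.-homog -> p.@[x] = 0 -> inI h p.
  apply: (simple_point (closed_infinite hchar) hh x1).
  - move=> k; rewrite /h; case: (enum_val k) => [[i j]|] /=; last exact: (jac_exf_x tau x0 x1).
    by rewrite mevalB !mevalZ -/(z i) -/(z j) mulrC subrr.
  - move=> y hy; apply: (ex_zeros x0 x1 xn0 hPhi) => o; have := hy (enum_rank o).
    by rewrite /h enum_rankK.
  move=> v hv; apply: (ex_tangent x0 x1 xn0) => o; have := hv (enum_rank o).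
  rewrite /h enum_rankK /z /exz => hvo; exact: hvo.
(* The added terms ensure that no degree [t - fibdeg d o] is truncated. *)
exists (T + d ^ 2 + N * d.-1)%N => t p Tt hp px.
have [|c cE] := hT t p _ hp px; first by move: Tt; clear; lia.
have dt (o : O) : (fibdeg d o <= t)%N.
  rewrite (leq_trans _ Tt) // /fibdeg; case: o => [_|]; last exact: leq_addl.
  by rewrite -addnA addnCA leq_addr.
exists (fun o => hcomp (t - fibdeg d o) (c (enum_rank o))); split=> //.
  by move=> o; apply: pihomogP.
rewrite -(pihomog_dE hp) cE linear_sum /=.
rewrite [RHS](reindex (@enum_val O predT)) /=; last exact: (onW_bij _ (enum_val_bij _)).
by apply: eq_bigr => k _; rewrite (hcompM _ _ (hh k)) dt enum_valK.
Qed.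

End Example.

(** * Interpolation of forms and Cramer's rule *)

Section Interpolation.
Variable F : fieldType.

Lemma det_right_kernel M (V : 'M[F]_M) (be : 'I_M -> F) : \det V != 0 ->
  (forall i, \sum_l V i l * be l = 0) -> forall l, be l = 0.
Proof.
move=> dV h l; apply/eqP/negP => /negP bl; case/negP: dV; rewrite -det_tr; apply/det0P.
exists (\row_l be l); first by apply: contraNneq bl => /(congr1 (fun A : 'rV_M => A 0 l)); rewrite !mxE => ->.
by apply/rowP => i; rewrite [RHS]mxE mxE -[RHS](h i); apply: eq_bigr => j _; rewrite !mxE mulrC.
Qed.

Lemma select_rows (I : finType) M (V : I -> 'I_M -> F) :
  (forall be, (forall a, \sum_l V a l * be l = 0) -> forall l, be l = 0) ->
  exists sel : 'I_M -> I, \det (\matrix_(i, l) V (sel i) l) != 0.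
Proof.
move=> h; pose A : 'M[F]_(#|I|, M) := \matrix_(k, l) V (enum_val k) l.
have fA : row_full A.
  rewrite /row_full -mxrank_tr -/(row_free A^T) -kermx_eq0; apply/eqP/row_matrixP => i.
  rewrite row0; apply/rowP => l; rewrite [RHS]mxE.
  apply: (h (fun l => row i (kermx A^T) 0 l)) => a.
  have E : row i (kermx A^T) *m A^T = 0 by rewrite -row_mul mulmx_ker row0.
  have := congr1 (fun B : 'rV[F]_#|I| => B 0 (enum_rank a)) E; rewrite /= [in RHS]mxE mxE => E'.
  by rewrite -[RHS]E'; apply: eq_bigr => j _; rewrite [A^T _ _]mxE [A _ _]mxE enum_rankK mulrC.
exists (fun i => enum_val (fullrankfun fA i)).
have := fullrowsub_unit fA; rewrite unitmxE unitfE.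
suff -> : rowsub (fullrankfun fA) A = \matrix_(i, l) V (enum_val (fullrankfun fA i)) l by [].
by apply/matrixP => i j; rewrite !mxE.
Qed.

(** The combination [b V - a V'] in row [l0] is orthogonal to [al] like all other rows; so either
    its determinant vanishes, which is the claim, or [al = 0]. *)
Lemma cramer_row M (V V' : 'M[F]_M) l0 (al : 'I_M -> F) :
  (forall i, i != l0 -> forall l, V' i l = V i l) ->
  (forall i, i != l0 -> \sum_l V i l * al l = 0) ->
  \det V * (\sum_l V' l0 l * al l) = \det V' * (\sum_l V l0 l * al l).
Proof.
move=> eV kV; pose a := \sum_l V l0 l * al l; pose b := \sum_l V' l0 l * al l.
pose W : 'M[F]_M := \matrix_(i, l) if i == l0 then b * V l0 l - a * V' l0 l else V i l.
have dW : \det W = b * \det V + (- a) * \det V'.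
  apply: (@determinant_multilinear _ _ W V V' l0).
  - by apply/rowP => l; rewrite !mxE eqxx mulNr.
  - by apply/matrixP => i l; rewrite !mxE eq_sym (negPf (neq_lift _ _)).
  - by apply/matrixP => i l; rewrite !mxE eq_sym (negPf (neq_lift _ _)) eV // eq_sym neq_lift.
case: (eqVneq (\det W) 0) => [d0|dn].
  move: dW; rewrite d0 mulNr => /esym/eqP; rewrite subr_eq0 -/a -/b => /eqP E.
  by rewrite mulrC E mulrC.
have al0 l : al l = 0.
  apply: (det_right_kernel dn) => i; have [->|il] := eqVneq i l0.
    transitivity (b * a - a * b); last by rewrite mulrC subrr.
    rewrite {1}/a {2}/b !mulr_sumr -sumrB; apply: eq_bigr => j _; by rewrite mxE eqxx mulrBl !mulrA.
  by rewrite -[RHS](kV i il); apply: eq_bigr => j _; rewrite mxE (negPf il).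
by rewrite !big1 ?mulr0 // => l _; rewrite al0 mulr0.
Qed.

Hypothesis Finf : forall s : seq F, exists x, x \notin s.

Lemma unisolvent_fin n (I : finType) (g : I -> {mpoly F[n]}) :
  (forall al : I -> F, \sum_i al i *: g i = 0 -> forall i, al i = 0) ->
  exists x : 'I_#|I| -> 'I_n -> F, \det (\matrix_(i, l) (g (enum_val i)).@[x l]) != 0.
Proof.
move=> ind; apply: (unisolvent Finf (g := fun i => g (enum_val i))) => al E i.
have := ind (fun i => al (enum_rank i)) _ (enum_val i); rewrite enum_valK; apply.
rewrite -[RHS]E (reindex (@enum_val I predT)) /=; last exact: (onW_bij _ (enum_val_bij _)).
by apply: eq_bigr => k _; rewrite enum_valK.
Qed.

(** With as many points as monomials and an invertible matrix of values, evaluation at any [y] is a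
    combination of evaluations at the points. *)
Lemma interpolation_points n t : exists M (x : 'I_M -> 'I_n -> F),
  (forall be, (forall p, p \is t.-homog -> \sum_l p.@[x l] * be l = 0) -> forall l, be l = 0) /\
  (forall y, exists al, forall p, p \is t.-homog -> p.@[y] = \sum_l p.@[x l] * al l).
Proof.
pose I : finType := {m : 'X_{1..n < t.+1} | mdeg m == t}.
pose g (i : I) : {mpoly F[n]} := 'X_[bmnm (val i)].
have hg i : g i \is t.-homog by rewrite dhomogX; exact: (valP i).
have [al E i|x dx] := @unisolvent_fin n I g.
  have := congr1 (mcoeff (bmnm (val i))) E.
  rewrite mcoeff0 raddf_sum (bigD1 i) //= mcoeffZ mcoeffX eqxx mulr1 big1 ?addr0 // => j ji.
  by rewrite mcoeffZ mcoeffX (inj_eq val_inj) (inj_eq val_inj) (negPf ji) mulr0.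
exists #|I|, x.
have span p : p \is t.-homog -> exists c : 'I_#|I| -> F, p = \sum_i c i *: g (enum_val i).
  move=> /dhomogP hp; rewrite [p]mpolyE big_seq.
  elim/big_ind: _ => [|p1 p2 [c1 ->] [c2 ->]|m mp].
  - by exists (fun=> 0); rewrite big1 // => i _; rewrite scale0r.
  - exists (fun i => c1 i + c2 i); rewrite -big_split; apply: eq_bigr => i _; by rewrite /= scalerDl.
  have mt : mdeg m = t := hp m mp.
  have lt : (mdeg m < t.+1)%N by rewrite mt.
  have mt' : mdeg (BMultinom lt) == t by apply/eqP.
  pose i0 : I := exist _ (BMultinom lt) mt'.
  exists (fun i => if i == enum_rank i0 then p@_m else 0).
  rewrite (bigD1 (enum_rank i0)) //= eqxx enum_rankK big1 ?addr0 // => i /negPf->.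
  by rewrite scale0r.
split=> [be hb|y].
  by apply: (det_right_kernel dx) => i; rewrite -[RHS](hb _ (hg (enum_val i))); apply: eq_bigr => l _; rewrite mxE.
pose V : 'M[F]_#|I| := \matrix_(i, l) (g (enum_val i)).@[x l].
have uV : V \in unitmx by rewrite unitmxE unitfE.
pose w : 'cV[F]_#|I| := \col_i (g (enum_val i)).@[y].
exists (fun l => (invmx V *m w) l 0) => p /span[c ->].
have E (i : 'I_#|I|) : (g (enum_val i)).@[y] = \sum_l (g (enum_val i)).@[x l] * (invmx V *m w) l 0.
  have := congr1 (fun A : 'cV[F]_#|I| => A i 0) (mulKVmx uV w); rewrite /= [in RHS]mxE mxE => <-.
  by apply: eq_bigr => l _; rewrite mxE.
rewrite (raddf_sum (meval y)) /=.
transitivity (\sum_i \sum_l c i * ((g (enum_val i)).@[x l] * (invmx V *m w) l 0)).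
  by apply: eq_bigr => i _; rewrite mevalZ E mulr_sumr.
rewrite exchange_big; apply: eq_bigr => l _ /=.
rewrite (raddf_sum (meval (x l))) /= mulr_suml; apply: eq_bigr => i _; by rewrite mevalZ mulrA.
Qed.

End Interpolation.

Lemma dhomog_det (F : closedFieldType) n M (A : 'M[{mpoly F[n]}]_M) (ka : 'I_M -> nat) :
  (forall i j, A i j \is (ka i).-homog) -> \det A \is (\sum_i ka i)%N.-homog.
Proof.
move=> hA; apply: rpred_sum => s _; rewrite -signr_odd -(rmorph_sign (@mpolyC n F)).
rewrite mul_mpolyC rpredZ //.
by elim/big_rec2: _ => [|i q1 d1 _ IH]; [exact: dhomog1|apply: dhomogM].
Qed.

Section GenericBirational.
Variable F : closedFieldType.
Hypothesis hchar : [pchar F] =i pred0.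
Variables (n d : nat).
Hypothesis d2 : (1 < d)%N.
Notation N := n.+2.
Let Finf := closed_infinite hchar.
Let K := #|{: coef_index n.+1 d}|.
Notation j1 := (@i1 n).

Section Determinants.
Variables (t r M : nat) (xs : 'I_M -> 'I_N -> F).
(** Labels of forms of degree [t]: monomial multiples of the fibre equations, and [None] for a power
    of [f^2] that does not vanish at the base point. *)
Definition lab : finType := option (option ('I_N * 'I_N) * 'X_{1..N < t.+1}).

Definition rho (f : polymap F n.+1) (z : 'I_N -> F) (a : lab) : {mpoly F[N]} :=
  match a with
  | Some (o, ga) => if (mdeg ga + fibdeg d o == t)%N then 'X_[bmnm ga] * fibgen f z o else 0
  | None => fiter f 2 j1 ^+ r
  end.

(** The values of [rho] at a fixed point, seen as polynomials in [z], so that determinants of them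
    can be composed with [f^2]. *)
Definition ent (f : polymap F n.+1) (a : lab) (w : 'I_N -> F) : {mpoly F[N]} :=
  match a with
  | Some (o, ga) => if (mdeg ga + fibdeg d o == t)%N then
      ('X_[bmnm ga] : {mpoly F[N]}).@[w] *: (if o is Some ij then
        (fiter f 2 ij.1).@[w] *: 'X_(ij.2) - (fiter f 2 ij.2).@[w] *: 'X_(ij.1)
        else ((jac f).@[w])%:MP) else 0
  | None => ((fiter f 2 j1).@[w] ^+ r)%:MP
  end.

Lemma entE f a w z : (ent f a w).@[z] = (rho f z a).@[w].
Proof.
case: a => [[o ga]|] /=; last by rewrite mevalC mevalXn.
case: ifP => _; last by rewrite !meval0.
rewrite mevalZ mevalM; congr (_ * _); case: o => [ij|] /=; last by rewrite mevalC.
by rewrite !mevalB !mevalZ !mevalXU mulrC [X in _ - X]mulrC.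
Qed.

Definition rowdeg (a : lab) : nat := if a is Some (Some _, _) then 1%N else 0%N.

Lemma ent_homog f a w : ent f a w \is (rowdeg a).-homog.
Proof.
case: a => [[o ga]|] /=; last by rewrite -[_%:MP]mulr1 mul_mpolyC rpredZ // dhomog1.
case: ifP => _; last by rewrite rpred0.
rewrite rpredZ //; case: o => [ij|].
  by rewrite rpredB // rpredZ // dhomogX /= mdeg1.
by rewrite -[_%:MP]mulr1 mul_mpolyC rpredZ // dhomog1.
Qed.

Lemma rho_homog f z a : (forall i, f i \is d.-homog) -> t = (d ^ 2 * r)%N -> rho f z a \is t.-homog.
Proof.
move=> hf tE; case: a => [[o ga]|] /=; last by rewrite tE; apply: dhomog_exp; apply: fiter_homog.
case: ifP => [/eqP E|_]; last by rewrite rpred0.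
have : 'X_[bmnm ga] * fibgen f z o \is (mdeg ga + fibdeg d o).-homog.
  by apply: dhomogM; [rewrite dhomogX|apply: fibgen_homog].
by rewrite E.
Qed.

Lemma pf_fiter2 i (x : 'I_N -> ('I_K -> F) -> F) : (forall j, polyfun (x j)) ->
  polyfun (fun c => (fiter (fc c) 2 i).@[fun j => x j c]).
Proof.
move=> hx; apply: (@pf_ext _ _ (fun c => (fc c i).@[fun j => (fc c j).@[fun k => x k c]])).
  by move=> c; rewrite fiter_eval.
by apply: pf_meval_fc => j; apply: pf_meval_fc.
Qed.

Lemma pf_jac (x : 'I_N -> F) : polyfun (fun c : 'I_K -> F => (jac (fc c)).@[x]).
Proof.
apply: (@pf_ext _ _ (fun c => \det (\matrix_(i, j) ((fc c i)^`M(j)).@[x]))).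
  by move=> c; rewrite meval_jac.
by apply: pf_det => i j; apply: pf_mderiv_fc => k; apply: pf_const.
Qed.

Lemma pf_ent a w (z : 'I_N -> ('I_K -> F) -> F) : (forall j, polyfun (z j)) ->
  polyfun (fun c => (ent (fc c) a w).@[fun j => z j c]).
Proof.
move=> hz; have pw i : polyfun (fun c : 'I_K -> F => (fiter (fc c) 2 i).@[w]).
  by apply: (pf_fiter2 i (x := fun j _ => w j)) => j; apply: pf_const.
case: a => [[o ga]|] /=; last first.
  apply: (@pf_ext _ _ (fun c => (fiter (fc c) 2 j1).@[w] ^+ r)); first by move=> c; rewrite mevalC.
  exact: pf_exp.
case: (mdeg ga + fibdeg d o == t)%N; last first.
  by apply: (@pf_ext _ _ (fun=> 0)); [move=> c; rewrite meval0|apply: pf_const].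
apply: (@pf_ext _ _ (fun c => ('X_[bmnm ga] : {mpoly F[N]}).@[w] *
  (if o is Some ij then (fiter (fc c) 2 ij.1).@[w] * z ij.2 c - (fiter (fc c) 2 ij.2).@[w] * z ij.1 c
   else (jac (fc c)).@[w]))).
  move=> c; rewrite mevalZ; case: o => [ij|]; last by rewrite mevalC.
  by rewrite mevalB !mevalZ !mevalXU.
apply: pf_mul; first exact: pf_const.
case: o => [ij|]; last exact: pf_jac.
by apply: pf_add; last apply: pf_opp; apply: pf_mul.
Qed.

Variables (sel : 'I_M -> lab) (l0 : 'I_M).
Hypothesis sel0 : sel l0 = None.
Hypothesis selS : forall i, i != l0 -> sel i != None.
Hypothesis tE : t = (d ^ 2 * r)%N.
Hypothesis interp : forall y, exists al, forall p : {mpoly F[N]}, p \is t.-homog ->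
  p.@[y] = \sum_l p.@[xs l] * al l.

Definition spoly f : {mpoly F[N]} := \det (\matrix_(i, l) ent f (sel i) (xs l)).
Definition upoly f (m : 'X_{1..N}) : {mpoly F[N]} := 'X_j1 ^+ r *
  \det (\matrix_(i, l) if i == l0 then (('X_[m] : {mpoly F[N]}).@[xs l])%:MP else ent f (sel i) (xs l)).
Definition sdeg : nat := \sum_i rowdeg (sel i).

Lemma spoly_homog f : spoly f \is sdeg.-homog.
Proof. by apply: dhomog_det => i l; rewrite mxE ent_homog. Qed.

Lemma upoly_homog f m : upoly f m \is (sdeg + r).-homog.
Proof.
rewrite addnC; apply: dhomogM.
  have hX : ('X_j1 : {mpoly F[N]}) \is 1.-homog by rewrite dhomogX /= mdeg1.
  by have := dhomog_exp r hX; rewrite mul1n.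
apply: dhomog_det => i l; rewrite mxE; case: eqP => [->|_]; last exact: ent_homog.
by rewrite sel0 -[_%:MP]mulr1 mul_mpolyC rpredZ // dhomog1.
Qed.

Lemma spoly_eval f z : (spoly f).@[z] = \det (\matrix_(i, l) (rho f z (sel i)).@[xs l]).
Proof.
by rewrite /spoly -det_map_mx; congr (\det _); apply/matrixP => i l; rewrite !mxE /= entE.
Qed.

(** For [z = f^2(y)] with [y] on the critical locus, every selected form except the row [l0]
    vanishes at [y], and that row has the value [z j1 ^+ r]. Evaluation at [y] is a combination of
    those at the [xs l], so Cramer's rule expresses the monomial in terms of [z]. *)
Lemma spoly_upoly f y m : (forall i, f i \is d.-homog) -> (jac f).@[y] = 0 -> mdeg m = t ->
  (msub (fiter f 2) (spoly f)).@[y] * 'X_[m].@[y] = (msub (fiter f 2) (upoly f m)).@[y].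
Proof.
move=> hf Py mt; rewrite !meval_msub; set z := fun i => (fiter f 2 i).@[y].
have [al hal] := interp y.
have hm : ('X_[m] : {mpoly F[N]}) \is t.-homog by rewrite dhomogX /= mt.
rewrite /upoly mevalM mevalXn mevalXU spoly_eval -det_map_mx.
set V := \matrix_(i, l) _; set V' := map_mx _ _.
have := @cramer_row F M V V' l0 al.
have -> : \sum_l V' l0 l * al l = 'X_[m].@[y].
  by rewrite (hal _ hm); apply: eq_bigr => l _; rewrite !mxE eqxx /= mevalC.
have -> : \sum_l V l0 l * al l = z j1 ^+ r.
  have hr : fiter f 2 j1 ^+ r \is t.-homog by rewrite tE; apply: dhomog_exp; apply: fiter_homog.
  by rewrite /z -mevalXn (hal _ hr); apply: eq_bigr => l _; rewrite !mxE sel0.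
move=> H; rewrite [RHS]mulrC; apply: H.
  by move=> i il l; rewrite !mxE (negPf il) /= entE.
move=> i il; have hr := rho_homog z (sel i) hf tE.
transitivity ((rho f z (sel i)).@[y]).
  by rewrite (hal _ hr); apply: eq_bigr => l _; rewrite !mxE.
case: (sel i) (selS il) => [[o ga]|] //= _; case: ifP => _; last by rewrite meval0.
rewrite mevalM; apply/eqP; rewrite mulf_eq0; apply/orP; right.
case: o => [ij|] /=; last by rewrite Py.
by rewrite mevalB !mevalZ -/(z ij.1) -/(z ij.2) mulrC subrr.
Qed.

End Determinants.

(* Non-divisibility is witnessed by linear independence of the multiples of [P f] and [A f]. *)
Lemma gen_not_dv D e (P A : polymap F n.+1 -> {mpoly F[N]}) f0 :
  (forall f, (forall i, f i \is d.-homog) -> P f \is e.-homog) ->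
  (forall f, (forall i, f i \is d.-homog) -> A f \is D.-homog) ->
  (forall x, polyfun (fun c : 'I_K -> F => (P (fc c)).@[x])) ->
  (forall x, polyfun (fun c : 'I_K -> F => (A (fc c)).@[x])) ->
  (forall i, f0 i \is d.-homog) -> P f0 != 0 -> ~ dv (P f0) (A f0) ->
  gen d (fun f => ~ dv (P f) (A f)).
Proof.
move=> hP hA pP pA hf0 P0 nd.
pose I : finType := option 'X_{1..N < D.+1}.
pose g f (o : I) := if o is Some ga then 'X_[bmnm ga] * P f else A f.
have [al E|w dw] := @unisolvent_fin F Finf N I (g f0).
  rewrite (bigD1 None) //= in E.
  pose B := \sum_(ga : 'X_{1..N < D.+1}) al (Some ga) *: 'X_[bmnm ga] : {mpoly F[N]}.
  have EB : al None *: A f0 + P f0 * B = 0.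
    rewrite -[RHS]E; congr (_ + _); rewrite mulr_sumr [RHS](reindex_omap Some id) /=; last by case.
    by apply: eq_big => [ga|ga _]; rewrite ?eqxx // -scalerAr mulrC.
  have aN : al None = 0.
    apply/eqP/negP => /negP aN; apply: nd; exists (- (al None)^-1 *: B).
    apply: (can_inj (scalerK aN)); rewrite -[LHS](addrK (P f0 * B)) EB sub0r.
    by rewrite -scalerAr scalerA mulrN divff // scaleN1r.
  move: EB; rewrite aN scale0r add0r => /eqP; rewrite mulf_eq0 (negPf P0) => /= /eqP B0.
  move=> [ga|//]; have := congr1 (mcoeff (bmnm ga)) B0.
  rewrite mcoeff0 raddf_sum (bigD1 ga) //= mcoeffZ mcoeffX eqxx mulr1 big1 ?addr0 // => j ji.
  by rewrite mcoeffZ mcoeffX (inj_eq val_inj) (negPf ji) mulr0.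
apply: (@gen_pf F n.+1 d (fun c => \det (\matrix_(i, l) (g (fc c) (enum_val i)).@[w l])) f0).
- apply: pf_det => i l; case: (enum_val i) => [ga|] /=; last exact: pA.
  apply: (@pf_ext _ _ (fun c => ('X_[bmnm ga] : {mpoly F[N]}).@[w l] * (P (fc c)).@[w l])).
    by move=> c; rewrite mevalM.
  by apply: pf_mul; [apply: pf_const|apply: pP].
- exact: hf0.
- by rewrite fcK.
move=> c dn [B AB]; case/negP: dn; apply/det0P.
have hPc := hP (fc c) (fc_homog c); have hAc := hA (fc c) (fc_homog c).
have [B' [sB' AB']] : exists B', (msize B' <= D.+1)%N /\ A (fc c) = B' * P (fc c).
  have := hcompM D B hPc; rewrite -[in LHS]mulrC -AB (pihomog_dE hAc) => ->.
  case: ifP => _; last by exists 0; rewrite msize0 mul0r.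
  exists (hcomp (D - e) B); split=> //; apply: leq_trans (msize_homog (pihomogP _ _ _)) _.
  by rewrite ltnS leq_subr.
pose be (o : I) : F := if o is Some ga then B'@_(bmnm ga) else -1.
exists (\row_i be (enum_val i)).
  apply/eqP => /(congr1 (fun V : 'rV[F]_#|I| => V 0 (enum_rank None))); rewrite !mxE enum_rankK /=.
  by move/eqP; rewrite oppr_eq0 oner_eq0.
apply/rowP => l; rewrite [RHS]mxE mxE.
transitivity (\sum_(o : I) be o * (g (fc c) o).@[w l]).
  rewrite (reindex (@enum_val I predT)) /=; last exact: (onW_bij _ (enum_val_bij _)).
  by apply: eq_bigr => i _; rewrite !mxE.
rewrite (bigD1 None) //= AB' mevalM mulN1r.
rewrite (reindex_omap Some id) /=; last by case.
have BE : B'.@[w l] = \sum_(ga : 'X_{1..N < D.+1}) B'@_(bmnm ga) * 'X_[bmnm ga].@[w l].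
  rewrite {1}(mpolywE sB') (raddf_sum (meval (w l))); apply: eq_bigr => ga _; by rewrite /= mevalZ.
rewrite BE mulr_suml; set s1 := \sum_i _; set s2 := \sum_(_ | _) _.
suff -> : s2 = s1 by rewrite addNr.
by apply: eq_big => [ga|ga _]; rewrite ?eqxx // mevalM mulrA.
Qed.

(** The identity between [spoly] and [upoly] holds for every [f]; only the nonvanishing of [spoly]
    on [C] is a condition, and the example shows that it is generic. *)
Lemma gen_birational : gen d (fun f : polymap F n.+1 => birational d f (jac f)).
Proof.
have [f1 [x1 [hf1 z1 [P1x P1n] [T hT]]]] := @birational_example F hchar n d d2.
pose z i := (fiter f1 2 i).@[x1].
pose r := T.+1; pose t := (d ^ 2 * r)%N.
have v0 : (0 < d ^ 2)%N by rewrite expn_gt0 ltnW.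
have Tt : (T <= t)%N by apply: leq_trans (leq_pmull _ v0).
have [M [xs [uni interp]]] := @interpolation_points F Finf N t.
(* The forms labelled by [lab] span degree [t]: the fibre equations give those vanishing at [x1],
   and the row [None] is [1] there. *)
have [sel dsel] : exists sel : 'I_M -> lab t, \det (\matrix_(i, l) (rho r f1 z (sel i)).@[xs l]) != 0.
  apply: (@select_rows F (lab t) M (fun a l => (rho r f1 z a).@[xs l])) => be hbe.
  apply: uni => p hp.
  have ker q : q \is t.-homog -> q.@[x1] = 0 -> \sum_l q.@[xs l] * be l = 0.
    move=> hq qx; have [c [dt hc ->]] := hT t q Tt hq qx.
    transitivity (\sum_o \sum_l (c o * fibgen f1 z o).@[xs l] * be l).
      rewrite exchange_big; apply: eq_bigr => l _; by rewrite (raddf_sum (meval (xs l))) /= mulr_suml.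
    apply: big1 => o _; pose Q0 (q : {mpoly F[N]}) := \sum_l (q * fibgen f1 z o).@[xs l] * be l = 0.
    suff : Q0 (c o) by [].
    rewrite [c o]mpolyE big_seq; elim/big_ind: _ => [|p1 p2 h1 h2|m mp]; rewrite /Q0.
    - by rewrite big1 // => l _; rewrite mul0r meval0 mul0r.
    - transitivity (\sum_l (p1 * fibgen f1 z o).@[xs l] * be l + \sum_l (p2 * fibgen f1 z o).@[xs l] * be l).
        by rewrite -big_split; apply: eq_bigr => l _ /=; rewrite mulrDl mevalD mulrDl.
      by rewrite h1 h2 addr0.
    have mE : mdeg m = (t - fibdeg d o)%N by have /dhomogP := hc o; apply.
    have lt : (mdeg m < t.+1)%N by rewrite mE ltnS leq_subr.
    have := hbe (Some (o, BMultinom lt)); rewrite /= mE subnK // eqxx => E.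
    transitivity ((c o)@_m * \sum_l ('X_[m] * fibgen f1 z o).@[xs l] * be l); last by rewrite E mulr0.
    rewrite mulr_sumr; apply: eq_bigr => l _.
    by rewrite -scalerAl mevalZ mulrA.
  have hr : fiter f1 2 j1 ^+ r \is t.-homog by apply: dhomog_exp; apply: fiter_homog.
  have h0 := hbe None.
  have hq : p - p.@[x1] *: fiter f1 2 j1 ^+ r \is t.-homog by rewrite rpredB // rpredZ.
  have := ker _ hq; rewrite mevalB mevalZ mevalXn z1 expr1n mulr1 subrr => /(_ erefl) E.
  transitivity (\sum_l (p - p.@[x1] *: fiter f1 2 j1 ^+ r).@[xs l] * be l
      + p.@[x1] * \sum_l (rho r f1 z (None : lab t)).@[xs l] * be l); last by rewrite E h0 mulr0 addr0.
  rewrite mulr_sumr -big_split.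
  by apply: eq_bigr => l _ /=; rewrite mevalB mevalZ mulrBl mulrA subrK.
have [al hal] := interp x1.
have rho_x1 a : a != None -> (rho r f1 z a).@[x1] = 0.
  case: a => [[o ga]|] //= _; case: ifP => _; last by rewrite meval0.
  rewrite mevalM; apply/eqP; rewrite mulf_eq0; apply/orP; right.
  case: o => [ij|] /=; last by rewrite P1x.
  by rewrite mevalB !mevalZ -/(z ij.1) -/(z ij.2) mulrC subrr.
(* Were [None] not selected, all selected forms would vanish at [x1], although their values
   determine evaluation at [x1]. *)
have [l0 sel0] : exists l0, sel l0 = None.
  apply: NNPP => nN.
  have al0 : forall l, al l = 0.
    apply: (det_right_kernel dsel) => i.
    have hr := rho_homog z (sel i) hf1 (erefl t).
    transitivity ((rho r f1 z (sel i)).@[x1]).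
      by rewrite (hal _ hr); apply: eq_bigr => l _; rewrite mxE.
    by apply: rho_x1; apply/eqP => si; apply: nN; exists i.
  have hr : fiter f1 2 j1 ^+ r \is t.-homog by apply: dhomog_exp; apply: fiter_homog.
  have := hal _ hr; rewrite mevalXn z1 expr1n big1 => [/eqP|l _]; first by rewrite oner_eq0.
  by rewrite al0 mulr0.
have selS i : i != l0 -> sel i != None.
  move=> il; apply: contraNneq dsel => si; apply/eqP; apply: (determinant_alternate il) => l.
  by rewrite !mxE si sel0.
pose A f := msub (fiter f 2) (spoly r xs sel f).
apply: (@gen_weak F n.+1 d (fun f => ~ dv (jac f) (A f))).
  move=> f hf nd; exists t, (sdeg sel), (spoly r xs sel f), (upoly r xs sel l0 f); split.
  - by rewrite muln_gt0 v0 dvdn_mulr.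
  - exact: spoly_homog.
  - exact: nd.
  - by move=> m _; rewrite mulKn //; apply: upoly_homog.
  - by move=> y Py m mt; apply: spoly_upoly.
apply: (@gen_not_dv (sdeg sel * d ^ 2) (N * d.-1) (fun f => jac f) A f1).
- by move=> f hf; apply: dhomog_jac.
- by move=> f hf; apply: dhomog_msub (spoly_homog _ _ _ _) _ => i; apply: fiter_homog.
- exact: pf_jac.
- move=> x; apply: (@pf_ext _ _ (fun c => \det (\matrix_(i, l)
    (ent r (fc c) (sel i) (xs l)).@[fun j => (fiter (fc c) 2 j).@[x]]))).
    move=> c; rewrite /A meval_msub /spoly -det_map_mx; congr (\det _).
    by apply/matrixP => i l; rewrite !mxE.
  apply: pf_det => i l; apply: pf_ent => j.
  by apply: (pf_fiter2 j (x := fun j _ => x j)) => k; apply: pf_const.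
- exact: hf1.
- exact: P1n.
move=> [B AB]; case/negP: dsel; rewrite -spoly_eval; apply/eqP.
have := congr1 (meval x1) AB; by rewrite /A meval_msub mevalM P1x mul0r.
Qed.

End GenericBirational.

Theorem theorem31 (F : closedFieldType) (hchar : [pchar F] =i pred0)
  (n d : nat) (hn : (3 <= n)%N) (hd : (3 <= d)%N) :
  exists G : {mpoly F[#|{: coef_index n d}|]},
    (exists f0 : polymap F n, is_endo d f0 /\ G.@[coef_vec (d:=d) f0] != 0) /\
    (forall f : polymap F n, is_endo d f ->
       (exists k, (3 <= k)%N /\ crit_image_incl f k 2) ->
       G.@[coef_vec (d:=d) f] = 0).
Proof.
(* From here on [n] is one less than the dimension of the projective space, as in the sections
   above. *)
case: n hn => // n n2.
have d1 : (1 < d)%N by apply: ltnW.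
have d0 : (0 < d)%N by apply: ltnW.
pose Q (f : polymap F n.+1) := (freedet d f != 0 /\ forall l, (jac f).@[pt F l] != 0) /\
  ((is_endo d f -> smooth_on_plane (jac f)) /\ birational d f (jac f)).
have genQ : gen d (fun f => Q f /\ forall i, f i \is d.-homog).
  apply: (@gen_weak _ _ _ Q) => [f hf Qf|]; first by split.
  apply: gen_and; apply: gen_and.
  - exact: gen_freedet.
  - exact: gen_jac_pt.
  - exact: gen_smooth.
  - exact: gen_birational.
apply: (@gen_final F n.+1 d hchar _ (fun f => exists k, (3 <= k)%N /\ crit_image_incl f k 2) genQ).
  move=> f [[[fd _] _] hf]; exact: (freedet_endo d0 hf fd).
move=> f [[[fd Ppt] [sm bir]] hf] endo [k [k3 bad]].
exact: (main_contradiction hchar n2 hd k3 hf fd Ppt (sm endo) bir bad).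
Qed.
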